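(* Let $\rho\in(0,\infty)$, let $W$ be a standard Brownian motion and let $X^\rho=(X^\rho_t)_{t\in[0,1]}$ be the Riemann-Liouville process \[X^\rho_t:=\int_0^t (t-s)^{\rho-\frac12}\,dW_s,\qquad t\in[0,1],\] taken in a pathwise continuous modification and regarded as a centered Gaussian random vector with values in $H=L^2([0,1],dt)$. Then \[ e_n(X^\rho)\sim \pi^{-(\rho+\frac12)}(\rho+1/2)^{\rho}\Big(\frac{2\rho+1}{2\rho}\Big)^{1/2}\Gamma(\rho+1/2)\,(\log n)^{-\rho}\quad\text{as } n\to\infty.\]
   Context: For a random vector $X$ with values in a separable Hilbert space $(H,\|\cdot\|)$ with ${\mathbb E}\|X\|^2<\infty$, the minimal $n$th $L^2$-quantization error is $e_n(X):=\inf\{({\mathbb E}\min_{a\in\alpha}\|X-a\|^2)^{1/2}:\alpha\subset H,\ \mathrm{card}(\alpha)\le n\}$. Here $H=L^2([0,1],dt)$ with its usual norm. The notation $a_n\sim b_n$ means $a_n/b_n\to1$. *)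

(* Defs.v *)
From HB Require Import structures.
From mathcomp Require Import all_boot all_order all_algebra.
From mathcomp Require Import all_classical all_reals all_analysis.
Set Implicit Arguments. Unset Strict Implicit. Unset Printing Implicit Defensive.
Import Order.TTheory GRing.Theory Num.Theory.
Import numFieldNormedType.Exports.
Local Open Scope classical_set_scope.
Local Open Scope ring_scope.

Section defs.
Context {R : realType}.

Definition Gamma (x : R) : R :=
  Rintegral lebesgue_measure `]0, +oo[ (fun t => t `^ (x - 1) * expR (- t)).

Definition centered_gaussian_law d (Omega : measurableType d)
    (P : probability Omega R) (Y : Omega -> R) (v : R) : Prop :=
  measurable_fun setT Y /\
  (if v == 0 then P (Y @^-1` [set 0]) = 1%E
   else forall A : set R, measurable A ->
          P (Y @^-1` A) = normal_prob 0 (Num.sqrt v) A).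

Definition centered_gaussian_family d (Omega : measurableType d)
    (P : probability Omega R) (I : Type) (D : set I)
    (Z : I -> Omega -> R) (C : I -> I -> R) : Prop :=
  forall (k : nat) (i : 'I_k -> I) (c : 'I_k -> R),
    (forall j, D (i j)) ->
    centered_gaussian_law P (fun w => \sum_(j < k) c j * Z (i j) w)
      (\sum_(j < k) \sum_(l < k) c j * c l * C (i j) (i l)).

Definition RL_kernel (rho t s : R) : R := (t - s) `^ (rho - 2^-1).

(* Joint covariance structure of (X, W) when W is a standard Brownian
   motion and X_t = int_0^t (t-s)^(rho-1/2) dW_s (Wiener integral).
   Index (true, t) stands for X_t, (false, u) for W_u. *)
Definition RL_BM_cov (rho : R) (a b : bool * R) : R :=
  match a, b with
  | (false, u), (false, v) => Num.min u v
  | (true, t), (false, u) | (false, u), (true, t) =>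
      Rintegral lebesgue_measure `[0, Num.min t u] (RL_kernel rho t)
  | (true, t), (true, t') =>
      Rintegral lebesgue_measure `[0, Num.min t t']
        (fun s => RL_kernel rho t s * RL_kernel rho t' s)
  end.

Definition RL_BM_domain : set (bool * R) :=
  fun a => if a.1 then 0 <= a.2 <= 1 else 0 <= a.2.

(* W is a standard Brownian motion (continuous paths, W_0 = 0, centered
   Gaussian with covariance min(s,t)), and X = (X_t)_{t in [0,1]} is a
   pathwise continuous process with X_t = int_0^t (t-s)^(rho-1/2) dW_s
   almost surely for each t; the latter is expressed by the joint
   Gaussianity of (X, W) with the covariance RL_BM_cov. *)
Definition is_RL_process_of_BM d (Omega : measurableType d)
    (P : probability Omega R) (rho : R) (W X : R -> Omega -> R) : Prop :=
  [/\ forall w, W 0 w = 0,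
      forall w, {within `[0, +oo[, continuous (fun t => W t w)},
      forall w, {within `[0, 1], continuous (fun t => X t w)} &
      centered_gaussian_family P RL_BM_domain
        (fun a => if a.1 then X a.2 else W a.2) (RL_BM_cov rho)].

Definition L2_01 (a : R -> R) : Prop :=
  measurable_fun (`[0, 1]%classic : set R) a /\
  (\int[lebesgue_measure]_(t in (`[0%R, 1%R] : set R)) ((a t) ^+ 2)%:E < +oo)%E.

Definition L2_01_dist2 (f g : R -> R) : \bar R :=
  (\int[lebesgue_measure]_(t in (`[0%R, 1%R] : set R)) ((f t - g t) ^+ 2)%:E)%E.

Definition distortion d (Omega : measurableType d) (P : probability Omega R)
    (X : R -> Omega -> R) (alpha : seq (R -> R)) : \bar R :=
  (\int[P]_w \big[Order.min/+oo%E]_(a <- alpha) L2_01_dist2 (fun t => X t w) a)%E.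

Definition quant_err d (Omega : measurableType d) (P : probability Omega R)
    (X : R -> Omega -> R) (n : nat) : R :=
  Num.sqrt (fine (ereal_inf
    [set distortion P X alpha | alpha in
       [set alpha : seq (R -> R) | (size alpha <= n)%N /\
                                   forall i, (i < size alpha)%N -> L2_01 (nth (fun _ => 0) alpha i)]])).

End defs.

(* Main.v *)
Require Import Defs.
From HB Require Import structures.
From mathcomp Require Import all_boot all_order all_algebra.
From mathcomp Require Import all_classical all_reals all_analysis.
From mathcomp Require Import measurable_realfun gauss_integral normal_distribution ring lra zify.
Set Implicit Arguments. Unset Strict Implicit. Unset Printing Implicit Defensive.
Import Order.TTheory GRing.Theory Num.Theory.
Import numFieldNormedType.Exports.
Local Open Scope classical_set_scope.
Local Open Scope ring_scope.

(** Put a = rho + 1/2.  For a random vector V, let "ach V L D" mean that some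
    codebook of at most exp(L) points has mean squared error at most D.

    For independent centered Gaussian coordinates, random coding on the
    coordinates of large variance (with a Chernoff bound for chi-square
    variables) and a Shannon-type lower bound give the trade-off of reverse
    water-filling, in which only the eigenvalues of the covariance enter.

    The process is close in L^2, uniformly in n, to Gamma(a) times the lower
    triangular Toeplitz transform of the Brownian increments on a grid of mesh
    1/n with weights w_m, the coefficients of (1 - z)^(-a): these satisfy
    Gamma(a) w_m ~ m^(a-1).  With weights damped by q^m, q = exp(-c/N), this
    triangular matrix is a circulant matrix minus a matrix of wrapped terms.
    - The circulant matrix is diagonalised by the Hartley basis, with squared
      singular values |1 - q e^(i theta)|^(-2a), and the leading term of its
      trade-off does not depend on c.
    - The rows of the wrapped terms are smooth: Newton interpolation on
      geometrically growing blocks codes them with o(L) nats and an error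
      smaller than any fixed power of 1/L.
    - Damping conjugates the triangular matrix by diag(q^i), and q^i lies
      between exp(-c) and 1, so that c -> 0 removes the damping.
    Hence n points achieve squared error Gamma(a)^2 qcst(a) (ln n)^(1-2a),
    up to a factor 1 + o(1), and not less. *)

(** * Gaussian vectors and their laws *)

(** The obstacle is spectral: in general neither the covariance operator of the process nor the
    triangular matrix has explicit singular values, whereas those of a circulant matrix are values
    of a symbol. Multiplied by N^(-2a), the squared singular values tend to (c^2 + (2 pi k)^2)^(-a)
    at frequency k, and each positive frequency occurs twice; [qcst] is the outcome of water-filling
    for (2 pi k)^(-2a). Damping is forced, because the w_m are not summable and the wrapped sums
    would diverge at q = 1; it also keeps the eigenvalue of frequency 0 finite. Factors on the rows
    act by a Lipschitz map, but factors on the columns do not: that shrinking the noise variables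
    never makes coding harder is [ach_noise], and the conjugation rests on it. The limits are nested
    as tolerance and c, L, N, each depending on the preceding ones, so discretization errors only
    have to vanish for each fixed L. Laws are compared through integrals of 1 + cos, which are real
    and nonnegative, so that Tonelli applies with no integrability condition. *)

Section normal.
Context {R : realType}.
Notation mu := (@lebesgue_measure R).

(** Integration by parts on the line: the fundamental theorem on [-n-1, n+1], and dominated
    convergence with majorant |h|. Boundary values are needed along the integers only. *)
Lemma Rintegral_derive_line (h H : R -> R) :
  continuous h -> mu.-integrable [set: R] (EFin \o h) ->
  (forall x : R, is_derive x 1 H (h x)) ->
  H n%:R @[n --> \oo] --> (0:R) -> H (- n%:R) @[n --> \oo] --> (0:R) ->
  \int[mu]_x h x = 0.
Proof.
move=> ch ih dH H1 H2.
have dbl x : derivable H x 1 by have [] := dH x.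
pose f_ (n : nat) : R -> \bar R := (fun x : R => ((h \_ `[(- n.+1%:R : R), (n.+1%:R : R)]) x)%:E).
have mh : measurable_fun [set: R] h by have /integrableP[/measurable_EFinP] := ih.
have [] := @dominated_convergence _ _ R mu [set: R] measurableT f_ (EFin \o h : R -> \bar R) (abse \o (EFin \o h)).
- move=> n; rewrite /f_; apply/measurable_EFinP.
  by apply/measurable_restrict => //; apply: measurable_funTS.
- exact/measurable_EFinP.
- apply/aeW => x _; rewrite /f_.
  apply/fine_cvgP; split; first by near=> n.
  apply: cvg_near_cst; near=> n => /=; rewrite patchE mem_set//= in_itv/=.
  rewrite -ler_norml; near: n; exists (Num.bound `|x|) => // n /= nx.
  by rewrite (le_trans (ltW (archi_boundP (normr_ge0 _))))// ler_nat (leq_trans nx).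
- exact: integrable_abse.
- apply/aeW => x n _; rewrite /f_ /= patchE; case: ifP => // _; by rewrite normr0 lee_fin.
move=> _ _ cv.
have E n : (\int[mu]_x f_ n x = (H n.+1%:R)%:E - (H (- n.+1%:R))%:E)%E.
  have n0 : (- n.+1%:R < n.+1%:R :> R) by rewrite (@lt_trans _ _ 0)// oppr_lt0.
  rewrite -(@continuous_FTC2 _ h H)//.
  - rewrite [RHS]integral_mkcond; apply: eq_integral => x _.
    by rewrite /f_ restrict_EFin.
  - exact: continuous_subspaceT.
  - split; first by move=> x _; exact: dbl.
    + by apply: cvg_at_right_filter; apply: differentiable_continuous; apply/derivable1_diffP; exact: dbl.
    + by apply: cvg_at_left_filter; apply: differentiable_continuous; apply/derivable1_diffP; exact: dbl.
  - by move=> x _; rewrite derive1E derive_val.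
have cv2 : (\int[mu]_x f_ n x)%E @[n --> \oo] --> 0%:E.
  under eq_fun do rewrite E -EFinB.
  apply: cvg_EFin; first by near=> n.
  rewrite -[X in _ --> X]subr0 /comp /=; apply: cvgB.
    by have := H1; rewrite -(@cvg_shiftS _ (fun n => H n%:R)).
  by have := H2; rewrite -(@cvg_shiftS _ (fun n => H (- n%:R))).
have := cvg_unique _ cv cv2; rewrite /Rintegral /comp => ->//.
Unshelve. all: by end_near. Qed.

Definition gs (x : R) : R := normal_pdf 0 1 x.

Lemma gsE x : gs x = (Num.sqrt (pi *+ 2))^-1 * expR (- (x ^+ 2 / 2)).
Proof.
rewrite /gs normal_pdfE ?oner_eq0// /normal_peak /normal_fun subr0 expr1n mul1r.
by rewrite mulNr.
Qed.

Lemma gs_ge0 x : 0 <= gs x. Proof. exact: normal_pdf_ge0. Qed.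

Lemma continuous_gs : continuous gs.
Proof. exact/continuous_normal_pdf/oner_neq0. Qed.

Lemma measurable_gs : measurable_fun setT gs.
Proof. exact: measurable_normal_pdf. Qed.

Lemma sqrt2pi_neq0 : Num.sqrt (pi *+ 2) != 0 :> R.
Proof. by rewrite gt_eqF// sqrtr_gt0 pmulrn_lgt0// pi_gt0. Qed.

Lemma is_derive_gs (x : R) : is_derive x (1:R) gs (- x * gs x).
Proof.
have -> : gs = (fun x => (Num.sqrt (pi *+ 2))^-1 * expR (- (x ^+ 2 / 2))) by apply/funext => y; rewrite gsE.
apply: is_derive_eq.
by rewrite /= /GRing.scale /=; field; exact: sqrt2pi_neq0.
Qed.

(** The dominating function is a multiple of the normal density of variance 2, since 1 + x^2 <= 4
    exp(x^2/4). *)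
Lemma integrable_mul_gs (C : R) (f : R -> R) : measurable_fun setT f ->
  (forall x, `|f x| <= C * (1 + x ^+ 2)) ->
  mu.-integrable [set: R] (EFin \o (fun x => f x * gs x)).
Proof.
move=> mf fC.
have C0 : 0 <= C by have := le_trans (normr_ge0 _) (fC 0); rewrite expr0n addr0 mulr1.
have := @integrable_normal_pdf R 0 (Num.sqrt 2).
move=> /(@integrableZl _ _ R mu setT measurableT (C * 4 * Num.sqrt 2)) i2.
apply: (le_integrable measurableT _ _ i2) => //.
  apply/measurable_EFinP; apply: measurable_funM => //; exact: measurable_gs.
move=> x _ /=; rewrite lee_fin.
rewrite [leRHS]ger0_norm; last first.
  by rewrite !mulr_ge0 ?sqrtr_ge0 ?normal_pdf_ge0.
rewrite normrM (ger0_norm (gs_ge0 _)).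
apply: (@le_trans _ _ (C * (1 + x ^+ 2) * gs x)).
  by rewrite ler_wpM2r ?gs_ge0.
rewrite gsE normal_pdfE ?gt_eqF ?sqrtr_gt0// /normal_peak /normal_fun subr0 sqr_sqrtr//.
have -> : Num.sqrt (2 * pi *+ 2) = Num.sqrt 2 * Num.sqrt (pi *+ 2) :> R.
  by rewrite -sqrtrM// -mulrnAr.
have s2 : Num.sqrt 2 != 0 :> R by rewrite gt_eqF ?sqrtr_gt0.
have s3 : Num.sqrt (pi *+ 2) != 0 :> R by exact: sqrt2pi_neq0.
have -> : C * 4 * Num.sqrt 2 * ((Num.sqrt 2 * Num.sqrt (pi *+ 2))^-1 * expR (- x ^+ 2 / (2 *+ 2))) =
   C * (4 * expR (- x ^+ 2 / 4)) / Num.sqrt (pi *+ 2).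
  have -> : 2 *+ 2 = 4 :> R by rewrite -mulrnA.
  by field; apply/andP; split; [exact: s3|exact: s2].
rewrite [leLHS](_ : _ = C * ((1 + x ^+ 2) * expR (- (x ^+ 2 / 2))) / Num.sqrt (pi *+ 2)); last by field.
rewrite ler_wpM2r ?invr_ge0 ?sqrtr_ge0// ler_wpM2l//.
rewrite -ler_pdivlMr ?expR_gt0// -mulrA -expRN -expRD.
have -> : - x ^+ 2 / 4 + - - (x ^+ 2 / 2) = x ^+ 2 / 4 by field.
by have := expR_ge1Dx (x ^+ 2 / 4); lra.
Qed.

Lemma gs_bound x : (1 + x ^+ 2) * gs x <= 4.
Proof.
rewrite gsE; set K := (Num.sqrt _)^-1.
have K1 : K <= 1.
  rewrite invf_le1; last by rewrite sqrtr_gt0 pmulrn_lgt0// pi_gt0.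
  rewrite -[leLHS]sqrtr1 ler_wsqrtr// -mulr_natr.
  have := @pi_ge2 R; nra.
have K0 : 0 <= K by rewrite invr_ge0 sqrtr_ge0.
rewrite mulrCA; apply: (@le_trans _ _ (1 * ((1 + x ^+ 2) * expR (- (x ^+ 2 / 2))))).
  by rewrite ler_wpM2r// mulr_ge0 ?expR_ge0// addr_ge0 ?sqr_ge0.
rewrite mul1r expRN ler_pdivrMr ?expR_gt0//.
by have := expR_ge1Dx (x ^+ 2 / 2); nra.
Qed.

Lemma cvg_gs_tail (K : R) (H : R -> R) : (forall x, `|H x| <= K * ((1 + `|x|) * gs x)) ->
  H n%:R @[n --> \oo] --> (0:R) /\ H (- n%:R) @[n --> \oo] --> (0:R).
Proof.
move=> HK.
have K0 : 0 <= K.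
  have := le_trans (normr_ge0 _) (HK 0); rewrite normr0 addr0 mul1r pmulr_lge0// gsE.
  by rewrite mulr_gt0 ?expR_gt0// invr_gt0 lt_def sqrt2pi_neq0 sqrtr_ge0.
have B x (n : nat) : `|x| = n%:R -> `|H x| <= K * 8 * harmonic n.
  move=> xn; apply: (le_trans (HK x)); rewrite -mulrA ler_wpM2l//= ler_pdivlMr ?ltr0Sn//.
  rewrite -natr1 -xn (addrC `|x|) mulrAC -expr2.
  have := gs_bound x; have := gs_ge0 x; have : x ^+ 2 = `|x| ^+ 2 by rewrite real_normK// num_real.
  move=> ->; set y := `|x|; set g := gs x => g0 g4.
  have : 0 <= (1 - y) ^+ 2 * g by rewrite mulr_ge0// sqr_ge0.
  nra.
have hK : K * 8 * harmonic n @[n --> \oo] --> (0:R).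
  by rewrite -[X in _ --> X](mulr0 (K * 8)); apply: cvgMr; exact: cvg_harmonic.
split; apply: (@squeeze_cvgr _ _ _ _ (fun n => - (K * 8 * harmonic n)) (fun n => K * 8 * harmonic n)) => //.
- by near=> n; rewrite -ler_norml B// ger0_norm.
- by rewrite -oppr0; exact: cvgN.
- by near=> n; rewrite -ler_norml B// normrN ger0_norm.
- by rewrite -oppr0; exact: cvgN.
Unshelve. all: by end_near. Qed.

Lemma continuous_cos_affine (c p : R) : continuous (fun x : R => cos (c * x + p)).
Proof.
move=> x; apply: continuous_comp; last exact: continuous_cos.
by apply: cvgD; [apply: cvgMr; exact: cvg_id|exact: cvg_cst].
Qed.

Lemma continuous_sin_affine (c p : R) : continuous (fun x : R => sin (c * x + p)).
Proof.
move=> x; apply: continuous_comp; last exact: continuous_sin.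
by apply: cvgD; [apply: cvgMr; exact: cvg_id|exact: cvg_cst].
Qed.

(** The phase [p] lets one real cosine carry both the real and the imaginary part of the
    characteristic function. *)
Definition phi (p c : R) : R := \int[mu]_x (cos (c * x + p) * gs x).

Lemma integrable_phi p c : mu.-integrable [set: R] (EFin \o (fun x => cos (c * x + p) * gs x)).
Proof.
apply: (@integrable_mul_gs 1).
  apply: continuous_measurable_fun; exact: continuous_cos_affine.
by move=> x; rewrite mul1r (le_trans (cos_max _))// lerDl sqr_ge0.
Qed.

Lemma integrable_phi' p c : mu.-integrable [set: R] (EFin \o (fun x => x * sin (c * x + p) * gs x)).
Proof.
apply: (@integrable_mul_gs 1).
  apply: continuous_measurable_fun => x.
  by apply: cvgM; [exact: cvg_id|exact: continuous_sin_affine].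
move=> x; rewrite mul1r normrM (@le_trans _ _ (`|x| * 1)) ?ler_wpM2l ?sin_max//.
rewrite mulr1 -(real_normK (num_real x)); have := sqr_ge0 (`|x| - 1); nra.
Qed.

Lemma phi_ibp p c : \int[mu]_x (x * sin (c * x + p) * gs x) = c * phi p c.
Proof.
pose H x := gs x * sin (c * x + p).
pose h x := c * (cos (c * x + p) * gs x) - x * sin (c * x + p) * gs x.
have dH (x : R) : is_derive x (1:R) H (h x).
  have ? := is_derive_gs x; rewrite /H /h; apply: is_derive_eq; rewrite /GRing.scale /=; ring.
have ih : mu.-integrable [set: R] (EFin \o h).
  rewrite (_ : h = (fun x => (c * cos (c * x + p) - x * sin (c * x + p)) * gs x)); last first.
    by apply/funext => x; rewrite /h; ring.
  apply: (@integrable_mul_gs (`|c| + 1)).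
    apply: continuous_measurable_fun => x; apply: cvgB.
      by apply: cvgMr; exact: continuous_cos_affine.
    by apply: cvgM; [exact: cvg_id|exact: continuous_sin_affine].
  move=> x; rewrite (le_trans (ler_normB _ _))// !normrM.
  have -> : 1 + x ^+ 2 = 1 + `|x| ^+ 2 by rewrite real_normK// num_real.
  have := cos_max (c * x + p); have := sin_max (c * x + p).
  have := normr_ge0 x; have := normr_ge0 c.
  set y := `|x|; set k := `|c|; set u := `|sin _|; set v := `|cos _| => k0 y0 u1 v1.
  have : k * v <= k * 1 by rewrite ler_wpM2l.
  have : y * u <= y * 1 by rewrite ler_wpM2l.
  have := sqr_ge0 (y - 1); have := mulr_ge0 k0 (sqr_ge0 y). lra.
have [H1 H2] : H n%:R @[n --> \oo] --> (0:R) /\ H (- n%:R) @[n --> \oo] --> (0:R).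
  apply: (@cvg_gs_tail 1) => x; rewrite /H mul1r normrM mulrC (ger0_norm (gs_ge0 _)).
  rewrite ler_wpM2r ?gs_ge0// (le_trans (sin_max _))// lerDl//.
have ch : continuous h.
  move=> x; rewrite /h; apply: cvgB.
    by apply: cvgMr; apply: cvgM; [exact: continuous_cos_affine|exact: continuous_gs].
  apply: cvgM; last exact: continuous_gs.
  by apply: cvgM; [exact: cvg_id|exact: continuous_sin_affine].
have := Rintegral_derive_line ch ih dH H1 H2.
rewrite /h RintegralB//; last 2 first.
- exact: (@integrableZl _ _ R mu setT measurableT c _ (integrable_phi p c)).
- exact: integrable_phi'.
rewrite RintegralZl//; last exact: integrable_phi.
by move/eqP; rewrite subr_eq0 => /eqP.
Qed.

Lemma is_derive_phi p c : is_derive c (1:R) (phi p) (- c * phi p c).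
Proof.
pose f (c x : R) := cos (c * x + p) * gs x.
have df y x : is_derive y (1:R) (f ^~ x) (- (x * sin (y * x + p) * gs x)).
  rewrite /f; apply: is_derive_eq; rewrite /GRing.scale /=; ring.
have E y x : partial1of2 f y x = - (x * sin (y * x + p) * gs x).
  by rewrite partial1of2E derive_val.
have Ic : `](c - 1), (c + 1)[%classic c.
  by rewrite /= in_itv/= ltrBlDr ltrDl ltr01.
have i2 : mu.-integrable [set: R] (EFin \o (fun x => (1 + x ^+ 2) * gs x)).
  apply: (@integrable_mul_gs 1).
    by apply: measurable_funD => //; exact: measurable_funX.
  by move=> x; rewrite mul1r ger0_norm// addr_ge0 ?sqr_ge0.
have Gub y x : `|partial1of2 f y x| <= (1 + x ^+ 2) * gs x.
  rewrite E normrN normrM (ger0_norm (gs_ge0 _)) ler_wpM2r ?gs_ge0// normrM.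
  rewrite (@le_trans _ _ (`|x| * 1)) ?ler_wpM2l ?sin_max//.
  rewrite mulr1 -(real_normK (num_real x)); have := sqr_ge0 (`|x| - 1); nra.
have G0 x : 0 <= (1 + x ^+ 2) * gs x by rewrite mulr_ge0 ?gs_ge0// addr_ge0 ?sqr_ge0.
apply: DeriveDef.
  apply: (@derivable_under_integral _ _ _ mu f setT measurableT c _ _ Ic _ _ _ G0 i2).
  - by move=> y _; exact: integrable_phi.
  - by move=> y x _ _; have [] := df y x.
  - by move=> y x _ _; exact: Gub.
rewrite -derive1E (@differentiation_under_integral _ _ _ mu f setT measurableT c _ _ Ic _ _ _ G0 i2).
- under eq_Rintegral do rewrite E.
  rewrite mulNr -phi_ibp -[RHS]mulN1r -RintegralZl//; last exact: integrable_phi'.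
  by under [RHS]eq_Rintegral do rewrite mulN1r.
- by move=> y _; exact: integrable_phi.
- by move=> y x _ _; have [] := df y x.
- by move=> y x _ _; exact: Gub.
Qed.

Lemma Rintegral_gs : \int[mu]_x gs x = 1.
Proof. by rewrite /Rintegral integral_normal_pdf. Qed.

(** By [is_derive_phi], [phi p] solves u' = - c u, so its product with exp(c^2/2) has derivative 0;
    at c = 0 only the total mass remains. *)
Lemma phiE p c : phi p c = cos p * expR (- (c ^+ 2 / 2)).
Proof.
pose u c := phi p c * expR (c ^+ 2 / 2).
have du x : is_derive x (1:R) u 0.
  have ? := is_derive_phi p x.
  rewrite /u; by apply: is_derive_eq; rewrite /GRing.scale /=; field.
have : u c = u 0 by apply: is_derive_0_is_cst.
have e0 : expR (c ^+ 2 / 2) != 0 by rewrite gt_eqF ?expR_gt0.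
rewrite /u expr0n mul0r expR0 mulr1 expRN => /(canRL (mulfK e0)) ->.
rewrite /phi; under eq_Rintegral do rewrite mul0r add0r.
by rewrite RintegralZl// ?Rintegral_gs ?mulr1//; exact: integrable_normal_pdf.
Qed.

End normal.

(** * Integrals against an image of a measure with density *)

Section density.
Context d1 d2 (T1 : measurableType d1) (T2 : measurableType d2) {R : realType}.
Import HBNNSimple.
Variables (mu : {measure set T1 -> \bar R}) (nu : {measure set T2 -> \bar R})
  (phi : T1 -> T2) (g : T1 -> R).
Hypotheses (mphi : measurable_fun setT phi) (mg : measurable_fun setT g)
  (g0 : forall x, 0 <= g x)
  (nuE : forall A, measurable A -> nu A = (\int[mu]_(x in phi @^-1` A) (g x)%:E)%E).

(** Density and image are treated at once, by simple functions and monotone convergence: with [phi]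
    the identity this serves normal laws, with [g] = 1 laws of random variables, and with both
    general it serves the weighted images [wpush]. *)
Lemma ge0_integral_density (f : T2 -> \bar R) : measurable_fun setT f ->
  (forall x, 0 <= f x)%E ->
  (\int[nu]_x f x = \int[mu]_x (f (phi x) * (g x)%:E))%E.
Proof.
move=> mf f0.
pose f_ := nnsfun_approx measurableT mf.
have cvf x : (fun n => (f_ n x)%:E) @ \oo --> f x by exact: cvg_nnsfun_approx.
transitivity (limn (fun n => \int[nu]_x (f_ n x)%:E))%E.
  rewrite -monotone_convergence//.
  - by apply: eq_integral => y _; apply/esym/cvg_lim.
  - by move=> n; exact/measurable_EFinP.
  - by move=> n y _; rewrite lee_fin.
  - by move=> y _ m n mn; rewrite lee_fin; exact/lefP/nd_nnsfun_approx.
have mfn n : measurable_fun setT (f_ n \o phi) by exact: measurableT_comp.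
rewrite [X in limn X](_ : _ = (fun n => \int[mu]_x ((f_ n (phi x))%:E * (g x)%:E))%E).
  rewrite -monotone_convergence//.
  - apply: eq_integral => x _; apply/cvg_lim => //.
    by apply: cvgeZr.
  - by move=> n; apply: emeasurable_funM; apply/measurable_EFinP => //; exact: mfn.
  - by move=> n x _; rewrite mule_ge0// lee_fin.
  - move=> x _ m n mn; apply: lee_wpmul2r; first by rewrite lee_fin.
    by rewrite lee_fin; exact/lefP/nd_nnsfun_approx.
apply/funext => n.
have mind r : measurable_fun setT ((\1_(f_ n @^-1` [set r]) : T2 -> R) \o phi).
  by apply: measurableT_comp => //; exact: measurable_indic.
under eq_integral do rewrite fimfunE -fsumEFin//.
rewrite ge0_integral_fsum//; last 2 first.
- by move=> y; exact/measurable_EFinP/measurable_funM.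
- by move=> y x _; rewrite nnfun_muleindic_ge0.
transitivity (\sum_(k \in range (f_ n))
   \int[mu]_x ((k * \1_(f_ n @^-1` [set k]) (phi x))%:E * (g x)%:E))%E; last first.
  rewrite -ge0_integral_fsum//.
  - by apply: eq_integral => x _; rewrite fimfunE -fsumEFin// ge0_mule_fsuml// => r; rewrite nnfun_muleindic_ge0.
  - move=> r; apply: emeasurable_funM; apply/measurable_EFinP => //; apply: measurable_funM => //.
    exact: mind.
  - by move=> r x _; rewrite mule_ge0 ?nnfun_muleindic_ge0// lee_fin.
apply: eq_fsbigr => r /set_mem [] x0 _ rE.
have r0 : 0 <= r by rewrite -rE.
rewrite integralZl_indic_nnsfun// integral_indic//= setIT nuE//.
transitivity (r%:E * \int[mu]_x ((\1_(f_ n @^-1` [set r]) (phi x))%:E * (g x)%:E))%E.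
  congr (_ * _)%E; rewrite integral_mkcond; apply: eq_integral => x _.
  rewrite patchE indicE; have -> : (x \in phi @^-1` (f_ n @^-1` [set r])) = (phi x \in f_ n @^-1` [set r]).
    by apply/idP/idP => /set_mem h; apply/mem_set.
  by case: ifP; rewrite ?mul1e ?mul0e.
rewrite -ge0_integralZl//.
- by apply: eq_integral => x _; rewrite muleA.
- apply: emeasurable_funM; apply/measurable_EFinP => //.
  exact: mind.
- by move=> x _; rewrite mule_ge0// lee_fin.
Qed.

End density.

Section gamma1.
Context {R : realType}.
Notation mu := (@lebesgue_measure R).
Definition gamma1 : probability (measurableTypeR R) R := normal_prob 0 1.

Lemma integral_gamma1 (f : R -> \bar R) : measurable_fun [set: R] f ->
  (forall x, 0 <= f x)%E ->
  (\int[gamma1]_x f x = \int[mu]_x (f x * (gs x)%:E))%E.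
Proof.
move=> mf f0; apply: (@ge0_integral_density _ _ _ _ _ mu gamma1 idfun gs) => //.
- exact: measurable_id.
- exact: measurable_gs.
- exact: gs_ge0.
Qed.

(** Adding 1 makes the cosine nonnegative, so that the integral makes sense for every measure and
    obeys Tonelli. These are the test functions by which all laws are identified below. *)
Lemma integral_gamma1_cos (c p : R) :
  (\int[gamma1]_x (1 + cos (c * x + p))%:E = (1 + cos p * expR (- (c ^+ 2 / 2)))%:E)%E.
Proof.
rewrite integral_gamma1; last 2 first.
- apply/measurable_EFinP; apply: measurable_funD => //.
  by apply: continuous_measurable_fun; exact: continuous_cos_affine.
- by move=> x; rewrite lee_fin -lerBlDl sub0r; have := cos_geN1 (c * x + p).
transitivity (\int[mu]_x ((gs x)%:E + (cos (c * x + p) * gs x)%:E))%E.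
  by apply: eq_integral => x _; rewrite -EFinM mulrDl mul1r EFinD.
rewrite integralD//; last 2 first.
- exact: integrable_normal_pdf.
- exact: integrable_phi.
rewrite integral_normal_pdf EFinD; congr (_ + _)%E.
rewrite -phiE /phi /Rintegral fineK//.
by apply: integrable_fin_num => //; exact: integrable_phi.
Qed.

End gamma1.

Lemma bounded_cvg_integral d (T : measurableType d) (R : realType)
    (m : {finite_measure set T -> \bar R}) (f_ : nat -> T -> \bar R) (f : T -> \bar R) :
  (forall n, measurable_fun setT (f_ n)) -> measurable_fun setT f ->
  (forall n x, 0 <= f_ n x <= 1)%E -> (forall x, f_ n x @[n --> \oo] --> f x) ->
  (\int[m]_x f_ n x @[n --> \oo] --> \int[m]_x f x)%E.
Proof.
move=> mf_ mf b cv.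
have [] := @dominated_convergence _ _ _ m setT measurableT f_ f (cst 1%E) mf_ mf.
- by apply/aeW => x _; exact: cv.
- apply/integrableP; split => //.
  under eq_integral do rewrite abse1.
  by rewrite integral_cst// mul1e ltey_eq fin_num_measure.
- by apply/aeW => x n _; have /andP[? ?] := b n x; rewrite gee0_abs.
by [].
Qed.

(** * Fourier uniqueness on the line *)

Section unique1.
Context {R : realType}.
Notation mu := (@lebesgue_measure R).
Notation T := (measurableTypeR R).

Definition same_cos (m1 m2 : {finite_measure set T -> \bar R}) := forall c p : R,
  (\int[m1]_x (1 + cos (c * x + p))%:E = \int[m2]_x (1 + cos (c * x + p))%:E)%E.

(** Unnormalised Gaussian density centred at [y], of standard deviation 1/s for s > 0. *)
Definition bump (s y x : R) : R := expR (- ((s * (x - y)) ^+ 2 / 2)).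

Lemma measurable_bump2 (s : R) : measurable_fun [set: T * T] (fun z => bump s z.2 z.1).
Proof.
rewrite /bump; apply: measurableT_comp => //; apply: measurableT_comp => //.
apply: measurable_funM => //; apply: measurable_funX => //; apply: measurable_funM => //.
exact: measurable_funB.
Qed.

Lemma measurable_bump (s y : R) : measurable_fun [set: T] (bump s y).
Proof.
rewrite /bump; apply: measurableT_comp => //; apply: measurableT_comp => //.
apply: measurable_funM => //; apply: measurable_funX => //; apply: measurable_funM => //.
exact: measurable_funB.
Qed.

Lemma cos1_ge0 (x : R) : 0 <= 1 + cos x.
Proof. by rewrite -lerBlDl sub0r cos_geN1. Qed.

(** The Gaussian is its own Fourier transform: averaging cos(s u (x - y)) over a standard normal u
    gives the bump, and Tonelli exchanges the two integrals. *)
Lemma integral_bump1 (m : {finite_measure set T -> \bar R}) s y :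
  (\int[m]_x (1 + bump s y x)%:E =
   \int[gamma1]_u \int[m]_x (1 + cos (s * u * x + - (s * u * y)))%:E)%E.
Proof.
pose f (z : T * T) : \bar R := (1 + cos (s * z.2 * z.1 + - (s * z.2 * y)))%:E.
have mf : measurable_fun setT f.
  apply/measurable_EFinP; apply: measurable_funD => //; apply: measurableT_comp.
    by apply: continuous_measurable_fun; exact: continuous_cos.
  apply: measurable_funD.
    by apply: measurable_funM => //; exact: measurable_funM.
  by apply: measurableT_comp => //; apply: measurable_funM => //; exact: measurable_funM.
have f0 z : (0 <= f z)%E by rewrite lee_fin cos1_ge0.
have := @fubini_tonelli _ _ _ _ R m gamma1 f mf f0.
rewrite /fubini_F /fubini_G /f /= => <-.
apply: eq_integral => x _.
under eq_integral => u _.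
  rewrite (_ : s * u * x + - (s * u * y) = s * (x - y) * u + 0); last by ring.
  over.
by rewrite integral_gamma1_cos cos0 mul1r.
Qed.

Variables (m1 m2 : {finite_measure set T -> \bar R}).
Hypothesis H : same_cos m1 m2.

Lemma same_cos_setT : m1 setT = m2 setT.
Proof.
have := H 0 (pi / 2).
under eq_integral do rewrite mul0r add0r cos_pihalf addr0.
under [in RHS]eq_integral do rewrite mul0r add0r cos_pihalf addr0.
by rewrite !integral_cst// !mul1e.
Qed.

Lemma same_cos_bump s y : (\int[m1]_x (bump s y x)%:E = \int[m2]_x (bump s y x)%:E)%E.
Proof.
have : (\int[m1]_x (1 + bump s y x)%:E = \int[m2]_x (1 + bump s y x)%:E)%E.
  by rewrite !integral_bump1; apply: eq_integral => u _; rewrite H.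
have mb : measurable_fun [set: T] (fun x => (bump s y x)%:E).
  by apply/measurable_EFinP; exact: measurable_bump.
have b0 x : (0 <= (bump s y x)%:E)%E by rewrite lee_fin expR_ge0.
have E (m : {finite_measure set T -> \bar R}) :
    (\int[m]_x (1 + bump s y x)%:E = m setT + \int[m]_x (bump s y x)%:E)%E.
  under eq_integral do rewrite EFinD.
  by rewrite ge0_integralD// integral_cst// mul1e.
rewrite !E same_cos_setT => /(congr1 (fun z => z - m2 setT)%E).
by rewrite -!(addeC (\int[_]_x _)%E) !addeK ?fin_num_measure.
Qed.

Lemma gamma1_smooth (G : R -> R) (s x : R) : continuous G -> (forall y, 0 <= G y) -> 0 < s ->
  (\int[gamma1]_z (G (x + z / s))%:E =
   \int[mu]_y (G y * (s * (Num.sqrt (pi *+ 2))^-1) * bump s y x)%:E)%E.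
Proof.
move=> cG G0 s0.
have cA : continuous (fun z : R => x + z / s).
  by move=> z; apply: cvgD; [exact: cvg_cst|apply: cvgMl; exact: cvg_id].
rewrite integral_gamma1; last 2 first.
- apply/measurable_EFinP; apply: continuous_measurable_fun => z.
  by apply: continuous_comp; [exact: cA|exact: cG].
- by move=> z; rewrite lee_fin.
have dF (z : R) : is_derive z (1:R) (fun z : R => x + z / s) s^-1.
  by apply: is_derive_eq; rewrite /GRing.scale /=; ring.
have F'E : (fun z : R => x + z / s)^`()%classic = cst s^-1.
  by apply/funext => z; rewrite derive1E derive_val.
rewrite [RHS](@increasing_ge0_integration_by_substitutionT _ (fun z : R => x + z / s)).
- apply: eq_integral => z _; rewrite F'E /= -EFinM; congr EFin.
  rewrite [RHS](_ : _ = G (x + z / s) * (s * (Num.sqrt (pi *+ 2))^-1) *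
    expR (- ((s * (x - (x + z / s))) ^+ 2 / 2)) * s^-1)// gsE.
  have -> : s * (x - (x + z / s)) = - z by field; rewrite gt_eqF.
  by rewrite sqrrN; field; rewrite sqrt2pi_neq0 gt_eqF.
- by move=> y z yz; rewrite ltrD2l ltr_pM2r ?invr_gt0.
- by rewrite F'E => ?; exact: cvg_cst.
- by rewrite F'E; exact: is_cvg_cst.
- by rewrite F'E; exact: is_cvg_cst.
- by move=> z; have [] := dF z.
- apply/cvgrNyPle => A; near=> z.
  rewrite -lerBrDl ler_pdivrMr//; near: z; exact: nbhs_ninfty_le.
- apply/cvgryPge => A; near=> z.
  rewrite -lerBlDl ler_pdivlMr//; near: z; exact: nbhs_pinfty_ge.
- move=> y; apply: cvgM; first by apply: cvgM; [exact: cG|exact: cvg_cst].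
  rewrite /bump; apply: continuous_comp; last exact: continuous_expR.
  apply: cvgN; apply: cvgM; last exact: cvg_cst.
  have cB : continuous (fun y : R => s * (x - y)).
    by move=> z; apply: cvgM; [exact: cvg_cst|apply: cvgB; [exact: cvg_cst|exact: cvg_id]].
  rewrite (_ : (fun x0 : R => (s * (x - x0)) ^+ 2) = (fun y => s * (x - y) * (s * (x - y)))).
    by apply: cvgM; exact: cB.
  by apply/funext => z; rewrite expr2.
- by move=> y; rewrite mulr_ge0 ?expR_ge0// mulr_ge0// mulr_ge0 ?invr_ge0 ?sqrtr_ge0// ltW.
Unshelve. all: by end_near. Qed.

(** Smoothing [G] at scale 1/s is a superposition of bumps with nonnegative weights, so its integral
    is determined by the integrals of the bumps. Letting s grow then recovers the integral of [G]
    itself. *)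
Lemma integral_gamma1_smooth (m : {finite_measure set T -> \bar R}) (G : R -> R) (s : R) : continuous G -> (forall y, 0 <= G y) -> 0 < s ->
  (\int[m]_x \int[gamma1]_z (G (x + z / s))%:E =
   \int[mu]_y ((G y * (s * (Num.sqrt (pi *+ 2))^-1))%:E * \int[m]_x (bump s y x)%:E))%E.
Proof.
move=> cG G0 s0.
under eq_integral do rewrite gamma1_smooth//.
pose f (z : T * T) : \bar R := (G z.2 * (s * (Num.sqrt (pi *+ 2))^-1) * bump s z.2 z.1)%:E.
have mf : measurable_fun setT f.
  apply/measurable_EFinP; apply: measurable_funM => //; last exact: measurable_bump2.
  apply: measurable_funM => //; apply: measurableT_comp => //.
  exact: continuous_measurable_fun.
have s0' : 0 <= s * (Num.sqrt (pi *+ 2))^-1 by rewrite mulr_ge0 ?invr_ge0 ?sqrtr_ge0// ltW.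
have f0 z : (0 <= f z)%E by rewrite lee_fin mulr_ge0 ?expR_ge0// mulr_ge0.
have := @fubini_tonelli _ _ _ _ R m mu f mf f0.
rewrite /fubini_F /fubini_G /f /= => ->.
apply: eq_integral => y _; rewrite -ge0_integralZl//.
- by apply/measurable_EFinP; exact: measurable_bump.
- by move=> x _; rewrite lee_fin expR_ge0.
- by rewrite lee_fin mulr_ge0.
Qed.

Lemma same_cos_continuous (G : R -> R) : continuous G -> (forall y, 0 <= G y <= 1) ->
  (\int[m1]_x (G x)%:E = \int[m2]_x (G x)%:E)%E.
Proof.
move=> cG G01.
have G0 y : 0 <= G y by have /andP[] := G01 y.
have cA (x s : R) : continuous (fun z : R => x + z / s).
  by move=> z; apply: cvgD; [exact: cvg_cst|apply: cvgMl; exact: cvg_id].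
pose g_ (n : nat) (x : R) := (\int[gamma1]_z (G (x + z / n.+1%:R))%:E)%E.
have cv (m : {finite_measure set T -> \bar R}) :
    (\int[m]_x g_ n x @[n --> \oo] --> \int[m]_x (G x)%:E)%E.
  apply: bounded_cvg_integral.
  - move=> n.
    pose f (z : T * T) : \bar R := (G (z.1 + z.2 / n.+1%:R))%:E.
    have mf : measurable_fun setT f.
      apply/measurable_EFinP; apply: measurableT_comp; first exact: continuous_measurable_fun.
      by apply: measurable_funD => //; exact: measurable_funM.
    apply: (@measurable_fun_fubini_tonelli_F _ _ _ _ R gamma1 f mf) => z; by rewrite lee_fin.
  - by apply/measurable_EFinP; exact: continuous_measurable_fun.
  - move=> n x; rewrite integral_ge0//=; last by move=> z _; rewrite lee_fin.
    apply: (@le_trans _ _ (\int[gamma1]_z (cst 1%E z)))%E; last by rewrite integral_cst// mul1e; exact: probability_le1.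
    apply: ge0_le_integral => //.
    + by move=> z _; rewrite lee_fin.
    + apply/measurable_EFinP; apply: continuous_measurable_fun => z.
      by apply: continuous_comp; [exact: cA|exact: cG].
    + by move=> z _; rewrite lee_fin; have /andP[] := G01 (x + z / n.+1%:R).
  - move=> x; have -> : (G x)%:E = (\int[gamma1]_z (cst (G x)%:E z))%E.
      by rewrite integral_cst// [X in (_ * X)%E]probability_setT mule1.
    apply: bounded_cvg_integral => //.
    + move=> n; apply/measurable_EFinP; apply: continuous_measurable_fun => z.
      by apply: continuous_comp; [exact: cA|exact: cG].
    + by move=> n z; rewrite !lee_fin.
    + move=> z; apply: cvg_EFin; first by near=> n.
      apply: continuous_cvg; first exact: cG.
      rewrite -[X in _ --> X]addr0; apply: cvgD; first exact: cvg_cst.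
      rewrite -(mulr0 z); apply: cvgMr; exact: cvg_harmonic.
have E n : (\int[m1]_x g_ n x = \int[m2]_x g_ n x)%E.
  by rewrite !integral_gamma1_smooth//; apply: eq_integral => y _; rewrite same_cos_bump.
have c1 := cv m1; have c2 := cv m2.
rewrite (_ : (fun n => _) = (fun n => \int[m2]_x g_ n x)%E) in c1; last by apply/funext.
exact: cvg_unique c1 c2.
Unshelve. all: by end_near. Qed.

Lemma same_cos_unique A : measurable A -> m1 A = m2 A.
Proof.
have key (a : R) : m1 `]a, +oo[%classic = m2 `]a, +oo[%classic.
  (* This is n (x - a) clamped to [0, 1]: a continuous ramp converging pointwise to the indicator of
     ]a, +oo[. *)
  pose G (n : nat) (x : R) := (`|n%:R * (x - a)| - `|n%:R * (x - a) - 1| + 1) / 2.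
  have cG n : continuous (G n).
    have cu : continuous (fun x : R => n%:R * (x - a)).
      by move=> x; apply: cvgMr; apply: cvgB; [exact: cvg_id|exact: cvg_cst].
    move=> x; apply: cvgMl; apply: cvgD; last exact: cvg_cst.
    apply: cvgB; apply: cvg_norm; first exact: cu.
    by apply: cvgB; [exact: cu|exact: cvg_cst].
  have G01 n x : 0 <= G n x <= 1.
    rewrite /G; set u := n%:R * (x - a).
    have := lerB_normD u (- 1); have := ler_normB (u - 1) (- 1); rewrite normrN normr1 opprK subrK.
    have := ler_normB u 1; rewrite normr1; lra.
  have cv (m : {finite_measure set T -> \bar R}) :
      (\int[m]_x (G n x)%:E @[n --> \oo] --> m `]a, +oo[%classic)%E.
    have -> : m `]a, +oo[%classic = (\int[m]_x (\1_(`]a, +oo[%classic) x)%:E)%E.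
      by rewrite integral_indic// setIT.
    apply: bounded_cvg_integral => //.
    + by move=> n; apply/measurable_EFinP; exact: continuous_measurable_fun.
    + by apply/measurable_EFinP.
    + move=> x; apply: cvg_EFin; first by near=> n.
      apply: cvg_near_cst; rewrite indicE.
      have [ax|xa] := ltP a x.
        near=> n; rewrite mem_set/= ?in_itv/= ?ax// /G.
        have : 1 <= n%:R * (x - a).
          rewrite -ler_pdivrMr ?subr_gt0// mul1r.
          near: n; exists (Num.bound (x - a)^-1) => // k /= kx.
          by rewrite (le_trans (ltW (archi_boundP _)))// ?ler_nat// invr_ge0 subr_ge0 ltW.
        by move=> h; rewrite ger0_norm ?(le_trans ler01)// ger0_norm ?subr_ge0//; lra.
      near=> n; rewrite memNset/= ?in_itv/= ?andbT; last by apply/negP; rewrite -leNgt.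
      have h : n%:R * (x - a) <= 0 by rewrite mulr_ge0_le0// subr_le0.
      by rewrite /G ler0_norm// ler0_norm; lra.
  have c1 := cv m1; have c2 := cv m2.
  have E n : (\int[m1]_x (G n x)%:E = \int[m2]_x (G n x)%:E)%E by rewrite same_cos_continuous.
  rewrite (_ : (fun n => _) = (fun n => \int[m2]_x (G n x)%:E)%E) in c1; last by apply/funext.
  exact: cvg_unique c1 c2.
move=> mA.
apply: (@measure_unique _ R T (@RGenOInfty.G R) (fun n => `](- n%:R), +oo[%classic)) => //.
- exact: RGenOInfty.measurableE.
- move=> B C [x ->] [y ->]; exists (Num.max x y).
  by rewrite predeqE => z; split; rewrite /= !in_itv/= !andbT gt_max => /andP.
- by move=> n; exists (- n%:R).
- rewrite -subTset => x _; exists (Num.bound `|x|) => //=.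
  rewrite in_itv/= andbT ltrNl (le_lt_trans (ler_norm _))// normrN.
  exact: archi_boundP.
- by move=> B [x ->]; exact: key.
- by move=> k; rewrite ltey_eq fin_num_measure.
Unshelve. all: by end_near. Qed.

End unique1.

Lemma measurable_preimageT d1 d2 (T1 : measurableType d1) (T2 : measurableType d2) (f : T1 -> T2) A :
  measurable_fun setT f -> measurable A -> measurable (f @^-1` A).
Proof. by move=> mf mA; rewrite -[X in measurable X]setTI; exact: mf. Qed.

Section weighted_pushforward.
Context d1 d2 (T1 : measurableType d1) (T2 : measurableType d2) {R : realType}.
Variables (m : {finite_measure set T1 -> \bar R}) (phi : T1 -> T2) (h : T1 -> R).
Hypotheses (mphi : measurable_fun setT phi) (mh : measurable_fun setT h)
  (h02 : forall x, 0 <= h x <= 2).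

(** Image under [phi] of the measure with density [h]. The proofs are arguments so that the measure
    structure can be attached to the term. The weights that occur are 1 + cos, indicators and 1,
    whence the bound 2. *)
Definition wpush (_ : measurable_fun setT phi) (_ : measurable_fun setT h)
    (_ : forall x, 0 <= h x <= 2) (A : set T2) : \bar R :=
  (\int[m]_(x in phi @^-1` A) (h x)%:E)%E.

Let nu := wpush mphi mh h02.

Let mpre A : measurable A -> measurable (phi @^-1` A).
Proof. by move=> mA; rewrite -[X in measurable X]setTI; exact: mphi. Qed.

Let h0 x : (0 <= (h x)%:E)%E. Proof. by rewrite lee_fin; have /andP[] := h02 x. Qed.

Let wpush0 : nu set0 = 0%E.
Proof. by rewrite /nu /wpush preimage_set0 integral_set0. Qed.

Let wpush_ge0 A : (0 <= nu A)%E.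
Proof. exact: integral_ge0. Qed.

Let wpush_sigma_additive : semi_sigma_additive nu.
Proof.
move=> F mF tF mUF; rewrite /nu /wpush preimage_bigcup.
rewrite ge0_integral_bigcup//=.
- by apply: is_cvg_ereal_nneg_natsum_cond => n _ _; exact: integral_ge0.
- by move=> k; exact: mpre.
- by apply: measurable_funTS; exact/measurable_EFinP.
- apply/trivIsetP => /= i j _ _ ij; rewrite -preimage_setI.
  by move/trivIsetP : tF => /(_ _ _ _ _ ij) ->//; rewrite preimage_set0.
Qed.

HB.instance Definition _ := isMeasure.Build _ _ _ (wpush mphi mh h02)
  wpush0 wpush_ge0 wpush_sigma_additive.

Let wpush_fin : fin_num_fun (wpush mphi mh h02).
Proof.
move=> A mA; rewrite ge0_fin_numE ?wpush_ge0//.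
apply: (@le_lt_trans _ _ (\int[m]_(x in phi @^-1` A) (cst 2%:E x)))%E.
  apply: ge0_le_integral => //; first exact: mpre.
    by apply: measurable_funTS; exact/measurable_EFinP.
  by move=> x _; rewrite lee_fin; have /andP[] := h02 x.
rewrite integral_cst; last exact: mpre.
by rewrite lte_mul_pinfty// ltey_eq fin_num_measure//; exact: mpre.
Qed.

HB.instance Definition _ := @Measure_isFinite.Build _ _ _ (wpush mphi mh h02) wpush_fin.

Lemma integral_wpush (f : T2 -> \bar R) : measurable_fun setT f -> (forall x, 0 <= f x)%E ->
  (\int[wpush mphi mh h02]_x f x = \int[m]_x (f (phi x) * (h x)%:E))%E.
Proof. by move=> mf f0; apply: ge0_integral_density => // x; have /andP[] := h02 x. Qed.

End weighted_pushforward.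

(** * Fourier uniqueness for tuples *)

Section unique_tuple.
Context {R : realType}.
Notation T := (measurableTypeR R).

Definition lin n (c : 'I_n -> R) (v : n.-tuple T) : R := \sum_(i < n) c i * tnth v i.

Lemma measurable_lin n (c : 'I_n -> R) : measurable_fun setT (lin c).
Proof.
apply: measurable_sum => i; apply: measurable_funM => //; exact: measurable_tnth.
Qed.

Lemma measurable_1cos d (S : measurableType d) (f : S -> R) : measurable_fun setT f ->
  measurable_fun setT (fun x => 1 + cos (f x)).
Proof.
move=> mf; apply: measurable_funD => //; apply: measurableT_comp => //.
by apply: continuous_measurable_fun; exact: continuous_cos.
Qed.

Lemma lin_cons n (c : 'I_n.+1 -> R) (v : n.+1.-tuple T) :
  lin c v = c ord0 * thead v + lin (fun i => c (lift ord0 i)) [tuple of behead v].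
Proof.
rewrite /lin big_ord_recl; congr (_ + _).
by apply: eq_bigr => i _; rewrite [in LHS](tuple_eta v) tnthS.
Qed.

Definition same_cosn n (m1 m2 : {finite_measure set (n.-tuple T) -> \bar R}) :=
  forall (c : 'I_n -> R) (p : R),
  (\int[m1]_v (1 + cos (lin c v + p))%:E = \int[m2]_v (1 + cos (lin c v + p))%:E)%E.

Lemma same_cosn_setT n (m1 m2 : {finite_measure set (n.-tuple T) -> \bar R}) :
  same_cosn m1 m2 -> m1 setT = m2 setT.
Proof.
move=> H; have := H (fun=> 0) (pi / 2).
have E (m : {finite_measure set (n.-tuple T) -> \bar R}) :
  (\int[m]_v (1 + cos (lin (fun=> 0) v + pi / 2))%:E = m setT)%E.
  transitivity (\int[m]_v (cst 1%E v))%E; last by rewrite integral_cst// mul1e.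
  apply: eq_integral => v _; rewrite /lin big1 ?add0r ?cos_pihalf ?addr0// => i _.
  by rewrite mul0r.
by rewrite !E.
Qed.

(** The product-to-sum formula, with constants arranged so that both sides are sums of nonnegative
    terms; it can then be integrated term by term in the extended reals. *)
Lemma one_cos_mul (a b : R) :
  (1 + cos a) * (1 + cos b) + 2 = (1 + cos a) + (1 + cos b) + (2^-1 * (1 + cos (a + b)) + 2^-1 * (1 + cos (a - b))).
Proof. by rewrite cosD cosB; field. Qed.

Lemma same_cosn_prod n (m1 m2 : {finite_measure set (n.-tuple T) -> \bar R}) :
  same_cosn m1 m2 -> forall (c c' : 'I_n -> R) (p p' : R),
  (\int[m1]_v ((1 + cos (lin c v + p)) * (1 + cos (lin c' v + p')))%:E =
   \int[m2]_v ((1 + cos (lin c v + p)) * (1 + cos (lin c' v + p')))%:E)%E.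
Proof.
move=> H c c' p p'.
have mc k q : measurable_fun [set: n.-tuple T] (fun v => (1 + cos (lin k v + q))%:E).
  by apply/measurable_EFinP; apply: measurable_1cos; apply: measurable_funD => //; exact: measurable_lin.
have c0 k q v : (0 <= (1 + cos (lin k v + q))%:E)%E by rewrite lee_fin cos1_ge0.
have E (m : {finite_measure set (n.-tuple T) -> \bar R}) :
  (\int[m]_v ((1 + cos (lin c v + p)) * (1 + cos (lin c' v + p')))%:E + 2%:E * m setT =
   (\int[m]_v (1 + cos (lin c v + p))%:E + \int[m]_v (1 + cos (lin c' v + p'))%:E) +
   (2^-1%:E * \int[m]_v (1 + cos (lin (fun i => c i + c' i) v + (p + p')))%:E +
    2^-1%:E * \int[m]_v (1 + cos (lin (fun i => c i - c' i) v + (p - p')))%:E))%E.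
  have mp : measurable_fun [set: n.-tuple T] (fun v => ((1 + cos (lin c v + p)) * (1 + cos (lin c' v + p')))%:E).
    by apply: (@emeasurable_funM _ _ _ _ (fun v => (1 + cos (lin c v + p))%:E) (fun v => (1 + cos (lin c' v + p'))%:E)).
  rewrite -!ge0_integralZl// -(@integral_cst _ _ _ m setT measurableT).
  rewrite -!ge0_integralD//; last first.
  all: try by move=> v _; rewrite /cst ?adde_ge0 ?mule_ge0 ?lee_fin ?mulr_ge0 ?cos1_ge0// invr_ge0.
  all: try by repeat first [exact: mc | exact: mp | apply: emeasurable_funD | apply: measurable_funeM].
  apply: eq_integral => v _; rewrite -!EFinM -!EFinD one_cos_mul.
  have -> : lin (fun i => c i + c' i) v = lin c v + lin c' v.
    by rewrite /lin -big_split/=; apply: eq_bigr => i _; rewrite mulrDl.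
  have -> : lin (fun i => c i - c' i) v = lin c v - lin c' v.
    by rewrite /lin -sumrB/=; apply: eq_bigr => i _; rewrite mulrBl.
  by congr (_ + (_ * (1 + cos _) + _ * (1 + cos _)))%:E; ring.
have : (2%:E * m2 setT)%E \is a fin_num by rewrite fin_numM// fin_num_measure.
move=> /addeK K.
have E1 := E m1; have := E m2.
rewrite -!(H _ _) -E1 (same_cosn_setT H) => /(congr1 (fun z => z - 2%:E * m2 setT)%E).
by rewrite !K.
Qed.

(** Induction on the dimension. Weighting by 1 + cos of the head gives images on the tail that agree
    by induction; for a fixed set of tails, the restricted images on the head then have the same
    cosine integrals and agree by the case of the line. This settles rectangles, and the uniqueness
    theorem for measures on a pi-system does the rest. *)
Lemma same_cosn_unique n (m1 m2 : {finite_measure set (n.-tuple T) -> \bar R}) :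
  same_cosn m1 m2 -> forall A, measurable A -> m1 A = m2 A.
Proof.
elim: n => [|n IH] in m1 m2 *.
  move=> H A mA; have [->|A0] := eqVneq A set0; first by rewrite !measure0.
  have -> : A = setT; last exact: same_cosn_setT.
  rewrite -subTset => x _; move/set0P : A0 => [y Ay].
  by rewrite (tuple0 x) -(tuple0 y).
move=> H A mA.
have mth : measurable_fun [set: n.+1.-tuple T] (fun v => thead v : T) by exact: measurable_tnth.
have mbe : measurable_fun [set: n.+1.-tuple T] (fun v => [tuple of behead v] : n.-tuple T).
  exact: measurable_behead.
pose h c0 p0 (v : n.+1.-tuple T) := 1 + cos (c0 * thead v + p0).
have mh c0 p0 : measurable_fun [set: n.+1.-tuple T] (h c0 p0).
  by apply: measurable_1cos; apply: measurable_funD => //; exact: measurable_funM.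
have h02 c0 p0 v : 0 <= h c0 p0 v <= 2.
  by rewrite /h cos1_ge0; have := cos_le1 (c0 * thead v + p0); lra.
have step1 c0 p0 B : measurable B -> (wpush m1 mbe (mh c0 p0) (h02 c0 p0) B = wpush m2 mbe (mh c0 p0) (h02 c0 p0) B)%E.
  move=> mB; apply: (IH (wpush m1 mbe (mh c0 p0) (h02 c0 p0)) (wpush m2 mbe (mh c0 p0) (h02 c0 p0))) => // c p.
  have mc : measurable_fun [set: n.-tuple T] (fun v => (1 + cos (lin c v + p))%:E).
    by apply/measurable_EFinP; apply: measurable_1cos; apply: measurable_funD => //; exact: measurable_lin.
  rewrite !integral_wpush//; try by move=> v; rewrite lee_fin cos1_ge0.
  (* Frequency vectors on the whole tuple: [k] vanishes on the head and [k0] outside it, which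
     brings the integrand to the form of [same_cosn_prod]. *)
  pose k (i : 'I_n.+1) := if unlift ord0 i is Some j then c j else 0.
  pose k0 (i : 'I_n.+1) := if unlift ord0 i is Some j then 0 else c0.
  have E (v : n.+1.-tuple T) : ((1 + cos (lin c [tuple of behead v] + p))%:E * (h c0 p0 v)%:E)%E =
      ((1 + cos (lin k v + p)) * (1 + cos (lin k0 v + p0)))%:E :> \bar R.
    rewrite -EFinM !lin_cons /k /k0 /h unlift_none mul0r add0r.
    have -> : (fun i : 'I_n => if unlift ord0 (lift ord0 i) is Some j then c j else 0) = c.
      by apply/funext => i; rewrite liftK.
    have -> : (fun i : 'I_n => if unlift ord0 (lift ord0 i) is Some j then 0 else c0) = fun=> 0.
      by apply/funext => i; rewrite liftK.
    by rewrite [X in _ + X + p0](_ : _ = 0) ?addr0// /lin big1// => i _; rewrite mul0r.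
  under eq_integral do rewrite E.
  under [in RHS]eq_integral do rewrite E.
  exact: same_cosn_prod.
pose Bpre B := (fun v : n.+1.-tuple T => [tuple of behead v] : n.-tuple T) @^-1` B.
have mBpre B : measurable B -> measurable (Bpre B).
  by move=> mB; exact: (measurable_preimageT mbe).
have ind02 B v : 0 <= (\1_(Bpre B) v : R) <= 2 by rewrite indicE; case: (_ \in _); rewrite /=; lra.
have mind B (mB : measurable B) : measurable_fun [set: n.+1.-tuple T] (\1_(Bpre B) : _ -> R).
  by apply: measurable_indic; exact: (mBpre _ mB).
have step2 B : measurable B -> forall C, measurable C ->
    m1 ((fun v => thead v) @^-1` C `&` Bpre B) = m2 ((fun v => thead v) @^-1` C `&` Bpre B).
  move=> mB C mC.
  have E (m : {finite_measure set (n.+1.-tuple T) -> \bar R}) :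
     m ((fun v => thead v) @^-1` C `&` Bpre B) = wpush m mth (mind B mB) (ind02 B) C.
    rewrite /wpush integral_indic; first by rewrite setIC.
      by exact: (measurable_preimageT mth).
    exact: mBpre.
  rewrite !E; apply: (@same_cos_unique _ (wpush m1 mth (mind B mB) (ind02 B)) (wpush m2 mth (mind B mB) (ind02 B))) => // c p.
  have mc : measurable_fun [set: T] (fun x => (1 + cos (c * x + p))%:E).
    by apply/measurable_EFinP; apply: measurable_1cos; apply: measurable_funD => //; exact: measurable_funM.
  rewrite !integral_wpush//; try by move=> v; rewrite lee_fin cos1_ge0.
  have := step1 c p B mB; rewrite /wpush.
  have E2 (m : {finite_measure set (n.+1.-tuple T) -> \bar R}) :
    (\int[m]_(x in Bpre B) (h c p x)%:E = \int[m]_x ((1 + cos (c * thead x + p))%:E * (\1_(Bpre B) x)%:E))%E.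
    rewrite integral_mkcond; apply: eq_integral => v _; rewrite patchE indicE.
    by case: ifP; rewrite ?mule1 ?mule0.
  by rewrite -/(Bpre B) !E2.
pose psi (v : n.+1.-tuple T) : T * n.-tuple T := (thead v, [tuple of behead v]).
pose cn (z : T * n.-tuple T) : n.+1.-tuple T := [tuple of z.1 :: z.2].
have mpsi : measurable_fun setT psi by exact/measurable_fun_pairP.
have mcn : measurable_fun setT cn by apply: measurable_cons.
have cnK v : cn (psi v) = v by rewrite /cn /psi/= -tuple_eta.
have one02 (v : n.+1.-tuple T) : 0 <= (1 : R) <= 2 by lra.
have m1' : measurable_fun [set: n.+1.-tuple T] (fun=> 1 : R) by [].
have E3 (m : {finite_measure set (n.+1.-tuple T) -> \bar R}) C : measurable C ->
   wpush m mpsi m1' one02 C = m (psi @^-1` C).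
  move=> mC; rewrite /wpush integral_cst ?mul1e//.
  by exact: (measurable_preimageT mpsi).
have key : forall C, measurable C -> wpush m1 mpsi m1' one02 C = wpush m2 mpsi m1' one02 C.
  apply: (@measure_unique _ R _ [set A `*` B | A in measurable & B in measurable] (fun=> setT)) => //.
  - exact: measurable_prod_measurableType.
  - move=> _ _ [A1 mA1 [B1 mB1 <-]] [A2 mA2 [B2 mB2 <-]].
    rewrite -setXI; exists (A1 `&` A2); first exact: measurableI.
    by exists (B1 `&` B2) => //; exact: measurableI.
  - by move=> _; exists setT => //; exists setT => //; rewrite setXTT.
  - by rewrite bigcup_const.
  - move=> _ [C mC [B mB <-]]; have mCB := measurableX mC mB.
    exact: (etrans (E3 m1 _ mCB) (etrans (step2 B mB C mC) (esym (E3 m2 _ mCB)))).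
  - by move=> _; rewrite ltey_eq fin_num_measure.
have mA' : measurable (cn @^-1` A) by exact: (measurable_preimageT mcn).
have := key _ mA'; rewrite !E3//.
have -> : psi @^-1` (cn @^-1` A) = A by apply/seteqP; split => v /=; rewrite cnK.
by [].
Qed.

End unique_tuple.

(** * The standard Gaussian measure on tuples *)

Section gam.
Context {R : realType}.
Notation T := (measurableTypeR R).

Definition tcons n (z : T * n.-tuple T) : n.+1.-tuple T := [tuple of z.1 :: z.2].

Lemma measurable_tcons n : measurable_fun setT (@tcons n).
Proof. exact: measurable_cons. Qed.

HB.instance Definition _ n := isMeasurableFun.Build _ _ _ _ (@tcons n) (@measurable_tcons n).

Fixpoint gam n : probability (n.-tuple T) R :=
  if n is m.+1 then distribution (gamma1 \x gam m)%E (@tcons m)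
  else \d_([tuple] : 0.-tuple T).

Lemma integral_gamS n (f : n.+1.-tuple T -> \bar R) : measurable_fun setT f ->
  (forall v, 0 <= f v)%E ->
  (\int[gam n.+1]_v f v = \int[gam n]_v \int[gamma1]_x f (tcons (x, v)))%E.
Proof.
move=> mf f0.
have mfc : measurable_fun setT (f \o @tcons n) by exact: measurableT_comp.
have f0' z : (0 <= (f \o @tcons n) z)%E by exact: f0.
have h := @fubini_tonelli _ _ _ _ R gamma1 (gam n) _ mfc f0'.
have h1 := @fubini_tonelli1 _ _ _ _ R gamma1 (gam n) _ mfc f0'.
have h2 := @ge0_integral_distribution _ _ _ _ _ (gamma1 \x gam n)%E (@tcons n) f mf f0.
by apply: (etrans h2); apply: (etrans h1); exact: h.
Qed.

Lemma integral_gam0 (f : 0.-tuple T -> \bar R) : measurable_fun setT f ->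
  (\int[gam 0]_v f v = f [tuple])%E.
Proof.
move=> mf; have := @integral_dirac _ (0.-tuple T) ([tuple] : 0.-tuple T) R setT measurableT f mf.
by rewrite diracT mul1e.
Qed.

Lemma lin_tcons n (c : 'I_n.+1 -> R) x (v : n.-tuple T) :
  lin c (tcons (x, v)) = c ord0 * x + lin (fun i => c (lift ord0 i)) v.
Proof.
rewrite /lin big_ord_recl; congr (_ + _).
by apply: eq_bigr => i _; rewrite /tcons tnthS.
Qed.

Lemma integral_gam_cos n (c : 'I_n -> R) p :
  (\int[gam n]_v (1 + cos (lin c v + p))%:E =
   (1 + cos p * expR (- ((\sum_i c i ^+ 2) / 2)))%:E)%E.
Proof.
have mc k (c' : 'I_k -> R) q : measurable_fun [set: k.-tuple T] (fun v => (1 + cos (lin c' v + q))%:E).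
  by apply/measurable_EFinP; apply: measurable_1cos; apply: measurable_funD => //; exact: measurable_lin.
have c0 k (c' : 'I_k -> R) q v : (0 <= (1 + cos (lin c' v + q))%:E)%E by rewrite lee_fin cos1_ge0.
elim: n => [|n IH] in c p *.
  rewrite integral_gam0// big_ord0 mul0r oppr0 expR0 mulr1.
  by rewrite /lin big_ord0 add0r.
rewrite integral_gamS//.
have e01 : 0 <= expR (- (c ord0 ^+ 2 / 2)) <= 1.
  by rewrite expR_ge0 -[leRHS]expR0 ler_expR oppr_le0 divr_ge0 ?sqr_ge0.
set e := expR _ in e01.
transitivity (\int[gam n]_v ((cst (1 - e)%:E v) + e%:E * (1 + cos (lin (fun i => c (lift ord0 i)) v + p))%:E))%E.
  apply: eq_integral => v _.
  under eq_integral do rewrite lin_tcons -addrA.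
  by rewrite integral_gamma1_cos /cst -EFinM -EFinD; congr EFin; rewrite -/e; ring.
have /andP[e0 e1] := e01.
rewrite ge0_integralD//; last 3 first.
- by move=> v _; rewrite /cst lee_fin subr_ge0.
- by move=> v _; rewrite mule_ge0.
- by apply: measurable_funeM; exact: (mc n).
have -> : (\int[gam n]_v cst (1 - e)%:E v = (1 - e)%:E)%E.
  by rewrite integral_cst// [X in (_ * X)%E](probability_setT (gam n)) mule1.
rewrite ge0_integralZl//; last exact: (mc n).
rewrite IH -EFinM -EFinD; congr EFin; rewrite big_ord_recl mulrDl opprD expRD -/e; ring.
Qed.

(** The joint law is prescribed by its Fourier integrals; by [same_cosn_unique] this amounts to
    having law [gam n], and independence never has to be stated separately. *)
Definition std_gauss d (Omega : measurableType d) (P : probability Omega R) n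
    (xi : 'I_n -> Omega -> R) :=
  (forall i, measurable_fun setT (xi i)) /\
  forall (c : 'I_n -> R) p,
  (\int[P]_w (1 + cos (\sum_i c i * xi i w + p))%:E =
   (1 + cos p * expR (- ((\sum_i c i ^+ 2) / 2)))%:E)%E.

Definition tup d (Omega : measurableType d) n (xi : 'I_n -> Omega -> R) (w : Omega) : n.-tuple T :=
  [tuple (xi i w : T) | i < n].

Lemma measurable_tup d (Omega : measurableType d) n (xi : 'I_n -> Omega -> R) :
  (forall i, measurable_fun setT (xi i)) -> measurable_fun setT (tup xi).
Proof.
move=> mxi; apply/measurable_fun_tnthP => i.
have -> : (fun v => tnth v i) \o tup xi = xi i by apply/funext => w; rewrite /= tnth_mktuple.
exact: mxi.
Qed.

Lemma std_gauss_law d (Omega : measurableType d) (P : probability Omega R) n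
    (xi : 'I_n -> Omega -> R) (f : n.-tuple T -> \bar R) :
  std_gauss P xi -> measurable_fun setT f -> (forall v, 0 <= f v)%E ->
  (\int[P]_w f (tup xi w) = \int[gam n]_v f v)%E.
Proof.
move=> [mxi H] mf f0.
have mt := measurable_tup mxi.
have m1 : measurable_fun [set: Omega] (fun=> 1 : R) by [].
have one02 (v : Omega) : 0 <= (1 : R) <= 2 by lra.
have E g : measurable_fun [set: n.-tuple T] g -> (forall v, 0 <= g v)%E ->
    (\int[wpush P mt m1 one02]_v g v = \int[P]_w g (tup xi w))%E.
  by move=> mg g0; rewrite integral_wpush//; under eq_integral do rewrite mule1.
rewrite -E//; apply: eq_measure_integral => A mA _.
apply: (@same_cosn_unique _ n (wpush P mt m1 one02) (gam n)) => // c p.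
rewrite integral_gam_cos E.
- rewrite -H; apply: eq_integral => w _.
  by congr (1 + cos (_ + _))%:E; apply: eq_bigr => i _; rewrite tnth_mktuple.
- by apply/measurable_EFinP; apply: measurable_1cos; apply: measurable_funD => //; exact: measurable_lin.
- by move=> v; rewrite lee_fin cos1_ge0.
Qed.

Lemma std_gauss_gam n : std_gauss (gam n) (fun i v => tnth v i).
Proof.
split; first by move=> i; exact: measurable_tnth.
by move=> c p; exact: integral_gam_cos.
Qed.

(** Independence in product form: on [gam n] the coordinates are integrated one after the other, and
    [std_gauss_law] transports the result to any space. *)
Lemma std_gauss_prod d (Omega : measurableType d) (P : probability Omega R) n
    (xi : 'I_n -> Omega -> R) (F : 'I_n -> R -> R) :
  std_gauss P xi -> (forall i, measurable_fun [set: R] (F i)) -> (forall i x, 0 <= F i x) ->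
  (\int[P]_w (\prod_i F i (xi i w))%:E = \prod_i \int[gamma1]_x (F i x)%:E)%E.
Proof.
move=> H mF F0.
have mP k (F' : 'I_k -> R -> R) : (forall i, measurable_fun [set: R] (F' i)) ->
    measurable_fun [set: k.-tuple T] (fun v => (\prod_i F' i (tnth v i))%:E).
  move=> mF'; apply/measurable_EFinP; apply: measurable_prod => i _.
  by apply: (measurableT_comp (mF' i)); exact: measurable_tnth.
transitivity (\int[gam n]_v (\prod_i F i (tnth v i))%:E)%E.
  rewrite -(std_gauss_law H)//.
  - by apply: eq_integral => w _; congr EFin; apply: eq_bigr => i _; rewrite tnth_mktuple.
  - exact: mP.
  - by move=> v; rewrite lee_fin prodr_ge0.
elim: n => [|n IH] in xi F mF F0 {H} *.
  by rewrite integral_gam0 ?big_ord0//; exact: mP.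
rewrite integral_gamS; [|exact: mP|by move=> v; rewrite lee_fin prodr_ge0].
rewrite big_ord_recl -(IH (fun i => xi (lift ord0 i)) (fun i => F (lift ord0 i)))//.
rewrite muleC -ge0_integralZr//; last 3 first.
- by apply: (mP n (fun i => F (lift ord0 i))).
- by move=> v _; rewrite lee_fin prodr_ge0.
- by apply: integral_ge0 => x _; rewrite lee_fin.
apply: eq_integral => v _; rewrite -ge0_integralZl//; last 3 first.
- by apply/measurable_EFinP; exact: mF.
- by move=> x _; rewrite lee_fin.
- by rewrite lee_fin prodr_ge0.
apply: eq_integral => x _; rewrite -EFinM; congr EFin.
rewrite big_ord_recl mulrC; congr (_ * _).
by apply: eq_bigr => i _; rewrite /tcons tnthS.
Qed.

End gam.

(** * Gaussian integrals *)

Section gaussian_integrals.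
Context {R : realType}.
Notation T := (measurableTypeR R).
Notation mu := (@lebesgue_measure R).

Lemma normal_pdfE' (m r x : R) : 0 < r ->
  normal_pdf m r x = (r * Num.sqrt (pi *+ 2))^-1 * expR (- (x - m) ^+ 2 / (r ^+ 2 * 2)).
Proof.
move=> r0; rewrite normal_pdfE ?gt_eqF// /normal_peak /normal_fun mulr_natr.
congr (_^-1 * _); rewrite -mulrnAr sqrtrM ?sqr_ge0// sqrtr_sqr ger0_norm// ltW//.
Qed.

Lemma integral_gauss_fun (m v : R) : 0 < v ->
  (\int[mu]_x (expR (- (x - m) ^+ 2 / (v * 2)))%:E = (Num.sqrt v * Num.sqrt (pi *+ 2))%:E)%E.
Proof.
move=> v0; have s0 : 0 < Num.sqrt v by rewrite sqrtr_gt0.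
have k0 : 0 < Num.sqrt v * Num.sqrt (pi *+ 2).
  by rewrite mulr_gt0// lt_def sqrt2pi_neq0 sqrtr_ge0.
have := integral_normal_pdf m (Num.sqrt v).
under eq_integral do rewrite normal_pdfE'// sqr_sqrtr ?(ltW v0)// EFinM.
rewrite ge0_integralZl//; last 1 first.
- apply/measurable_EFinP; apply: measurableT_comp => //; apply: measurable_funM => //.
  by apply: measurableT_comp => //; apply: measurable_funX => //; exact: measurable_funB.
move=> /(congr1 (fun z => (Num.sqrt v * Num.sqrt (pi *+ 2))%:E * z)%E).
by rewrite mule1 muleA -EFinM mulfV ?gt_eqF// mul1e.
Qed.

(** Master formula for completed squares: the term x^2/2 in the exponent cancels the standard
    density, and an unnormalised normal density of mean [m] and variance [v] remains. *)
Lemma integral_gamma1_exp (F : R -> R) (K m v : R) : 0 < v -> 0 <= K ->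
  (forall x, F x = K * expR (- (x - m) ^+ 2 / (v * 2) + x ^+ 2 / 2)) ->
  (\int[gamma1]_x (F x)%:E = (K * Num.sqrt v)%:E)%E.
Proof.
move=> v0 K0 FE.
have me : measurable_fun [set: R] (fun x : R => expR (- (x - m) ^+ 2 / (v * 2))).
  apply: measurableT_comp => //; apply: measurable_funM => //.
  by apply: measurableT_comp => //; apply: measurable_funX => //; exact: measurable_funB.
rewrite integral_gamma1; last 2 first.
- rewrite (_ : F = (fun x => K * (expR (- (x - m) ^+ 2 / (v * 2)) * expR (x ^+ 2 / 2)))).
    apply/measurable_EFinP; apply: measurable_funM => //; apply: measurable_funM => //.
    by apply: measurableT_comp => //; apply: measurable_funM => //; exact: measurable_funX.
  by apply/funext => x; rewrite FE expRD.
- by move=> x; rewrite lee_fin FE mulr_ge0// expR_ge0.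
transitivity (\int[mu]_x ((K / Num.sqrt (pi *+ 2))%:E * (expR (- (x - m) ^+ 2 / (v * 2)))%:E))%E.
  apply: eq_integral => x _; rewrite -!EFinM FE gsE; congr EFin.
  rewrite expRD expRN; field; rewrite sqrt2pi_neq0/=; by rewrite gt_eqF// expR_gt0.
rewrite ge0_integralZl//; last 2 first.
- exact/measurable_EFinP.
- by rewrite lee_fin divr_ge0// sqrtr_ge0.
rewrite integral_gauss_fun// -EFinM; congr EFin; field; exact: sqrt2pi_neq0.
Qed.

Lemma integral_gamma1_expsqr (t : R) : t < 2^-1 ->
  (\int[gamma1]_x (expR (t * x ^+ 2))%:E = (Num.sqrt (1 - 2 * t)^-1)%:E)%E.
Proof.
move=> t2; have d0 : 0 < 1 - 2 * t by lra.
rewrite (@integral_gamma1_exp _ 1 0 (1 - 2 * t)^-1) ?mul1r ?invr_gt0// => x.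
by rewrite mul1r; congr expR; field; rewrite gt_eqF.
Qed.

Lemma integral_gamma1_explin (b : R) :
  (\int[gamma1]_x (expR (b * x))%:E = (expR (b ^+ 2 / 2))%:E)%E.
Proof.
rewrite (@integral_gamma1_exp _ (expR (b ^+ 2 / 2)) b 1) ?sqrtr1 ?mulr1 ?expR_ge0// => x.
by rewrite -expRD; congr expR; field.
Qed.

Lemma integral_gamma1_sqr : (\int[@gamma1 R]_x (x ^+ 2)%:E = 1)%E.
Proof.
have m2 : measurable_fun [set: R] (fun x : R => x ^+ 2) by exact: measurable_funX.
rewrite integral_gamma1; [|exact/measurable_EFinP|by move=> x; rewrite lee_fin; exact: sqr_ge0].
have i2 : mu.-integrable [set: R] (EFin \o (fun x => x ^+ 2 * gs x)).
  apply: (@integrable_mul_gs _ 1) => // x; rewrite mul1r ger0_norm ?sqr_ge0//; lra.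
pose h (x : R) := x ^+ 2 * gs x - gs x.
have ih : mu.-integrable [set: R] (EFin \o h).
  rewrite (_ : h = (fun x => (x ^+ 2 - 1) * gs x)); last by apply/funext => x; rewrite /h; ring.
  apply: (@integrable_mul_gs _ 1); first exact: measurable_funB.
  by move=> x; rewrite mul1r (le_trans (ler_normB _ _))// normr1 ger0_norm ?sqr_ge0// addrC.
have dH (x : R) : is_derive x (1:R) (fun x => - (x * gs x)) (h x).
  have ? := is_derive_gs x.
  by apply: is_derive_eq; rewrite /h /GRing.scale /=; ring.
have [] := @cvg_gs_tail R 1 (fun x => - (x * gs x)).
  move=> x; rewrite mul1r normrN normrM (ger0_norm (gs_ge0 _)) ler_wpM2r ?gs_ge0//.
  by rewrite lerDr.
move=> H1 H2.
have ch : continuous h.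
  move=> x; apply: cvgB; last exact: continuous_gs.
  by apply: cvgM; [exact: exprn_continuous|exact: continuous_gs].
have := Rintegral_derive_line ch ih dH H1 H2.
rewrite /h RintegralB//; last exact: integrable_normal_pdf.
rewrite Rintegral_gs => /eqP; rewrite subr_eq0 => /eqP.
move=> E; rewrite -[RHS]/(1%:E) -E /Rintegral fineK//.
exact: integrable_fin_num.
Qed.

(** Only finiteness matters: x^4 <= 64 exp(x^2/4), and the integral of exp(x^2/4) is sqrt 2 <= 2. *)
Lemma integral_gamma1_4 : (\int[@gamma1 R]_x (x ^+ 4)%:E <= 128%:E)%E.
Proof.
have m4 : measurable_fun [set: R] (fun x : R => (x ^+ 4)%:E) by apply/measurable_EFinP; exact: measurable_funX.
have me : measurable_fun [set: R] (fun x : R => (expR (4^-1 * x ^+ 2))%:E).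
  by apply/measurable_EFinP; apply: measurableT_comp => //; apply: measurable_funM => //; exact: measurable_funX.
apply: (@le_trans _ _ (\int[gamma1]_x (64%:E * (expR (4^-1 * x ^+ 2))%:E))%E).
  apply: ge0_le_integral => //.
  - by move=> x _; rewrite lee_fin exprn_even_ge0.
  - exact: measurable_funeM.
  move=> x _; rewrite -EFinM lee_fin.
  set y := 4^-1 * x ^+ 2; have y0 : 0 <= y by rewrite mulr_ge0 ?sqr_ge0.
  have -> : x ^+ 4 = 16 * y ^+ 2 by rewrite /y; field.
  have -> : expR y = expR (y / 2) ^+ 2 by rewrite expr2 -expRD; congr expR; field.
  have := expR_ge1Dx (y / 2); set z := expR _ => z1.
  have : (1 + y / 2) ^+ 2 <= z ^+ 2 by rewrite ler_sqr ?nnegrE; lra.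
  nra.
rewrite ge0_integralZl//.
rewrite integral_gamma1_expsqr; last by lra.
rewrite -EFinM lee_fin (_ : 1 - 2 * 4^-1 = 2^-1); last by field.
rewrite invrK.
have : Num.sqrt 2 <= 2 :> R by rewrite -[leRHS]ger0_norm// -sqrtr_sqr ler_wsqrtr//; lra.
lra.
Qed.

Lemma same_cos_push d1 d2 (T1 : measurableType d1) (T2 : measurableType d2)
    (m1 : probability T1 R) (m2 : probability T2 R) (g1 : T1 -> R) (g2 : T2 -> R) (f : R -> \bar R) :
  measurable_fun setT g1 -> measurable_fun setT g2 ->
  (forall c p, (\int[m1]_x (1 + cos (c * g1 x + p))%:E = \int[m2]_x (1 + cos (c * g2 x + p))%:E)%E) ->
  measurable_fun [set: R] f -> (forall x, 0 <= f x)%E ->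
  (\int[m1]_x f (g1 x) = \int[m2]_x f (g2 x))%E.
Proof.
move=> mg1 mg2 H mf f0.
have E d (S : measurableType d) (m : probability S R) (g : S -> R) (mg : measurable_fun setT (g : S -> T))
    (ms : measurable_fun [set: S] (fun=> 1 : R)) (one02 : S -> 0 <= (1 : R) <= 2) h :
    measurable_fun [set: T] h -> (forall v, 0 <= h v)%E ->
    (\int[wpush m mg ms one02]_v h v = \int[m]_w h (g w))%E.
  by move=> mh h0; rewrite integral_wpush//; under eq_integral do rewrite mule1.
have s1 : measurable_fun [set: T1] (fun=> 1 : R) by [].
have s2 : measurable_fun [set: T2] (fun=> 1 : R) by [].
have o1 (w : T1) : 0 <= (1 : R) <= 2 by rewrite ler01 ler1n.
have o2 (w : T2) : 0 <= (1 : R) <= 2 by rewrite ler01 ler1n.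
pose mg1' : measurable_fun setT (g1 : T1 -> T) := mg1.
pose mg2' : measurable_fun setT (g2 : T2 -> T) := mg2.
apply: (etrans (esym (E _ _ m1 g1 mg1 s1 o1 f mf f0))).
apply: (etrans _ (E _ _ m2 g2 mg2 s2 o2 f mf f0)).
apply: eq_measure_integral => A mA _.
apply: (@same_cos_unique _ (wpush m1 mg1' s1 o1) (wpush m2 mg2' s2 o2)) => // c p.
have mc : measurable_fun [set: T] (fun x => (1 + cos (c * x + p))%:E).
  by apply/measurable_EFinP; apply: measurable_1cos; apply: measurable_funD => //; exact: measurable_funM.
have c0 (x : T) : (0 <= (1 + cos (c * x + p))%:E)%E by rewrite lee_fin cos1_ge0.
apply: (etrans (E _ _ m1 g1 mg1 s1 o1 _ mc c0)).
by apply: (etrans _ (esym (E _ _ m2 g2 mg2 s2 o2 _ mc c0))); exact: H.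
Qed.

(** Stated by Fourier integrals, so that the degenerate law [v] = 0 is included without a case
    distinction. *)
Definition is_gauss d (Omega : measurableType d) (P : probability Omega R) (Y : Omega -> R) (v : R) :=
  measurable_fun setT Y /\ forall c p,
  (\int[P]_w (1 + cos (c * Y w + p))%:E = (1 + cos p * expR (- (c ^+ 2 * v / 2)))%:E)%E.

Lemma is_gauss_law d (Omega : measurableType d) (P : probability Omega R) (Y : Omega -> R) (v : R)
    (f : R -> \bar R) :
  0 <= v -> is_gauss P Y v -> measurable_fun [set: R] f -> (forall x, 0 <= f x)%E ->
  (\int[P]_w f (Y w) = \int[gamma1]_x f (Num.sqrt v * x)%R)%E.
Proof.
move=> v0 [mY H] mf f0.
have ms : measurable_fun [set: T] (fun x : R => Num.sqrt v * x) by exact: measurable_funM.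
apply: (@same_cos_push _ _ _ T P gamma1 Y (fun x => Num.sqrt v * x) f mY ms _ mf f0).
move=> c p; rewrite H; under eq_integral do rewrite mulrA.
by rewrite integral_gamma1_cos exprMn sqr_sqrtr.
Qed.

Lemma is_gauss_sqr d (Omega : measurableType d) (P : probability Omega R) (Y : Omega -> R) (v : R) :
  0 <= v -> is_gauss P Y v -> (\int[P]_w (Y w ^+ 2)%:E = v%:E)%E.
Proof.
move=> v0 H; have m2 : measurable_fun [set: R] (fun x : R => x ^+ 2) by exact: measurable_funX.
rewrite (is_gauss_law (f := fun x => (x ^+ 2)%:E) v0 H); last 2 first.
- exact/measurable_EFinP.
- by move=> x; rewrite lee_fin; exact: sqr_ge0.
under eq_integral do rewrite exprMn sqr_sqrtr// EFinM.
rewrite ge0_integralZl//.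
- by rewrite integral_gamma1_sqr mule1.
- exact/measurable_EFinP.
- by move=> x _; rewrite lee_fin; exact: sqr_ge0.
Qed.

Lemma is_gauss_4 d (Omega : measurableType d) (P : probability Omega R) (Y : Omega -> R) (v : R) :
  0 <= v -> is_gauss P Y v -> (\int[P]_w (Y w ^+ 4)%:E <= (128 * v ^+ 2)%:E)%E.
Proof.
move=> v0 H; have m4 : measurable_fun [set: R] (fun x : R => x ^+ 4) by exact: measurable_funX.
have p4 (x : R) : 0 <= x ^+ 4 by rewrite exprn_even_ge0.
rewrite (is_gauss_law (f := fun x => (x ^+ 4)%:E) v0 H)//; last exact/measurable_EFinP.
have v4 : Num.sqrt v ^+ 4 = v ^+ 2 by rewrite (exprM _ 2 2) sqr_sqrtr.
under eq_integral do rewrite exprMn v4 EFinM.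
rewrite ge0_integralZl//.
- by apply: (le_trans (lee_wpmul2l _ integral_gamma1_4)); rewrite ?lee_fin ?sqr_ge0// mulrC.
- exact/measurable_EFinP.
- by move=> x _; rewrite lee_fin.
- by rewrite lee_fin; exact: sqr_ge0.
Qed.

Lemma std_gauss_lin d (Omega : measurableType d) (P : probability Omega R) n
    (xi : 'I_n -> Omega -> R) (c : 'I_n -> R) :
  std_gauss P xi -> is_gauss P (fun w => \sum_i c i * xi i w) (\sum_i c i ^+ 2).
Proof.
move=> [mxi H]; split.
  by apply: measurable_sum => i; exact: measurable_funM.
move=> k p; have -> : k ^+ 2 * (\sum_i c i ^+ 2) = \sum_i (k * c i) ^+ 2.
  by rewrite mulr_sumr; apply: eq_bigr => i _; rewrite exprMn.
rewrite -H; apply: eq_integral => w _; rewrite mulr_sumr.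
by congr (1 + cos (_ + _))%:E; apply: eq_bigr => i _; rewrite mulrA.
Qed.

Lemma gamma1_affine (y r : R) (f : R -> \bar R) : 0 < r ->
  measurable_fun [set: R] f -> (forall x, 0 <= f x)%E ->
  (\int[gamma1]_x f (y + r * x)%R = \int[mu]_u (f u * (normal_pdf y r u)%:E))%E.
Proof.
move=> r0 mf f0.
have dens g : measurable_fun [set: T] g -> (forall x, 0 <= g x)%E ->
    (\int[normal_prob y r]_x g x = \int[mu]_u (g u * (normal_pdf y r u)%:E))%E.
  move=> mg g0; apply: (@ge0_integral_density _ _ _ _ _ mu (normal_prob y r) idfun (normal_pdf y r)) => //.
  - exact: measurable_id.
  - exact: measurable_normal_pdf.
  - by move=> x; exact: normal_pdf_ge0.
apply: (etrans _ (dens f mf f0)).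
have ms : measurable_fun [set: T] (fun x : R => y + r * x).
  by apply: measurable_funD => //; exact: measurable_funM.
apply: (@same_cos_push _ _ T T gamma1 (normal_prob y r) (fun x => y + r * x) idfun f ms (@measurable_id _ _ _) _ mf f0).
move=> c p /=.
have cc : continuous (fun x : R => 1 + cos (c * x + p)).
  by move=> x; apply: cvgD; [exact: cvg_cst|exact: continuous_cos_affine].
have mc : measurable_fun [set: T] (fun x => (1 + cos (c * x + p))%:E).
  by apply/measurable_EFinP; exact: continuous_measurable_fun.
have c0 (x : T) : (0 <= (1 + cos (c * x + p))%:E)%E by rewrite lee_fin cos1_ge0.
apply: (etrans _ (esym (dens _ mc c0))).
have := @gamma1_smooth R (fun x => 1 + cos (c * x + p)) r^-1 y cc (fun x => cos1_ge0 _).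
rewrite invr_gt0 => /(_ r0).
under eq_integral do rewrite invrK (mulrC _ r).
move=> ->; apply: eq_integral => x _; rewrite -EFinM; congr EFin.
rewrite normal_pdfE'// /bump -mulrA; congr (_ * _); rewrite invfM; congr (_ * expR _).
by field; rewrite gt_eqF.
Qed.

(** Likelihood ratio of N(y, r^2) to N(0, s^2), evaluated at the point s x. *)
Definition affr (y r s x : R) : R :=
  (s / r) * expR (x ^+ 2 / 2 - (s * x - y) ^+ 2 / (2 * r ^+ 2)).

Lemma measurable_affr y r s : measurable_fun [set: R] (affr y r s).
Proof.
apply: measurable_funM => //; apply: measurableT_comp => //; apply: measurable_funB.
  by apply: measurable_funM => //; exact: measurable_funX.
apply: measurable_funM => //; apply: measurable_funX => //; apply: measurable_funB => //.
Qed.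

Lemma affr_ge0 y r s x : 0 < r -> 0 < s -> 0 <= affr y r s x.
Proof. by move=> r0 s0; rewrite mulr_ge0 ?expR_ge0// divr_ge0// ltW. Qed.

Lemma gamma1_change (y r s : R) (f : R -> \bar R) : 0 < r -> 0 < s ->
  measurable_fun [set: R] f -> (forall x, 0 <= f x)%E ->
  (\int[gamma1]_x f (y + r * x)%R = \int[gamma1]_x (f (s * x)%R * (affr y r s x)%:E))%E.
Proof.
move=> r0 s0 mf f0; rewrite gamma1_affine//.
pose g u := (f u * (affr y r s (u / s))%:E)%E.
transitivity (\int[gamma1]_x (g (0 + s * x)%R))%E; last first.
  by apply: eq_integral => x _; rewrite /g add0r mulrAC mulfV ?gt_eqF// mul1r.
have mg : measurable_fun [set: R] g.
  apply: emeasurable_funM => //; apply/measurable_EFinP.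
  by apply: (measurableT_comp (measurable_affr y r s)); exact: measurable_funM.
rewrite (gamma1_affine (f := g) _ s0 mg); last by move=> x; rewrite mule_ge0// lee_fin affr_ge0.
apply: eq_integral => u _; rewrite /g -muleA -EFinM; congr (_ * _%:E)%E.
rewrite !normal_pdfE'// /affr subr0.
have -> : expR ((u / s) ^+ 2 / 2 - (s * (u / s) - y) ^+ 2 / (2 * r ^+ 2)) =
   expR (- (u - y) ^+ 2 / (r ^+ 2 * 2)) / expR (- u ^+ 2 / (s ^+ 2 * 2)).
  by rewrite -expRN -expRD; congr expR; field; rewrite !gt_eqF.
by field; rewrite sqrt2pi_neq0 !gt_eqF// expR_gt0.
Qed.

Definition daff n (y r : 'I_n -> R) (v : n.-tuple T) : n.-tuple T :=
  [tuple (y i + r i * tnth v i : T) | i < n].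

Lemma measurable_daff n (y r : 'I_n -> R) : measurable_fun setT (daff y r).
Proof.
have -> : daff y r = tup (fun i (v : n.-tuple T) => y i + r i * tnth v i) by [].
apply: measurable_tup => i; apply: measurable_funD => //; apply: measurable_funM => //.
exact: measurable_tnth.
Qed.

Lemma daff_tcons n (y r : 'I_n.+1 -> R) x (v : n.-tuple T) :
  daff y r (tcons (x, v)) =
  tcons (y ord0 + r ord0 * x, daff (fun i => y (lift ord0 i)) (fun i => r (lift ord0 i)) v).
Proof.
apply: eq_from_tnth => i; rewrite tnth_mktuple.
case: (unliftP ord0 i) => [j|] ->; last by rewrite /tcons !tnth0.
by rewrite /tcons !tnthS tnth_mktuple.
Qed.

(** Product of the one-dimensional likelihood ratios. It compares the law of the source given a
    codeword [y] with its unconditional law. *)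
Lemma gam_change n (y r s : 'I_n -> R) (f : n.-tuple T -> \bar R) :
  (forall i, 0 < r i) -> (forall i, 0 < s i) ->
  measurable_fun setT f -> (forall v, 0 <= f v)%E ->
  (\int[gam n]_v f (daff y r v) =
   \int[gam n]_v (f (daff (fun=> 0%R) s v) * (\prod_i affr (y i) (r i) (s i) (tnth v i))%:E))%E.
Proof.
move=> r0 s0 mf f0.
have mp k (y' r' s' : 'I_k -> R) : measurable_fun setT (fun v : k.-tuple T => (\prod_i affr (y' i) (r' i) (s' i) (tnth v i))%:E).
  apply/measurable_EFinP; apply: measurable_prod => i _.
  by apply: (measurableT_comp (measurable_affr _ _ _)); exact: measurable_tnth.
elim: n => [|n IH] in y r s f r0 s0 mf f0 *.
  have mfd k q : measurable_fun setT (fun v => f (daff k q v)) by apply: measurableT_comp => //; exact: measurable_daff.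
  rewrite !integral_gam0//.
  - by rewrite big_ord0 mule1; congr f; rewrite (tuple0 (daff _ _ _)) (tuple0 (daff _ s _)).
  - by apply: emeasurable_funM; [exact: (mfd (fun=> 0%R) s)|exact: (mp 0%N)].
have mfd k q : measurable_fun setT (fun v => f (daff k q v)) by apply: measurableT_comp => //; exact: measurable_daff.
have mh : measurable_fun setT (fun v => f (daff (fun=> 0%R) s v) * (\prod_i affr (y i) (r i) (s i) (tnth v i))%:E)%E.
  by apply: emeasurable_funM; [exact: (mfd (fun=> 0%R) s)|exact: (mp n.+1)].
have h0 v : (0 <= f (daff (fun=> 0%R) s v) * (\prod_i affr (y i) (r i) (s i) (tnth v i))%:E)%E.
  by rewrite mule_ge0// lee_fin prodr_ge0// => i _; exact: affr_ge0.
rewrite (integral_gamS (mfd y r)) ?(integral_gamS mh)//.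
pose y' i := y (lift ord0 i); pose r' i := r (lift ord0 i); pose s' i := s (lift ord0 i).
have mft (u : n.-tuple T) : measurable_fun [set: R] (fun x : R => f (tcons (x, u))).
  apply: (measurableT_comp mf); apply: (measurableT_comp (@measurable_tcons _ n)).
  exact: measurable_pair2.
pose g u := (\int[gamma1]_x (f (tcons ((s ord0 * x)%R, u)) * (affr (y ord0) (r ord0) (s ord0) x)%:E))%E.
have g0 u : (0 <= g u)%E.
  by apply: integral_ge0 => x _; rewrite mule_ge0// lee_fin affr_ge0.
have mg : measurable_fun setT g.
  pose F (z : n.-tuple T * T) := (f (tcons ((s ord0 * z.2)%R, z.1)) * (affr (y ord0) (r ord0) (s ord0) z.2)%:E)%E.
  have mF : measurable_fun setT F.
    apply: emeasurable_funM; last by apply/measurable_EFinP; apply: (measurableT_comp (measurable_affr _ _ _)).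
    apply: (measurableT_comp mf); apply: (measurableT_comp (@measurable_tcons _ n)).
    have ms2 : measurable_fun [set: n.-tuple T * T] (fun z => s ord0 * z.2 : R) by apply: measurable_funM.
    by apply/measurable_fun_pairP; split; [exact: ms2|exact: measurable_fst].
  apply: (@measurable_fun_fubini_tonelli_F _ _ _ _ R gamma1 F mF) => z.
  by rewrite mule_ge0// lee_fin affr_ge0.
transitivity (\int[gam n]_v g (daff y' r' v))%E.
  apply: eq_integral => v _; rewrite /g.
  under eq_integral do rewrite daff_tcons.
  by rewrite (@gamma1_change (y ord0) (r ord0) (s ord0) (fun x => f (tcons (x, _))))//.
apply: (etrans (IH y' r' s' g (fun i => r0 _) (fun i => s0 _) mg g0)).
apply: eq_integral => v _.
rewrite muleC /g -ge0_integralZl//; last 3 first.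
- apply: emeasurable_funM; last by apply/measurable_EFinP; exact: measurable_affr.
  by apply: (measurableT_comp (mft _)); exact: measurable_funM.
- by move=> x _; rewrite mule_ge0// lee_fin affr_ge0.
- by rewrite lee_fin prodr_ge0// => i _; apply: affr_ge0; [exact: r0|exact: s0].
apply: eq_integral => x _; rewrite daff_tcons add0r muleCA; congr (_ * _)%E.
rewrite -EFinM big_ord_recl mulrC; congr (_ * _)%:E.
by apply: eq_bigr => i _; rewrite /tcons tnthS.
Qed.

End gaussian_integrals.

(** * Quantization of Gaussian vectors *)

Section minimum.
Context {R : realType} {A : Type}.
Implicit Types (f g : A -> \bar R) (s : seq A).

(** The minimum in the form used by [distortion]. An empty codebook gets the value +oo, so a finite
    distortion excludes it. *)
Definition mind f s : \bar R := \big[Order.min/+oo%E]_(a <- s) f a.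

Lemma mind_cons f a s : mind f (a :: s) = Order.min (f a) (mind f s).
Proof. by rewrite /mind big_cons. Qed.

Lemma mind_ge f s (t : \bar R) : (forall i d, (i < size s)%N -> (t <= f (nth d s i))%E) -> (t <= mind f s)%E.
Proof.
elim: s => [|a s IH] H; first by rewrite /mind big_nil leey.
rewrite mind_cons le_min (H 0%N a)//= IH// => i d is_.
exact: (H i.+1 d).
Qed.

Lemma mind_le f s i d : (i < size s)%N -> (mind f s <= f (nth d s i))%E.
Proof.
elim: s i => // a s IH [_|i is_]; rewrite mind_cons /= ge_min ?lexx//.
by rewrite IH ?orbT.
Qed.

Lemma mind_ge0 f s : (forall a, 0 <= f a)%E -> (0 <= mind f s)%E.
Proof. by move=> f0; apply: mind_ge => i d _. Qed.

Lemma mind_ex f s d : s <> [::] -> exists2 i, (i < size s)%N & mind f s = f (nth d s i).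
Proof.
elim: s => // a [|b s] IH _; first by exists 0%N => //; rewrite mind_cons /mind big_nil miney.
rewrite mind_cons; have [//|i is_ ->] := IH.
have [h|h] := leP (f a) (f (nth d (b :: s) i)); first by exists 0%N.
by exists i.+1.
Qed.

End minimum.

Lemma measurable_mind {R : realType} d (T : measurableType d) (A : Type) (f : T -> A -> \bar R) (s : seq A) :
  (forall a, measurable_fun setT (f ^~ a)) -> measurable_fun setT (fun x => mind (f x) s).
Proof.
move=> mf; elim: s => [|a s IH].
  by rewrite (_ : (fun x => _) = cst +oo%E)//; apply/funext => x; rewrite /mind big_nil.
rewrite (_ : (fun x => _) = (fun x => Order.min (f x a) (mind (f x) s))); last first.
  by apply/funext => x; rewrite mind_cons.
exact: measurable_mine.
Qed.

(** * Codebooks of random vectors *)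

Section ach.
Context {R : realType} {d} {Omega : measurableType d} (P : probability Omega R).
Notation vec N := ('I_N -> R).

Definition dist2 N (x y : vec N) : R := \sum_i (x i - y i) ^+ 2.

Lemma dist2_ge0 N (x y : vec N) : 0 <= dist2 x y.
Proof. by apply: sumr_ge0 => i _; exact: sqr_ge0. Qed.

Definition rv N (V : 'I_N -> Omega -> R) (w : Omega) : vec N := fun i => V i w.

Definition distor N (V : 'I_N -> Omega -> R) (s : seq (vec N)) : \bar R :=
  (\int[P]_w mind (fun a => (dist2 (rv V w) a)%:E) s)%E.

Definition ach N (V : 'I_N -> Omega -> R) (L D : R) : Prop :=
  exists2 s : seq (vec N), (size s)%:R <= expR L & (distor V s <= D%:E)%E.

Definition mvec N (V : 'I_N -> Omega -> R) := forall i, measurable_fun setT (V i).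

Lemma measurable_dist2 N (V : 'I_N -> Omega -> R) (a : vec N) : mvec V ->
  measurable_fun setT (fun w => dist2 (rv V w) a).
Proof.
move=> mV; apply: measurable_sum => i; apply: measurable_funX.
by apply: measurable_funB; [exact: mV|].
Qed.

Lemma measurable_mdist N (V : 'I_N -> Omega -> R) (s : seq (vec N)) : mvec V ->
  measurable_fun setT (fun w => mind (fun a => (dist2 (rv V w) a)%:E) s).
Proof.
by move=> mV; apply: measurable_mind => a; apply/measurable_EFinP; exact: measurable_dist2.
Qed.

Lemma mind_dist2_ge0 N (x : vec N) s : (0 <= mind (fun a => (dist2 x a)%:E) s)%E.
Proof. by apply: mind_ge0 => a; rewrite lee_fin dist2_ge0. Qed.

Lemma ach_nnil N (V : 'I_N -> Omega -> R) s (D : R) : (distor V s <= D%:E)%E -> s <> [::].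
Proof.
move=> + s0; rewrite /distor s0.
under eq_integral do rewrite /mind big_nil.
by rewrite integral_cst// [X in (_ * X)%E]probability_setT mule1 leye_eq.
Qed.

Lemma ach_ge0 N (V : 'I_N -> Omega -> R) L D : ach V L D -> 0 <= D.
Proof.
move=> [s _ H]; rewrite -lee_fin; apply: le_trans H.
by apply: integral_ge0 => w _; exact: mind_dist2_ge0.
Qed.

Lemma ach_weak N (V : 'I_N -> Omega -> R) L L' D D' :
  L <= L' -> D <= D' -> ach V L D -> ach V L' D'.
Proof.
move=> LL DD [s sL H]; exists s; first by rewrite (le_trans sL)// ler_expR.
by rewrite (le_trans H)// lee_fin.
Qed.

(** The codewords are mapped by [F]. The same principle serves scalings, isometries, factors on the
    rows and matrices of bounded norm. *)
Lemma ach_lip N M (V : 'I_N -> Omega -> R) (W : 'I_M -> Omega -> R) (F : vec N -> vec M) (k L D : R) :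
  mvec V -> mvec W -> 0 <= k ->
  (forall x y, dist2 (F x) (F y) <= k * dist2 x y) ->
  (forall w i, W i w = F (rv V w) i) ->
  ach V L D -> ach W L (k * D).
Proof.
move=> mV mW k0 HF HW [s sL H]; exists (map F s); first by rewrite size_map.
have s0 := ach_nnil H.
rewrite EFinM; apply: le_trans (lee_wpmul2l _ H); rewrite ?lee_fin//.
rewrite /distor -ge0_integralZl//; [|exact: measurable_mdist|by move=> w _; exact: mind_dist2_ge0].
apply: ge0_le_integral => //.
- by move=> w _; exact: mind_dist2_ge0.
- exact: measurable_mdist.
- by apply: measurable_funeM; exact: measurable_mdist.
move=> w _; have [i is_ ->] := mind_ex (fun a => (dist2 (rv V w) a)%:E) (fun=> 0) s0.
apply: (le_trans (@mind_le _ _ _ _ i (F (fun=> 0)) _)); first by rewrite size_map.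
rewrite (nth_map (fun=> 0))// -EFinM lee_fin (le_trans _ (HF _ _))//.
by rewrite (_ : rv W w = F (rv V w))//; apply/funext => j; exact: HW.
Qed.

Lemma sqr_add_le (x y e : R) : 0 < e -> (x + y) ^+ 2 <= (1 + e) * x ^+ 2 + (1 + e^-1) * y ^+ 2.
Proof.
move=> e0; rewrite -subr_ge0.
have -> : (1 + e) * x ^+ 2 + (1 + e^-1) * y ^+ 2 - (x + y) ^+ 2 = e^-1 * (e * x - y) ^+ 2.
  by field; rewrite gt_eqF.
by rewrite mulr_ge0 ?invr_ge0 ?sqr_ge0// ltW.
Qed.

(** The codebook consists of all sums of two codewords, so sizes multiply and rates add. The free
    [e] lets a vector with a much smaller error be added at little cost. *)
Lemma ach_add N (V V' : 'I_N -> Omega -> R) (L L' D D' e : R) :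
  mvec V -> mvec V' -> 0 < e ->
  ach V L D -> ach V' L' D' ->
  ach (fun i w => V i w + V' i w) (L + L') ((1 + e) * D + (1 + e^-1) * D').
Proof.
move=> mV mV' e0 [s sL H] [s' sL' H'].
exists [seq (fun i => a i + b i) | a <- s, b <- s'].
  by rewrite size_allpairs natrM expRD ler_pM.
have s0 := ach_nnil H; have s0' := ach_nnil H'.
have e1 : 0 <= 1 + e by lra.
have e1' : 0 <= 1 + e^-1 by rewrite addr_ge0// invr_ge0 ltW.
rewrite EFinD !EFinM; apply: le_trans (leeD (lee_wpmul2l _ H) (lee_wpmul2l _ H')); rewrite ?lee_fin//.
have mW : mvec (fun i w => V i w + V' i w) by move=> i; exact: measurable_funD.
rewrite /distor -!ge0_integralZl//; last 4 first.
- exact: measurable_mdist.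
- by move=> w _; exact: mind_dist2_ge0.
- exact: measurable_mdist.
- by move=> w _; exact: mind_dist2_ge0.
rewrite -ge0_integralD//; last 4 first.
- by move=> w _; rewrite mule_ge0 ?lee_fin ?mind_dist2_ge0.
- by apply: measurable_funeM; exact: measurable_mdist.
- by move=> w _; rewrite mule_ge0 ?lee_fin ?mind_dist2_ge0.
- by apply: measurable_funeM; exact: measurable_mdist.
apply: ge0_le_integral => //.
- by move=> w _; exact: mind_dist2_ge0.
- exact: measurable_mdist.
- by apply: emeasurable_funD; apply: measurable_funeM; exact: measurable_mdist.
move=> w _; have [i is_ ->] := mind_ex (fun a => (dist2 (rv V w) a)%:E) (fun=> 0) s0.
have [j js_ ->] := mind_ex (fun a => (dist2 (rv V' w) a)%:E) (fun=> 0) s0'.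
pose F (a b : vec N) : vec N := fun i => a i + b i.
have [k ks E] : exists2 k, (k < size [seq F a b | a <- s, b <- s'])%N &
   nth (fun=> 0) [seq F a b | a <- s, b <- s'] k = F (nth (fun=> 0) s i) (nth (fun=> 0) s' j).
  elim: s i is_ {H s0 sL} => // a s IH [_|i is_] /=.
    exists j; first by rewrite size_cat size_map ltn_addr.
    by rewrite nth_cat size_map js_ (nth_map (fun=> 0)).
  have [k ks E] := IH i is_; exists (size s' + k)%N; first by rewrite size_cat size_map ltn_add2l.
  by rewrite nth_cat size_map ltnNge leq_addr/= addKn.
apply: (le_trans (@mind_le _ _ _ _ k (fun=> 0) ks)); rewrite E.
rewrite -!EFinM -EFinD lee_fin /dist2 !mulr_sumr -big_split/= ler_sum// => l _.
rewrite /rv /F opprD addrACA; exact: sqr_add_le.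
Qed.

Lemma ach0 N (V : 'I_N -> Omega -> R) (D : R) : mvec V ->
  (\sum_i \int[P]_w (V i w ^+ 2)%:E <= D%:E)%E -> ach V 0 D.
Proof.
move=> mV H; exists [:: fun=> 0]; first by rewrite /= expR0.
rewrite /distor; apply: le_trans H.
rewrite -ge0_integral_sum//; last 2 first.
- by move=> i; apply/measurable_EFinP; exact: measurable_funX.
- by move=> i w _; rewrite lee_fin sqr_ge0.
rewrite le_eqVlt; apply/orP; left; apply/eqP; apply: eq_integral => w _.
rewrite mind_cons /mind big_nil miney sumEFin /dist2; congr EFin.
by apply: eq_bigr => i _; rewrite subr0.
Qed.

End ach.

Lemma integral_prob_cst {R : realType} {d} {Omega : measurableType d} (P : probability Omega R) (k : \bar R) :
  (\int[P]_w k = k)%E.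
Proof. by rewrite integral_cst// [X in (_ * X)%E]probability_setT mule1. Qed.

Lemma lee_prod_nneg {R : realType} (I : finType) (f g : I -> \bar R) :
  (forall i, 0 <= f i)%E -> (forall i, f i <= g i)%E -> (\prod_i f i <= \prod_i g i)%E.
Proof.
move=> f0 fg.
suff [_ //] : (0 <= \prod_i f i)%E /\ (\prod_i f i <= \prod_i g i)%E.
elim/big_ind2: _ => // x1 x2 y1 y2 [x10 x12] [y10 y12].
by split; [exact: mule_ge0|exact: lee_pmul].
Qed.

Lemma std_gauss_marginal {R : realType} {d} {Omega : measurableType d} (P : probability Omega R) N
    (xi : 'I_N -> Omega -> R) i : std_gauss P xi -> is_gauss P (xi i) 1.
Proof.
move=> H; have := std_gauss_lin (fun j => (j == i)%:R) H.
rewrite (bigD1 i)//= eqxx expr1n big1 ?addr0; last by move=> j /negPf ->; rewrite expr0n.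
rewrite (_ : (fun w => _) = xi i)//; apply/funext => w.
by rewrite (bigD1 i)//= eqxx mul1r big1 ?addr0// => j /negPf ->; rewrite mul0r.
Qed.

(** * A Shannon-type lower bound *)

Section lower.
Context {R : realType} {d} {Omega : measurableType d} (P : probability Omega R).
Variables (N : nat) (xi : 'I_N -> Omega -> R) (sg : 'I_N -> R) (th : R).
Hypotheses (Hxi : std_gauss P xi) (sg0 : forall i, 0 < sg i) (th0 : 0 < th).

Let V (i : 'I_N) (w : Omega) : R := sg i * xi i w.
Let S (i : 'I_N) := th <= sg i ^+ 2.
(* cancels the Gaussian density on S; off S it makes F equal to 1 at a = 0 *)
Let wt (i : 'I_N) (x : R) : R := if S i then x ^+ 2 / 2 else sg i ^+ 2 * x ^+ 2 / (2 * th).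
Let F (a : 'I_N -> R) (i : 'I_N) (x : R) : R := expR (- (sg i * x - a i) ^+ 2 / (2 * th) + wt i x).

Let mwt i : measurable_fun [set: R] (wt i).
Proof.
rewrite /wt; have [Si|Si] := boolP (S i) => /=.
  by apply: measurable_funM => //; exact: measurable_funX.
by apply: measurable_funM => //; apply: measurable_funM => //; exact: measurable_funX.
Qed.

Let mF a i : measurable_fun [set: R] (F a i).
Proof.
have mq : measurable_fun [set: R] (fun x => - (sg i * x - a i) ^+ 2 / (2 * th)).
  apply: measurable_funM => //; apply: measurableT_comp => //; apply: measurable_funX.
  by apply: measurable_funB => //; exact: measurable_funM.
by apply: measurableT_comp => //; exact: (measurable_funD mq (mwt i)).
Qed.

(** On [S] the completed square has variance th/sg^2 whatever [a] is; off [S] the integral is the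
    exponential of a nonpositive multiple of a^2. Hence the bound is uniform in the codeword. *)
Let EF a i : (\int[gamma1]_x (F a i x)%:E <= (expR (- (ln (Num.max (sg i ^+ 2 / th) 1) / 2)))%:E)%E.
Proof.
have s2 : 0 < sg i ^+ 2 by rewrite exprn_gt0.
rewrite /F /wt; have [Si|Si] := boolP (S i); rewrite ?Si ?(negbTE Si).
  rewrite (@integral_gamma1_exp _ _ 1 (a i / sg i) (th / sg i ^+ 2)) ?divr_gt0//; last first.
    by move=> x; rewrite mul1r; congr expR; field; rewrite !gt_eqF.
  rewrite mul1r lee_fin (max_idPl _) ?ler_pdivlMr ?mul1r//.
  have q0 : 0 < sg i ^+ 2 / th by rewrite divr_gt0.
  have -> : th / sg i ^+ 2 = (sg i ^+ 2 / th)^-1 by rewrite invf_div.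
  rewrite -[X in Num.sqrt X^-1](@lnK _ (sg i ^+ 2 / th)) ?posrE//.
  set l := ln _; rewrite -expRN (_ : - l = - (l / 2) + - (l / 2)); last by field.
  by rewrite expRD -expr2 sqrtr_sqr ger0_norm ?expR_ge0.
have s2th : sg i ^+ 2 <= th by by move: Si; rewrite -ltNge => /ltW.
rewrite (max_idPr _) ?ler_pdivrMr ?mul1r// ln1 mul0r oppr0 expR0.
pose b := a i * sg i / th.
under eq_integral => x _.
  rewrite (_ : _ + _ = - (a i ^+ 2 / (2 * th)) + b * x); last by rewrite /b; field; rewrite gt_eqF.
  rewrite expRD EFinM; over.
rewrite ge0_integralZl//; last 1 first.
- by apply/measurable_EFinP; apply: measurableT_comp => //; exact: measurable_funM.
rewrite integral_gamma1_explin -EFinM lee_fin -expRD -[leRHS]expR0 ler_expR.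
have -> : - (a i ^+ 2 / (2 * th)) + b ^+ 2 / 2 = a i ^+ 2 / (2 * th) * (sg i ^+ 2 / th - 1).
  by rewrite /b; field; rewrite gt_eqF.
apply: mulr_ge0_le0; first by rewrite divr_ge0 ?sqr_ge0// mulr_ge0// ltW.
by rewrite subr_le0 ler_pdivrMr// mul1r.
Qed.

(** Lagrangian duality at water level [th]: for each codeword the tilted exponential [E] has mean at
    most exp(-L), so over the whole codebook the means add up to at most 1. The bound 1 + x <= exp x
    at the nearest codeword turns this into a linear inequality for the distortion. *)
Lemma ach_lower L D : ach P V L D ->
  \sum_i Num.min (sg i ^+ 2) th + th * (\sum_i ln (Num.max (sg i ^+ 2 / th) 1) - 2 * L) <= D.
Proof.
move=> [s sL H].
have [mxi Hc] := Hxi.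
have mV : mvec V by move=> i; exact: measurable_funM.
have s0 := ach_nnil H.
pose sp : R := (2 * th)^-1.
have sp0 : 0 < sp by rewrite invr_gt0 mulr_gt0.
pose u w := \sum_i wt i (xi i w).
have wt0 i x : 0 <= wt i x.
  rewrite /wt; case: ifP => _; first by rewrite divr_ge0 ?sqr_ge0.
  by rewrite divr_ge0 ?(mulr_ge0 (sqr_ge0 _) (sqr_ge0 _))// mulr_ge0// ltW.
have u0 w : 0 <= u w by apply: sumr_ge0.
have mwx i : measurable_fun setT (fun w => wt i (xi i w)) by apply: (measurableT_comp (mwt i)).
have mu_ : measurable_fun setT u by apply: measurable_sum.
pose l := \sum_i ln (Num.max (sg i ^+ 2 / th) 1).
(* The product of the factors has mean at most exp(-l/2) by [EF], so subtracting [kp] in the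
   exponent leaves exp(-L). *)
pose kp := L - l / 2.
pose E a w := expR (- sp * dist2 (rv V w) a + u w - kp).
have mE a : measurable_fun setT (fun w => (E a w)%:E).
  apply/measurable_EFinP; apply: measurableT_comp => //; apply: measurable_funB => //.
  by apply: measurable_funD => //; apply: measurable_funM => //; exact: measurable_dist2.
have EE a : (\int[P]_w (E a w)%:E <= (expR (- L))%:E)%E.
  have -> : (fun w => (E a w)%:E) = (fun w => (expR (- kp))%:E * (\prod_i F a i (xi i w))%:E)%E.
    apply/funext => w; rewrite -EFinM /F /E -expR_sum -expRD; congr (expR _)%:E.
    rewrite addrC; congr (_ + _); rewrite big_split/= /u; congr (_ + _).
    rewrite /dist2 mulNr mulr_sumr -sumrN; apply: eq_bigr => i _.
    by rewrite /rv /V /sp !mulNr mulrC.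
  rewrite ge0_integralZl//; last 2 first.
  - apply/measurable_EFinP; apply: measurable_prod => i _.
    by apply: (measurableT_comp (mF a i)).
  - by move=> w _; rewrite lee_fin prodr_ge0// => i _; exact: expR_ge0.
  rewrite (std_gauss_prod Hxi) ?mF//; last by move=> i x; exact: expR_ge0.
  have : (\prod_i \int[gamma1]_x (F a i x)%:E <= \prod_i (expR (- (ln (Num.max (sg i ^+ 2 / th) 1) / 2)))%:E)%E.
    apply: lee_prod_nneg => i; last exact: EF.
    by apply: integral_ge0 => x _; rewrite lee_fin expR_ge0.
  move=> /(lee_wpmul2l _) => /(_ (expR (- kp))%:E); rewrite lee_fin expR_ge0 => /(_ isT)/le_trans; apply.
  rewrite prodEFin -EFinM lee_fin -expR_sum -expRD ler_expR /kp sumrN -mulr_suml -/l.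
  lra.
have u_E : (\int[P]_w (u w)%:E = (sp * \sum_i Num.min (sg i ^+ 2) th)%:E)%E.
  rewrite mulr_sumr -sumEFin.
  under eq_integral do rewrite /u -sumEFin.
  rewrite ge0_integral_sum//; last 2 first.
  - by move=> i; exact/measurable_EFinP.
  - by move=> i w _; rewrite lee_fin.
  apply: eq_bigr => i _.
  have x2 : (\int[P]_w (xi i w ^+ 2)%:E = 1)%E by exact: (is_gauss_sqr ler01 (std_gauss_marginal i Hxi)).
  have mx2 : measurable_fun setT (fun w => (xi i w ^+ 2)%:E).
    by apply/measurable_EFinP; apply: measurable_funX; exact: mxi.
  have K k : 0 <= k -> (\int[P]_w (k * xi i w ^+ 2)%:E = k%:E)%E.
    move=> k0; under eq_integral do rewrite EFinM.
    by rewrite ge0_integralZl// ?x2 ?mule1// => w _; rewrite lee_fin sqr_ge0.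
  have [Si|Si] := boolP (S i); rewrite /wt ?Si ?(negbTE Si).
    rewrite (min_idPr Si) /sp; under eq_integral do rewrite mulrC.
    by rewrite K//; congr EFin; field; rewrite gt_eqF.
  have s2th : sg i ^+ 2 <= th by move: Si; rewrite -ltNge => /ltW.
  rewrite (min_idPl s2th) -K; last by rewrite mulr_ge0 ?sqr_ge0// ltW.
  by apply: eq_integral => w _; rewrite /sp; congr EFin; field; rewrite gt_eqF.
pose md w := mind (fun a => (dist2 (rv V w) a)%:E) s.
have md0 w : (0 <= md w)%E by exact: mind_dist2_ge0.
have mmd : measurable_fun setT md by exact: measurable_mdist.
have E0 a w : (0 <= (E a w)%:E)%E by rewrite lee_fin expR_ge0.
have kp0 : 0 <= kp + `|kp| by have := ler_norm (- kp); rewrite normrN; lra.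
have mS : measurable_fun setT (fun w => \sum_(a <- s) (E a w)%:E)%E by exact: emeasurable_sum.
have msm : measurable_fun setT (fun w => sp%:E * md w)%E by exact: measurable_funeM.
(* The term |kp| on both sides keeps every summand nonnegative, so that the integrals can be
   split. *)
have ptw w : ((1 + `|kp|)%:E + (u w)%:E <= (sp%:E * md w + (kp + `|kp|)%:E) + \sum_(a <- s) (E a w)%:E)%E.
  have [i is_ dE] := mind_ex (fun a => (dist2 (rv V w) a)%:E) (fun=> 0) s0.
  rewrite /md dE; set a := nth _ _ _ in dE *.
  apply: (@le_trans _ _ ((sp%:E * (dist2 (rv V w) a)%:E + (kp + `|kp|)%:E) + (E a w)%:E)%E).
    rewrite -!EFinM -!EFinD lee_fin.
    by have := expR_ge1Dx (- sp * dist2 (rv V w) a + u w - kp); rewrite /E; lra.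
  apply: leeD2l; rewrite /a.
  elim: (s) i is_ {dE a} => // b s' IH [_|i is_]; rewrite big_cons /=.
    by rewrite leeDl// sume_ge0.
  by apply: (le_trans (IH i is_)); rewrite leeDr.
have : (\int[P]_w ((1 + `|kp|)%:E + (u w)%:E) <=
    \int[P]_w ((sp%:E * md w + (kp + `|kp|)%:E) + \sum_(a <- s) (E a w)%:E))%E.
  apply: ge0_le_integral => //.
  - by move=> w _; rewrite adde_ge0 ?lee_fin ?addr_ge0.
  - by apply: emeasurable_funD => //; exact/measurable_EFinP.
  - by apply: emeasurable_funD => //; apply: emeasurable_funD.
have nn1 (w : Omega) : [set: Omega] w -> (0 <= (1 + `|kp|)%:E)%E by move=> _; rewrite lee_fin addr_ge0.
have nn2 (w : Omega) : [set: Omega] w -> (0 <= (u w)%:E)%E by move=> _; rewrite lee_fin.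
have nn3 (w : Omega) : [set: Omega] w -> (0 <= sp%:E * md w)%E by move=> _; rewrite mule_ge0// lee_fin ltW.
have nn4 (w : Omega) : [set: Omega] w -> (0 <= (kp + `|kp|)%:E)%E by move=> _; rewrite lee_fin.
have nn5 (w : Omega) : [set: Omega] w -> (0 <= sp%:E * md w + (kp + `|kp|)%:E)%E by move=> ww; rewrite adde_ge0 ?nn3.
have nn6 (w : Omega) : [set: Omega] w -> (0 <= \sum_(a <- s) (E a w)%:E)%E by move=> _; rewrite sume_ge0.
have m1 : measurable_fun setT (fun w => (u w)%:E) by apply/measurable_EFinP.
have m2 : measurable_fun setT (fun w => sp%:E * md w + (kp + `|kp|)%:E)%E by apply: emeasurable_funD.
rewrite (ge0_integralD _ measurableT nn1 _ nn2 m1)// (ge0_integralD _ measurableT nn5 m2 nn6 mS).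
rewrite (ge0_integralD _ measurableT nn3 msm nn4)//.
rewrite !integral_prob_cst u_E.
rewrite ge0_integralZl//; last by rewrite lee_fin ltW.
rewrite ge0_integral_sum//.
have sumE : (\sum_(a <- s) \int[P]_w (E a w)%:E <= (1:R)%:E)%E.
  apply: (@le_trans _ _ (\sum_(a <- s) (expR (- L))%:E)%E); first exact: lee_sum.
  rewrite sumEFin lee_fin big_const_seq count_predT iter_addr_0 -mulr_natl expRN.
  by rewrite ler_pdivrMr ?expR_gt0// mul1r.
have dE : (sp%:E * \int[P]_w md w <= (sp * D)%:E)%E.
  by rewrite EFinM lee_wpmul2l// lee_fin ltW.
move=> /le_trans => /(_ ((sp * D)%:E + (kp + `|kp|)%:E + (1:R)%:E)%E) => /(_ (leeD (leeD dE (le_refl _)) sumE)) fin.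
have {}fin : 1 + `|kp| + sp * (\sum_i Num.min (sg i ^+ 2) th) <= sp * D + (kp + `|kp|) + 1.
  by move: fin; rewrite -!EFinD lee_fin.
have e1 : \sum_i Num.min (sg i ^+ 2) th = 2 * th * (sp * \sum_i Num.min (sg i ^+ 2) th).
  by rewrite mulrA mulfV ?mul1r// mulf_neq0 ?gt_eqF.
have e2 : D = 2 * th * (sp * D) by rewrite mulrA mulfV ?mul1r// mulf_neq0 ?gt_eqF.
rewrite e1 e2 -/l (_ : th * (l - 2 * L) = 2 * th * (- kp)); last by rewrite /kp; field.
by rewrite -mulrDr ler_pM2l ?mulr_gt0//; lra.
Qed.

End lower.

(** * Averages over a product space *)

Section mixing.
Context {R : realType} {d} {Omega : measurableType d} (P : probability Omega R).

Lemma prob_le_ex (f : Omega -> \bar R) (D D' : R) :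
  measurable_fun setT f -> (forall w, 0 <= f w)%E ->
  (\int[P]_w f w <= D%:E)%E -> D < D' -> exists w, (f w <= D'%:E)%E.
Proof.
move=> mf f0 fD DD'; apply: contrapT => /forallNP H.
suff : (D'%:E <= D%:E)%E by rewrite lee_fin leNgt DD'.
apply: le_trans fD; rewrite -(integral_prob_cst P D'%:E).
have [D0|D0] := leP 0 D'; last first.
  apply: (@le_trans _ _ 0%E); first by rewrite integral_prob_cst lee_fin ltW.
  exact: integral_ge0.
apply: ge0_le_integral => //.
by move=> w _; have /negP := H w; rewrite -ltNge => /ltW.
Qed.

Lemma prob_ge_ex (f : Omega -> \bar R) (c : R) :
  measurable_fun setT f -> (forall w, 0 <= f w)%E -> 0 < c ->
  (c%:E <= \int[P]_w f w)%E -> exists w, ((c / 2)%:E <= f w)%E.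
Proof.
move=> mf f0 c0 fc; apply: contrapT => /forallNP H.
suff : (c%:E <= (c / 2)%:E)%E by rewrite lee_fin; lra.
apply: (le_trans fc); rewrite -(integral_prob_cst P (c / 2)%:E).
apply: ge0_le_integral => //.
by move=> w _; have /negP := H w; rewrite -ltNge => /ltW.
Qed.

(** The product space supplies the independent copy. Integrating over the second factor multiplies
    the cosine by [eB], which is written as the convex combination of 1 and 1 + cos to stay
    nonnegative. *)
Lemma std_gauss_mix n (xi : 'I_n -> Omega -> R) (a b : 'I_n -> R) :
  std_gauss P xi -> (forall i, a i ^+ 2 + b i ^+ 2 = 1) ->
  std_gauss (P \x P)%E (fun i z => a i * xi i z.1 + b i * xi i z.2).
Proof.
move=> [mxi H] ab.
have mz i : measurable_fun setT (fun z : Omega * Omega => a i * xi i z.1 + b i * xi i z.2).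
  apply: measurable_funD; apply: measurable_funM => //.
    exact: (measurableT_comp (mxi i) measurable_fst).
  exact: (measurableT_comp (mxi i) measurable_snd).
split=> // c p.
pose f (z : Omega * Omega) := (1 + cos (\sum_i c i * (a i * xi i z.1 + b i * xi i z.2) + p))%:E.
have mf : measurable_fun setT f.
  apply/measurable_EFinP/measurable_funD => //.
  apply: measurableT_comp; first exact: measurable_realfun.continuous_measurable_fun (@continuous_cos R).
  apply: measurable_funD => //; apply: measurable_sum => i; exact: measurable_funM.
have f0 z : (0 <= f z)%E by rewrite lee_fin cos1_ge0.
rewrite -/(f _) (@fubini_tonelli1 _ _ _ _ R P P f mf f0) /fubini_F.
pose A := \sum_i (c i * a i) ^+ 2; pose B := \sum_i (c i * b i) ^+ 2.
have AB : A + B = \sum_i c i ^+ 2.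
  by rewrite -big_split; apply: eq_bigr => i _ /=; rewrite !exprMn -mulrDr ab mulr1.
pose eB := expR (- (B / 2)).
have eB0 : 0 <= eB by exact: expR_ge0.
have eB1 : eB <= 1.
  by rewrite -expR0 ler_expR oppr_le0 divr_ge0// sumr_ge0// => i _; exact: sqr_ge0.
transitivity (\int[P]_x ((1 - eB)%:E + eB%:E * (1 + cos (\sum_i (c i * a i) * xi i x + p))%:E))%E.
  apply: eq_integral => x _.
  have := H (fun i => c i * b i) (\sum_i (c i * a i) * xi i x + p).
  rewrite -/B -/eB => E; rewrite (_ : (_ + _)%E = (1 + cos (\sum_i c i * a i * xi i x + p) * eB)%:E); last first.
    by rewrite -EFinM -EFinD; congr EFin; ring.
  rewrite -E; apply: eq_integral => y _; rewrite /f /=; congr (1 + cos _)%:E.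
  by rewrite addrA -big_split/=; congr (_ + _); apply: eq_bigr => i _; ring.
have mg : measurable_fun setT (fun x => (1 + cos (\sum_i (c i * a i) * xi i x + p))%:E).
  apply/measurable_EFinP/measurable_funD => //.
  apply: measurableT_comp; first exact: measurable_realfun.continuous_measurable_fun (@continuous_cos R).
  by apply: measurable_funD => //; apply: measurable_sum => i; exact: measurable_funM.
rewrite ge0_integralD//; last 3 first.
- by move=> x _; rewrite lee_fin subr_ge0.
- by move=> x _; rewrite mule_ge0 ?lee_fin ?cos1_ge0.
- exact: measurable_funeM.
rewrite integral_prob_cst ge0_integralZl//.
rewrite H -/A -EFinM -EFinD -AB mulrDl opprD expRD -/eB; congr EFin; ring.
Qed.

End mixing.

(** * Codebooks depend on the law only *)

Section law_invariance.
Context {R : realType}.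
Notation T := (measurableTypeR R).

Lemma ach_law d (Omega : measurableType d) (P : probability Omega R) n M
    (xi : 'I_n -> Omega -> R) (V : 'I_M -> n.-tuple T -> R) L D :
  std_gauss P xi -> mvec V ->
  ach P (fun i w => V i (tup xi w)) L D <-> ach (gam n) V L D.
Proof.
move=> H mV.
have E s : distor P (fun i w => V i (tup xi w)) s = distor (gam n) V s.
  rewrite /distor -(std_gauss_law H)//; first exact: measurable_mdist.
  by move=> v; exact: mind_dist2_ge0.
by split=> -[s sL sD]; exists s => //; rewrite ?E// -E.
Qed.

Definition lmap d (Omega : measurableType d) M N (A : 'I_M -> 'I_N -> R)
  (xi : 'I_N -> Omega -> R) (i : 'I_M) (w : Omega) : R := \sum_l A i l * xi l w.

Lemma measurable_lmap d (Omega : measurableType d) M N (A : 'I_M -> 'I_N -> R)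
  (xi : 'I_N -> Omega -> R) : (forall l, measurable_fun setT (xi l)) -> mvec (lmap A xi).
Proof. by move=> mxi i; apply: measurable_sum => l; exact: measurable_funM. Qed.

(** The distortion is an integral of a function of [xi], hence depends on its law. A codebook may
    thus be looked for on another space, in particular on [P \x P], where an independent copy is at
    hand. *)
Lemma ach_lmap d (Omega : measurableType d) (P : probability Omega R)
  d' (Omega' : measurableType d') (P' : probability Omega' R) M N (A : 'I_M -> 'I_N -> R)
  (xi : 'I_N -> Omega -> R) (xi' : 'I_N -> Omega' -> R) L D :
  std_gauss P xi -> std_gauss P' xi' ->
  ach P (lmap A xi) L D -> ach P' (lmap A xi') L D.
Proof.
move=> H H'.
have mV : mvec (lmap A (fun i (v : N.-tuple T) => tnth v i)).
  by apply: measurable_lmap => i; exact: measurable_tnth.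
have E d0 (O : measurableType d0) (x : 'I_N -> O -> R) :
    lmap A x = fun i w => lmap A (fun i (v : N.-tuple T) => tnth v i) i (tup x w).
  by apply/funext => i; apply/funext => w; apply: eq_bigr => l _; rewrite tnth_mktuple.
by rewrite (E _ _ xi) (E _ _ xi') => /(ach_law _ _ H mV)/(ach_law _ _ H' mV).
Qed.

(* Write xi = a z + sqrt(1 - a^2) z' with z, z' independent; some realisation of the second
   term leaves a codebook for the first one that is as good as the original. *)
Lemma ach_noise d (Omega : measurableType d) (P : probability Omega R) M N (A : 'I_M -> 'I_N -> R)
  (xi : 'I_N -> Omega -> R) (a : 'I_N -> R) L D D' :
  std_gauss P xi -> (forall l, 0 <= a l <= 1) -> D < D' ->
  ach P (lmap A xi) L D -> ach P (lmap (fun i l => A i l * a l) xi) L D'.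
Proof.
move=> H a01 DD'.
pose b l := Num.sqrt (1 - a l ^+ 2).
have ba l : b l ^+ 2 + a l ^+ 2 = 1.
  have /andP[a0 a1] := a01 l; rewrite sqr_sqrtr ?subrK// subr_ge0.
  by rewrite expr_le1.
have H2 := std_gauss_mix H ba.
move=> /(ach_lmap H H2)[s sL].
rewrite /distor; set f := fun w => mind _ _ => sD.
have mf : measurable_fun setT f by apply: measurable_mdist; apply: measurable_lmap; exact: H2.1.
have f0 z : (0 <= f z)%E by exact: mind_dist2_ge0.
move: sD; rewrite (@fubini_tonelli1 _ _ _ _ R P P f mf f0) /fubini_F => sD.
have [|x|w0 Hw0] := prob_le_ex _ _ sD DD'.
- exact: measurable_fun_fubini_tonelli_F.
- exact: integral_ge0.
exists (map (fun y i => y i - \sum_l A i l * (b l * xi l w0)) s); first by rewrite size_map.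
rewrite /distor; apply: le_trans Hw0; rewrite le_eqVlt; apply/orP; left; apply/eqP.
apply: eq_integral => w _; rewrite /f /mind big_map; apply: eq_bigr => y _; congr EFin.
rewrite /dist2; apply: eq_bigr => i _; congr (_ ^+ 2); rewrite /rv /lmap /= opprB addrA; congr (_ - _).
rewrite addrC.
by rewrite -big_split/=; apply: eq_bigr => l _; ring.
Qed.

End law_invariance.

Section boolean_events.
Context {R : realType} {d} {Omega : measurableType d} (P : probability Omega R).
Implicit Types b c : Omega -> bool.

Definition mev b := measurable_fun [set: Omega] b.

(** Real-valued probabilities of boolean predicates, so that operations on events become boolean
    connectives. *)
Definition prb b : R := fine (\int[P]_w (b w)%:R%:E)%E.

Lemma mevI b c : mev b -> mev c -> mev (fun w => b w && c w).
Proof. exact: measurable_and. Qed.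

Lemma mevN b : mev b -> mev (fun w => ~~ b w).
Proof. by move=> mb; apply: (measurableT_comp _ mb) => // _ A _; rewrite setTI. Qed.

Lemma mev_le (f g : Omega -> R) : measurable_fun setT f -> measurable_fun setT g ->
  mev (fun w => f w <= g w).
Proof. exact: measurable_fun_ler. Qed.

Lemma measurable_ev b : mev b -> measurable_fun setT (fun w => (b w)%:R : R).
Proof.
move=> mb; apply: (@measurableT_comp _ _ _ _ _ _ (fun x : bool => x%:R : R) _ b) => //.
Qed.

Lemma measurable_evE b : mev b -> measurable_fun setT (fun w => ((b w)%:R : R)%:E).
Proof. by move=> mb; apply/measurable_EFinP; exact: measurable_ev. Qed.

Lemma prbE b : mev b -> (\int[P]_w (b w)%:R%:E = (prb b)%:E)%E.
Proof.
move=> mb; rewrite /prb fineK// ge0_fin_numE; last by apply: integral_ge0 => w _; rewrite lee_fin.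
apply: (@le_lt_trans _ _ 1%E); last exact: ltry.
rewrite -(integral_prob_cst P 1%E); apply: ge0_le_integral => //.
- exact: measurable_evE.
by move=> w _; rewrite lee_fin; case: (b w).
Qed.

Lemma prb_ge0 b : 0 <= prb b.
Proof. by apply: fine_ge0; apply: integral_ge0 => w _; rewrite lee_fin. Qed.

Lemma prb_le b c : mev b -> mev c -> (forall w, b w -> c w) -> prb b <= prb c.
Proof.
move=> mb mc bc; rewrite -lee_fin -!prbE//; apply: ge0_le_integral => //.
- exact: measurable_evE.
- exact: measurable_evE.
by move=> w _; rewrite lee_fin ler_nat; case: (b w) (bc w) => // ->.
Qed.

Lemma prb1 : prb xpredT = 1.
Proof. by rewrite /prb integral_prob_cst. Qed.

Lemma prb_split b c : mev b -> mev c ->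
  prb b = prb (fun w => b w && c w) + prb (fun w => b w && ~~ c w).
Proof.
move=> mb mc; apply: EFin_inj; rewrite EFinD -!prbE//; last 2 first.
- by apply: mevI => //; exact: mevN.
- exact: mevI.
have m1 : measurable_fun setT (fun w => ((b w && c w)%:R : R)%:E) by apply: measurable_evE; exact: mevI.
have m2 : measurable_fun setT (fun w => ((b w && ~~ c w)%:R : R)%:E).
  by apply: measurable_evE; apply: mevI => //; exact: mevN.
rewrite -(ge0_integralD P measurableT _ m1 _ m2)//.
by apply: eq_integral => w _; rewrite -EFinD -natrD; case: (b w); case: (c w).
Qed.

Lemma prbI_ge b c : mev b -> mev c -> prb b - prb (fun w => ~~ c w) <= prb (fun w => b w && c w).
Proof.
move=> mb mc; rewrite lerBlDr (prb_split mb mc) lerD2l.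
by apply: prb_le => [||w /andP[]//]; [apply: mevI => //|]; exact: mevN.
Qed.

Lemma prbI_ge2 b c c' : mev b -> mev c -> mev c' ->
  prb b - prb (fun w => ~~ c w) - prb (fun w => ~~ c' w) <= prb (fun w => [&& b w, c w & c' w]).
Proof.
move=> mb mc mc'; have -> : (fun w => [&& b w, c w & c' w]) = (fun w => (b w && c w) && c' w).
  by apply/funext => w; rewrite andbA.
apply: le_trans (prbI_ge (mevI mb mc) mc'); rewrite lerD2r; exact: prbI_ge.
Qed.

Lemma prb_markov b (f : Omega -> R) (K : R) : mev b -> measurable_fun setT f ->
  (forall w, (b w)%:R <= f w) -> (\int[P]_w (f w)%:E <= K%:E)%E -> prb b <= K.
Proof.
move=> mb mf bf fK; rewrite -lee_fin -prbE//; apply: le_trans fK.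
apply: ge0_le_integral => //.
- exact: measurable_evE.
- exact/measurable_EFinP.
by move=> w _; rewrite lee_fin.
Qed.

End boolean_events.

(** * Concentration of sums of squares *)

Section chernoff.
Context {R : realType} {d} {Omega : measurableType d} (P : probability Omega R).
Variables (N : nat) (xi : 'I_N -> Omega -> R) (S : {set 'I_N}).
Hypothesis Hxi : std_gauss P xi.

Definition sqsum (x : 'I_N -> R) : R := \sum_i (i \in S)%:R * x i ^+ 2.

Lemma measurable_sqsum : measurable_fun setT (fun w => sqsum (rv xi w)).
Proof.
by apply: measurable_sum => i; apply: measurable_funM => //; apply: measurable_funX; exact: Hxi.1.
Qed.

(** The sign of [t] selects the tail, so that one exponential Markov bound serves both. *)
Lemma chernoff (t c : R) : t < 2^-1 ->
  prb P (fun w => t * c <= t * sqsum (rv xi w)) <= expR (- (t * c)) * Num.sqrt (1 - 2 * t)^-1 ^+ #|S|.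
Proof.
move=> t2.
have mq := measurable_sqsum.
have mtq : measurable_fun setT (fun w => t * sqsum (rv xi w)) by exact: measurable_funM.
apply: (prb_markov (f := fun w => expR (- (t * c)) * expR (t * sqsum (rv xi w)))).
- exact: mev_le.
- by apply: measurable_funM => //; exact: measurableT_comp.
- move=> w; rewrite -expRD; have [h|h] := leP (t * c) (t * sqsum (rv xi w)); last by rewrite mulr0n expR_ge0.
  by rewrite -expR0 ler_expR; lra.
under eq_integral do rewrite EFinM.
rewrite ge0_integralZl//; last 1 first.
- by apply/measurable_EFinP; exact: measurableT_comp.
rewrite EFinM lee_wpmul2l ?lee_fin ?expR_ge0//.
pose F (i : 'I_N) (x : R) := if i \in S then expR (t * x ^+ 2) else 1.
rewrite (_ : (fun w => _) = fun w => (\prod_i F i (xi i w))%:E); last first.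
  apply/funext => w; congr EFin; rewrite /sqsum mulr_sumr expR_sum.
  by apply: eq_bigr => i _; rewrite /F; case: ifP => _; rewrite ?mul1r// mul0r mulr0 expR0.
rewrite (std_gauss_prod Hxi); last 2 first.
- move=> i; rewrite /F; case: (i \in S) => //; apply: measurableT_comp => //; apply: measurable_funM => //.
- by move=> i x; rewrite /F; case: ifP => _ //; exact: expR_ge0.
rewrite (eq_bigr (fun i => (if i \in S then Num.sqrt (1 - 2 * t)^-1 else 1)%:E)); last first.
  move=> i _; rewrite /F; case: ifP => _; first exact: integral_gamma1_expsqr.
  by rewrite integral_prob_cst.
by rewrite prodEFin lee_fin -big_mkcond prodr_const.
Qed.

Variable dl : R.
Hypothesis dl01 : 0 < dl < 1.

(** Chernoff exponents per degree of freedom for the upper and the lower tail, at the optimal t =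
    dl/(2 (1 + dl)) and t = - dl/(2 (1 - dl)). *)
Definition kap : R := Num.min ((dl - ln (1 + dl)) / 2) (- (dl + ln (1 - dl)) / 2).

Lemma kap_gt0 : 0 < kap.
Proof.
have /andP[d0 d1] := dl01.
have lnlt (x : R) : x != 0 -> -1 < x -> ln (1 + x) < x.
  move=> x0 x1; rewrite -ltr_expR lnK ?posrE; last by lra.
  exact: expR_gt1Dx.
rewrite /kap lt_min; apply/andP; split.
  by rewrite divr_gt0// subr_gt0 lnlt ?gt_eqF//; lra.
have := lnlt (- dl); rewrite oppr_eq0 gt_eqF// => /(_ isT) h.
by rewrite divr_gt0//; have := h ltac:(lra); lra.
Qed.

Lemma kap_le : kap <= dl / 2.
Proof.
have /andP[d0 d1] := dl01; rewrite /kap ge_min; apply/orP; left.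
by rewrite ler_pM2r// gerBl ln_ge0// lerDl ltW.
Qed.

Definition typical (q : R) : bool := ((1 - dl) * #|S|%:R <= q) && (q <= (1 + dl) * #|S|%:R).

Lemma mev_typical : mev (fun w => typical (sqsum (rv xi w))).
Proof.
by apply: mevI; apply: mev_le => //; exact: measurable_sqsum.
Qed.

Lemma prb_atypical : prb P (fun w => ~~ typical (sqsum (rv xi w))) <= 2 * expR (- (kap * #|S|%:R)).
Proof.
have /andP[d0 d1] := dl01; set m : R := #|S|%:R.
have m0 : 0 <= m by [].
have sE (x : R) : 0 < x -> Num.sqrt x ^+ #|S| = expR (m * (ln x / 2)).
  move=> x0; rewrite -{1}[x]lnK ?posrE//.
  have -> : expR (ln x) = expR (ln x / 2) ^+ 2 by rewrite -expRM_natl; congr expR; field.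
  by rewrite sqrtr_sqr ger0_norm ?expR_ge0// -expRM_natl.
pose b1 w := dl / (2 * (1 + dl)) * ((1 + dl) * m) <= dl / (2 * (1 + dl)) * sqsum (rv xi w).
pose b2 w := - dl / (2 * (1 - dl)) * ((1 - dl) * m) <= - dl / (2 * (1 - dl)) * sqsum (rv xi w).
have t1 : 0 < dl / (2 * (1 + dl)) by apply: divr_gt0 => //; lra.
have t2 : - dl / (2 * (1 - dl)) < 0 by rewrite mulNr oppr_lt0; apply: divr_gt0 => //; lra.
have mb1 : mev b1 by apply: mev_le => //; apply: measurable_funM => //; exact: measurable_sqsum.
have mb2 : mev b2 by apply: mev_le => //; apply: measurable_funM => //; exact: measurable_sqsum.
have mt := mevN mev_typical.
have p1 : prb P b1 <= expR (- (kap * m)).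
  apply: (le_trans (@chernoff _ _ _)); first by rewrite ltr_pdivrMr; lra.
  have -> : 1 - 2 * (dl / (2 * (1 + dl))) = (1 + dl)^-1 by field; rewrite gt_eqF//; lra.
  rewrite invrK sE; last by lra.
  rewrite -expRD ler_expR.
  have -> : dl / (2 * (1 + dl)) * ((1 + dl) * m) = m * (dl / 2) by field; rewrite gt_eqF//; lra.
  have -> : - (m * (dl / 2)) + m * (ln (1 + dl) / 2) = - ((dl - ln (1 + dl)) / 2 * m) by field.
  by rewrite lerN2 ler_wpM2r// ge_min lexx.
have p2 : prb P b2 <= expR (- (kap * m)).
  apply: (le_trans (@chernoff _ _ _)); first by lra.
  have -> : 1 - 2 * (- dl / (2 * (1 - dl))) = (1 - dl)^-1 by field; rewrite gt_eqF//; lra.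
  rewrite invrK sE; last by lra.
  rewrite -expRD ler_expR.
  have -> : - dl / (2 * (1 - dl)) * ((1 - dl) * m) = m * (- dl / 2) by field; rewrite gt_eqF//; lra.
  have -> : - (m * (- dl / 2)) + m * (ln (1 - dl) / 2) = - (- (dl + ln (1 - dl)) / 2 * m) by field.
  by rewrite lerN2 ler_wpM2r// ge_min lexx orbT.
rewrite (prb_split _ mt mb1) mulr_natl mulr2n lerD//.
  by apply: le_trans p1; apply: prb_le => //; [exact: mevI|move=> w /andP[]].
apply: le_trans p2; apply: prb_le => //; first by apply: mevI => //; exact: mevN.
move=> w /andP[]; rewrite /typical /b1 /b2 -/m negb_and -!ltNge => /orP[h _|].
  by rewrite ler_nM2l// ltW.
by move=> h1; rewrite ltr_pM2l// => h2; move: (lt_trans h1 h2); rewrite ltxx.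
Qed.

End chernoff.

(** * Covering by Gaussian codewords *)

Section covering.
Context {R : realType}.
Variables (N : nat) (sg : 'I_N -> R) (S : {set 'I_N}) (th dl : R).
Hypotheses (sg0 : forall i, 0 < sg i) (th0 : 0 < th) (thS : forall i, i \in S -> th <= sg i ^+ 2)
  (dl01 : 0 < dl < 1).
Notation mu := (@gam R N).
Notation T := (measurableTypeR R).
Notation m := (#|S|%:R : R).

Definition near_code (y : 'I_N -> R) (v : N.-tuple T) : bool :=
  sqsum S (fun i => sg i * tnth v i - y i) <= (1 + dl) * m * th.

Lemma mev_near y : mev (near_code y).
Proof.
apply: mev_le => //; apply: measurable_sum => i; apply: measurable_funM => //; apply: measurable_funX.
by apply: measurable_funB => //; apply: measurable_funM => //; exact: measurable_tnth.
Qed.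

(** The rate, in nats, of reverse water-filling at level [th] on the active coordinates. *)
Definition info : R := (\sum_(i in S) ln (sg i ^+ 2 / th)) / 2.

Lemma info_ge0 : 0 <= info.
Proof.
rewrite divr_ge0// sumr_ge0// => i iS; rewrite ln_ge0// ler_pdivlMr// mul1r.
exact: thS.
Qed.

(** Backward test channel: the source sg xi has the law of a codeword with variances sg^2 - t plus
    an independent noise with variances t. Outside [S] the codeword vanishes. *)
Let t i := if i \in S then th else sg i ^+ 2.
Let r i := Num.sqrt (t i).
Let b i := Num.sqrt (sg i ^+ 2 - t i).

Let t0 i : 0 < t i. Proof. by rewrite /t; case: ifP => // _; rewrite exprn_gt0. Qed.
Let r0 i : 0 < r i. Proof. by rewrite sqrtr_gt0. Qed.
Let ts i : t i <= sg i ^+ 2. Proof. by rewrite /t; case: ifPn => // /thS. Qed.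

(** The factors outside [S] equal 1. On [S] the exponent is [info] plus half the difference of two
    sums of squares, which typicality bounds by 2 dl m. *)
Let affr_le y (v : N.-tuple T) : (forall i, i \notin S -> y i = 0) ->
  sqsum S (fun i => tnth v i) <= (1 + dl) * m ->
  (1 - dl) * m <= sqsum S (fun i => (sg i * tnth v i - y i) / r i) ->
  \prod_i affr (y i) (r i) (sg i) (tnth v i) <= expR (info + dl * m).
Proof.
move=> y0 h1 h2.
have -> : info + dl * m = info + ((1 + dl) * m - (1 - dl) * m) / 2 by field.
apply: (@le_trans _ _ (expR (info + (sqsum S (fun i => tnth v i) - sqsum S (fun i => (sg i * tnth v i - y i) / r i)) / 2))); last first.
  by rewrite ler_expR lerD2l ler_pM2r// lerB.
rewrite /info /sqsum -sumrB -mulrDl (big_mkcond (fun i => i \in S)) -big_split/= mulr_suml expR_sum.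
rewrite le_eqVlt; apply/orP; left; apply/eqP; apply: eq_bigr => i _; rewrite /affr /r /t.
case: ifPn => iS.
  rewrite sqr_sqrtr ?ltW// !mul1r expr_div_n sqr_sqrtr ?ltW//.
  have -> : sg i / Num.sqrt th = expR (ln (sg i ^+ 2 / th) / 2).
    have q0 : 0 < sg i / Num.sqrt th by rewrite divr_gt0// sqrtr_gt0.
    have -> : sg i ^+ 2 / th = (sg i / Num.sqrt th) ^+ 2 by rewrite expr_div_n sqr_sqrtr ?ltW.
    by rewrite lnXn// -[_ *+ 2]mulr_natr mulfK// lnK.
  by rewrite -expRD; congr expR; field; rewrite gt_eqF.
rewrite !mul0r subr0 addr0 mul0r expR0 y0// subr0 sqr_sqrtr ?sqr_ge0// sqrtr_sqr gtr0_norm//.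
rewrite divff ?gt_eqF// mul1r exprMn -[RHS]expR0; congr expR; field.
by rewrite gt_eqF.
Qed.

Definition cov_rate : R := expR (- (info + dl * m)) / 2.
Definition cov_fail : R := 4 * expR (- (kap dl * m)).

Let xi (i : 'I_N) (v : N.-tuple T) : R := tnth v i.

(** In the test channel, [c] together with typicality of source and noise has probability at least
    that of [c] minus [cov_fail], and some codeword attains half of this conditionally. Typical
    noise means closeness to the codeword, and the likelihood ratio, at most exp(info + dl m) there,
    brings the estimate back to the unconditional law. *)
Lemma cover_step (c : N.-tuple T -> bool) : mev c ->
  exists y, cov_rate * (prb mu c - cov_fail) <= prb mu (fun v => c v && near_code y v).
Proof.
move=> mc; have [neg|pos] := leP (prb mu c - cov_fail) 0.
  exists (fun=> 0); apply: (@le_trans _ _ 0); last exact: prb_ge0.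
  by rewrite mulr_ge0_le0// divr_ge0// expR_ge0.
have gx : std_gauss mu xi := @std_gauss_gam R N.
have mxi i : measurable_fun setT (xi i) by exact: measurable_tnth.
pose al i := b i / sg i; pose be i := r i / sg i.
have ab i : al i ^+ 2 + be i ^+ 2 = 1.
  have b2 : b i ^+ 2 = sg i ^+ 2 - t i by rewrite sqr_sqrtr// subr_ge0.
  have r2 : r i ^+ 2 = t i by rewrite sqr_sqrtr// ltW.
  rewrite /al /be !expr_div_n b2 r2 -mulrDl subrK divff//.
  by rewrite expf_neq0 ?gt_eqF.
have gz := std_gauss_mix gx ab.
pose ty := typical S dl.
(* Here x stands for the source sg xi. In this variable the event for a given codeword y has the
   form to which [gam_change] applies, while [qE] identifies it with an event about the Gaussian
   vector [zeta]. *)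
pose f y (x : N.-tuple T) : bool :=
  [&& c (daff (fun=> 0) (fun i => (sg i)^-1) x),
      ty (sqsum S (fun i => tnth x i / sg i)) & ty (sqsum S (fun i => (tnth x i - y i) / r i))].
pose yy (z : N.-tuple T) i := b i * tnth z i.
pose q (z : N.-tuple T * N.-tuple T) := f (yy z.1) (daff (yy z.1) r z.2).
pose zeta (i : 'I_N) (z : N.-tuple T * N.-tuple T) := al i * xi i z.1 + be i * xi i z.2.
have qE z : q z = [&& c (tup zeta z), ty (sqsum S (rv zeta z)) & ty (sqsum S (fun i => tnth z.2 i))].
  have sE i : tnth (daff (yy z.1) r z.2) i / sg i = zeta i z.
    by rewrite tnth_mktuple /yy /zeta /al /be /xi mulrDl -!(mulrAC _ (_^-1)).
  rewrite /q /f; congr [&& c _, ty _ & ty _].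
  - by apply: eq_from_tnth => i; rewrite !tnth_mktuple -sE add0r mulrC tnth_mktuple.
  - by rewrite /sqsum; apply: eq_bigr => i _; rewrite sE.
  - by rewrite /sqsum; apply: eq_bigr => i _; rewrite tnth_mktuple addrC addKr mulrAC divff ?gt_eqF// mul1r.
have mty (d' : measure_display) (O : measurableType d') (g : O -> R) : measurable_fun setT g -> mev (fun w => ty (g w)).
  by move=> mg; apply: mevI; apply: mev_le.
have mcz : mev (fun z => c (tup zeta z)).
  by apply: (measurableT_comp mc); apply: measurable_tup; exact: gz.1.
have mt1 : mev (fun z => ty (sqsum S (rv zeta z))) by apply: mty; exact: (measurable_sqsum S gz).
have mt2' : mev (fun v => ty (sqsum S (rv xi v))) by exact: (mev_typical S gx).
have mt2 : mev (fun z : N.-tuple T * N.-tuple T => ty (sqsum S (fun i => tnth z.2 i))).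
  exact: (measurableT_comp mt2' measurable_snd).
have mq : mev q by rewrite (funext qE); apply: mevI => //; exact: mevI.
have PE : prb (mu \x mu)%E (fun z => c (tup zeta z)) = prb mu c.
  rewrite /prb; congr fine; apply: (std_gauss_law (f := fun v => ((c v)%:R : R)%:E) gz) => //.
  exact: measurable_evE.
have t2E : prb (mu \x mu)%E (fun z => ~~ ty (sqsum S (fun i => tnth z.2 i))) = prb mu (fun v => ~~ ty (sqsum S (rv xi v))).
  have mF : measurable_fun setT (fun z : N.-tuple T * N.-tuple T => ((~~ ty (sqsum S (fun i => tnth z.2 i)))%:R : R)%:E).
    by apply: measurable_evE; exact: mevN.
  rewrite /prb (@fubini_tonelli1 _ _ _ _ R mu mu _ mF)// /fubini_F.
  set K : \bar R := (X in _ = fine X); transitivity (fine (\int[mu]_x K)%E); first by [].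
  by rewrite (integral_prob_cst mu K).
have q_ge : prb mu c - cov_fail <= prb (mu \x mu)%E q.
  have h1 := prb_atypical S gz dl01; have h2 := prb_atypical S gx dl01.
  have k1 := prbI_ge2 (mu \x mu)%E mcz mt1 mt2.
  rewrite (funext qE); apply: le_trans k1; rewrite PE t2E -addrA -opprD lerD2l lerN2.
  apply: (le_trans (lerD h1 h2)); rewrite /cov_fail -mulrDl.
  by rewrite (_ : 2 + 2 = 4 :> R)//; ring.
have mqE : measurable_fun setT (fun z => ((q z)%:R : R)%:E) by exact: measurable_evE.
have : ((prb mu c - cov_fail)%:E <= \int[(mu \x mu)%E]_z (q z)%:R%:E)%E by rewrite prbE// lee_fin.
rewrite (@fubini_tonelli1 _ _ _ _ R mu mu _ mqE)// /fubini_F.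
move=> /(prob_ge_ex _ _ pos)[||z Hz].
- by apply: (@measurable_fun_fubini_tonelli_F _ _ _ _ _ mu (fun z => ((q z)%:R : R)%:E)).
- by move=> z; exact: integral_ge0.
exists (yy z).
have mf : measurable_fun setT (fun x => ((f (yy z) x)%:R : R)%:E).
  apply: measurable_evE; apply: mevI.
    by apply: (measurableT_comp mc); exact: measurable_daff.
  apply: mevI; apply: mty; apply: measurable_sum => i; apply: measurable_funM => //;
    apply: measurable_funX; apply: measurable_funM => //; try apply: measurable_funB => //; exact: measurable_tnth.
move: Hz; rewrite /q /= (@gam_change _ _ (yy z) _ _ (fun x => ((f (yy z) x)%:R : R)%:E) r0 sg0 mf)//.
have mn : mev (fun v => c v && near_code (yy z) v) by apply: mevI => //; exact: mev_near.
move=> /le_trans h.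
have {}h : (((prb mu c - cov_fail) / 2)%:E <= (expR (info + dl * m) * prb mu (fun v => c v && near_code (yy z) v))%:E)%E.
  apply: h; rewrite EFinM -prbE// -ge0_integralZl//; last 1 first.
  - exact: measurable_evE.
  apply: ge0_le_integral => //.
  - by move=> v _; rewrite mule_ge0// lee_fin prodr_ge0// => i _; exact: affr_ge0.
  - apply: emeasurable_funM; first exact: (measurableT_comp mf (measurable_daff _ _)).
    apply/measurable_EFinP; apply: measurable_prod => i _.
    by apply: (measurableT_comp (measurable_affr _ _ _)); exact: measurable_tnth.
  - by apply: measurable_funeM; exact: measurable_evE.
  move=> v _; rewrite -!EFinM lee_fin /f.
  have sv i : tnth (daff (fun=> 0) sg v) i = sg i * tnth v i by rewrite tnth_mktuple add0r.
  have -> : daff (fun=> 0) (fun i => (sg i)^-1) (daff (fun=> 0) sg v) = v.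
    by apply: eq_from_tnth => i; rewrite !tnth_mktuple !add0r mulrA mulVf ?gt_eqF// mul1r.
  have -> : sqsum S (fun i => tnth (daff (fun=> 0) sg v) i / sg i) = sqsum S (fun i => tnth v i).
    by rewrite /sqsum; apply: eq_bigr => i _; rewrite sv mulrAC divff ?gt_eqF// mul1r.
  have -> : sqsum S (fun i => (tnth (daff (fun=> 0) sg v) i - yy z i) / r i) = sqsum S (fun i => (sg i * tnth v i - yy z i) / r i).
    by rewrite /sqsum; apply: eq_bigr => i _; rewrite sv.
  case: (c v) => /=; last by rewrite !(mulr0n, mul0r, mulr0).
  case: (boolP (_ && _)); last by rewrite mulr0n mul0r => _; rewrite mulr_ge0 ?expR_ge0.
  move=> /andP[/andP[_ a1] /andP[a2 a3]].
  have -> : near_code (yy z) v.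
    rewrite /near_code -ler_pdivrMr//; apply: le_trans a3; rewrite /sqsum mulr_suml.
    rewrite le_eqVlt; apply/orP; left; apply/eqP; apply: eq_bigr => i _.
    have [iS|iS] := boolP (i \in S); last by rewrite !mul0r.
    by rewrite !mul1r expr_div_n /r sqr_sqrtr ?ltW// /t iS.
  rewrite mulr1n mul1r mulr1; apply: affr_le => // i iS.
  by rewrite /yy /b /t (negbTE iS) subrr sqrtr0 mul0r.
move: h; rewrite lee_fin /cov_rate expRN => h.
rewrite -mulrA mulrC ler_pdivrMr ?expR_gt0// (mulrC _ (expR _)).
by apply: le_trans h; rewrite mulrC.
Qed.

End covering.

(** * Codebooks from coverings *)

Section random_coding.
Context {R : realType}.
Variables (N : nat) (sg : 'I_N -> R) (S : {set 'I_N}) (th dl : R).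
Hypotheses (sg0 : forall i, 0 < sg i) (th0 : 0 < th) (thS : forall i, i \in S -> th <= sg i ^+ 2)
  (dl01 : 0 < dl < 1).
Notation mu := (@gam R N).
Notation T := (measurableTypeR R).
Notation m := (#|S|%:R : R).
Notation near := (near_code sg S th dl).
Notation rate := (cov_rate sg S th dl).
Notation fail := (cov_fail S dl).

Definition uncovered ys (v : N.-tuple T) : bool := all (fun y => ~~ near y v) ys.

Lemma mev_uncovered ys : mev (uncovered ys).
Proof.
elim: ys => [|y ys IH]; first exact: measurable_cst.
by rewrite /uncovered /=; apply: mevI => //; apply: mevN; exact: mev_near.
Qed.

Let rate01 : 0 <= rate <= 1.
Proof.
rewrite /cov_rate divr_ge0 ?expR_ge0//= ler_pdivrMr// mul1r.
apply: (@le_trans _ _ 1); last by lra.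
rewrite -expR0 ler_expR oppr_le0 addr_ge0 ?info_ge0// mulr_ge0//.
by have /andP[/ltW] := dl01.
Qed.

(** Greedy choice: [cover_step] applied to the event that is still uncovered multiplies the excess
    of its probability over [fail] by at most 1 - rate. *)
Lemma cover_list k : exists2 ys, size ys = k &
  prb mu (uncovered ys) <= fail + expR (- (rate * k%:R)).
Proof.
have /andP[a0 a1] := rate01.
have fail0 : 0 <= fail by rewrite mulr_ge0// expR_ge0.
suff [ys sy H] : exists2 ys, size ys = k & prb mu (uncovered ys) - fail <= (1 - rate) ^+ k.
  exists ys => //; rewrite -lerBlDl; apply: (le_trans H).
  rewrite (_ : - (rate * k%:R) = k%:R * - rate); last by ring.
  rewrite expRM_natl lerXn2r ?nnegrE ?expR_ge0 ?subr_ge0//.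
  exact: expR_ge1Dx.
elim: k => [|k [ys sy IH]].
  exists [::] => //; rewrite expr0 lerBlDr.
  by rewrite (_ : prb mu _ = 1) ?lerDl//; exact: prb1.
have mu_ := mev_uncovered ys.
have [y Hy] := cover_step sg0 th0 thS dl01 mu_.
exists (y :: ys); first by rewrite /= sy.
have E := prb_split mu mu_ (mev_near sg S th dl y).
have -> : prb mu (uncovered (y :: ys)) = prb mu (fun v => uncovered ys v && ~~ near y v).
  by congr prb; apply/funext => v; rewrite /uncovered /= andbC.
have h : prb mu (fun v => uncovered ys v && ~~ near y v) - fail <= (1 - rate) * (prb mu (uncovered ys) - fail).
  move: E => /eqP; rewrite addrC -subr_eq => /eqP <-.
  by rewrite mulrBl mul1r addrAC lerD2l lerN2.
apply: (le_trans h); rewrite exprS ler_wpM2l// subr_ge0//.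
Qed.

(** The covering words are cut to [S], and the word 0 is added. Covered points pay (1 + dl) m th on
    [S] and their own square elsewhere. Uncovered points use 0, and their second moment is
    controlled by fourth moments and the small probability of being uncovered. *)
Lemma ach_cover (k : nat) (L : R) : k.+1%:R <= expR L -> kap dl * m <= rate * k%:R ->
  ach mu (fun i v => sg i * tnth v i) L
    ((1 + dl) * m * th + \sum_(i | i \notin S) sg i ^+ 2
     + 67 * expR (- (kap dl * m / 2)) * \sum_i sg i ^+ 2).
Proof.
move=> kL kr; have [ys sy Hy] := cover_list k.
have /andP[dl0 dl1] := dl01.
(* Half of the Chernoff exponent balances x^2 u <= (t x^4 + u/t)/2: the fourth moment is at most 128
   and u has mean at most 5 t^2, which gives 133 t/2 <= 67 t. *)
pose t := expR (- (kap dl * m / 2)).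
have t0 : 0 < t by exact: expR_gt0.
have pt : prb mu (uncovered ys) <= 5 * t ^+ 2.
  apply: (le_trans Hy); rewrite /cov_fail.
  have tE : expR (- (kap dl * m)) = t ^+ 2 by rewrite -expRM_natl; congr expR; field.
  have : expR (- (rate * k%:R)) <= t ^+ 2 by rewrite -tE ler_expR lerN2.
  by rewrite tE; lra.
pose V (i : 'I_N) (v : N.-tuple T) := sg i * tnth v i.
have mt i : measurable_fun setT (fun v : N.-tuple T => tnth v i) by exact: measurable_tnth.
have mV : mvec V by move=> i; apply: measurable_funM => //; exact: measurable_tnth.
pose g (y : 'I_N -> R) i := if i \in S then y i else 0.
exists ((fun=> 0) :: map g ys); first by rewrite /= size_map sy.
pose u v : R := (uncovered ys v)%:R.
have mu_ := mev_uncovered ys.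
pose h i (v : N.-tuple T) := ((sg i ^+ 2)%:E * (((i \notin S)%:R)%:E * (tnth v i ^+ 2)%:E + (2^-1)%:E * (t%:E * (tnth v i ^+ 4)%:E + t^-1%:E * (u v)%:E)))%E.
have mtE i n : measurable_fun setT (fun v : N.-tuple T => ((tnth v i : R) ^+ n)%:E).
  by apply/measurable_EFinP; apply: measurable_funX; exact: measurable_tnth.
have muE : measurable_fun setT (fun v => (u v)%:E) by exact: measurable_evE.
have m1 i : measurable_fun setT (fun v : N.-tuple T => t%:E * (tnth v i ^+ 4)%:E + t^-1%:E * (u v)%:E)%E.
  by apply: emeasurable_funD; exact: measurable_funeM.
have m2 i : measurable_fun setT (fun v : N.-tuple T => ((i \notin S)%:R)%:E * (tnth v i ^+ 2)%:E + (2^-1)%:E * (t%:E * (tnth v i ^+ 4)%:E + t^-1%:E * (u v)%:E))%E.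
  by apply: emeasurable_funD; exact: measurable_funeM.
have mh i : measurable_fun setT (h i) by exact: measurable_funeM.
have p4 (x : R) : 0 <= x ^+ 4 by rewrite exprn_even_ge0.
have n1 i v : (0 <= t%:E * (tnth v i ^+ 4)%:E + t^-1%:E * (u v)%:E)%E.
  by rewrite -!EFinM -EFinD lee_fin addr_ge0// mulr_ge0// ?invr_ge0 ltW.
have n2 i v : (0 <= ((i \notin S)%:R)%:E * (tnth v i ^+ 2)%:E + (2^-1)%:E * (t%:E * (tnth v i ^+ 4)%:E + t^-1%:E * (u v)%:E))%E.
  by rewrite adde_ge0// mule_ge0// lee_fin ?invr_ge0 ?sqr_ge0.
have h0 i v : (0 <= h i v)%E by rewrite mule_ge0// lee_fin sqr_ge0.
pose c0 := (1 + dl) * m * th.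
have c00 : 0 <= c0 by rewrite /c0 !mulr_ge0 ?(ltW th0)// addr_ge0// ltW.
have gx : std_gauss mu (fun i v => tnth v i) := @std_gauss_gam R N.
have G i := std_gauss_marginal i gx.
have hE i : (\int[mu]_v h i v <= (sg i ^+ 2 * ((i \notin S)%:R + 67 * t))%:E)%E.
  rewrite /h ge0_integralZl ?lee_fin ?sqr_ge0// [leRHS]EFinM lee_wpmul2l ?lee_fin ?sqr_ge0//.
  have e2 : (\int[mu]_v (tnth v i ^+ 2)%:E = 1)%E by exact: (is_gauss_sqr ler01 (G i)).
  have e4 : (\int[mu]_v (tnth v i ^+ 4)%:E <= 128%:E)%E by have := is_gauss_4 ler01 (G i); rewrite expr1n mulr1.
  have ma : measurable_fun setT (fun v : N.-tuple T => ((i \notin S)%:R)%:E * (tnth v i ^+ 2)%:E)%E by exact: measurable_funeM.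
  have mb : measurable_fun setT (fun v : N.-tuple T => (2^-1)%:E * (t%:E * (tnth v i ^+ 4)%:E + t^-1%:E * (u v)%:E))%E by exact: measurable_funeM.
  have mc : measurable_fun setT (fun v : N.-tuple T => t%:E * (tnth v i ^+ 4)%:E)%E by exact: measurable_funeM.
  have md : measurable_fun setT (fun v : N.-tuple T => t^-1%:E * (u v)%:E)%E by exact: measurable_funeM.
  have na (v : N.-tuple T) : setT v -> (0 <= ((i \notin S)%:R)%:E * (tnth v i ^+ 2)%:E)%E by move=> _; rewrite -EFinM lee_fin mulr_ge0 ?sqr_ge0.
  have nb (v : N.-tuple T) : setT v -> (0 <= (2^-1)%:E * (t%:E * (tnth v i ^+ 4)%:E + t^-1%:E * (u v)%:E))%E by move=> _; apply: mule_ge0 => //; rewrite lee_fin invr_ge0.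
  have nc (v : N.-tuple T) : setT v -> (0 <= t%:E * (tnth v i ^+ 4)%:E)%E by move=> _; rewrite -EFinM lee_fin mulr_ge0// ltW.
  have nd (v : N.-tuple T) : setT v -> (0 <= t^-1%:E * (u v)%:E)%E by move=> _; rewrite -EFinM lee_fin mulr_ge0// invr_ge0 ltW.
  rewrite (ge0_integralD mu measurableT na ma nb mb).
  rewrite !ge0_integralZl ?lee_fin ?invr_ge0//; last by move=> v _; rewrite lee_fin sqr_ge0.
  rewrite (ge0_integralD mu measurableT nc mc nd md).
  rewrite !ge0_integralZl ?lee_fin ?invr_ge0 ?(ltW t0)//; [|by move=> v _; rewrite lee_fin..].
  rewrite e2 mule1 EFinD leeD2l//.
  have e5 : (t%:E * \int[mu]_v (tnth v i ^+ 4)%:E + t^-1%:E * \int[mu]_v (u v)%:E <= (128 * t)%:E + (5 * t)%:E)%E.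
    apply: leeD; first by rewrite EFinM muleC lee_wpmul2r// lee_fin ltW.
    rewrite /u prbE// -EFinM lee_fin mulrC ler_pdivrMr//.
    by apply: (le_trans pt); rewrite expr2 mulrA.
  apply: (@le_trans _ _ ((2^-1)%:E * ((128 * t)%:E + (5 * t)%:E))%E).
    by rewrite lee_wpmul2l// lee_fin invr_ge0.
  by rewrite -EFinD -EFinM lee_fin; lra.
apply: (@le_trans _ _ (\int[mu]_v (c0%:E + \sum_i h i v))%E); last first.
  have ms : measurable_fun setT (fun v => \sum_i h i v)%E by exact: emeasurable_sum.
  have ns (v : N.-tuple T) : setT v -> (0 <= \sum_i h i v)%E by move=> _; exact: sume_ge0.
  rewrite (ge0_integralD mu measurableT _ _ ns ms)//.
  rewrite integral_prob_cst ge0_integral_sum//.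
  apply: (@le_trans _ _ (c0%:E + \sum_i (sg i ^+ 2 * ((i \notin S)%:R + 67 * t))%:E)%E).
    by rewrite leeD2l//; apply: lee_sum => i _; exact: hE.
  rewrite sumEFin -EFinD lee_fin -/c0 -addrA lerD2l.
  under eq_bigr do rewrite mulrDr; rewrite big_split/= lerD//; last by rewrite -mulr_suml mulrC.
  rewrite [leRHS]big_mkcond ler_sum// => i _; case: (i \notin S); last by rewrite mulr0.
  by rewrite mulr1.
apply: ge0_le_integral => //.
- by move=> v _; exact: mind_dist2_ge0.
- exact: measurable_mdist.
- by apply: emeasurable_funD => //; exact: emeasurable_sum.
have hv i v : h i v = (sg i ^+ 2 * ((i \notin S)%:R * tnth v i ^+ 2 + 2^-1 * (t * tnth v i ^+ 4 + t^-1 * u v)))%:E by [].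
move=> v _; have [uv|uv] := boolP (uncovered ys v).
  apply: (le_trans (@mind_le _ _ _ _ 0 (fun=> 0) _)) => //=.
  apply: (@le_trans _ _ (\sum_i h i v)%E); last by rewrite leeDr// lee_fin.
  rewrite /dist2 -sumEFin lee_sum// => i _; rewrite /rv hv lee_fin subr0 exprMn.
  rewrite ler_wpM2l ?sqr_ge0// /u uv mulr1.
  apply: (@le_trans _ _ (2^-1 * (t * tnth v i ^+ 4 + t^-1))); last by rewrite lerDr mulr_ge0 ?sqr_ge0.
  rewrite -subr_ge0 (_ : _ - _ = t^-1 / 2 * (t * tnth v i ^+ 2 - 1) ^+ 2); last by field; rewrite gt_eqF.
  by rewrite mulr_ge0 ?sqr_ge0// divr_ge0// invr_ge0 ltW.
have /has_nthP : has (near ^~ v) ys.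
  by rewrite -[has _ _]negbK; apply: contra uv; rewrite -all_predC.
move=> /(_ (fun=> 0))[k' k's ny]; set y := nth _ _ _ in ny.
apply: (le_trans (@mind_le _ _ _ _ k'.+1 (g (fun=> 0)) _)); first by rewrite /= ltnS size_map.
rewrite /= (nth_map (fun=> 0))// -/y.
apply: (@le_trans _ _ (\sum_i ((i \in S)%:R * (sg i * tnth v i - y i) ^+ 2)%:E + \sum_i h i v)%E); last first.
  by apply: leeD2r; rewrite sumEFin lee_fin.
rewrite -big_split/= /dist2 -sumEFin lee_sum// => i _; rewrite /rv hv /g -EFinD lee_fin.
have hh : 0 <= 2^-1 * (t * tnth v i ^+ 4 + t^-1 * u v).
  by rewrite mulr_ge0 ?invr_ge0// addr_ge0// mulr_ge0// ?invr_ge0 ltW.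
case: (i \in S) => /=; first by rewrite !mul1r lerDl mulr_ge0 ?sqr_ge0// mul0r add0r.
by rewrite mul0r add0r mul1r subr0 exprMn ler_wpM2l ?sqr_ge0// lerDl.
Qed.

End random_coding.

(** The surplus 2 dl m + 4 in the rate makes [cov_rate] times the number of covering words at least
    (dl m + 5)/2 - 1, which exceeds kap m as [ach_cover] requires. *)
Lemma ach_upper {R : realType} {d} {Omega : measurableType d} (P : probability Omega R) (N : nat)
    (xi : 'I_N -> Omega -> R) (sg : 'I_N -> R) (S : {set 'I_N}) (th dl : R) :
  std_gauss P xi -> (forall i, 0 < sg i) -> 0 < th -> (forall i, i \in S -> th <= sg i ^+ 2) ->
  0 < dl < 1 ->
  ach P (fun i w => sg i * xi i w) (info sg S th + 2 * dl * #|S|%:R + 4)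
    ((1 + dl) * #|S|%:R * th + \sum_(i | i \notin S) sg i ^+ 2
     + 67 * expR (- (kap dl * #|S|%:R / 2)) * \sum_i sg i ^+ 2).
Proof.
move=> H sg0 th0 thS dl01; have /andP[dl0 dl1] := dl01.
have mt : mvec (fun i (v : N.-tuple (measurableTypeR R)) => sg i * tnth v i).
  by move=> i; apply: measurable_funM => //; exact: measurable_tnth.
have -> : (fun i w => sg i * xi i w) = fun i w => sg i * tnth (tup xi w) i.
  by apply/funext => i; apply/funext => w; rewrite tnth_mktuple.
apply/(ach_law _ _ H mt).
set m : R := #|S|%:R; set I := info sg S th; set L := I + _ + _.
have I0 : 0 <= I by exact: info_ge0.
have m0 : 0 <= dl * m by rewrite mulr_ge0// ltW.
have L0 : 1 + (I + dl * m + 4) <= expR L.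
  by apply: le_trans (expR_ge1Dx _) _; rewrite ler_expR /L; lra.
have /andP[t1 t2] := truncn_itv (expR_ge0 L).
have tpos : (0 < Num.truncn (expR L))%N.
  rewrite lt0n; apply: contraTneq (lt_le_trans t2 (le_refl _)) => ->.
  by rewrite -leNgt; apply: le_trans L0; lra.
apply: (@ach_cover _ _ _ _ _ _ sg0 th0 thS dl01 (Num.truncn (expR L)).-1); first by rewrite prednK.
have kE : expR L - 2 <= (Num.truncn (expR L)).-1%:R.
  by rewrite lerBlDr -natrD addn2 prednK// ltW.
apply: (@le_trans _ _ (cov_rate sg S th dl * (expR L - 2))); last first.
  by rewrite ler_wpM2l// divr_ge0// expR_ge0.
have -> : cov_rate sg S th dl * (expR L - 2) = expR (dl * m + 4) / 2 - expR (- (I + dl * m)).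
  rewrite /cov_rate -/I -/m (_ : dl * m + 4 = - (I + dl * m) + L); last by rewrite /L; ring.
  by rewrite (expRD _ L); field.
have e1 : expR (- (I + dl * m)) <= 1 by rewrite -expR0 ler_expR oppr_le0 addr_ge0.
have e2 := expR_ge1Dx (dl * m + 4).
have := ler_wpM2r (ler0n R #|S|) (kap_le dl01); rewrite -/m => k1.
by lra.
Qed.

(** * Circulant matrices and fractional differences *)

Section hartley.
Context {R : realType}.
Implicit Types (x y : R) (k j m t : nat).

Lemma cosDn2pi x n : cos (x + n%:R * (2 * pi)) = cos x.
Proof.
elim: n => [|n IH]; first by rewrite mul0r addr0.
rewrite -natr1 mulrDl mul1r addrA (_ : 2 * pi = pi *+ 2 :> R); last by rewrite mulr_natl.
by rewrite cosD2pi -[pi *+ 2]mulr_natl IH.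
Qed.

Lemma sinDn2pi x n : sin (x + n%:R * (2 * pi)) = sin x.
Proof.
elim: n => [|n IH]; first by rewrite mul0r addr0.
rewrite -natr1 mulrDl mul1r addrA (_ : 2 * pi = pi *+ 2 :> R); last by rewrite mulr_natl.
by rewrite sinD2pi -[pi *+ 2]mulr_natl IH.
Qed.

Variable N : nat.
Hypothesis N0 : (0 < N)%N.

Definition ang t : R := 2 * pi * t%:R / N%:R.

Let NR : (N%:R : R) != 0. Proof. by rewrite pnatr_eq0 -lt0n. Qed.

Lemma ang_mod t : exists u : nat, ang t = ang (t %% N) + u%:R * (2 * pi).
Proof.
exists (t %/ N)%N; rewrite /ang {1}(divn_eq t N) natrD natrM; field.
by apply: NR.
Qed.

Lemma cos_ang_mod t : cos (ang t) = cos (ang (t %% N)).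
Proof. by have [u ->] := ang_mod t; rewrite cosDn2pi. Qed.

Lemma sin_ang_mod t : sin (ang t) = sin (ang (t %% N)).
Proof. by have [u ->] := ang_mod t; rewrite sinDn2pi. Qed.

Lemma ang_half_sin r : (0 < r < N)%N -> 0 < sin (pi * r%:R / N%:R : R).
Proof.
move=> /andP[r0 rN]; apply: sin_gt0_pi.
rewrite divr_gt0 ?mulr_gt0 ?pi_gt0 ?ltr0n//= ltr_pdivrMr ?ltr0n//.
by rewrite ltr_pM2l ?pi_gt0// ltr_nat.
Qed.

(** Multiplied by 2 sin h the sums telescope; h lies strictly between 0 and pi, so this factor does
    not vanish. *)
Lemma sum_trig_aux r : (0 < r < N)%N ->
  \sum_(m < N) cos (ang (r * m)) = 0 /\ \sum_(m < N) sin (ang (r * m)) = 0.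
Proof.
move=> rN; pose h : R := pi * r%:R / N%:R.
have h0 : 2 * sin h != 0 by rewrite mulf_neq0// gt_eqF// ang_half_sin.
have angE m : ang (r * m) = 2 * m%:R * h by rewrite /ang /h natrM; ring.
have last_ : (2 * N%:R - 1) * h = - h + r%:R * (2 * pi).
  by rewrite /h; field; exact: NR.
have E1 n : 2 * sin h * \sum_(m < n) cos (ang (r * m)) = sin ((2 * n%:R - 1) * h) + sin h.
  elim: n => [|n IH]; first by rewrite big_ord0 mulr0 (_ : (2 * 0 - 1) * h = - h) ?sinN ?addNr//; ring.
  rewrite big_ord_recr mulrDr IH /= angE -[n.+1%:R]natr1.
  rewrite (_ : (2 * (n%:R + 1) - 1) * h = 2 * n%:R * h + h); last by ring.
  rewrite (_ : (2 * n%:R - 1) * h = 2 * n%:R * h - h); last by ring.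
  by rewrite sinB sinD; ring.
have E2 n : 2 * sin h * \sum_(m < n) sin (ang (r * m)) = cos h - cos ((2 * n%:R - 1) * h).
  elim: n => [|n IH]; first by rewrite big_ord0 mulr0 (_ : (2 * 0 - 1) * h = - h) ?cosN ?subrr//; ring.
  rewrite big_ord_recr mulrDr IH /= angE -[n.+1%:R]natr1.
  rewrite (_ : (2 * (n%:R + 1) - 1) * h = 2 * n%:R * h + h); last by ring.
  rewrite (_ : (2 * n%:R - 1) * h = 2 * n%:R * h - h); last by ring.
  by rewrite cosB cosD; ring.
split; apply: (mulfI h0); rewrite mulr0 ?E1 ?E2 last_ ?sinDn2pi ?cosDn2pi ?sinN ?cosN ?addNr ?subrr//.
Qed.

Lemma sum_cos_ang t : \sum_(m < N) cos (ang (t * m)) = if (t %% N == 0)%N then N%:R else 0.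
Proof.
transitivity (\sum_(m < N) cos (ang ((t %% N) * m))).
  by apply: eq_bigr => m _; rewrite cos_ang_mod -modnMml -cos_ang_mod.
case: eqP => [->|/eqP t0].
  under eq_bigr do rewrite mul0n /ang mulr0 mul0r cos0.
  by rewrite sumr_const card_ord.
by apply: (sum_trig_aux _).1; rewrite lt0n t0 ltn_pmod.
Qed.

Lemma sum_sin_ang t : \sum_(m < N) sin (ang (t * m)) = 0.
Proof.
transitivity (\sum_(m < N) sin (ang ((t %% N) * m))).
  by apply: eq_bigr => m _; rewrite sin_ang_mod -modnMml -sin_ang_mod.
have [->|t0] := eqVneq (t %% N)%N 0%N.
  by rewrite big1// => m _; rewrite mul0n /ang mulr0 mul0r sin0.
by apply: (sum_trig_aux _).2; rewrite lt0n t0 ltn_pmod.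
Qed.

Let rN : R := Num.sqrt N%:R.

Let rN2 : rN ^-1 * rN^-1 = N%:R^-1 :> R.
Proof. by rewrite -invfM -expr2 sqr_sqrtr. Qed.

(* the real Fourier (Hartley) basis cos + sin, and its reflection cos - sin *)
Definition ht k m : R := (cos (ang (k * m)) + sin (ang (k * m))) / rN.
Definition ht' k m : R := (cos (ang (k * m)) - sin (ang (k * m))) / rN.

Lemma ht_sym k m : ht k m = ht m k.
Proof. by rewrite /ht mulnC. Qed.

Lemma ht_mod k m : ht k m = ht k (m %% N).
Proof. by rewrite /ht cos_ang_mod sin_ang_mod -modnMmr -cos_ang_mod -sin_ang_mod. Qed.

(** A cyclic shift keeps [ht k] in the plane spanned by it and its reflection, so a circulant matrix
    acts at each frequency like a complex multiplier. *)
Lemma ht_add k p l : ht k (p + l) = cos (ang (k * p)) * ht k l + sin (ang (k * p)) * ht' k l.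
Proof.
by rewrite /ht /ht' (_ : ang (k * (p + l)) = ang (k * p) + ang (k * l)) ?cosD ?sinD; [ring|rewrite /ang mulnDr natrD; ring].
Qed.

Let ang_sub k j m : (j <= k)%N -> ang (k * m) - ang (j * m) = ang ((k - j) * m).
Proof. by move=> jk; rewrite /ang mulnBl natrB ?leq_mul2r ?jk ?orbT//; ring. Qed.

Let ang_add k j m : ang (k * m) + ang (j * m) = ang ((k + j) * m).
Proof. by rewrite /ang mulnDl natrD; ring. Qed.

Let sum_cosB k j : (k < N)%N -> (j < N)%N ->
  \sum_(m < N) cos (ang (k * m) - ang (j * m)) = if k == j then N%:R else 0.
Proof.
move=> kN jN; wlog jk : k j kN jN / (j <= k)%N.
  move=> H; have [/H->//|/ltnW/H H'] := leqP j k.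
  rewrite eq_sym -H'//; apply: eq_bigr => m _; rewrite -cosN; congr cos; ring.
under eq_bigr do rewrite ang_sub//; rewrite sum_cos_ang modn_small; last exact: leq_ltn_trans (leq_subr _ _) kN.
by rewrite subn_eq0 eqn_leq jk andbT.
Qed.

Let sum_sinB k j : \sum_(m < N) sin (ang (k * m) - ang (j * m)) = 0.
Proof.
wlog jk : k j / (j <= k)%N.
  move=> H; have [/H->//|/ltnW/H H'] := leqP j k.
  apply/eqP; rewrite -oppr_eq0 -sumrN; apply/eqP; rewrite -[RHS]H'; apply: eq_bigr => m _; rewrite -sinN; congr sin; ring.
by under eq_bigr do rewrite ang_sub//; exact: sum_sin_ang.
Qed.

Lemma ht_orth k j : (k < N)%N -> (j < N)%N -> \sum_(m < N) ht k m * ht j m = (k == j)%:R.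
Proof.
move=> kN jN.
transitivity (\sum_(m < N) (cos (ang (k * m) - ang (j * m)) + sin (ang ((k + j) * m))) * N%:R^-1).
  apply: eq_bigr => m _; rewrite /ht -ang_add cosB sinD -rN2; ring.
rewrite -mulr_suml big_split/= sum_cosB// sum_sin_ang addr0.
by case: eqP => _; rewrite ?mul0r// divff.
Qed.

Lemma ht'_orth k j : (k < N)%N -> (j < N)%N -> \sum_(m < N) ht' k m * ht' j m = (k == j)%:R.
Proof.
move=> kN jN.
transitivity (\sum_(m < N) (cos (ang (k * m) - ang (j * m)) - sin (ang ((k + j) * m))) * N%:R^-1).
  apply: eq_bigr => m _; rewrite /ht' -ang_add cosB sinD -rN2; ring.
rewrite -mulr_suml big_split/= sumrN sum_cosB// sum_sin_ang subr0.
by case: eqP => _; rewrite ?mul0r// divff.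
Qed.

Lemma ht_ht' k j : \sum_(m < N) ht k m * ht' j m = ((k + j) %% N == 0)%N%:R.
Proof.
transitivity (\sum_(m < N) (cos (ang ((k + j) * m)) + sin (ang (k * m) - ang (j * m))) * N%:R^-1).
  apply: eq_bigr => m _; rewrite /ht /ht' -ang_add cosD sinB -rN2; ring.
rewrite -mulr_suml big_split/= sum_sinB sum_cos_ang addr0.
by case: eqP => _; rewrite ?mul0r// divff.
Qed.

End hartley.

(** * Power series with coefficients of polynomial growth *)

Section power_series.
Context {R : realType}.
Implicit Types (c f g : nat -> R) (x : R).

(** Polynomial growth is stable under sums, products, shifts and [pseries_diffs], and it ensures
    convergence for |x| < 1; no radius of convergence has to be tracked. *)
Definition polyb c := exists C (d : nat), forall m, `|c m| <= C * m.+1%:R ^+ d.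

Lemma bernoulli x n : 0 <= x -> 1 + n%:R * x <= (1 + x) ^+ n.
Proof.
move=> x0; elim: n => [|n IH]; first by rewrite mul0r addr0 expr0.
rewrite exprS; apply: le_trans (ler_wpM2l _ IH); last by rewrite addr_ge0.
rewrite mulrDr mulr1 mulrDl mul1r -natr1 mulrDl mul1r -subr_ge0.
rewrite (_ : _ - _ = x * (n%:R * x)); last by ring.
by rewrite !mulr_ge0.
Qed.

Lemma polyb_cvg c x : polyb c -> `|x| < 1 -> cvgn (pseries c x).
Proof.
move=> [C [d Hc]] x1; pose y := (`|x| + 1) / 2.
have xy : `|x| <= y by rewrite /y; lra.
have y1 : y < 1 by rewrite /y; lra.
have y0 : 0 < y by rewrite /y; have := normr_ge0 x; lra.
pose s := - ln y; have s0 : 0 < s by rewrite oppr_gt0 ln_lt0// y0.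
have yE : y = expR (- s) by rewrite opprK lnK.
have C0 : 0 <= C.
  by have := Hc 0%N; rewrite expr1n mulr1; apply: le_trans.
pose K := (2 * d%:R / s) ^+ d.
have K0 : 0 <= K by rewrite exprn_ge0// divr_ge0 ?mulr_ge0// ltW.
(* The power of m is paid for with half of the geometric decay exp(- s m). *)
have pol (m : nat) : m.+1%:R ^+ d <= K * expR (s * m.+1%:R / 2).
  have [d0|d0] := eqVneq d 0%N.
    by rewrite /K d0 !expr0 mul1r -expR0 ler_expR divr_ge0// mulr_ge0// ltW.
  have d0' : (0 : R) < d%:R by rewrite ltr0n lt0n.
  have -> : s * m.+1%:R / 2 = d%:R * (s * m.+1%:R / (2 * d%:R)) by field; rewrite gt_eqF.
  rewrite expRM_natl /K -exprMn lerXn2r ?nnegrE ?mulr_ge0 ?expR_ge0 ?invr_ge0 ?(ltW s0)//.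
  have := expR_ge1Dx (s * m.+1%:R / (2 * d%:R)).
  move=> h; have {}h : s * m.+1%:R / (2 * d%:R) <= expR (s * m.+1%:R / (2 * d%:R)) by lra.
  apply: le_trans (ler_wpM2l _ h); last by rewrite divr_ge0 ?mulr_ge0// ltW.
  rewrite le_eqVlt; apply/orP; left; apply/eqP; field; rewrite !gt_eqF//.
apply: normed_cvg; rewrite /normed_series_of/=.
apply: (@series_le_cvg _ _ (geometric (C * (K * expR (s / 2))) (expR (- (s / 2))))).
- by move=> m /=.
- by move=> m /=; apply: mulr_ge0; rewrite ?exprn_ge0 ?expR_ge0 ?mulr_ge0 ?expR_ge0.
- move=> m; rewrite /= normrM normrX.
  apply: (@le_trans _ _ ((C * m.+1%:R ^+ d) * y ^+ m)).
    by rewrite ler_pM ?exprn_ge0// lerXn2r ?nnegrE// ltW.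
  rewrite -!mulrA ler_wpM2l//; apply: (le_trans (ler_wpM2r _ (pol m))); first by rewrite exprn_ge0// ltW.
  rewrite -[K * _ * _]mulrA ler_wpM2l// yE -!expRM_natl -!expRD ler_expR -natr1.
  by rewrite le_eqVlt; apply/orP; left; apply/eqP; field.
by apply: is_cvg_geometric_series; rewrite ger0_norm ?expR_ge0// -expR0 ltr_expR oppr_lt0 divr_gt0.
Qed.

Lemma polyb_mul c f : polyb c -> polyb f -> polyb (fun m => c m * f m).
Proof.
move=> [C [d H]] [C' [d' H']]; exists (C * C'), (d + d')%N => m.
by rewrite normrM exprD mulrACA ler_pM.
Qed.

Lemma polyb_bounded c (C : R) : (forall m, `|c m| <= C) -> polyb c.
Proof. by move=> H; exists C, 0%N => m; rewrite mulr1. Qed.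

Lemma polybD c f : polyb c -> polyb f -> polyb (fun m => c m + f m).
Proof.
move=> [C [d H]] [C' [d' H']]; exists (`|C| + `|C'|), (d + d')%N => m.
apply: (le_trans (ler_normD _ _)); rewrite mulrDl lerD//.
  apply: (le_trans (H m)); apply: (le_trans (ler_wpM2r _ (ler_norm C))); first by rewrite exprn_ge0.
  by rewrite ler_wpM2l// ler_weXn2l ?leq_addr// ler1n.
apply: (le_trans (H' m)); apply: (le_trans (ler_wpM2r _ (ler_norm C'))); first by rewrite exprn_ge0.
by rewrite ler_wpM2l// ler_weXn2l ?leq_addl// ler1n.
Qed.

Lemma polyb_diffs c : polyb c -> polyb (pseries_diffs c).
Proof.
move=> [C [d H]]; exists (C * 2 ^+ d), d.+1 => m.
have C0 : 0 <= C by have := H 0%N; rewrite expr1n mulr1; apply: le_trans.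
rewrite /pseries_diffs normrM ger0_norm// exprS mulrCA ler_wpM2l//.
apply: (le_trans (H _)); rewrite -mulrA ler_wpM2l// -exprMn lerXn2r ?nnegrE//.
rewrite -!natr1; have := ler0n R m; lra.
Qed.

Definition pser c x : R := limn (pseries c x).

Lemma pser_cvg c x : polyb c -> `|x| < 1 -> pseries c x @ \oo --> pser c x.
Proof. by move=> *; exact: polyb_cvg. Qed.

Lemma pser_deriv c x : polyb c -> `|x| < 1 -> is_derive x 1 (pser c) (pser (pseries_diffs c) x).
Proof.
move=> H x1.
have k1 : `|(`|x| + 1) / 2| < 1 by rewrite ger0_norm ?divr_ge0 ?addr_ge0//; lra.
apply: (@pseries_snd_diffs _ _ ((`|x| + 1) / 2)).
- exact: polyb_cvg.
- by apply: polyb_cvg => //; exact: polyb_diffs.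
- by apply: polyb_cvg => //; do 2 apply: polyb_diffs.
by rewrite [ltRHS]ger0_norm ?divr_ge0 ?addr_ge0//; lra.
Qed.

Lemma pser_lin c f x (s t : R) : polyb c -> polyb f -> `|x| < 1 ->
  pser (fun m => s * c m + t * f m) x = s * pser c x + t * pser f x.
Proof.
move=> H H' x1; apply: (cvg_lim (@Rhausdorff R)).
have -> : pseries (fun m => s * c m + t * f m) x = (fun n => s * pseries c x n + t * pseries f x n).
  apply/funext => n; rewrite /pseries /series/= !mulr_sumr -big_split/=.
  by apply: eq_bigr => i _; ring.
by apply: cvgD; apply: cvgMr; exact: pser_cvg.
Qed.

Lemma pser_mulX c x : polyb c -> `|x| < 1 ->
  pser (fun m => m%:R * c m) x = x * pser (pseries_diffs c) x.
Proof.
move=> H x1; apply: (cvg_lim (@Rhausdorff R)).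
rewrite -cvg_shiftS/=.
have -> : (fun n => pseries (fun m => m%:R * c m) x n.+1) = (fun n => x * pseries (pseries_diffs c) x n).
  apply/funext => n; rewrite /pseries /series/= big_nat_recl// !mul0r add0r mulr_sumr.
  by apply: eq_bigr => i _; rewrite /pseries_diffs exprS; ring.
by apply: cvgMr; apply: pser_cvg => //; exact: polyb_diffs.
Qed.

Lemma pser0 c : pser c 0 = c 0%N.
Proof.
apply: (cvg_lim (@Rhausdorff R)); rewrite -cvg_shiftS/=.
have -> : (fun n => pseries c 0 n.+1) = cst (c 0%N); last exact: cvg_cst.
apply/funext => n; rewrite /pseries /series/= big_nat_recl// expr0 mulr1 big1 ?addr0//.
by move=> i _; rewrite expr0n mulr0.
Qed.

End power_series.

(** * The modulus of (1 - q e^(i theta))^(-a) *)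

Section binomial_series.
Context {R : realType}.
Variable a : R.
Hypothesis a0 : 0 < a.

(* coefficients of (1 - z)^(-a) *)
Definition wc (m : nat) : R := \prod_(i < m) ((a + i%:R) / i.+1%:R).

Lemma wc0 : wc 0 = 1. Proof. by rewrite /wc big_ord0. Qed.

Lemma wcS m : wc m.+1 = wc m * ((a + m%:R) / m.+1%:R).
Proof. by rewrite /wc big_ord_recr. Qed.

Lemma wc_gt0 m : 0 < wc m.
Proof. by apply: prodr_gt0 => i _; rewrite divr_gt0// ltr_wpDr. Qed.

Lemma wc_polyb : polyb wc.
Proof.
have [d ad] : exists d : nat, a <= d%:R by exists (Num.truncn a).+1; exact/ltW/truncnS_gt.
exists 1, d => m; rewrite mul1r gtr0_norm ?wc_gt0//.
elim: m => [|m IH]; first by rewrite wc0 expr1n.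
rewrite wcS; apply: (@le_trans _ _ (m.+1%:R ^+ d * (m.+2%:R / m.+1%:R) ^+ d)); last first.
  by rewrite -exprMn mulrCA mulfV ?mulr1.
rewrite ler_pM//; [exact/ltW/wc_gt0|by rewrite divr_ge0// addr_ge0// ltW|].
have -> : m.+2%:R / m.+1%:R = 1 + m.+1%:R^-1 :> R.
  by rewrite -[m.+2%:R]natr1 mulrDl divff// mul1r.
apply: le_trans (bernoulli _ _); last by rewrite invr_ge0.
rewrite ler_pdivrMr// mulrDl mul1r mulfVK// -natr1; lra.
Qed.

Variable th : R.
Notation wcos := (fun m : nat => wc m * cos (m%:R * th)).
Notation wsin := (fun m : nat => wc m * sin (m%:R * th)).

Let pc : polyb wcos.
Proof. by apply: polyb_mul wc_polyb (polyb_bounded (C := 1) _) => m; exact: cos_max. Qed.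
Let ps : polyb wsin.
Proof. by apply: polyb_mul wc_polyb (polyb_bounded (C := 1) _) => m; exact: sin_max. Qed.

(** Real part, at x, of the series of (1 - x e^(i th))^(-a); [gsn] is the imaginary part. *)
Definition gc : R -> R := pser wcos.
Definition gsn : R -> R := pser wsin.
Let dgc := pser (pseries_diffs wcos).
Let dgs := pser (pseries_diffs wsin).

Let pm (c : nat -> R) : polyb c -> polyb (fun m => m%:R * c m).
Proof.
by move=> H; apply: polyb_mul => //; exists 1, 1%N => m; rewrite mul1r expr1 ger0_norm// ler_nat.
Qed.

Let pam (c : nat -> R) : polyb c -> polyb (fun m => (a + m%:R) * c m).
Proof.
move=> H; have -> : (fun m => (a + m%:R) * c m) = (fun m => a * c m + m%:R * c m).
  by apply/funext => m; rewrite mulrDl.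
by apply: polybD; [apply: polyb_mul => //; exact: (polyb_bounded (C := `|a|))|exact: pm].
Qed.

Let pamE (c : nat -> R) x : polyb c -> `|x| < 1 ->
  pser (fun m => (a + m%:R) * c m) x = a * pser c x + x * pser (pseries_diffs c) x.
Proof.
move=> H x1; rewrite -pser_mulX// -[X in _ + X]mul1r -pser_lin//; last exact: pm.
by congr pser; apply/funext => m; ring.
Qed.

(** Real part of g' = e^(i th) (a g + x g'), read off from the recurrence [wcS]; [ode2] is the
    imaginary part. *)
Let ode1 x : `|x| < 1 -> dgc x = cos th * (a * gc x + x * dgc x) - sin th * (a * gsn x + x * dgs x).
Proof.
move=> x1; rewrite -!pamE// -mulNr -pser_lin; [|exact: pam..|by []].
congr pser; apply/funext => m; rewrite /pseries_diffs wcS (_ : m.+1%:R * th = m%:R * th + th) ?cosD; last by rewrite -natr1; ring.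
by field.
Qed.

Let ode2 x : `|x| < 1 -> dgs x = sin th * (a * gc x + x * dgc x) + cos th * (a * gsn x + x * dgs x).
Proof.
move=> x1; rewrite -!pamE// -pser_lin; [|exact: pam..|by []].
congr pser; apply/funext => m; rewrite /pseries_diffs wcS (_ : m.+1%:R * th = m%:R * th + th) ?sinD; last by rewrite -natr1; ring.
by field.
Qed.

(** This is |1 - q e^(i th)|^2, written so that both terms are visibly nonnegative for q >= 0. *)
Definition symb (q : R) : R := (1 - q) ^+ 2 + 2 * q * (1 - cos th).

Lemma symb_gt0 q : 0 <= q < 1 -> 0 < symb q.
Proof.
move=> /andP[q0 q1]; rewrite ltr_wpDr ?exprn_gt0 ?subr_gt0//.
by rewrite !mulr_ge0// subr_ge0 cos_le1.
Qed.

Let symbE q : symb q = 1 - 2 * q * cos th + q ^+ 2.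
Proof. by rewrite /symb; ring. Qed.

Let energy x : `|x| < 1 ->
  symb x * (gc x * dgc x + gsn x * dgs x) = a * (cos th - x) * (gc x ^+ 2 + gsn x ^+ 2).
Proof.
move=> x1; have := ode1 x1; have := ode2 x1; have := cos2Dsin2 th; rewrite symbE.
move: (cos th) (sin th) (gc x) (gsn x) (dgc x) (dgs x) => C S A B D F cs e2 e1.
have {}e1 : D - (C * (a * A + x * D) - S * (a * B + x * F)) = 0 by rewrite -e1 subrr.
have {}e2 : F - (S * (a * A + x * D) + C * (a * B + x * F)) = 0 by rewrite -e2 subrr.
have {}cs : C ^+ 2 + S ^+ 2 - 1 = 0 by rewrite cs subrr.
(* The difference of the two sides is an explicit combination of the two differential equations and
   of cos^2 + sin^2 = 1. *)
apply/eqP; rewrite -subr_eq0; apply/eqP; transitivity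
  (A * ((1 - x * C) * (D - (C * (a * A + x * D) - S * (a * B + x * F)))
        - x * S * (F - (S * (a * A + x * D) + C * (a * B + x * F))))
   + B * (x * S * (D - (C * (a * A + x * D) - S * (a * B + x * F)))
        + (1 - x * C) * (F - (S * (a * A + x * D) + C * (a * B + x * F))))
   - (C ^+ 2 + S ^+ 2 - 1) * (A * (x ^+ 2 * D + a * x * A) + B * (x ^+ 2 * F + a * x * B))); first by ring.
by rewrite e1 e2 cs !(mulr0, mul0r, subr0, addr0).
Qed.

Let dsymb (x : R) : is_derive x 1 symb (2 * (x - cos th)).
Proof.
rewrite (funext symbE); apply: is_derive_eq.
rewrite /GRing.scale/=; ring.
Qed.

(** By [energy], |g|^2 times symb^a has zero derivative on [0, 1[, and its value at 0 is 1. The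
    modulus is thus found without complex powers. *)
Lemma binomial_series_norm q : 0 <= q < 1 ->
  gc q ^+ 2 + gsn q ^+ 2 = symb q `^ (- a).
Proof.
move=> /andP[q0 q1].
pose g x := (gc x ^+ 2 + gsn x ^+ 2) * expR (a * ln (symb x)).
have dg (x : R) : 0 <= x < 1 -> is_derive x 1 g 0.
  move=> x01; have sx := symb_gt0 x01; have /andP[x0 x1] := x01.
  have nx : `|x| < 1 by rewrite ger0_norm.
  have d1 : is_derive x 1 gc (dgc x) by exact: pser_deriv.
  have d2 : is_derive x 1 gsn (dgs x) by exact: pser_deriv.
  have d3 : is_derive x 1 (fun y => ln (symb y)) ((symb x)^-1 * (2 * (x - cos th))).
    by apply: (is_derive1_comp (f := @ln R) (g := symb)) => //; exact: is_derive1_ln.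
  have d4 : is_derive x 1 (fun y => a * ln (symb y)) (a * ((symb x)^-1 * (2 * (x - cos th)))).
    by apply: is_derive_eq; rewrite /GRing.scale/=; ring.
  have d5 : is_derive x 1 (fun y => expR (a * ln (symb y))) (expR (a * ln (symb x)) * (a * ((symb x)^-1 * (2 * (x - cos th))))).
    exact: (is_derive1_comp (f := @expR R) (g := fun y => a * ln (symb y))).
  rewrite /g; apply: is_derive_eq; rewrite /GRing.scale/=.
  have e : gc x * dgc x + gsn x * dgs x = (symb x)^-1 * (a * (cos th - x) * (gc x ^+ 2 + gsn x ^+ 2)).
    by rewrite -energy// mulKf// gt_eqF.
  transitivity (expR (a * ln (symb x)) * 2 * ((gc x * dgc x + gsn x * dgs x) - (symb x)^-1 * (a * (cos th - x) * (gc x ^+ 2 + gsn x ^+ 2)))).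
    by ring.
  by rewrite e subrr mulr0.
have gq : g q = g 0.
  have [->//|qn] := eqVneq q 0; have q0' : 0 < q by rewrite lt_neqAle eq_sym qn.
  have [x||c _ E] := @MVT _ g (fun=> 0) 0 q q0'.
  - by rewrite in_itv/= => /andP[x0 xq]; apply: dg; rewrite ltW//= (lt_trans xq).
  - apply: derivable_within_continuous => x; rewrite in_itv/= => /andP[x0 xq].
    by have [] := dg x; rewrite ?x0 ?(le_lt_trans xq).
  by apply/eqP; rewrite -subr_eq0 E mul0r.
have sq : 0 < symb q by apply: symb_gt0; rewrite q0.
have : g 0 = 1.
  rewrite /g /gc /gsn !pser0 wc0 !mul0r cos0 sin0 mulr1 mulr0 /symb.
  rewrite (_ : (1 - 0) ^+ 2 + 2 * 0 * _ = 1); last by ring.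
  by rewrite ln1 mulr0 expR0; ring.
rewrite -gq /g => h; rewrite /powR gt_eqF// mulNr expRN.
by apply: (mulIf (x := expR (a * ln (symb q)))); rewrite ?gt_eqF ?expR_gt0// h mulVf// gt_eqF ?expR_gt0.
Qed.

End binomial_series.

Section power_series_more.
Context {R : realType}.
Implicit Types (c : nat -> R) (x : R).

Lemma pser_sum (I : Type) (r : seq I) (F : I -> nat -> R) (s : I -> R) x :
  (forall i, polyb (F i)) -> `|x| < 1 ->
  polyb (fun m => \sum_(i <- r) s i * F i m) /\
  pser (fun m => \sum_(i <- r) s i * F i m) x = \sum_(i <- r) s i * pser (F i) x.
Proof.
move=> H x1; elim: r => [|j r [IH1 IH2]].
  rewrite big_nil (_ : (fun m => _) = fun=> 0); last by apply/funext => m; rewrite big_nil.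
  split; first by apply: (polyb_bounded (C := 0)) => m; rewrite normr0.
  apply: (cvg_lim (@Rhausdorff R)); rewrite (_ : pseries _ _ = cst 0); first exact: cvg_cst.
  by apply/funext => k; rewrite /pseries /series/= big1// => i _; rewrite mul0r.
rewrite (_ : (fun m => _) = fun m => s j * F j m + 1 * \sum_(i <- r) s i * F i m); last first.
  by apply/funext => m; rewrite big_cons mul1r.
rewrite pser_lin// IH2 big_cons mul1r; split=> //.
apply: polybD; first by apply: polyb_mul => //; exact: (polyb_bounded (C := `|s j|)).
by apply: polyb_mul => //; apply: (polyb_bounded (C := 1)) => m; rewrite normr1.
Qed.

Lemma sum_nat_shift (F : nat -> R) k n :
  \sum_(0 <= m < n + k) F m = \sum_(0 <= m < k) F m + \sum_(0 <= m < n) F (k + m)%N.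
Proof.
elim: n => [|n IH]; first by rewrite add0n [X in _ + X]big_nil addr0.
by rewrite addSn !big_nat_recr//= IH addrA addnC.
Qed.

Lemma pser_fin c x k : (forall m, (k <= m)%N -> c m = 0) ->
  pser c x = \sum_(m < k) c m * x ^+ m.
Proof.
move=> H; apply: (cvg_lim (@Rhausdorff R)).
rewrite -(cvg_shiftn k)/= (_ : (fun n => _) = cst (\sum_(m < k) c m * x ^+ m)); first exact: cvg_cst.
apply/funext => n; rewrite /pseries /series/= sum_nat_shift big_mkord.
by rewrite [X in _ + X]big1 ?addr0// => i _; rewrite H ?mul0r// leq_addr.
Qed.

Lemma polyb_shift c k : polyb c -> polyb (fun m => c (k + m)%N).
Proof.
move=> [C [d H]]; exists (C * k.+1%:R ^+ d), d => m.
have C0 : 0 <= C by have := H 0%N; rewrite expr1n mulr1; apply: le_trans.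
apply: (le_trans (H _)); rewrite -mulrA ler_wpM2l// -exprMn lerXn2r ?nnegrE ?mulr_ge0//.
rewrite -natrM ler_nat mulSn mulnS; lia.
Qed.

Lemma pser_shift c x k : polyb c -> `|x| < 1 -> (forall m, (m < k)%N -> c m = 0) ->
  pser c x = x ^+ k * pser (fun m => c (k + m)%N) x.
Proof.
move=> pc x1 H; apply: (cvg_lim (@Rhausdorff R)).
rewrite -(cvg_shiftn k)/= (_ : (fun n => _) = fun n => x ^+ k * pseries (fun m => c (k + m)%N) x n).
  by apply: cvgMr; apply: pser_cvg => //; exact: polyb_shift.
apply/funext => n; rewrite /pseries /series/= sum_nat_shift [X in X + _]big_nat_cond [X in X + _]big1 ?add0r.
  by rewrite mulr_sumr; apply: eq_bigr => i _; rewrite exprD; ring.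
by move=> i /andP[/andP[_ ik] _]; rewrite H// mul0r.
Qed.

Lemma pser_le c f x : polyb c -> polyb f -> 0 <= x < 1 -> (forall m, c m <= f m) -> pser c x <= pser f x.
Proof.
move=> pc pf /andP[x0 x1] H; have x1' : `|x| < 1 by rewrite ger0_norm.
apply: (ler_cvg_to (pser_cvg pc x1') (pser_cvg pf x1')).
by apply: nearW => n; rewrite /pseries /series/=; apply: ler_sum => i _; rewrite ler_wpM2r ?exprn_ge0.
Qed.

End power_series_more.

Lemma std_gauss_orth {R : realType} {d} {Omega : measurableType d} (P : probability Omega R) M N
    (xi : 'I_N -> Omega -> R) (B : 'I_M -> 'I_N -> R) :
  std_gauss P xi -> (forall k j, \sum_l B k l * B j l = (k == j)%:R) -> std_gauss P (lmap B xi).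
Proof.
move=> [mxi H] HB; split; first exact: measurable_lmap.
move=> c p.
have -> : \sum_k c k ^+ 2 = \sum_l (\sum_k c k * B k l) ^+ 2.
  under [RHS]eq_bigr => l _ do rewrite expr2 big_distrlr/=.
  rewrite exchange_big/=; apply: eq_bigr => k _; rewrite exchange_big/= (bigD1 k)//=.
  rewrite [X in _ + X]big1 ?addr0.
    rewrite (eq_bigr (fun l => c k ^+ 2 * (B k l * B k l))); last by move=> l _; ring.
    by rewrite -mulr_sumr HB eqxx mulr1.
  move=> j jk; rewrite (eq_bigr (fun l => c k * c j * (B k l * B j l))); last by move=> l _; ring.
  by rewrite -mulr_sumr HB eq_sym (negbTE jk) mulr0.
rewrite -H; apply: eq_integral => w _; congr (1 + cos (_ + _))%:E.
rewrite /lmap; under eq_bigr do rewrite mulr_sumr.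
rewrite exchange_big/=; apply: eq_bigr => l _; rewrite mulr_suml; apply: eq_bigr => k _; ring.
Qed.

(** * Diagonalisation of the damped circulant matrix *)

Section circulant.
Context {R : realType}.
Variables (a : R) (n : nat) (q : R).
Hypotheses (a0 : 0 < a) (q01 : 0 < q < 1).
Notation N := n.+1.
Notation w := (wc a).

Let q0 : 0 < q. Proof. by have /andP[] := q01. Qed.
Let q1 : `|q| < 1. Proof. by rewrite gtr0_norm//; have /andP[] := q01. Qed.
Let q01' : 0 <= q < 1. Proof. by have /andP[/ltW-> ->] := q01. Qed.

(** Periodisation modulo N of the damped weights w_m q^m. *)
Definition kp (p : nat) : R := pser (fun m => (m %% N == p)%N%:R * w m) q.

Let polyb_bool (b : nat -> bool) c : polyb c -> polyb (fun m => (b m)%:R * c m : R).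
Proof.
move=> H; apply: polyb_mul => //; apply: (polyb_bounded (C := 1)) => m.
by case: (b m); rewrite ?normr1 ?normr0.
Qed.

Let pw : polyb w := wc_polyb a0.

Lemma kp_ge0 p : 0 <= kp p.
Proof.
have <- : pser (fun=> 0) q = 0 by rewrite (@pser_fin _ _ _ 0) ?big_ord0.
apply: pser_le => //; first by apply: (polyb_bounded (C := 0)) => m; rewrite normr0.
  exact: polyb_bool.
by move=> m; rewrite mulr_ge0// ltW// wc_gt0.
Qed.

(** The subtraction is that of the ring ['I_N], that is, modulo N. *)
Definition Cm (i l : 'I_N) : R := kp (i - l)%R.
Definition TZ (i l : 'I_N) : R := if (l <= i)%N then w (i - l) * q ^+ (i - l) else 0.
(** The wrapped terms have index m = i + t with t > 0 and t congruent to -l modulo N. The factor q^i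
    is taken out, so that i enters only through w_(i+t); i is a natural number, so that differences
    in i make sense at the last row. *)
Definition Hm (i : nat) (l : 'I_N) : R :=
  pser (fun t => ((0 < t) && ((t + l) %% N == 0))%N%:R * w (i + t)%N) q.

Lemma Hm_ge0 i l : 0 <= Hm i l.
Proof.
have <- : pser (fun=> 0) q = 0 by rewrite (@pser_fin _ _ _ 0) ?big_ord0.
apply: pser_le => //; first by apply: (polyb_bounded (C := 0)) => m; rewrite normr0.
  by apply: polyb_bool; exact: polyb_shift.
by move=> m; rewrite mulr_ge0// ltW// wc_gt0.
Qed.

Lemma circ_split i l : Cm i l = TZ i l + q ^+ i * Hm i l.
Proof.
rewrite /Cm; pose f m : R := (m %% N == (i - l)%R)%N%:R * w m.
have pf : polyb f by exact: polyb_bool.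
have vE : val (i - l)%R = ((i + (N - l)) %% N)%N by rewrite /= modnDmr.
have iN := ltn_ord i; have lN := ltn_ord l.
have fE m : (m %% N == (i - l)%R)%N = ((m + l) %% N == i %% N)%N.
  rewrite vE -(eqn_modDr l) -addnA subnK ?modnDr//; exact: ltnW.
rewrite /kp -/f (_ : f = fun m => 1 * ((m <= i)%N%:R * f m) + 1 * ((i < m)%N%:R * f m)); last first.
  by apply/funext => m; rewrite !mul1r -mulrDl leqNgt; case: ltnP => _; rewrite /= ?mulr0n ?mulr1n ?add0r ?addr0 ?mul1r.
rewrite pser_lin ?mul1r//; [|exact: polyb_bool..].
congr (_ + _).
  rewrite (@pser_fin _ _ _ i.+1); last by move=> m im; rewrite leqNgt im mul0r.
  rewrite /TZ /f; case: ifPn => [li|].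
    have il : (i - l < i.+1)%N by rewrite ltnS leq_subr.
    rewrite (bigD1 (Ordinal il))//= [X in _ + X]big1 ?addr0.
      by rewrite fE subnK// eqxx leq_subr !mul1r.
    move=> m; rewrite -val_eqE/= => mil; rewrite fE.
    have mi : (m <= i)%N by rewrite -ltnS.
    case: eqP; rewrite ?(mul0r, mulr0)// => /eqP.
    rewrite (modn_small iN) => h; case/negP: mil; apply/eqP.
    have [ml|ml] := ltnP (m + l) N; first by move: h; rewrite modn_small// => /eqP; lia.
    move: h; rewrite -(subnK ml) modnDr modn_small => [/eqP|]; lia.
  rewrite -ltnNge => il; apply: big1 => m _; rewrite fE.
  have mi : (m <= i)%N by rewrite -ltnS.
  case: eqP; rewrite ?(mul0r, mulr0)// => /eqP.
  rewrite (modn_small iN) => h; exfalso.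
  have [ml|ml] := ltnP (m + l) N; first by move: h; rewrite modn_small// => /eqP; lia.
  move: h; rewrite -(subnK ml) modnDr modn_small => [/eqP|]; lia.
rewrite (@pser_shift _ _ _ i)//; last 2 first.
- exact: polyb_bool.
- by move=> m mi; rewrite ltnNge (ltnW mi) mul0r.
congr (_ * _); rewrite /Hm; congr pser; apply/funext => t; rewrite /f fE mulrA -natrM mulnb.
congr (_%:R * _); congr (nat_of_bool (_ && _)); first by rewrite -[X in (X < _)%N]addn0 ltn_add2l.
by rewrite -addnA -[X in _ == X %[mod _]]addn0 eqn_modDl mod0n.
Qed.

Lemma TZ_ge0 i l : 0 <= TZ i l.
Proof. by rewrite /TZ; case: ifP => // _; rewrite mulr_ge0 ?exprn_ge0 ?(ltW q0)// ltW// wc_gt0. Qed.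

Lemma Hm_le_circ (i l : 'I_N) : q ^+ i * Hm i l <= Cm i l.
Proof. by rewrite circ_split lerDr TZ_ge0. Qed.

Definition lam (k : nat) : R := symb (ang N k : R) q `^ (- a).

Let gck k := gc a (ang N k : R) q.
Let gsk k := gsn a (ang N k : R) q.

Lemma lam_gt0 k : 0 < lam k.
Proof. by rewrite powR_gt0// symb_gt0. Qed.

Let lamE k : gck k ^+ 2 + gsk k ^+ 2 = lam k.
Proof. exact: binomial_series_norm. Qed.

Let angM k m : ang N (k * m) = m%:R * ang N k :> R.
Proof. by rewrite /ang natrM; ring. Qed.

Let gckE k : gck k = \sum_(p < N) kp p * cos (ang N (k * p)).
Proof.
transitivity (pser (fun m => \sum_(p < N) cos (ang N (k * p)) * ((m %% N == p)%N%:R * w m)) q).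
  rewrite /gck /gc; congr pser; apply/funext => m.
  have mN : (m %% N < N)%N by rewrite ltn_pmod.
  rewrite (bigD1 (Ordinal mN))//= eqxx mul1r big1 ?addr0.
    by rewrite -angM mulrC cos_ang_mod// -modnMmr -cos_ang_mod.
  by move=> p; rewrite -val_eqE/= eq_sym => /negbTE ->; rewrite mul0r mulr0.
rewrite (pser_sum _ _ _ _).2//; last by move=> p; exact: polyb_bool.
by apply: eq_bigr => p _; rewrite mulrC.
Qed.

Let gskE k : gsk k = \sum_(p < N) kp p * sin (ang N (k * p)).
Proof.
transitivity (pser (fun m => \sum_(p < N) sin (ang N (k * p)) * ((m %% N == p)%N%:R * w m)) q).
  rewrite /gsk /gsn; congr pser; apply/funext => m.
  have mN : (m %% N < N)%N by rewrite ltn_pmod.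
  rewrite (bigD1 (Ordinal mN))//= eqxx mul1r big1 ?addr0.
    by rewrite -angM mulrC sin_ang_mod// -modnMmr -sin_ang_mod.
  by move=> p; rewrite -val_eqE/= eq_sym => /negbTE ->; rewrite mul0r mulr0.
rewrite (pser_sum _ _ _ _).2//; last by move=> p; exact: polyb_bool.
by apply: eq_bigr => p _; rewrite mulrC.
Qed.

Let Mk (k l : nat) : R := gck k * ht N k l + gsk k * ht' N k l.

Let MkE (k l : 'I_N) : \sum_(i < N) ht N k i * Cm i l = Mk k l.
Proof.
rewrite (reindex_inj (addIr l))/= /Mk gckE gskE !mulr_suml -big_split/=.
apply: eq_bigr => p _; rewrite /Cm addrK -ht_mod// ht_add; ring.
Qed.

Let trig_refl k j : ((k + j) %% N == 0)%N -> gck j = gck k /\ gsk j = - gsk k.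
Proof.
move=> kj.
have E p : ang N (j * p) + ang N (k * p) = ang N ((k + j) * p) :> R by rewrite /ang mulnDl natrD; ring.
have kj0 p : ((k + j) * p %% N = 0)%N by rewrite -modnMml (eqP kj).
have ang0 : ang N 0 = 0 :> R by rewrite /ang mulr0 mul0r.
have cj p : cos (ang N (j * p)) = cos (ang N (k * p)) :> R.
  rewrite (_ : ang N (j * p) = ang N ((k + j) * p) - ang N (k * p)); last by rewrite -E addrK.
  by rewrite cosB (cos_ang_mod _ ((k + j) * p))// (sin_ang_mod _ ((k + j) * p))// kj0 ang0 cos0 sin0 mul1r mul0r addr0.
have sj p : sin (ang N (j * p)) = - sin (ang N (k * p)) :> R.
  rewrite (_ : ang N (j * p) = ang N ((k + j) * p) - ang N (k * p)); last by rewrite -E addrK.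
  by rewrite sinB (cos_ang_mod _ ((k + j) * p))// (sin_ang_mod _ ((k + j) * p))// kj0 ang0 cos0 sin0 mul1r mul0r sub0r.
split; first by rewrite !gckE; apply: eq_bigr => p _; rewrite cj.
by rewrite !gskE -sumrN; apply: eq_bigr => p _; rewrite sj mulrN.
Qed.

(** The mixed products of [ht] and [ht'] survive only for j = -k modulo N, where [gck] takes the
    same value and [gsk] the opposite one, so they cancel. *)
Let Mk_orth (k j : 'I_N) : \sum_(l < N) Mk k l * Mk j l = (k == j)%:R * lam k.
Proof.
transitivity (gck k * gck j * \sum_(l < N) ht N k l * ht N j l + gsk k * gsk j * \sum_(l < N) ht' N k l * ht' N j l
   + gck k * gsk j * (\sum_(l < N) ht N k l * ht' N j l) + gsk k * gck j * (\sum_(l < N) ht N j l * ht' N k l)).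
  by rewrite !mulr_sumr -!big_split/=; apply: eq_bigr => l _; rewrite /Mk; ring.
rewrite ht_orth// ht'_orth// !ht_ht'// [(j + k)%N]addnC -[LHS]addrA.
have -> : gck k * gsk j * ((k + j) %% N == 0)%N%:R + gsk k * gck j * ((k + j) %% N == 0)%N%:R = 0.
  have [kj|_] := boolP ((k + j) %% N == 0)%N; last by rewrite !mulr0 addr0.
  by have [-> ->] := trig_refl kj; ring.
rewrite -val_eqE/=; case: eqP => [<-|_]; rewrite ?mulr0 ?mul0r ?addr0//.
by rewrite !mulr1 mul1r -lamE; ring.
Qed.

Definition hartley_map (x : 'I_N -> R) (k : 'I_N) : R := \sum_(i < N) ht N k i * x i.

Lemma hartley_mapK x : hartley_map (hartley_map x) = x.
Proof.
apply/funext => k; rewrite /hartley_map.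
under eq_bigr do rewrite mulr_sumr.
rewrite exchange_big/= (bigD1 k)//= [X in _ + X]big1 ?addr0.
  rewrite (eq_bigr (fun i : 'I_N => ht N k i * ht N k i * x k)); last by move=> i _; rewrite (ht_sym _ i k) mulrA.
  by rewrite -mulr_suml ht_orth// eqxx mul1r.
move=> j jk; rewrite (eq_bigr (fun i : 'I_N => ht N k i * ht N j i * x j)); last by move=> i _; rewrite (ht_sym _ i j) mulrA.
by rewrite -mulr_suml ht_orth// val_eqE eq_sym (negbTE jk) mul0r.
Qed.

Lemma hartley_map_sqr x : \sum_k hartley_map x k ^+ 2 = \sum_k x k ^+ 2.
Proof.
transitivity (\sum_i x i * hartley_map (hartley_map x) i); last by rewrite hartley_mapK.
under [RHS]eq_bigr do rewrite {1}/hartley_map mulr_sumr.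
rewrite exchange_big/=; apply: eq_bigr => k _; rewrite expr2 {1}/hartley_map mulr_suml.
by apply: eq_bigr => i _; rewrite (ht_sym _ k i); ring.
Qed.

Lemma hartley_map_dist2 x y : dist2 (hartley_map x) (hartley_map y) = dist2 x y.
Proof.
rewrite /dist2 -[RHS]hartley_map_sqr; apply: eq_bigr => k _; congr (_ ^+ 2).
by rewrite /hartley_map -sumrB; apply: eq_bigr => i _; rewrite mulrBr.
Qed.

(* Parseval: each row of the circulant matrix has the same norm. *)
Lemma circ_row (i : 'I_N) : \sum_l Cm i l ^+ 2 = (\sum_(k < N) lam k) / N%:R.
Proof.
have row (j : 'I_N) : \sum_l Cm j l ^+ 2 = \sum_(p < N) kp p ^+ 2 by
  rewrite (reindex_inj (subrI j))/=; apply: eq_bigr => p _; rewrite /Cm subKr.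
have col (l : 'I_N) : \sum_j Cm j l ^+ 2 = \sum_(p < N) kp p ^+ 2.
  by rewrite (reindex_inj (addIr l))/=; apply: eq_bigr => p _; rewrite /Cm addrK.
have -> : \sum_(k < N) lam k = \sum_(l < N) \sum_(k < N) Mk k l ^+ 2.
  rewrite exchange_big/=; apply: eq_bigr => k _.
  by have := Mk_orth k k; rewrite eqxx mul1r => <-.
rewrite row -(@mulfK _ N%:R _ (\sum_(p < N) kp p ^+ 2)) ?pnatr_eq0//; congr (_ / _).
rewrite mulr_natr -[X in _ *+ X]card_ord -sumr_const; apply: eq_bigr => l _.
rewrite -(col l) -hartley_map_sqr; apply: eq_bigr => k _.
by rewrite -MkE.
Qed.

(** The Hartley transform is an isometry and its own inverse, so it carries codebooks both ways; by
    [Mk_orth] it turns the circulant image of [xi] into independent coordinates of variances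
    [lam k]. *)
Lemma circ_diag d (Omega : measurableType d) (P : probability Omega R) (xi : 'I_N -> Omega -> R) :
  std_gauss P xi -> exists2 eta : 'I_N -> Omega -> R, std_gauss P eta &
   forall L D, ach P (lmap Cm xi) L D <-> ach P (fun k w => Num.sqrt (lam k) * eta k w) L D.
Proof.
move=> H; pose B (k l : 'I_N) := (Num.sqrt (lam k))^-1 * Mk k l.
have sl k : Num.sqrt (lam k) != 0 by rewrite gt_eqF// sqrtr_gt0 lam_gt0.
have HB k j : \sum_l B k l * B j l = (k == j)%:R.
  rewrite (eq_bigr (fun l : 'I_N => (Num.sqrt (lam k))^-1 * (Num.sqrt (lam j))^-1 * (Mk k l * Mk j l))); last by move=> l _; rewrite /B; ring.
  rewrite -mulr_sumr Mk_orth; case: eqP => [<-|_]; last by rewrite mul0r mulr0.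
  by rewrite mul1r -invfM -expr2 sqr_sqrtr ?mulVf ?gt_eqF ?lam_gt0// ltW// lam_gt0.
have Heta := std_gauss_orth H HB.
exists (lmap B xi) => // L D.
have mC : mvec (lmap Cm xi) by apply: measurable_lmap; exact: H.1.
have mE : mvec (fun (k : 'I_N) w => Num.sqrt (lam k) * lmap B xi k w).
  by move=> k; apply: measurable_funM => //; exact: Heta.1.
have E w (k : 'I_N) : Num.sqrt (lam k) * lmap B xi k w = hartley_map (rv (lmap Cm xi) w) k.
  rewrite /lmap mulr_sumr /hartley_map /rv.
  under [RHS]eq_bigr do rewrite mulr_sumr.
  rewrite exchange_big/=; apply: eq_bigr => l _; rewrite /B mulrA mulVKf// -MkE mulr_suml.
  by apply: eq_bigr => i _; rewrite mulrA.
split=> h; rewrite -[D]mul1r.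
  by apply: (ach_lip (F := hartley_map) mC mE ler01 _ _ h) => [x y|w k]; rewrite ?hartley_map_dist2 ?mul1r// E.
apply: (ach_lip (F := hartley_map) mE mC ler01 _ _ h) => [x y|w k]; first by rewrite hartley_map_dist2 mul1r.
by rewrite (_ : rv _ w = hartley_map (rv (lmap Cm xi) w)) ?hartley_mapK//; apply/funext => j; exact: E.
Qed.

End circulant.

(** * Quantization of smooth rows *)

Section differences.
Context {R : realType}.
Implicit Types (f : nat -> R) (i j r s t : nat).

Definition fd f i : R := f i.+1 - f i.
Definition fds s f : nat -> R := iter s fd f.

Lemma fdsS s f : fds s.+1 f = fds s (fd f).
Proof. by rewrite /fds iterSr. Qed.

(** Newton's forward interpolation polynomial of degree below [r], based at i and evaluated at i +
    j. *)
Definition newton r f i j : R := \sum_(s < r) 'C(j, s)%:R * fds s f i.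

Lemma newton_rem0 r f i : newton r.+1 f i 0 = f i.
Proof. by rewrite /newton big_ord_recl/= big1 ?addr0 ?bin0 ?mul1r// => s _; rewrite bin0n mul0r. Qed.

(** By Pascal's rule, the increment in j of the remainder of order r+1 is the remainder of order r
    of the difference sequence. This drives the induction in [newton_bound]. *)
Lemma newton_remS r f i j :
  f (i + j)%N - newton r.+1 f i j = \sum_(t < j) (fd f (i + t)%N - newton r (fd f) i t).
Proof.
elim: j => [|j IH]; first by rewrite addn0 newton_rem0 subrr big_ord0.
rewrite big_ord_recr/= -IH addnS /fd -/(fd f).
suff -> : newton r.+1 f i j.+1 = newton r.+1 f i j + newton r (fd f) i j by ring.
have key (s : 'I_r) : 'C(j.+1, s.+1)%:R * fds s.+1 f i =
    'C(j, s.+1)%:R * fds s.+1 f i + 'C(j, s)%:R * fds s (fd f) i.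
  by rewrite binS natrD fdsS; ring.
rewrite /newton big_ord_recl [X in _ = X + _]big_ord_recl !bin0 -addrA; congr (_ + _).
by rewrite -big_split; apply: eq_bigr => s _; rewrite lift0; exact: key.
Qed.

Lemma sqr_sum_le n (x : 'I_n -> R) : (\sum_i x i) ^+ 2 <= n%:R * \sum_i x i ^+ 2.
Proof.
rewrite expr2 big_distrlr/=.
apply: (@le_trans _ _ (\sum_(i < n) \sum_(j < n) (x i ^+ 2 / 2 + x j ^+ 2 / 2))).
  apply: ler_sum => i _; apply: ler_sum => j _.
  by rewrite -subr_ge0 (_ : _ - _ = (x i - x j) ^+ 2 / 2); [rewrite divr_ge0 ?sqr_ge0|field].
rewrite (eq_bigr (fun i : 'I_n => n%:R * (x i ^+ 2 / 2) + (\sum_j x j ^+ 2) / 2)); last first.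
  by move=> i _; rewrite big_split/= sumr_const card_ord mulr_natl mulr_suml.
rewrite big_split/= sumr_const card_ord -mulr_sumr -mulr_suml -[X in _ + X]mulr_natl.
by rewrite le_eqVlt; apply/orP; left; apply/eqP; field.
Qed.

(** All columns are treated together, because only the l^2 norm of a row of differences is
    controlled; each order costs a factor j^2 by Cauchy-Schwarz. *)
Lemma newton_bound n r i j (F : 'I_n -> nat -> R) (B : R) :
  (forall t, (t <= j)%N -> \sum_l fds r (F l) (i + t)%N ^+ 2 <= B) ->
  \sum_l (F l (i + j)%N - newton r (F l) i j) ^+ 2 <= j%:R ^+ (2 * r) * B.
Proof.
elim: r F j => [|r IH] F j H.
  rewrite muln0 expr0 mul1r; apply: le_trans (H j (leqnn j)).
  by apply: ler_sum => l _; rewrite /newton big_ord0 subr0.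
under eq_bigr do rewrite newton_remS.
apply: (@le_trans _ _ (\sum_l j%:R * \sum_(t < j) (fd (F l) (i + t)%N - newton r (fd (F l)) i t) ^+ 2)).
  by apply: ler_sum => l _; exact: sqr_sum_le.
rewrite -mulr_sumr exchange_big/= mulnS exprD expr2 -!mulrA ler_wpM2l//.
have B0 : 0 <= B by apply: le_trans (H 0%N isT); apply: sumr_ge0 => l _; exact: sqr_ge0.
apply: (@le_trans _ _ (\sum_(t < j) j%:R ^+ (2 * r) * B)); last first.
  by rewrite sumr_const card_ord mulr_natl.
apply: ler_sum => t _; apply: (@le_trans _ _ (t%:R ^+ (2 * r) * B)).
  by apply: IH => u ut; under eq_bigr do rewrite -fdsS; apply: H; exact: (leq_trans ut (ltnW (ltn_ord t))).
by rewrite ler_wpM2r// lerXn2r ?nnegrE// ler_nat ltnW.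
Qed.

Variable a : R.
Hypothesis a0 : 0 < a.

Definition fdK s : R := \prod_(j < s) `|a - j.+1%:R|.

Lemma fdK_ge0 s : 0 <= fdK s. Proof. exact: prodr_ge0. Qed.

(** Differences of w remain products because w_(p+1)/w_p = (a + p)/(p + 1). Each order gains a
    factor of size 1/p: this is the smoothness of the rows. *)
Lemma fds_wcE s p : fds s (wc a) p = wc a p * \prod_(j < s) ((a - j.+1%:R) / (p + j).+1%:R).
Proof.
elim: s p => [|s IH] p; first by rewrite big_ord0 mulr1.
rewrite /fds iterS -/(fds s (wc a)) {1}/fd !IH wcS big_ord_recr/=.
have -> : \prod_(j < s) ((a - j.+1%:R) / (p.+1 + j).+1%:R) =
   \prod_(j < s) ((a - j.+1%:R) / (p + j).+1%:R) * (p.+1%:R / (p + s).+1%:R).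
  elim: (s) => [|k IHk]; first by rewrite !big_ord0 addn0 divff ?mul1r.
  have p0 := ler0n R p; have k0 := ler0n R k.
  by rewrite !big_ord_recr/= IHk addSn addnS; field; rewrite !gt_eqF//; lra.
have -> : (p + s).+1%:R = p%:R + s%:R + 1 :> R by rewrite -natr1 natrD.
rewrite -!natr1; field.
have p0 := ler0n R p; have s0 := ler0n R s.
by rewrite !gt_eqF//; lra.
Qed.

Lemma fds_wc s p i : (i <= p)%N -> `|fds s (wc a) p| <= fdK s / i.+1%:R ^+ s * wc a p.
Proof.
move=> ip; rewrite fds_wcE normrM (gtr0_norm (wc_gt0 a0 p)) mulrC ler_wpM2r//; first exact/ltW/wc_gt0.
have -> : fdK s / i.+1%:R ^+ s = \prod_(j < s) (`|a - j.+1%:R| / i.+1%:R).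
  by rewrite big_split/= prodr_const card_ord exprVn.
rewrite normr_prod; apply: ler_prod => j _; rewrite normr_ge0 normrM ler_wpM2l// ger0_norm ?invr_ge0//.
by rewrite lef_pV2 ?posrE// ler_nat ltnS (leq_trans ip)// leq_addr.
Qed.

End differences.

(** * Grid codes and their linear images *)

Section quantizing_smooth.
Context {R : realType}.

(** Each coordinate is rounded down to a grid of mesh 1/M on [-M, M]; values outside are coded by 0,
    which costs y^2 <= y^4/M^2. *)
Lemma ach_grid d (Omega : measurableType d) (P : probability Omega R) m
    (Y : 'I_m -> Omega -> R) (B : R) (M : nat) :
  mvec Y -> (0 < M)%N -> (forall k, \int[P]_w (Y k w ^+ 4)%:E <= B%:E)%E ->
  ach P Y (m%:R * ln (2 * M ^ 2).+1%:R) (m%:R * ((1 + B) / M%:R ^+ 2)).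
Proof.
move=> mY M0 YB; have MR : (0 : R) < M%:R by rewrite ltr0n.
have MM : (M%:R : R) != 0 by rewrite gt_eqF.
pose grid (j : 'I_(2 * M ^ 2).+1) : R := j%:R / M%:R - M%:R.
have gridP (y : R) : exists j, (y - grid j) ^+ 2 <= (1 + y ^+ 4) / M%:R ^+ 2.
  have y4 : 0 <= y ^+ 4 by rewrite exprn_even_ge0.
  have [yM|yM] := leP `|y| M%:R.
    have y0 : 0 <= M%:R * (y + M%:R) by move: yM; rewrite ler_norml => /andP[h _]; rewrite mulr_ge0//; lra.
    have /andP[t1 t2] := truncn_itv y0.
    have jb : (Num.truncn (M%:R * (y + M%:R)) < (2 * M ^ 2).+1)%N.
      rewrite ltnS -(ler_nat R); apply: (le_trans t1); rewrite natrM natrX.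
      rewrite [M%:R ^+ 2]expr2 mulrCA ler_pM2l//; move: yM; rewrite ler_norml => /andP[_ h]; lra.
    exists (Ordinal jb); rewrite /grid /=; move: t1 t2; set j := Num.truncn _ => t1 t2.
    have -> : y - (j%:R / M%:R - M%:R) = (M%:R * (y + M%:R) - j%:R) / M%:R by field.
    rewrite expr_div_n ler_pM2r ?invr_gt0 ?exprn_gt0//.
    apply: (@le_trans _ _ 1); last by rewrite lerDl.
    rewrite expr_le1// ?subr_ge0//; move: t2; rewrite -natr1; lra.
  (* The index M^2 is the grid point 0. *)
  have jb : (M ^ 2 < (2 * M ^ 2).+1)%N by rewrite ltnS leq_pmull.
  exists (Ordinal jb); rewrite /grid /= natrX expr2 mulfK// subrr subr0.
  rewrite ler_pdivlMr ?exprn_gt0//; apply: (@le_trans _ _ (y ^+ 2 * y ^+ 2)); last by rewrite -exprD; lra.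
  rewrite ler_wpM2l ?sqr_ge0// -(real_normK (num_real y)) lerXn2r ?nnegrE// ltW//.
pose gf (f : {ffun 'I_m -> 'I_(2 * M ^ 2).+1}) (k : 'I_m) : R := grid (f k).
have [s sE] : exists s, s = map gf (enum {ffun 'I_m -> 'I_(2 * M ^ 2).+1}) by exists (map gf (enum {ffun 'I_m -> 'I_(2 * M ^ 2).+1})).
exists s.
  by rewrite sE size_map -cardE card_ffun !card_ord natrX expRM_natl lnK ?posrE ?ltr0n.
have m4 k : measurable_fun setT (fun w => (Y k w ^+ 4)%:E).
  by apply/measurable_EFinP; apply: measurable_funX; exact: mY.
have p4 (y : R) : 0 <= y ^+ 4 by rewrite exprn_even_ge0.
have n1 (w : Omega) : setT w -> (0 <= (1 : R)%:E)%E by rewrite lee_fin.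
have n5 k (w : Omega) : (0 <= (1 : R)%:E + (Y k w ^+ 4)%:E)%E by rewrite -EFinD lee_fin addr_ge0.
have n4 k (w : Omega) : setT w -> (0 <= (Y k w ^+ 4)%:E)%E by rewrite lee_fin.
have mh k : measurable_fun setT (fun w => (M%:R ^- 2)%:E * ((1 : R)%:E + (Y k w ^+ 4)%:E))%E.
  by apply: measurable_funeM; apply: emeasurable_funD.
have nh k (w : Omega) : setT w -> (0 <= (M%:R ^- 2)%:E * ((1 : R)%:E + (Y k w ^+ 4)%:E))%E.
  by move=> _; apply: mule_ge0 => //; rewrite lee_fin invr_ge0 exprn_ge0.
apply: (@le_trans _ _ (\int[P]_w \sum_k ((M%:R ^- 2)%:E * ((1 : R)%:E + (Y k w ^+ 4)%:E)))%E); last first.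
  rewrite ge0_integral_sum//.
  rewrite (_ : m%:R * _ = \sum_(k < m) (1 + B) / M%:R ^+ 2); last by rewrite sumr_const card_ord mulr_natl.
  rewrite -sumEFin.
  apply: lee_sum => k _; rewrite ge0_integralZl ?lee_fin ?invr_ge0 ?exprn_ge0//; last exact: emeasurable_funD.
  rewrite (ge0_integralD P measurableT n1 _ (n4 k) (m4 k))// integral_prob_cst.
  rewrite mulrC EFinM lee_wpmul2l ?lee_fin ?invr_ge0 ?exprn_ge0// EFinD leeD2l//.
apply: ge0_le_integral => //.
- by move=> w _; apply: mind_ge0 => b; rewrite lee_fin dist2_ge0.
- exact: measurable_mdist.
- by apply: emeasurable_sum => k; exact: mh.
move=> w _.
have [f Hf] : exists f : 'I_m -> 'I_(2 * M ^ 2).+1, forall k, (Y k w - grid (f k)) ^+ 2 <= (1 + Y k w ^+ 4) / M%:R ^+ 2.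
  by have [f Hf] := choice (fun k => gridP (Y k w)); exists f.
pose ff := [ffun k => f k].
have ffs : (index ff (enum {ffun 'I_m -> 'I_(2 * M ^ 2).+1}) < size (enum {ffun 'I_m -> 'I_(2 * M ^ 2).+1}))%N.
  by rewrite index_mem mem_enum.
apply: (le_trans (@mind_le _ _ _ _ (index ff (enum {ffun 'I_m -> 'I_(2 * M ^ 2).+1})) (fun=> 0) _)).
  by rewrite sE size_map.
rewrite sE (nth_map ff)// nth_index ?mem_enum//.
rewrite /dist2 -sumEFin lee_sum// => k _; rewrite lee_fin /rv /gf ffunE mulrC; exact: Hf.
Qed.

(** The squared Hilbert-Schmidt norm of [c] is at most m, and it bounds the Lipschitz constant. *)
Lemma ach_matrix d (Omega : measurableType d) (P : probability Omega R) N m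
    (Y : 'I_m -> Omega -> R) (c : 'I_N -> 'I_m -> R) L D :
  mvec Y -> (forall i k, c i k ^+ 2 <= N%:R^-1) ->
  ach P Y L D -> ach P (lmap c Y) L (m%:R * D).
Proof.
move=> mY Hc; apply: (ach_lip (F := fun x i => \sum_k c i k * x k)) => //.
  by apply: measurable_lmap.
move=> x y; rewrite /dist2.
apply: (@le_trans _ _ (\sum_(i < N) m%:R * \sum_k N%:R^-1 * (x k - y k) ^+ 2)).
  apply: ler_sum => i _; rewrite -sumrB; apply: (le_trans (sqr_sum_le _)); rewrite ler_wpM2l//.
  by apply: ler_sum => k _; rewrite -mulrBr exprMn ler_wpM2r ?sqr_ge0.
rewrite sumr_const card_ord -[leLHS]mulr_natl mulrCA ler_wpM2l// -mulr_sumr mulrA.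
have [->|N0] := eqVneq N 0%N; first by rewrite !mul0r sumr_ge0// => k _; exact: sqr_ge0.
by rewrite divff ?mul1r// pnatr_eq0.
Qed.

Lemma lmap_sqr d (Omega : measurableType d) (P : probability Omega R) M N
    (xi : 'I_N -> Omega -> R) (A : 'I_M -> 'I_N -> R) i : std_gauss P xi ->
  (\int[P]_w (lmap A xi i w ^+ 2)%:E = (\sum_l A i l ^+ 2)%:E)%E.
Proof. by move=> H; apply: (is_gauss_sqr _ (std_gauss_lin (A i) H)); apply: sumr_ge0 => l _; exact: sqr_ge0. Qed.

Lemma lmap_4 d (Omega : measurableType d) (P : probability Omega R) M N
    (xi : 'I_N -> Omega -> R) (A : 'I_M -> 'I_N -> R) i : std_gauss P xi ->
  (\int[P]_w (lmap A xi i w ^+ 4)%:E <= (128 * (\sum_l A i l ^+ 2) ^+ 2)%:E)%E.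
Proof. by move=> H; apply: (is_gauss_4 _ (std_gauss_lin (A i) H)); apply: sumr_ge0 => l _; exact: sqr_ge0. Qed.

Lemma sum_divn_modn (A r : nat) (G : nat -> nat -> R) : (0 < r)%N ->
  \sum_(k < A * r) G (k %/ r)%N (k %% r)%N = \sum_(b < A) \sum_(s < r) G b s.
Proof.
move=> r0; rewrite -(big_mkord xpredT (fun k => G (k %/ r)%N (k %% r)%N)).
elim: A => [|A IH]; first by rewrite mul0n big_nil big_ord0.
rewrite mulSn sum_nat_shift IH big_ord_recr/=; congr (_ + _).
rewrite big_mkord; apply: eq_bigr => s _; rewrite divnMDl// divn_small// addn0.
by rewrite modnMDl modn_small.
Qed.

Lemma count_below (n : nat) (x : R) : 0 <= x -> \sum_(i < n) (i.+1%:R < x)%R%:R <= x.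
Proof.
move=> x0; elim: n => [|n IH]; first by rewrite big_ord0.
have [nx|nx] := ltP n.+1%:R x; last by rewrite big_ord_recr/= ltNge nx addr0.
apply: le_trans (ltW nx); rewrite -[X in _ <= X%:R](card_ord n.+1) -sumr_const.
by apply: ler_sum => i _; case: (_ < x).
Qed.

End quantizing_smooth.

(** * Differences of the wrapped rows *)

Section circulant_rows.
Context {R : realType}.
Variables (a : R) (n : nat) (q : R).
Hypotheses (a0 : 0 < a) (q01 : 0 < q < 1).
Notation N := n.+1.

Let q1 : `|q| < 1. Proof. by have /andP[h ?] := q01; rewrite gtr0_norm. Qed.

Lemma fds_polyb s (c : nat -> R) : polyb c -> polyb (fds s c).
Proof.
move=> H; elim: s => [//|s IH]; rewrite /fds iterS -/(fds s c).
rewrite (_ : fd (fds s c) = fun i => fds s c (1 + i)%N + (-1) * fds s c i); last first.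
  by apply/funext => i; rewrite /fd mulN1r.
apply: polybD; first exact: polyb_shift.
by apply: polyb_mul => //; apply: (polyb_bounded (C := 1)) => m; rewrite normrN1.
Qed.

Lemma fds_Hm s (l : 'I_N) i :
  fds s (fun i => Hm a q i l) i =
  pser (fun t => ((0 < t) && ((t + l) %% N == 0))%N%:R * fds s (wc a) (i + t)%N) q.
Proof.
have pb j k : polyb (fun t => ((0 < t) && ((t + l) %% N == 0))%N%:R * fds j (wc a) (k + t)%N).
  apply: polyb_mul; first by apply: (polyb_bounded (C := 1)) => m; case: (_ && _); rewrite ?normr1 ?normr0.
  by apply: polyb_shift; apply: fds_polyb; exact: wc_polyb.
elim: s i => [//|s IH] i; rewrite {1}/fds iterS -/(fds s _) {1}/fd !IH.
rewrite -[X in X - _]mul1r -mulN1r -pser_lin//; congr pser; apply/funext => t.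
by rewrite [fds s.+1 _]iterS -/(fds s _) /fd addSn; ring.
Qed.

(** [Hm] is a series in w_(i+t) with nonnegative coefficients, so differences are taken term by
    term; [fds_wc] gives the same factor for every t because i + t >= i. *)
Lemma fds_Hm_le s (l : 'I_N) i :
  `|fds s (fun i => Hm a q i l) i| <= fdK a s / i.+1%:R ^+ s * Hm a q i l.
Proof.
have pb (c : nat -> R) : polyb c -> polyb (fun t => ((0 < t) && ((t + l) %% N == 0))%N%:R * c t).
  by move=> H; apply: polyb_mul => //; apply: (polyb_bounded (C := 1)) => m; case: (_ && _); rewrite ?normr1 ?normr0.
have q01' : 0 <= q < 1 by have /andP[/ltW -> ->] := q01.
have pw : polyb (fun t => wc a (i + t)%N) by apply: polyb_shift; exact: wc_polyb.
have pf : polyb (fun t => fds s (wc a) (i + t)%N) by apply: polyb_shift; apply: fds_polyb; exact: wc_polyb.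
have z0 : polyb (fun=> 0 : R) by apply: (polyb_bounded (C := 0)) => m; rewrite normr0.
rewrite fds_Hm ler_norml; set K := _ / _.
have E x : x * Hm a q i l = pser (fun t => x * (((0 < t) && ((t + l) %% N == 0))%N%:R * wc a (i + t)%N) + 0 * 0) q.
  by rewrite pser_lin ?mul0r ?addr0//; exact: pb.
have pE x : polyb (fun t => x * (((0 < t) && ((t + l) %% N == 0))%N%:R * wc a (i + t)%N) + 0 * 0).
  apply: polybD; last by rewrite mul0r.
  by apply: polyb_mul; [exact: (polyb_bounded (C := `|x|))|exact: pb].
rewrite -mulNr !E; apply/andP; split; apply: pser_le => //; do ?exact: pb; move=> t; rewrite mul0r addr0.
  case: (_ && _); last by rewrite !mul0r mulr0.
  have := fds_wc a0 s (leq_addr t i); rewrite ler_norml => /andP[h _].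
  by rewrite !mul1r mulNr.
case: (_ && _); last by rewrite !mul0r mulr0.
have := fds_wc a0 s (leq_addr t i); rewrite ler_norml => /andP[_ h].
by rewrite !mul1r.
Qed.

(** The entries are nonnegative and q^i Hm is dominated by the circulant matrix, whose rows have the
    norm given by [circ_row]. No estimate of the wrapped sums themselves is needed. *)
Lemma fds_Hm_row s (i : 'I_N) (Q : R) : q ^- i <= Q ->
  \sum_(l < N) fds s (fun i => Hm a q i l) i ^+ 2 <=
  (fdK a s / i.+1%:R ^+ s) ^+ 2 * (Q ^+ 2 * ((\sum_(k < N) lam a n q k) / N%:R)).
Proof.
move=> qQ; have qi : 0 < q ^+ i by rewrite exprn_gt0//; have /andP[] := q01.
rewrite -(circ_row a0 q01 i) !mulr_sumr; apply: ler_sum => l _.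
rewrite -[leLHS]real_normK ?num_real// -!exprMn lerXn2r ?nnegrE//.
  by rewrite !mulr_ge0 ?divr_ge0 ?exprn_ge0 ?fdK_ge0 ?kp_ge0// (le_trans _ qQ)// invr_ge0 ltW.
apply: (le_trans (fds_Hm_le s l i)); rewrite ler_wpM2l ?divr_ge0 ?exprn_ge0 ?fdK_ge0//.
have H0 := Hm_ge0 a0 q01 i l.
apply: (@le_trans _ _ (q ^- i * Cm a q i l)); last by rewrite ler_wpM2r ?kp_ge0.
by rewrite mulrC ler_pdivlMr// mulrC Hm_le_circ.
Qed.

End circulant_rows.

Lemma bin_le_expn j s : ('C(j, s) <= j ^ s)%N.
Proof.
elim: s => [|s IH]; first by rewrite bin0.
apply: (@leq_trans (s.+1 * 'C(j, s.+1))); first by rewrite leq_pmull.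
by rewrite mul_bin_left expnS leq_mul// leq_subr.
Qed.

(** * Coding smooth rows by interpolation on blocks *)

Section smooth_rows.
Context {R : realType} {d} {Omega : measurableType d} (P : probability Omega R).
Variables (n p : nat) (U : nat -> 'I_n.+1 -> R) (kappa l : R) (xi : 'I_n.+1 -> Omega -> R).
Notation N := n.+1.
Notation r := (2 * p)%N.
Hypotheses (Hxi : std_gauss P xi) (p0 : (0 < p)%N) (l2 : 2 <= l) (k0 : 0 <= kappa).
Hypothesis HU : forall s (i : 'I_N), (s <= r)%N ->
  \sum_j fds s (U ^~ j) i ^+ 2 <= kappa / N%:R / i.+1%:R ^+ (2 * s).

Let l0 : 0 < l. Proof. exact: lt_le_trans l2. Qed.
Let l1 : 1 <= l. Proof. by apply: le_trans l2; lra. Qed.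
Let T := l ^+ (4 * p).
Let T0 : 0 < T. Proof. exact: exprn_gt0. Qed.
Let T1 : 1 <= T. Proof. exact: exprn_ege1. Qed.

(* indices below N/T are not coded; the others are grouped in blocks of ratio about exp(1/l) *)
Let coded (i : 'I_N) : bool := N%:R / T <= i.+1%:R.
Let block (i : 'I_N) : nat := Num.truncn (l * ln (i.+1%:R * T / N%:R)).
Let A : nat := (Num.truncn (l * ln T)).+1.
Let anchor (b : nat) : 'I_N :=
  if [pick i | coded i && (block i == b)] is Some i0
  then [arg min_(i < i0 | coded i && (block i == b)) (i : nat)] else ord0.

Let coded_ge1 i : coded i -> 1 <= i.+1%:R * T / N%:R.
Proof. by rewrite /coded ler_pdivrMr// ler_pdivlMr// mul1r. Qed.

Let block_lt i : coded i -> (block i < A)%N.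
Proof.
move=> ci; rewrite ltnS; apply: le_truncn; rewrite ler_pM2l// ler_ln ?posrE//.
  by rewrite ler_pdivrMr// mulrC ler_pM2l// ler_nat.
exact: lt_le_trans (coded_ge1 ci).
Qed.

Let anchorP i : coded i -> [/\ coded (anchor (block i)), block (anchor (block i)) = block i & (anchor (block i) <= i)%N].
Proof.
move=> ci; rewrite /anchor; case: pickP => [i0 Hi0|/(_ i)]; last by rewrite ci eqxx.
case: arg_minnP => // j /andP[cj /eqP bj] /(_ i); rewrite ci eqxx => /(_ isT) ji.
by split.
Qed.

(** Within a block the values of l ln(i + 1) differ by at most 1, so the ratio of two shifted
    indices is at most exp(1/l) <= 1 + 2/l. *)
Let block_close i : coded i -> (i - anchor (block i))%:R <= 2 / l * (anchor (block i)).+1%:R.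
Proof.
move=> ci; have [ca ba ai] := anchorP ci; move: ca ba ai; set j := anchor _ => ca ba ai.
have x1 := coded_ge1 ci; have y1 := coded_ge1 ca.
pose x := i.+1%:R * T / N%:R; pose y := j.+1%:R * T / N%:R.
have x0 : 0 < x by exact: lt_le_trans x1.
have y0 : 0 < y by exact: lt_le_trans y1.
have lx0 : 0 <= l * ln x by rewrite mulr_ge0 ?ln_ge0// ltW.
have ly0 : 0 <= l * ln y by rewrite mulr_ge0 ?ln_ge0// ltW.
have /andP[_ tx] := truncn_itv lx0; have /andP[ty _] := truncn_itv ly0.
have lxy : l * (ln x - ln y) <= 1.
  move: tx ty; rewrite -[Num.truncn (l * ln x)]/(block i) -[Num.truncn (l * ln y)]/(block j) ba -natr1; lra.
have lxy' : ln x - ln y <= l^-1 by rewrite -div1r ler_pdivlMr// mulrC.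
have xy : x <= y * (1 + 2 / l).
  have -> : x = y * expR (ln x - ln y) by rewrite expRD expRN !lnK ?posrE// mulrCA mulfV ?mulr1// gt_eqF.
  rewrite ler_pM2l//; apply: (@le_trans _ _ (expR l^-1)); first by rewrite ler_expR.
  have h2 : l^-1 <= 2^-1 by rewrite lef_pV2 ?posrE.
  have h := expR_ge1Dx (- l^-1); rewrite expRN in h.
  have h0 : 0 < l^-1 by rewrite invr_gt0.
  have e0 := expR_gt0 l^-1.
  have : (1 - l^-1) * expR l^-1 <= 1.
    by move: h; rewrite -(ler_pM2r e0) mulVf// gt_eqF.
  set u := l^-1 in h2 h0 e0 *; set e := expR u in e0 *; nra.
have : i.+1%:R <= j.+1%:R * (1 + 2 / l).
  have NT : 0 < T / N%:R by rewrite divr_gt0.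
  by rewrite -(ler_pM2r NT) mulrAC !mulrA.
by rewrite natrB// -!natr1; lra.
Qed.

Let m := (A * r)%N.
(** The data to be coded: k = b r + s stands for the difference of order s at the anchor of block b,
    normalised to variance at most [kappa]. [c] holds the Newton weights with the inverse
    normalisation and [Rm] the interpolation error, so that U = c Zm + Rm. *)
Let Zm (k : 'I_m) (j : 'I_N) : R := let i0 := anchor (k %/ r) in
  i0.+1%:R ^+ (k %% r) * Num.sqrt N%:R * fds (k %% r) (U ^~ j) i0.
Let c (i : 'I_N) (k : 'I_m) : R := let i0 := anchor (k %/ r) in
  if coded i && (k %/ r == block i)%N then 'C(i - i0, k %% r)%:R / i0.+1%:R ^+ (k %% r) / Num.sqrt N%:R else 0.
Let Rm (i : 'I_N) (j : 'I_N) : R := U i j - \sum_k c i k * Zm k j.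

Let sN : Num.sqrt (N%:R : R) != 0. Proof. by rewrite gt_eqF// sqrtr_gt0. Qed.
Let sN2 : Num.sqrt (N%:R : R) ^+ 2 = N%:R. Proof. by rewrite sqr_sqrtr. Qed.

Let r0 : (0 < r)%N. Proof. by rewrite muln_gt0. Qed.

Let Zm_row k : \sum_j Zm k j ^+ 2 <= kappa.
Proof.
rewrite /Zm; set i0 := anchor _; set s := (k %% r)%N.
have sr : (s <= r)%N by rewrite ltnW// ltn_pmod.
rewrite (eq_bigr (fun j => (i0.+1%:R ^+ (2 * s) * N%:R) * fds s (U ^~ j) i0 ^+ 2)); last first.
  by move=> j _; rewrite !exprMn sN2 -exprM mulnC.
rewrite -mulr_sumr; apply: (le_trans (ler_wpM2l _ (HU _ sr))); first by rewrite mulr_ge0 ?exprn_ge0.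
rewrite le_eqVlt; apply/orP; left; apply/eqP; field.
by rewrite expf_neq0//= ?pnatr_eq0.
Qed.

Let c_sqr i k : c i k ^+ 2 <= N%:R^-1.
Proof.
rewrite /c; set i0 := anchor _; case: ifPn => [/andP[ci /eqP kb]|_]; last by rewrite expr0n invr_ge0.
rewrite expr_div_n sN2 ler_pdivrMr// mulVf ?pnatr_eq0// expr_le1// ?divr_ge0 ?exprn_ge0//.
rewrite ler_pdivrMr ?exprn_gt0// mul1r.
have close := block_close ci; rewrite -kb -/i0 in close.
have ij : ((i - i0)%N <= i0.+1)%N.
  rewrite -(ler_nat R); apply: (le_trans close); rewrite ler_piMl// ler_pdivrMr// mul1r//.
apply: (@le_trans _ _ ((i - i0)%:R ^+ (k %% r))); first by rewrite -natrX ler_nat bin_le_expn.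
by rewrite lerXn2r ?nnegrE// ler_nat.
Qed.

Let newtonE i j : coded i -> \sum_k c i k * Zm k j = newton r (U ^~ j) (anchor (block i)) (i - anchor (block i)).
Proof.
move=> ci; pose G b s := if b == block i then 'C(i - anchor (block i), s)%:R * fds s (U ^~ j) (anchor (block i)) else 0.
transitivity (\sum_(k < A * r) G (k %/ r)%N (k %% r)%N).
  apply: eq_bigr => k _; rewrite /c /Zm /G ci /=; case: eqP => [->|_]; last by rewrite mul0r.
  have : (anchor (block i)).+1%:R ^+ (k %% r) != 0 :> R by rewrite expf_neq0// pnatr_eq0.
  by move: (_ ^+ (k %% r)) (sN) => x sN' x0; field; rewrite ?x0 ?sN'.
rewrite sum_divn_modn// (bigD1 (Ordinal (block_lt ci)))//= [X in _ + X]big1 ?addr0.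
  by apply: eq_bigr => s _; rewrite /G eqxx.
by move=> b; rewrite -val_eqE/= => /negbTE bb; rewrite big1// => s _; rewrite /G bb.
Qed.

(** Interpolation of order r = 2p turns the relative block length 2/l into (2/l)^(4p) = 2^(4p)/T.
    The uncoded rows are kept in full, but there are at most N/T of them. *)
Let Rm_row (i : 'I_N) : \sum_j Rm i j ^+ 2 <= kappa / N%:R * (2 ^+ (4 * p) / T) + (i.+1%:R < N%:R / T)%R%:R * (kappa / N%:R).
Proof.
have kN : 0 <= kappa / N%:R by rewrite divr_ge0.
have [ci|nci] := boolP (coded i); last first.
  rewrite /coded -ltNge in nci; rewrite nci mul1r.
  apply: (@le_trans _ _ (kappa / N%:R)); last by rewrite lerDr mulr_ge0// divr_ge0 ?exprn_ge0// ltW.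
  have := @HU 0%N i isT; rewrite muln0 expr0 divr1; apply: le_trans.
  rewrite le_eqVlt; apply/orP; left; apply/eqP; apply: eq_bigr => j _; rewrite /Rm big1 ?subr0// => k _.
  by rewrite /c /coded leNgt nci mul0r.
apply: (@le_trans _ _ (kappa / N%:R * (2 ^+ (4 * p) / T))); last by rewrite lerDl mulr_ge0.
have close := block_close ci; have [_ _ ai] := anchorP ci.
move: close ai (fun j => @newtonE i j ci); set i0 := anchor _ => close ai nE.
pose B := kappa / N%:R / i0.+1%:R ^+ (2 * r).
apply: (@le_trans _ _ ((i - i0)%:R ^+ (2 * r) * B)).
  under eq_bigr do rewrite /Rm nE.
  have iE : (i : nat) = (i0 + (i - i0))%N by rewrite subnKC.
  under eq_bigr => j _ do rewrite {1}iE.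
  apply: newton_bound => t ti.
  have tN : (i0 + t < N)%N by apply: (leq_ltn_trans _ (ltn_ord i)); rewrite iE leq_add2l.
  apply: (le_trans (@HU r (Ordinal tN) (leqnn _))); rewrite /B ler_wpM2l// lef_pV2 ?posrE ?exprn_gt0//.
  by rewrite lerXn2r ?nnegrE// ler_nat /= ltnS leq_addr.
rewrite /B (_ : _ * _ = kappa / N%:R * ((i - i0)%:R ^+ (2 * r) / i0.+1%:R ^+ (2 * r))); last by ring.
rewrite ler_wpM2l// ler_pdivrMr ?exprn_gt0//.
apply: (@le_trans _ _ ((2 / l * i0.+1%:R) ^+ (2 * r))).
  by rewrite lerXn2r ?nnegrE// mulr_ge0// divr_ge0// ltW.
by rewrite exprMn expr_div_n /T mulnA.
Qed.

Let Rm_total : \sum_i \sum_j Rm i j ^+ 2 <= kappa * (2 ^+ (4 * p) + 1) / T.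
Proof.
apply: (le_trans (ler_sum _ (fun i _ => Rm_row i))).
rewrite big_split/= sumr_const card_ord -mulr_suml.
have := @count_below R N (N%:R / T); rewrite divr_ge0 ?(ltW T0)// => /(_ isT) h.
have kN : 0 <= kappa / N%:R by rewrite divr_ge0.
have := ler_wpM2r kN h => h'.
apply: (le_trans (lerD (lexx _) h')); rewrite le_eqVlt; apply/orP; left; apply/eqP.
by rewrite -mulr_natl; field; rewrite gt_eqF//= pnatr_eq0.
Qed.

Let lnl : ln l <= l.
Proof. by apply: ltW; exact: ln_sublinear. Qed.

Let m_le : m%:R <= (2 * p)%:R * (4 * p + 1)%:R * l ^+ 2.
Proof.
rewrite /m natrM mulrC -mulrA ler_wpM2l//.
have lT : 0 <= l * ln T by rewrite mulr_ge0 ?ln_ge0// ltW.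
have /andP[h _] := truncn_itv lT.
rewrite /A -natr1 natrD mulrDl mul1r; apply: lerD; last by rewrite exprn_ege1.
have lnT : ln T = (4 * p)%:R * ln l by rewrite /T lnXn// mulr_natl.
by apply: (le_trans h); rewrite lnT mulrCA ler_wpM2l// [l ^+ 2]expr2 ler_pM2l.
Qed.

(** About l ln T blocks with 2p data each give O(l^2) Gaussian numbers, as ln T = 4p ln l <= 4p l,
    and each number is rounded at a cost of O(l) nats. For the price l^3 the error is l^(-4p), with
    p at choice. *)
Lemma ach_smooth : ach P (lmap (fun i j : 'I_N => U i j) xi)
  ((2 * p)%:R * (4 * p + 1)%:R * (8 * p + 9)%:R * l ^+ 3)
  ((2 * ((2 * p)%:R * (4 * p + 1)%:R) ^+ 2 * (1 + 128 * kappa ^+ 2) + 2 * kappa * (2 ^+ (4 * p) + 1)) / l ^+ (4 * p)).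
Proof.
rewrite -/T.
pose M := (Num.truncn T).+1.
have /andP[t1 t2] := truncn_itv (ltW T0); rewrite -/M in t2.
have TM : T <= M%:R by exact: ltW.
have MT : M%:R <= 2 * T by rewrite -[leLHS]natr1; have := T1; lra.
have mxi := Hxi.1.
have mZ : mvec (lmap Zm xi) by exact: measurable_lmap.
have hZ : ach P (lmap Zm xi) (m%:R * ln (2 * M ^ 2).+1%:R) (m%:R * ((1 + 128 * kappa ^+ 2) / M%:R ^+ 2)).
  apply: ach_grid => // k; apply: (le_trans (lmap_4 Zm k Hxi)); rewrite lee_fin ler_wpM2l//.
  by rewrite lerXn2r ?nnegrE ?Zm_row// sumr_ge0// => j _; exact: sqr_ge0.
have hc := ach_matrix mZ c_sqr hZ.
have hR : ach P (lmap Rm xi) 0 (kappa * (2 ^+ (4 * p) + 1) / T).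
  apply: ach0; first exact: measurable_lmap.
  rewrite (eq_bigr (fun i => (\sum_j Rm i j ^+ 2)%:E)); last by move=> i _; exact: lmap_sqr.
  by rewrite sumEFin lee_fin.
have mc : mvec (lmap c (lmap Zm xi)) by exact: measurable_lmap.
have mR : mvec (lmap Rm xi) by exact: measurable_lmap.
have := ach_add mc mR ltr01 hc hR.
have -> : (fun i w => lmap c (lmap Zm xi) i w + lmap Rm xi i w) = lmap (fun i j : 'I_N => U i j) xi.
  apply/funext => i; apply/funext => w; rewrite /lmap.
  under eq_bigr do rewrite mulr_sumr.
  rewrite exchange_big/= -big_split/=; apply: eq_bigr => j _.
  rewrite (eq_bigr (fun k => c i k * Zm k j * xi j w)); last by move=> k _; rewrite mulrA.
  by rewrite -mulr_suml -mulrDl /Rm addrCA subrr addr0.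
have mle := m_le; set c1 := (2 * p)%:R * (4 * p + 1)%:R in mle *.
have c10 : 0 <= c1 by rewrite mulr_ge0.
have m0 : (0 : R) <= m%:R by [].
apply: ach_weak.
  rewrite addr0.
  (* From M <= 2 T and T >= 1 one has 2 M^2 + 1 <= 9 T^2, and T^2 = l^(8p). *)
  have lnM : ln (2 * M ^ 2).+1%:R <= (8 * p + 9)%:R * l.
    apply: (@le_trans _ _ (ln (9 * T ^+ 2))).
      rewrite ler_ln ?posrE ?mulr_gt0 ?exprn_gt0// -natr1 natrM natrX.
      have T2 : 1 <= T ^+ 2 by exact: exprn_ege1.
      have : M%:R ^+ 2 <= (2 * T) ^+ 2 by rewrite lerXn2r ?nnegrE// mulr_ge0// ltW.
      by rewrite exprMn; lra.
    rewrite lnM ?posrE ?exprn_gt0// natrD mulrDl addrC lerD//.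
      have -> : T ^+ 2 = l ^+ (8 * p) by rewrite /T -exprM mulnAC.
      by rewrite lnXn// -[leLHS]mulr_natl ler_wpM2l.
    apply: (@le_trans _ _ 9); first by apply/ltW/ln_sublinear.
    by rewrite ler_peMr.
  apply: (le_trans (ler_pM m0 _ mle lnM)); first by rewrite ln_ge0// ler1n.
  by rewrite le_eqVlt; apply/orP; left; apply/eqP; ring.
have M0 : 0 < M%:R :> R by [].
have B0 : 0 <= 1 + 128 * kappa ^+ 2 by rewrite addr_ge0// mulr_ge0// exprn_ge0.
have -> : (1 + 1^-1 : R) = 2 by rewrite invr1.
rewrite [leRHS]mulrDl; apply: lerD; last first.
  by rewrite le_eqVlt; apply/orP; left; apply/eqP; field; rewrite gt_eqF.
have -> : (1 + 1) * (m%:R * (m%:R * ((1 + 128 * kappa ^+ 2) / M%:R ^+ 2))) = 2 * ((m%:R / M%:R) ^+ 2 * (1 + 128 * kappa ^+ 2)).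
  by field; rewrite gt_eqF.
have -> : 2 * c1 ^+ 2 * (1 + 128 * kappa ^+ 2) / T = 2 * (c1 ^+ 2 * T^-1 * (1 + 128 * kappa ^+ 2)) by ring.
rewrite ler_wpM2l//.
have mM : m%:R / M%:R <= c1 * l ^+ 2 / T.
  apply: ler_pM => //.
  by rewrite lef_pV2 ?posrE.
have lT : (l ^+ 2 / T) ^+ 2 <= T^-1.
  rewrite expr_div_n ler_pdivrMr ?exprn_gt0// [T ^+ 2]expr2 mulKf ?gt_eqF// -exprM /T ler_weXn2l//.
  by rewrite (leq_pmulr 4).
apply: (@le_trans _ _ ((c1 * l ^+ 2 / T) ^+ 2 * (1 + 128 * kappa ^+ 2))).
  rewrite ler_wpM2r// lerXn2r ?nnegrE ?divr_ge0// ?mulr_ge0 ?exprn_ge0// ltW//.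
apply: (@le_trans _ _ (c1 ^+ 2 * T^-1 * (1 + 128 * kappa ^+ 2))).
  by rewrite -mulrA exprMn -mulrA mulrA ler_wpM2r// ler_wpM2l ?exprn_ge0.
by [].
Qed.

End smooth_rows.

(** * Asymptotics for the triangular matrix *)

Section elementary_bounds.
Context {R : realType}.

Lemma sin_bounds (y : R) : 0 <= y <= pi / 2 -> y * cos y <= sin y <= y.
Proof.
move=> /andP[y0 yp]; have [->|yn] := eqVneq y 0; first by rewrite mul0r sin0 lexx.
have y0' : 0 < y by rewrite lt_neqAle eq_sym yn.
have [z] := @MVT R sin cos 0 y y0' (fun x _ => is_derive_sin x) (continuous_subspaceT (@continuous_sin R)).
rewrite in_itv/= => /andP[z0 zy]; rewrite sin0 !subr0 => ->.
have pp := pi_gt0 R; apply/andP; split; last first.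
  by rewrite -[leRHS]mul1r ler_wpM2r ?cos_le1.
rewrite mulrC ler_wpM2r// leNgt ltr_cos ?in_itv/=; last 2 first.
- by rewrite y0/=; lra.
- by rewrite (ltW z0)/=; lra.
by rewrite -leNgt ltW.
Qed.

Lemma one_sub_cos (x : R) : 1 - cos x = 2 * sin (x / 2) ^+ 2.
Proof.
rewrite {1}(_ : x = x / 2 + x / 2); last by field.
rewrite cosD -!expr2; have := cos2Dsin2 (x / 2); lra.
Qed.

Lemma sin_ge_half (y : R) : 0 <= y <= pi / 2 -> y / 2 <= sin y.
Proof.
move=> /andP[y0 yp]; have pp := pi_gt0 R.
have h : 0 <= y / 2 <= pi / 2 by lra.
have /andP[h1 _] := sin_bounds h.
have c0 : 0 <= cos y by apply: cos_ge0_pihalf; lra.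
have c2 : 0 <= cos (y / 2) by apply: cos_ge0_pihalf; lra.
have e1 : sin y = 2 * (sin (y / 2) * cos (y / 2)).
  by rewrite {1}(_ : y = y / 2 + y / 2) ?sinD; [ring|field].
have e2 := one_sub_cos y; have e3 := cos2Dsin2 (y / 2).
have e4 : 2^-1 <= cos (y / 2) ^+ 2 by lra.
rewrite e1; apply: (@le_trans _ _ (2 * (y / 2 * cos (y / 2) * cos (y / 2)))).
  have := ler_wpM2l y0 e4; rewrite expr2; lra.
by rewrite ler_wpM2l// ler_wpM2r.
Qed.

Lemma sin_ge_cube (y : R) : 0 <= y <= pi / 2 -> y * (1 - y ^+ 2 / 2) <= sin y.
Proof.
move=> hy; have /andP[y0 yp] := hy; have pp := pi_gt0 R.
have /andP[h1 _] := sin_bounds hy; apply: le_trans h1; rewrite ler_wpM2l//.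
have h : 0 <= y / 2 <= pi / 2 by lra.
have /andP[_ h3] := sin_bounds h; have e2 := one_sub_cos y.
have s0 : 0 <= sin (y / 2) by apply: le_trans (sin_ge_half h); lra.
have : sin (y / 2) ^+ 2 <= (y / 2) ^+ 2 by rewrite lerXn2r ?nnegrE//; lra.
by rewrite expr_div_n; lra.
Qed.

Lemma powRN_le (a x y : R) : 0 <= a -> 0 < x -> x <= y -> y `^ (- a) <= x `^ (- a).
Proof.
move=> a0 x0 xy; rewrite /powR !gt_eqF//; last exact: lt_le_trans xy.
by rewrite ler_expR !mulNr lerN2 ler_wpM2l// ler_ln// posrE//; exact: lt_le_trans xy.
Qed.

(* the graph of x^(1-b) lies above its tangent at y *)
Lemma powR_tangent (b x y : R) : 1 < b -> 0 < x -> 0 < y ->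
  y `^ (1 - b) + (1 - b) * y `^ (- b) * (x - y) <= x `^ (1 - b).
Proof.
move=> b1 x0 y0; have yb : y `^ (- b) = y `^ (1 - b) / y.
  by rewrite -{3}[y]powRr1 ?ltW// -powRN -powRD ?(gt_eqF y0) ?implybT//; congr (_ `^ _); ring.
have -> : x `^ (1 - b) = y `^ (1 - b) * (x / y) `^ (1 - b).
  by rewrite -powRM ?divr_ge0 ?ltW// mulrCA mulfV ?mulr1// gt_eqF.
rewrite yb (_ : _ + _ = y `^ (1 - b) * (1 + (1 - b) * (x / y - 1))); last by field; rewrite gt_eqF.
rewrite ler_wpM2l ?powR_ge0//; have xy : 0 < x / y by rewrite divr_gt0.
rewrite /powR gt_eqF//; apply: le_trans (expR_ge1Dx _); rewrite lerD2l.
rewrite -subr_ge0 -mulrBr mulr_le0//; first by lra.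
have h : -1 < x / y - 1 by lra.
by have := le_ln1Dx h; rewrite (_ : 1 + (x / y - 1) = x / y) ?subr_le0//; ring.
Qed.

(** Comparison with an integral, done by telescoping the tangent inequality instead of
    integrating. *)
Lemma sum_powR_le (b : R) (J K : nat) : 1 < b -> (0 < J)%N ->
  \sum_(J <= k < K) k.+1%:R `^ (- b) <= J%:R `^ (1 - b) / (b - 1).
Proof.
move=> b1 J0; have b10 : 0 < b - 1 by lra.
have [JK|KJ] := leqP J K; last by rewrite big_geq ?divr_ge0 ?powR_ge0 ?ltW// ltnW.
suff : \sum_(J <= k < K) k.+1%:R `^ (- b) <= (J%:R `^ (1 - b) - K%:R `^ (1 - b)) / (b - 1).
  by move/le_trans; apply; rewrite ler_pM2r ?invr_gt0// gerBl powR_ge0.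
elim: K JK => [|K IH]; first by rewrite leqn0 => /eqP JE; rewrite JE in J0.
rewrite leq_eqVlt => /orP[/eqP <-|]; first by rewrite big_geq// subrr mul0r.
rewrite ltnS => JK; rewrite big_nat_recr//=.
apply: (le_trans (lerD (IH JK) (lexx _))).
have K0 : (0 : R) < K%:R by rewrite ltr0n (leq_trans J0).
have := @powR_tangent b K%:R K.+1%:R b1 K0 (ltr0Sn _ _).
rewrite -[X in X - K.+1%:R]/(K%:R) -[in K%:R - _]natr1 opprD addrA subrr sub0r mulrN1 -mulNr opprB => h.
rewrite ler_pdivlMr// mulrDl mulfVK ?gt_eqF//.
by rewrite [_ * (b - 1)]mulrC; lra.
Qed.

Lemma sum_powR_ge (b : R) (J K : nat) : 1 < b -> (0 < J)%N -> (J <= K)%N ->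
  (J%:R `^ (1 - b) - K%:R `^ (1 - b)) / (b - 1) <= \sum_(J <= k < K) k%:R `^ (- b).
Proof.
move=> b1 J0; have b10 : 0 < b - 1 by lra.
elim: K => [|K IH]; first by rewrite leqn0 => /eqP JE; rewrite JE in J0.
rewrite leq_eqVlt => /orP[/eqP <-|]; first by rewrite big_geq// subrr mul0r.
rewrite ltnS => JK; rewrite big_nat_recr//=.
apply: le_trans (lerD (IH JK) (lexx _)).
have K0 : (0 : R) < K%:R by rewrite ltr0n (leq_trans J0).
have := @powR_tangent b K.+1%:R K%:R b1 (ltr0Sn _ _) K0.
rewrite (_ : K.+1%:R - K%:R = 1); last by rewrite -natr1; ring.
move=> h.
rewrite ler_pdivrMr// mulrDl mulfVK ?gt_eqF//.
by rewrite [_ * (b - 1)]mulrC; lra.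
Qed.

(** Together with [ln_fact_le], a weak Stirling formula; an error O(ln J) is negligible against
    rates of order J. *)
Lemma ln_fact_ge J : J%:R * ln J%:R - J%:R <= \sum_(k < J) ln k.+1%:R :> R.
Proof.
elim: J => [|J IH]; first by rewrite big_ord0 mul0r subrr.
rewrite big_ord_recr/=; apply: le_trans (lerD IH (lexx _)).
have [->|J0] := posnP J; first by rewrite mul0r subrr add0r ln1 mulr0 sub0r oppr_le0.
have JR : (0 : R) < J%:R by rewrite ltr0n.
have E : ln J.+1%:R = ln J%:R + ln (1 + J%:R^-1) :> R.
  rewrite -lnM ?posrE ?addr_gt0 ?invr_gt0//; congr ln; rewrite -natr1 mulrDr mulr1 mulfV// gt_eqF//.
have J1 : 0 < (J%:R : R)^-1 by rewrite invr_gt0.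
have h : ln (1 + J%:R^-1) <= J%:R^-1 :> R by apply: le_ln1Dx; lra.
have : J%:R * ln (1 + J%:R^-1) <= 1 :> R by rewrite mulrC -ler_pdivlMr// div1r.
rewrite E -natr1; lra.
Qed.

Lemma ln_fact_le J : (0 < J)%N -> \sum_(k < J) ln k.+1%:R <= J%:R * ln J%:R - J%:R + ln J%:R + 1 :> R.
Proof.
case: J => // J _; elim: J => [|J IH].
  by rewrite big_ord_recl big_ord0 ln1; lra.
rewrite big_ord_recr/=; apply: (le_trans (lerD IH (lexx _))).
have JR : (0 : R) < J.+2%:R by [].
have E : ln J.+1%:R = ln J.+2%:R + ln (1 - J.+2%:R^-1) :> R.
  have J1 : (1 : R) < J.+2%:R by rewrite ltr1n.
  rewrite -lnM ?posrE ?subr_gt0 ?invf_lt1//; congr ln; rewrite mulrBr mulr1 mulfV ?gt_eqF//.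
  by rewrite -[J.+2%:R]natr1 addrK.
have h : ln (1 - J.+2%:R^-1) <= - J.+2%:R^-1 :> R by apply: le_ln1Dx; rewrite ltrN2 invf_lt1// ltr1n.
have : J.+2%:R * ln (1 - J.+2%:R^-1) <= - 1 :> R.
  by rewrite mulrC -ler_pdivlMr// mulN1r.
rewrite E (_ : J.+1%:R = J.+2%:R - 1 :> R); last by rewrite -[J.+2%:R]natr1 addrK.
lra.
Qed.

Lemma lin_dom (C e : R) : 0 <= C -> 0 < e -> exists2 x0, 1 <= x0 & forall x, x0 <= x -> C + C * ln x <= e * x.
Proof.
move=> C0 e0; exists (Num.max 1 ((3 * C / e) ^+ 2)); first by rewrite le_max lexx.
move=> x; rewrite ge_max => /andP[x1 xC].
have x0 : 0 < x by lra.
pose s := Num.sqrt x; have s0 : 0 < s by rewrite sqrtr_gt0.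
have sx : s ^+ 2 = x by rewrite sqr_sqrtr// ltW.
have s1 : 1 <= s by rewrite /s -[leLHS]sqrtr1 ler_wsqrtr.
have sC : 3 * C / e <= s.
  by rewrite -[leLHS]ger0_norm ?divr_ge0 ?mulr_ge0 ?(ltW e0)// -sqrtr_sqr ler_wsqrtr.
have lx : ln x <= 2 * s.
  by rewrite -sx lnXn// -[leLHS]mulr_natl ler_wpM2l// ltW// ln_sublinear.
have h1 := ler_wpM2l C0 lx; have h2 := ler_wpM2l C0 s1.
have h3 : 3 * C * s <= e * x.
  by rewrite -sx [s ^+ 2]expr2 mulrA ler_pM2r// [e * s]mulrC -ler_pdivrMr.
lra.
Qed.

End elementary_bounds.

(** * Sums symmetric under k -> N - k *)

Section folded_sums.
Context {R : realType}.
Variables (N : nat) (h : nat -> R).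
Hypothesis h0 : forall k, 0 <= h k.

(** The eigenvalues at k and N - k coincide, so every frequency is reduced to one of size at most
    N/2, where the bounds on the sine apply. Positive frequencies are counted twice. *)
Definition fold (k : nat) : nat := minn k (N - k).

Lemma fold_le2 k : (2 * fold k <= N)%N.
Proof. by rewrite /fold; lia. Qed.

Lemma sum_fold_le : \sum_(k < N) h (fold k) <= h 0 + 2 * \sum_(1 <= t < N) h t.
Proof.
have [->|N0] := posnP N; first by rewrite big_ord0 big_geq// mulr0 addr0.
rewrite -(big_mkord xpredT (fun k => h (fold k))) big_ltn//.
apply: lerD; first by rewrite /fold min0n.
have -> : 2 * \sum_(1 <= t < N) h t = \sum_(1 <= t < N) (h t + h (N - t)%N).
  rewrite big_split/= [X in _ = _ + X]big_nat_rev/= mulr2n mulrDl mul1r; congr (_ + _).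
  by rewrite !big_nat; apply: eq_bigr => t /andP[t1 tN]; congr h; lia.
apply: ler_sum => t _; rewrite /fold /minn; case: ifP => _; first by rewrite lerDl.
by rewrite lerDr.
Qed.

Lemma sum_fold_ge K : (2 * K < N)%N -> 2 * \sum_(1 <= t < K.+1) h t <= \sum_(k < N) h (fold k).
Proof.
move=> KN.
have KN1 : (K.+1 <= N)%N by lia.
have KN2 : (K.+1 <= N - K)%N by lia.
rewrite -(big_mkord xpredT (fun k => h (fold k))) [leRHS](big_cat_nat (n := K.+1))//=.
rewrite [X in _ <= _ + X](big_cat_nat (n := (N - K)%N))//=; last exact: leq_subr.
rewrite mulr2n mulrDl mul1r; apply: lerD.
  rewrite [leRHS]big_ltn// -[leLHS]add0r lerD//.
  rewrite le_eqVlt; apply/orP; left; apply/eqP; rewrite !big_nat; apply: eq_bigr => t /andP[t1 tK].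
  by congr h; rewrite /fold; lia.
rewrite -[leLHS]add0r lerD ?sumr_ge0//.
rewrite [leLHS]big_nat_rev/= -{1}[1%N]add0n -[K.+1 in X in X <= _]add1n.
rewrite (_ : \sum_(N - K <= i < N) h (fold i) = \sum_(1 <= i < K.+1) h (fold (N - (1 + K.+1 - i.+1)))).
  rewrite le_eqVlt; apply/orP; left; apply/eqP; rewrite !add1n !add0n !big_nat; apply: eq_bigr => t /andP[t1 tK].
  by congr h; rewrite /fold; lia.
have -> : N = (K + (N - K))%N by lia.
rewrite {1}(_ : (K + (N - K) - K = 0 + (N - K))%N); last by lia.
rewrite big_addn (_ : (K + (N - K) - (N - K) = K)%N); last by lia.
rewrite big_add1/= !big_nat; apply: eq_bigr => t /andP[t1 tK].
by congr (h (fold _)); lia.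
Qed.

End folded_sums.

(** * Scaled eigenvalues *)

Section scaled_symbol.
Context {R : realType}.
Variables (n : nat) (c : R).
Hypotheses (c0 : 0 < c) (c1 : c <= 1).
Notation N := n.+1.

(** The choice makes damp^N = exp(-c), whatever N is. *)
Definition damp : R := expR (- (c / N%:R)).

Let NR : (0 : R) < N%:R. Proof. by []. Qed.
Let u0 : 0 < c / N%:R. Proof. by rewrite divr_gt0. Qed.
Let u1 : c / N%:R <= 1.
Proof. by rewrite ler_pdivrMr// mul1r (le_trans c1)// ler1n. Qed.

Lemma damp01 : 0 < damp < 1.
Proof. by rewrite expR_gt0/= -expR0 ltr_expR oppr_lt0. Qed.

Let damp_ge : 1 - c / N%:R <= damp.
Proof. exact: expR_ge1Dx. Qed.

Let damp_le : damp <= 1 - c / N%:R / 2.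
Proof.
rewrite /damp expRN; have h := expR_ge1Dx (c / N%:R).
apply: (@le_trans _ _ (1 + c / N%:R)^-1); first by rewrite lef_pV2 ?posrE ?expR_gt0// addr_gt0.
rewrite -div1r ler_pdivrMr ?addr_gt0//.
by move: u0 u1; set u := c / N%:R; nra.
Qed.

Let damp_quarter : 4^-1 <= damp.
Proof.
apply: (@le_trans _ _ (expR (- 1))); last by rewrite ler_expR lerN2.
have h : (2^-1 : R) <= expR (- 2^-1) by apply: le_trans (expR_ge1Dx _); lra.
have -> : expR (- 1) = expR (- 2^-1) * expR (- 2^-1) :> R by rewrite -expRD; congr expR; field.
have h0 : (0 : R) <= 2^-1 by rewrite invr_ge0.
have := ler_pM h0 h0 h h.
by apply: le_trans; lra.
Qed.

(** For fixed k this tends to c^2 + (2 pi k)^2 as N grows; its power -a is the squared singular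
    value after scaling, by [lam_scaled]. *)
Definition ssymb (k : nat) : R := N%:R ^+ 2 * symb (ang N k) damp.

Let half_ang k : ang N k / 2 = pi * k%:R / N%:R :> R.
Proof. by rewrite /ang; field; rewrite gt_eqF. Qed.

Let half_angP k : (2 * k <= N)%N -> 0 <= (pi * k%:R / N%:R : R) <= pi / 2.
Proof.
move=> kN; have pp := pi_gt0 R; rewrite divr_ge0 ?mulr_ge0 ?(ltW pp)//=.
rewrite ler_pdivrMr// -mulrA ler_pM2l// mulrC ler_pdivlMr// mulrC -natrM ler_nat//.
Qed.

Let ssymbE k : ssymb k = (N%:R * (1 - damp)) ^+ 2 + 4 * damp * (N%:R * sin (pi * k%:R / N%:R)) ^+ 2.
Proof. by rewrite /ssymb /symb one_sub_cos half_ang; ring. Qed.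

Let base_le : (N%:R * (1 - damp)) ^+ 2 <= c ^+ 2.
Proof.
have /andP[d0 d1] := damp01.
have h0 : 0 <= 1 - damp by lra.
rewrite lerXn2r ?nnegrE ?mulr_ge0 ?(ltW c0)//.
by rewrite mulrC -ler_pdivlMr//; move: damp_ge; set u := c / N%:R; lra.
Qed.

Let base_ge : c ^+ 2 / 4 <= (N%:R * (1 - damp)) ^+ 2.
Proof.
have -> : c ^+ 2 / 4 = (c / 2) ^+ 2 by field.
rewrite lerXn2r ?nnegrE ?divr_ge0 ?(ltW c0)//.
  by rewrite mulr_ge0// subr_ge0; have /andP[_ /ltW] := damp01.
rewrite [N%:R * _]mulrC -ler_pdivrMr//; rewrite (_ : c / 2 / N%:R = c / N%:R / 2); last by rewrite mulrAC.
by move: damp_le; set u := c / N%:R; lra.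
Qed.

Lemma ssymb_le k : (2 * k <= N)%N -> ssymb k <= c ^+ 2 + (2 * pi * k%:R) ^+ 2.
Proof.
move=> kN; rewrite ssymbE lerD//.
have /andP[d0 /ltW d1] := damp01; have /andP[h0 h1] := half_angP kN.
have /andP[_ s1] := sin_bounds (half_angP kN).
have s0 : 0 <= sin (pi * k%:R / N%:R) :> R by apply: le_trans (sin_ge_half (half_angP kN)); rewrite divr_ge0.
have e : N%:R * sin (pi * k%:R / N%:R) <= pi * k%:R :> R.
  by rewrite mulrC -ler_pdivlMr.
rewrite (_ : (2 * pi * k%:R) ^+ 2 = 4 * (1 * (pi * k%:R) ^+ 2)); last by ring.
rewrite -mulrA ler_wpM2l// ler_pM ?exprn_ge0 ?mulr_ge0 ?(ltW d0)//.
by rewrite lerXn2r ?nnegrE ?mulr_ge0// ltW// pi_gt0.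
Qed.

Lemma ssymb_ge0 k : c ^+ 2 / 4 <= ssymb k.
Proof.
rewrite ssymbE; apply: (le_trans base_ge); rewrite lerDl mulr_ge0 ?sqr_ge0// mulr_ge0//.
by have /andP[/ltW] := damp01.
Qed.

Lemma ssymb_gt0 k : 0 < ssymb k.
Proof. by apply: lt_le_trans (ssymb_ge0 k); rewrite divr_gt0// exprn_gt0. Qed.

Lemma ssymb_ge k : (2 * k <= N)%N -> k%:R ^+ 2 <= ssymb k.
Proof.
move=> kN; rewrite ssymbE -[leLHS]add0r lerD ?sqr_ge0//.
have h := sin_ge_half (half_angP kN).
have pp := pi_gt0 R; have p2 := pi_ge2 R.
have e : k%:R <= N%:R * sin (pi * k%:R / N%:R) :> R.
  apply: (@le_trans _ _ (N%:R * (pi * k%:R / N%:R / 2))); last by rewrite ler_wpM2l.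
  rewrite (_ : _ * _ = pi / 2 * k%:R); last by field; rewrite gt_eqF.
  by rewrite -[leLHS]mul1r ler_wpM2r//; lra.
have d4 : 1 <= 4 * damp by have := damp_quarter; lra.
rewrite -[leLHS]mul1r ler_pM ?exprn_ge0//.
by rewrite lerXn2r ?nnegrE// (le_trans _ e).
Qed.

(** Here the constant 4 pi^2 is sharp, but the bound is useful only for k small compared with N; the
    cruder [ssymb_ge] is effective up to N/2. *)
Lemma ssymb_sharp k : (2 * k <= N)%N ->
  (1 - N%:R^-1) * (1 - (pi * k%:R / N%:R) ^+ 2) * (2 * pi * k%:R) ^+ 2 <= ssymb k.
Proof.
move=> kN; rewrite ssymbE -[leLHS]add0r lerD ?sqr_ge0//.
have /andP[h0 h1] := half_angP kN; have := sin_ge_cube (half_angP kN).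
have pp := pi_gt0 R; set y := pi * k%:R / N%:R in h0 h1 * => h.
have ky : pi * k%:R = N%:R * y by rewrite /y mulrCA mulfV ?mulr1// gt_eqF.
rewrite (_ : (2 * pi * k%:R) ^+ 2 = 4 * (N%:R * y) ^+ 2); last by rewrite -ky; ring.
have [neg|pos] := leP (1 - y ^+ 2 / 2) 0.
  apply: (@le_trans _ _ 0); last by rewrite mulr_ge0 ?sqr_ge0// mulr_ge0//; have := damp_quarter; lra.
  rewrite -[_ * _ * _]mulrA; apply: mulr_ge0_le0; first by rewrite subr_ge0 invf_le1// ler1n.
  by apply: mulr_le0_ge0; rewrite ?mulr_ge0 ?sqr_ge0//; have := sqr_ge0 y; lra.
have s2 : (y * (1 - y ^+ 2 / 2)) ^+ 2 <= sin y ^+ 2.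
  have y1 : 0 <= y * (1 - y ^+ 2 / 2) by rewrite mulr_ge0// ltW.
  by rewrite lerXn2r ?nnegrE//; exact: le_trans h.
have c1' : c / N%:R <= N%:R^-1 by rewrite ler_pdivrMr// mulVf// gt_eqF.
have d1 : 1 - N%:R^-1 <= damp by apply: le_trans damp_ge; rewrite lerD2l lerN2.
have n1 : 0 <= 1 - (N%:R : R)^-1 by rewrite subr_ge0 invf_le1// ler1n.
apply: (@le_trans _ _ (4 * damp * (N%:R * (y * (1 - y ^+ 2 / 2))) ^+ 2)); last first.
  apply: ler_wpM2l; first by rewrite mulr_ge0//; have := damp_quarter; lra.
  by rewrite [leLHS]exprMn [leRHS]exprMn ler_wpM2l// exprn_ge0.
rewrite (_ : _ * _ * _ = (1 - N%:R^-1) * ((1 - y ^+ 2) * (4 * (N%:R * y) ^+ 2))); last by ring.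
rewrite (_ : 4 * damp * _ = damp * ((1 - y ^+ 2 / 2) ^+ 2 * (4 * (N%:R * y) ^+ 2))); last by ring.
have X0 : 0 <= 4 * (N%:R * y) ^+ 2 by rewrite mulr_ge0// sqr_ge0.
apply: (@le_trans _ _ ((1 - N%:R^-1) * ((1 - y ^+ 2 / 2) ^+ 2 * (4 * (N%:R * y) ^+ 2)))).
  rewrite ler_wpM2l// (ler_wpM2r X0)//.
  by have := sqr_ge0 (y ^+ 2); set z := y ^+ 2; lra.
by rewrite ler_wpM2r// mulr_ge0 ?sqr_ge0.
Qed.

Lemma ssymb_fold k : (k < N)%N -> ssymb k = ssymb (fold N k).
Proof.
move=> kN; rewrite /fold /minn; case: ifP => // _; rewrite /ssymb /symb; congr (_ * (_ + _ * (1 - _))).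
have -> : ang N (N - k) = - ang N k + 1%:R * (2 * pi) :> R.
  by rewrite /ang natrB ?(ltnW kN)//; field; rewrite gt_eqF.
by rewrite cosDn2pi cosN.
Qed.

Lemma lam_scaled a k : 0 < a -> (N%:R `^ (- a)) ^+ 2 * lam a n damp k = ssymb k `^ (- a).
Proof.
move=> a0; have s0 : 0 < symb (ang N k : R) damp.
  by apply: symb_gt0; have /andP[/ltW -> ->] := damp01.
rewrite /ssymb powRM ?exprn_ge0 ?(ltW s0)//; congr (_ * _).
by rewrite !expr2 powRM.
Qed.

End scaled_symbol.

Lemma ach_scale {R : realType} d (Omega : measurableType d) (P : probability Omega R) N
    (V W : 'I_N -> Omega -> R) (k L D : R) :
  mvec V -> mvec W -> (forall i w, W i w = k * V i w) -> ach P V L D -> ach P W L (k ^+ 2 * D).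
Proof.
move=> mV mW E; apply: (ach_lip (F := fun x i => k * x i)) => //; first exact: sqr_ge0.
move=> x y; rewrite /dist2 mulr_sumr; apply: ler_sum => i _.
by rewrite -mulrBr exprMn.
Qed.

(** * Water-filling for the circulant matrix: lower bound *)

Section circulant_quantization.
Context {R : realType}.
Variables (a c : R) (n : nat).
Hypotheses (a2 : 2^-1 < a) (c0 : 0 < c) (c1 : c <= 1).
Notation N := n.+1.
Notation q := (damp n c).
Notation v := (fun k => ssymb n c k `^ (- a)).

Definition CN (i l : 'I_N) : R := N%:R `^ (- a) * Cm a q i l.

Let a0 : 0 < a. Proof. by apply: lt_trans a2. Qed.
Let b1 : 1 < 2 * a. Proof. by have := a2; lra. Qed.

Lemma circ_diag_scaled d (Omega : measurableType d) (P : probability Omega R) (xi : 'I_N -> Omega -> R) :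
  std_gauss P xi -> exists2 eta : 'I_N -> Omega -> R, std_gauss P eta &
   forall L D, ach P (lmap CN xi) L D <-> ach P (fun k w => Num.sqrt (v k) * eta k w) L D.
Proof.
move=> H; have [eta He E] := circ_diag a0 (damp01 n c0) H.
exists eta; first exact: He.
move=> L D; set s := N%:R `^ (- a).
have s0 : 0 < s by rewrite powR_gt0.
have mC : mvec (lmap (Cm a q) xi) by apply: measurable_lmap; exact: H.1.
have mC' : mvec (lmap CN xi) by apply: measurable_lmap; exact: H.1.
have mE : mvec (fun (k : 'I_N) w => Num.sqrt (lam a n q k) * eta k w).
  by move=> k; apply: measurable_funM => //; exact: He.1.
have mE' : mvec (fun (k : 'I_N) w => Num.sqrt (v k) * eta k w).
  by move=> k; apply: measurable_funM => //; exact: He.1.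
have sE k : Num.sqrt (v k) = s * Num.sqrt (lam a n q k).
  by rewrite -lam_scaled// sqrtrM ?sqr_ge0// sqrtr_sqr gtr0_norm.
have EC i w : lmap CN xi i w = s * lmap (Cm a q) xi i w.
  by rewrite /lmap mulr_sumr; apply: eq_bigr => l _; rewrite mulrA.
have sK (x : R) : x = s ^+ 2 * (s^-1 ^+ 2 * x).
  by rewrite mulrA -exprMn divff ?gt_eqF// expr1n mul1r.
split=> h; rewrite [D]sK.
  apply: (ach_scale mE mE') => [i w|]; first by rewrite sE mulrA.
  apply/E; apply: (ach_scale mC' mC _ h) => i w.
  by rewrite EC mulKf// gt_eqF.
apply: (ach_scale mC mC') => [i w|]; first exact: EC.
apply/E; apply: (ach_scale mE' mE _ h) => i w.
by rewrite sE -mulrA mulKf// gt_eqF.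
Qed.

Let tp : 1 <= 2 * pi :> R. Proof. by have := pi_ge2 R; lra. Qed.
Let tp0 : 0 < 2 * pi :> R. Proof. by have := tp; lra. Qed.

Lemma sqr_powR (x : R) : 0 <= x -> (x ^+ 2) `^ (- a) = x `^ (- (2 * a)).
Proof. by move=> x0; rewrite -powR_mulrn// -powRrM; congr (_ `^ _); rewrite mulrN. Qed.

Lemma powR_2pi k : (2 * pi * k%:R) `^ (- (2 * a)) = (2 * pi) `^ (- (2 * a)) * k%:R `^ (- (2 * a)) :> R.
Proof. by rewrite powRM// ltW. Qed.

Lemma sum_inv_sqr J : \sum_(k < J) (k.+1%:R ^- 2 : R) <= 2.
Proof.
case: J => [|J]; first by rewrite big_ord0.
suff : \sum_(k < J.+1) (k.+1%:R ^- 2 : R) <= 2 - J.+1%:R^-1.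
  by move/le_trans; apply; rewrite gerBl invr_ge0.
elim: J => [|J IH]; first by rewrite big_ord_recl big_ord0 expr1n invr1 addr0; lra.
rewrite big_ord_recr/=; apply: (le_trans (lerD IH (lexx _))).
have x0 : (0 : R) < J.+1%:R by [].
have -> : J.+2%:R = J.+1%:R + 1 :> R by rewrite natr1.
move: x0; set x : R := J.+1%:R => x0.
rewrite -subr_ge0 (_ : _ - _ = (x * (x + 1) ^+ 2)^-1); last by field; rewrite !gt_eqF//; lra.
by rewrite invr_ge0 mulr_ge0 ?sqr_ge0// ltW.
Qed.

(* reverse water-filling at level theta = (2 pi J)^(-2a), truncated at frequency J^2 *)
Lemma circ_lower d (Omega : measurableType d) (P : probability Omega R) (xi : 'I_N -> Omega -> R) J L D :
  std_gauss P xi -> (0 < J)%N -> (2 * J ^ 2 < N)%N -> 2 * L <= 4 * a * J%:R ->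
  ach P (lmap CN xi) L D ->
  (2 * pi) `^ (- (2 * a)) * J%:R `^ (1 - 2 * a) *
   (2 * (1 + J%:R ^- 2) `^ (- a) * (1 + ((1 + J%:R^-1) `^ (1 - 2 * a) - J%:R `^ (1 - 2 * a)) / (2 * a - 1))
    - 4 * a * (ln J%:R + 2) / J%:R) <= D.
Proof.
move=> H J0 JN LJ h; have [eta He E] := circ_diag_scaled H.
move: h => /E h.
have JR : (0 : R) < J%:R by rewrite ltr0n.
have J1 : (1 : R) <= J%:R by rewrite ler1n.
set A := (2 * pi) `^ (- (2 * a)); have A0 : 0 < A by rewrite powR_gt0.
pose T k : R := A * k%:R `^ (- (2 * a)).
pose th := T J; have th0 : 0 < th by rewrite mulr_gt0// powR_gt0.
(* This factor pays for c^2 in the eigenvalues: for k >= J one has c^2 <= 1 <= J^(-2) (2 pi k)^2. *)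
pose rho : R := (1 + J%:R ^- 2) `^ (- a).
have J2 : (0 : R) < J%:R ^- 2 by rewrite invr_gt0 exprn_gt0.
have rho0 : 0 < rho by rewrite powR_gt0// addr_gt0.
have rho1 : rho <= 1.
  by have := @powRN_le R a 1 (1 + J%:R ^- 2) (ltW a0) ltr01; rewrite powR1; apply; rewrite lerDl ltW.
have v0 k : 0 < v k by rewrite powR_gt0// ssymb_gt0.
pose sg (k : 'I_N) := Num.sqrt (v k).
have sg0 k : 0 < sg k by rewrite sqrtr_gt0.
have sg2 k : sg k ^+ 2 = v (fold N k) by rewrite sqr_sqrtr ?ltW// (ssymb_fold c (ltn_ord k)).
have := ach_lower He sg0 th0 h.
under eq_bigr do rewrite sg2; under [X in _ + _ * (X - _)]eq_bigr do rewrite sg2.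
pose h1 k := Num.min (v k) th; pose h2 k := ln (Num.max (v k / th) 1).
have h10 k : 0 <= h1 k by rewrite le_min !ltW.
have h20 k : 0 <= h2 k by rewrite ln_ge0// le_max lexx orbT.
have KJ : (J <= J ^ 2)%N by rewrite -mulnn leq_pmulr.
have JN' : (2 * J < N)%N by apply: leq_ltn_trans JN; rewrite leq_mul2l KJ orbT.
have f1 := sum_fold_ge h10 JN; have f2 := sum_fold_ge h20 JN'.
rewrite -/(h1 _) in f1 *.
pose u k : R := (c ^+ 2 + (2 * pi * k%:R) ^+ 2) `^ (- a).
have uv k : (k <= J ^ 2)%N -> u k <= v k.
  move=> kJ; apply: powRN_le; rewrite ?ssymb_gt0 ?(ltW a0)//.
  by apply: ssymb_le => //; apply: ltnW; apply: leq_ltn_trans JN; rewrite leq_mul2l kJ orbT.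
have c2 : c ^+ 2 <= 1 by rewrite expr_le1// ltW.
have tk0 k : (0 < k)%N -> 0 < 2 * pi * k%:R :> R by move=> k1; rewrite mulr_gt0// ltr0n.
have uT k : (J <= k)%N -> rho * T k <= u k.
  move=> Jk; have kR : (0 : R) < k%:R by apply: (lt_le_trans JR); rewrite ler_nat.
  have TE : T k = ((2 * pi * k%:R) ^+ 2) `^ (- a) by rewrite /T -powR_2pi sqr_powR// ltW// tk0// (leq_trans J0).
  rewrite TE (_ : rho * _ = ((1 + J%:R ^- 2) * (2 * pi * k%:R) ^+ 2) `^ (- a)); last first.
    by rewrite [RHS]powRM ?sqr_ge0 ?addr_ge0 ?(ltW J2).
  apply: powRN_le; rewrite ?(ltW a0)//.
    by rewrite ltr_wpDl ?sqr_ge0// exprn_gt0// mulr_gt0.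
  rewrite [leRHS]mulrDl mul1r [leLHS]addrC lerD2l; apply: (le_trans c2).
  rewrite mulrC ler_pdivlMr ?exprn_gt0// mul1r.
  have kk : 0 <= 2 * pi * k%:R :> R by rewrite ltW// tk0// (leq_trans J0).
  rewrite lerXn2r ?nnegrE//.
  by rewrite -[leLHS]mul1r ler_pM// ler_nat.
have Tle k l : (0 < k)%N -> (k <= l)%N -> T l <= T k.
  by move=> k1 kl; rewrite ler_pM2l// powRN_le ?ltr0n// ?ler_nat//; have := a0; lra.
have h1J k : (1 <= k < J.+1)%N -> rho * th <= h1 k.
  move=> /andP[k1]; rewrite ltnS => kJ; rewrite /h1 le_min; apply/andP; split; last by rewrite ler_piMl// ltW.
  apply: (le_trans (uT J (leqnn J))); apply: le_trans (uv k (leq_trans kJ KJ)).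
  apply: powRN_le; rewrite ?(ltW a0)//; first by rewrite ltr_wpDl ?sqr_ge0// exprn_gt0// tk0.
  by rewrite lerD2l lerXn2r ?nnegrE ?(ltW (tk0 _ _))// ler_pM2l// ler_nat.
have h1K k : (J.+1 <= k < (J ^ 2).+1)%N -> rho * T k <= h1 k.
  move=> /andP[Jk]; rewrite ltnS => kK; have Jk' := ltnW Jk.
  rewrite /h1 le_min; apply/andP; split; first exact: le_trans (uT k Jk') (uv k kK).
  by apply: le_trans (Tle _ _ J0 Jk'); rewrite ler_piMl// ltW// mulr_gt0// powR_gt0// ltr0n (leq_trans J0).
have lnT k : (0 < k)%N -> ln (T k) = - (2 * a * (ln (2 * pi) + ln k%:R)).
  move=> k1; rewrite /T -powR_2pi ln_powR lnM ?posrE ?ltr0n//; ring.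
have h2J k : (k < J)%N -> 2 * a * (ln J%:R - ln k.+1%:R) - a * k.+1%:R ^- 2 <= h2 k.+1.
  move=> kJ; have k1 : (0 : R) < k.+1%:R by [].
  have u0 : 0 < u k.+1 by rewrite powR_gt0// ltr_wpDl ?sqr_ge0// exprn_gt0// tk0.
  apply: (@le_trans _ _ (ln (u k.+1 / th))); last first.
    rewrite ler_ln ?posrE ?divr_gt0//; last by rewrite lt_max ltr01 orbT.
    by rewrite le_max ler_pM2r ?invr_gt0// uv// (leq_trans kJ KJ).
  rewrite ln_div ?posrE// lnT// /u ln_powR.
  have -> : c ^+ 2 + (2 * pi * k.+1%:R) ^+ 2 = (2 * pi * k.+1%:R) ^+ 2 * (1 + c ^+ 2 / (2 * pi * k.+1%:R) ^+ 2).
    have y0 : 0 < (2 * pi * k.+1%:R) ^+ 2 :> R by rewrite exprn_gt0// tk0.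
    by move: y0; set y := (2 * pi * _) ^+ 2 => y0; field; rewrite gt_eqF.
  have x0 : 0 <= c ^+ 2 / (2 * pi * k.+1%:R) ^+ 2 by rewrite divr_ge0 ?sqr_ge0.
  have x1 : c ^+ 2 / (2 * pi * k.+1%:R) ^+ 2 <= k.+1%:R ^- 2.
    rewrite -[leRHS]mul1r ler_pM ?sqr_ge0 ?invr_ge0 ?sqr_ge0// lef_pV2 ?posrE ?exprn_gt0 ?tk0//.
    by rewrite lerXn2r ?nnegrE ?(ltW (tk0 _ _))// ler_peMl.
  rewrite lnM ?posrE ?exprn_gt0 ?tk0//; last by rewrite ltr_wpDr.
  rewrite lnXn ?tk0// lnM ?posrE//.
  have := @le_ln1Dx R (c ^+ 2 / (2 * pi * k.+1%:R) ^+ 2); rewrite (lt_le_trans (ltrN10 R) x0) => /(_ isT) hl.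
  have := ler_wpM2l (ltW a0) (le_trans hl x1).
  rewrite (mulr2n (ln (2 * pi) + ln k.+1%:R)); move: (ln (1 + c ^+ 2 / (2 * pi * k.+1%:R) ^+ 2)) (k.+1%:R ^- 2) (ln k.+1%:R) (ln J%:R) (ln (2 * pi)) => z1 z2 z3 z4 z5 hz.
  lra.
(* Frequencies up to J contribute the level [th], those from J + 1 to J^2 their own variance, both
   up to [rho]. *)
have S1 : J%:R * (rho * th) + rho * A * ((J.+1%:R `^ (1 - 2 * a) - (J ^ 2).+1%:R `^ (1 - 2 * a)) / (2 * a - 1)) <= \sum_(1 <= t < (J ^ 2).+1) h1 t.
  rewrite (big_cat_nat (n := J.+1))//=; apply: lerD.
    rewrite (_ : J%:R * (rho * th) = \sum_(1 <= t < J.+1) rho * th); last first.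
      by rewrite sumr_const_nat subn1 mulr_natl.
    by rewrite !big_nat; apply: ler_sum.
  apply: le_trans (ler_wpM2l _ (sum_powR_ge b1 (ltn0Sn J) _)) _; [by rewrite mulr_ge0// ltW|by []|].
  by rewrite mulr_sumr !big_nat; apply: ler_sum => k kJ; rewrite -mulrA; exact: h1K.
(* The main term comes from ln J!; the shift by c^2 costs at most a/k^2 at frequency k, which is
   summable. Doubled and compared with 2 L <= 4 a J, this leaves only -4 a (ln J + 2). *)
have S2 : 2 * a * (J%:R - ln J%:R - 2) <= \sum_(1 <= t < J.+1) h2 t.
  rewrite big_add1/= big_mkord.
  apply: le_trans (ler_sum _ (fun (k : 'I_J) _ => h2J k (ltn_ord k))).
  rewrite sumrB -!mulr_sumr sumrB sumr_const card_ord -[ln J%:R *+ J]mulr_natl.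
  have g1 := ler_wpM2l (ltW a0) (sum_inv_sqr J); have g2 := ler_wpM2l (ltW a0) (@ln_fact_le R _ J0).
  have aux (x y z t : R) : a * x <= a * 2 -> a * y <= a * (t * z - t + z + 1) ->
    2 * a * (t - z - 2) <= 2 * a * (t * z - y) - a * x by move=> h3 h4; lra.
  exact: aux g1 g2.
rewrite /h1 /h2 in f1 f2 S1 S2.
set X1 := \sum_i Num.min _ _ in f1 *; set X2 := \sum_i ln _ in f2 * => DX.
apply: le_trans DX.
apply: (@le_trans _ _ (2 * (J%:R * (rho * th) + rho * A * ((J.+1%:R `^ (1 - 2 * a) - (J ^ 2).+1%:R `^ (1 - 2 * a)) / (2 * a - 1)))
   + th * (2 * (2 * a * (J%:R - ln J%:R - 2)) - 4 * a * J%:R))); last first.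
  apply: lerD; first by apply: le_trans f1; rewrite ler_wpM2l.
  by rewrite ler_wpM2l ?(ltW th0)// lerB//; apply: le_trans f2; rewrite ler_wpM2l.
have thE : th = A * (J%:R `^ (1 - 2 * a) / J%:R).
  rewrite /th /T; congr (_ * _); rewrite -{3}[J%:R](@powRr1 R)// -powRN -powRD ?(gt_eqF JR) ?implybT//.
  by congr (_ `^ _); ring.
have JS : J.+1%:R `^ (1 - 2 * a) = J%:R `^ (1 - 2 * a) * (1 + J%:R^-1) `^ (1 - 2 * a).
  by rewrite -powRM ?addr_ge0 ?invr_ge0// mulrDr mulr1 mulfV ?gt_eqF// natr1.
have KS : (J ^ 2).+1%:R `^ (1 - 2 * a) <= J%:R `^ (1 - 2 * a) * J%:R `^ (1 - 2 * a).
  rewrite -powRM// -natrM mulnn -[1 - 2 * a]opprB; apply: powRN_le; rewrite ?ltr0n ?expn_gt0 ?J0// ?ler_nat//.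
  by have := b1; lra.
rewrite -/rho thE JS; set p := J%:R `^ (1 - 2 * a) in KS *; set p1 := (1 + J%:R^-1) `^ (1 - 2 * a); set p2 := (J ^ 2).+1%:R `^ _ in KS *.
have b10 : 0 < 2 * a - 1 by have := b1; lra.
rewrite -subr_ge0 (_ : _ - _ = 2 * rho * A / (2 * a - 1) * (p * p - p2)); last first.
  by field; rewrite !gt_eqF.
by rewrite mulr_ge0 ?subr_ge0// divr_ge0 ?(ltW b10)// !mulr_ge0// ltW.
Qed.

End circulant_quantization.

(** * Water-filling for the circulant matrix: upper bound *)

Section circulant_upper.
Context {R : realType}.
Variables (a c : R) (n : nat).
Hypotheses (a2 : 2^-1 < a) (c0 : 0 < c) (c1 : c <= 1).
Notation N := n.+1.
Notation q := (damp n c).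
Notation v := (fun k => ssymb n c k `^ (- a)).

Let a0 : 0 < a. Proof. by apply: lt_trans a2. Qed.
Let b1 : 1 < 2 * a. Proof. by have := a2; lra. Qed.
Let b10 : 0 < 2 * a - 1. Proof. by have := a2; lra. Qed.
Let tp : 1 <= 2 * pi :> R. Proof. by have := pi_ge2 R; lra. Qed.
Let tp0 : 0 < 2 * pi :> R. Proof. by have := tp; lra. Qed.

(** A bound for the trace of the scaled covariance that does not depend on N: frequency 0 is bounded
    through c, the others by twice the sum of k^(-2a). *)
Definition spec_mass : R := (c ^+ 2 / 4) `^ (- a) + 2 * (1 + (2 * a - 1)^-1).

Let v_le k : (2 * k <= N)%N -> (0 < k)%N -> v k <= k%:R `^ (- (2 * a)).
Proof.
move=> kN k0; rewrite -sqr_powR//; apply: powRN_le; [exact: ltW|by rewrite exprn_gt0// ltr0n|].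
exact: ssymb_ge.
Qed.

Let v0_le k : v k <= (c ^+ 2 / 4) `^ (- a).
Proof. by apply: powRN_le; [exact: ltW|by rewrite divr_gt0// exprn_gt0|exact: ssymb_ge0]. Qed.

Let sum_tail (J K : nat) : (0 < J)%N -> 
  \sum_(J.+1 <= t < K) t%:R `^ (- (2 * a)) <= J%:R `^ (1 - 2 * a) / (2 * a - 1) :> R.
Proof.
move=> J0; case: K => [|K]; first by rewrite big_geq// divr_ge0 ?powR_ge0// ltW.
by rewrite big_add1/=; exact: sum_powR_le.
Qed.

Lemma spec_mass_ge : \sum_(k < N) v k <= spec_mass.
Proof.
pose h (t : nat) := if t == 0%N then (c ^+ 2 / 4) `^ (- a) else t%:R `^ (- (2 * a)) : R.
apply: (@le_trans _ _ (\sum_(k < N) h (fold N k))).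
  apply: ler_sum => k _; rewrite (ssymb_fold c (ltn_ord k)) /h.
  case: eqP => [->//|/eqP t0]; apply: v_le; rewrite ?lt0n//; exact: fold_le2.
have h0 t : 0 <= h t by rewrite /h; case: eqP => _; exact: powR_ge0.
apply: (le_trans (sum_fold_le N h0)); rewrite {1}/h eqxx lerD2l ler_wpM2l//.
case: n => [|m]; first by rewrite big_geq// addr_ge0// invr_ge0 ltW.
rewrite big_ltn// {1}/h/= powR1 lerD2l.
have := @sum_tail 1 m.+2 (ltn0Sn 0); rewrite powR1 mul1r; apply: le_trans.
by rewrite !big_nat; apply: ler_sum => t /andP[t2 _]; rewrite /h gtn_eqF// (ltn_trans _ t2).
Qed.

Let sum_ind J : (2 * J < N)%N -> 
   ((2 * J)%:R <= \sum_(k < N) (fold N k <= J)%:R :> R) /\ (\sum_(k < N) (fold N k <= J)%:R <= (2 * J).+1%:R :> R).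
Proof.
move=> JN; have JJ K : (J <= K)%N -> \sum_(1 <= t < K.+1) ((t <= J)%N)%:R = J%:R :> R.
  move=> JK; rewrite (big_cat_nat (n := J.+1))//= [X in _ + X]big_nat [X in _ + X]big1 ?addr0; last first.
    by move=> i /andP[iJ _]; rewrite leqNgt iJ.
  rewrite big_nat (eq_bigr (fun=> 1)).
    by rewrite -big_nat sumr_const_nat subn1.
  by move=> i /andP[_ iJ]; rewrite -ltnS iJ.
split.
  have /= := @sum_fold_ge R N (fun t => ((t <= J)%N)%:R) (fun=> ler0n _ _) J JN.
  by rewrite JJ// natrM.
have /= := @sum_fold_le R N (fun t => ((t <= J)%N)%:R) (fun=> ler0n _ _).
have JN' : (J <= n)%N by lia.
by rewrite JJ//= -[(2 * J).+1%:R]natr1 natrM addrC.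
Qed.

(** Frequencies up to J are coded at a level [th] below all their eigenvalues. Between J and J^2 the
    symbol is sharp up to the factor exp(-e), which gives the leading constant; beyond J^2 the crude
    bound k^(-2a) suffices. The terms a ln(4 + ...)/2 + a ln J pay for frequency 0, whose eigenvalue
    is bounded only through c. *)
Lemma circ_upper d (Omega : measurableType d) (P : probability Omega R) (xi : 'I_N -> Omega -> R) J (e dl : R) :
  std_gauss P xi -> (0 < J)%N -> (2 * J ^ 2 < N)%N -> 0 <= e -> 0 < dl < 1 ->
  expR (- e) <= (1 - N%:R^-1) * (1 - (pi * (J ^ 2)%:R / N%:R) ^+ 2) ->
  ach P (lmap (@CN _ a c n) xi)
   (a * (2 + e) * J%:R + a + a * ln (4 + 4 * (2 * pi) ^+ 2 / c ^+ 2) / 2 + a * ln J%:R + 2 * dl * (2 * J).+1%:R + 4)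
   ((2 * pi) `^ (- (2 * a)) * J%:R `^ (1 - 2 * a) *
     ((1 + dl) * (2 + J%:R^-1) + 2 * expR (a * e) / (2 * a - 1))
      + 2 * (J ^ 2)%:R `^ (1 - 2 * a) / (2 * a - 1)
      + 67 * expR (- (kap dl * J%:R)) * spec_mass).
Proof.
move=> H J0 JN e0 dl01 HN; have [eta He E] := circ_diag_scaled a2 c0 H.
apply/E => {E}.
have /andP[d0 d1] := dl01.
have JR : (0 : R) < J%:R by rewrite ltr0n.
have J1 : (1 : R) <= J%:R by rewrite ler1n.
have JK : (J <= J ^ 2)%N by rewrite expnS expn1 leq_pmulr.
have JN' : (2 * J < N)%N by apply: leq_ltn_trans JN; rewrite leq_mul2l.
set A := (2 * pi) `^ (- (2 * a)); have A0 : 0 < A by rewrite powR_gt0.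
have v0 k : 0 < v k by rewrite powR_gt0// ssymb_gt0.
pose sg (k : 'I_N) := Num.sqrt (v k).
have sg0 k : 0 < sg k by rewrite sqrtr_gt0.
have sg2 (k : 'I_N) : sg k ^+ 2 = v (fold N k) by rewrite sqr_sqrtr ?ltW// (ssymb_fold c (ltn_ord k)).
pose th := (c ^+ 2 + (2 * pi * J%:R) ^+ 2) `^ (- a).
have B0 : 0 < c ^+ 2 + (2 * pi * J%:R) ^+ 2 by rewrite ltr_wpDr ?sqr_ge0// exprn_gt0.
have th0 : 0 < th by rewrite powR_gt0.
pose S := [set k : 'I_N | (fold N k <= J)%N]%SET.
have thS (k : 'I_N) : k \in S -> th <= sg k ^+ 2.
  rewrite inE sg2 => kJ; apply: powRN_le; [exact: ltW|exact: ssymb_gt0|].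
  apply: (le_trans (ssymb_le c0 (fold_le2 N k))); rewrite lerD2l lerXn2r ?nnegrE ?mulr_ge0 ?pi_ge0//.
  by rewrite ler_wpM2l ?ler_nat// mulr_ge0 ?pi_ge0.
have vK t : (0 < t <= J ^ 2)%N -> v t <= expR (a * e) * (A * t%:R `^ (- (2 * a))).
  move=> /andP[t0 tK].
  have tN : (2 * t <= N)%N by apply: leq_trans (ltnW JN); rewrite leq_mul2l.
  have y0 : 0 < (2 * pi * t%:R) ^+ 2 :> R by rewrite exprn_gt0// mulr_gt0// ltr0n.
  apply: (@le_trans _ _ ((expR (- e) * (2 * pi * t%:R) ^+ 2) `^ (- a))).
    apply: powRN_le; [exact: ltW|by rewrite mulr_gt0// expR_gt0|].
    apply: le_trans (ssymb_sharp c1 tN); rewrite ler_wpM2r ?(ltW y0)//.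
    apply: (le_trans HN); rewrite ler_wpM2l//.
      by rewrite subr_ge0 invf_le1 ?ler1n.
    rewrite lerD2l lerN2 lerXn2r ?nnegrE ?divr_ge0 ?mulr_ge0 ?pi_ge0//.
    by rewrite ler_wpM2r ?invr_ge0// ler_wpM2l ?pi_ge0// ler_nat.
  rewrite powRM ?expR_ge0 ?(ltW y0)// -expRM sqr_powR ?mulr_ge0 ?pi_ge0// powR_2pi.
  by rewrite mulrNN [e * a]mulrC.
have thA : th <= A * J%:R `^ (- (2 * a)).
  rewrite -powR_2pi -sqr_powR ?mulr_ge0 ?pi_ge0//; apply: powRN_le; [exact: ltW|by rewrite exprn_gt0// mulr_gt0|].
  by rewrite lerDr sqr_ge0.
have sumE (F : 'I_N -> R) : \sum_(i in S) F i = \sum_(i < N) (if (fold N i <= J)%N then F i else 0).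
  by rewrite big_mkcond; apply: eq_bigr => i _; rewrite inE.
have cS : #|S|%:R = \sum_(k < N) (fold N k <= J)%:R :> R.
  rewrite -sum1_card natr_sum sumE; apply: eq_bigr => i _; by case: leqP.
have [cS1 cS2] := sum_ind JN'; rewrite -cS in cS1 cS2.
have Jb : J%:R `^ (- (2 * a)) * J%:R = J%:R `^ (1 - 2 * a) :> R.
  by rewrite -{2}[J%:R](@powRr1 R)// -powRD ?(gt_eqF JR) ?implybT// addrC.
have hI : info sg S th <= a * (2 + e) * J%:R + a + a * ln (4 + 4 * (2 * pi) ^+ 2 / c ^+ 2) / 2 + a * ln J%:R.
  pose C0 := a * ln (4 + 4 * (2 * pi) ^+ 2 / c ^+ 2).
  have w0 : 0 <= 4 * (2 * pi) ^+ 2 / c ^+ 2 :> R by rewrite divr_ge0 ?sqr_ge0// mulr_ge0 ?sqr_ge0.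
  have C00 : 0 <= C0.
    rewrite mulr_ge0 ?(ltW a0)// ln_ge0//; move: w0; set z := _ / _; lra.
  have lJ : 0 <= ln J%:R :> R by exact: ln_ge0.
  (* Majorant of ln(v t / th). At t = 0 the eigenvalue has no factor t^(-2a), so the value there is
     separate; summed over folded frequencies it counts once. *)
  pose g (t : nat) := if (t <= J)%N then (if t == 0%N then C0 + 2 * a * ln J%:R
     else a * e + 2 * a * (ln J%:R - ln t%:R) + a * J%:R ^- 2) else 0.
  have g0 t : 0 <= g t.
    rewrite /g; case: leqP => tJ; last exact: lexx.
    case: (posnP t) => t0.
      by rewrite addr_ge0// !mulr_ge0// ltW.
    have tJ' : ln t%:R <= ln J%:R :> R by rewrite ler_ln ?posrE ?ltr0n// ler_nat.
    rewrite !addr_ge0// mulr_ge0 ?invr_ge0 ?sqr_ge0 ?(ltW a0)//.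
      by rewrite mulr_ge0// ltW.
    by rewrite subr_ge0.
  have lnth : ln th = - a * ln (c ^+ 2 + (2 * pi * J%:R) ^+ 2) by rewrite ln_powR.
  have hg (t : nat) : (t <= J)%N -> ln (v t / th) <= g t.
    move=> tJ; rewrite /g tJ ln_div ?posrE// lnth; have [->|t0] := posnP t.
      rewrite ln_powR.
      have s0 := ssymb_gt0 n c0 c1 0.
      have -> : - a * ln (ssymb n c 0) - - a * ln (c ^+ 2 + (2 * pi * J%:R) ^+ 2) = a * (ln (c ^+ 2 + (2 * pi * J%:R) ^+ 2) - ln (ssymb n c 0)) by ring.
      have -> : C0 + 2 * a * ln J%:R = a * (ln (4 + 4 * (2 * pi) ^+ 2 / c ^+ 2) + ln J%:R *+ 2) by rewrite /C0 [ln J%:R *+ 2]mulr2n; ring.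
      rewrite ler_wpM2l ?(ltW a0)// -lnXn// -ln_div ?posrE// -lnM ?posrE ?exprn_gt0//; last first.
        by rewrite ltr_wpDr.
      have z0 : 0 < (4 + 4 * (2 * pi) ^+ 2 / c ^+ 2) * J%:R ^+ 2 by rewrite mulr_gt0 ?exprn_gt0// ltr_wpDr.
      rewrite ler_ln ?posrE ?divr_gt0//.
      rewrite ler_pdivrMr//; apply: le_trans (ler_wpM2l _ (ssymb_ge0 n c0 c1 0)); last first.
        by rewrite mulr_ge0 ?sqr_ge0// addr_ge0.
      have -> : (4 + 4 * (2 * pi) ^+ 2 / c ^+ 2) * J%:R ^+ 2 * (c ^+ 2 / 4) = c ^+ 2 * J%:R ^+ 2 + (2 * pi * J%:R) ^+ 2.
        by field; rewrite gt_eqF.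
      by rewrite lerD2r ler_peMr ?sqr_ge0// exprn_ege1.
    have vt : ln (v t) <= a * e - 2 * a * (ln (2 * pi) + ln t%:R).
      have tR : (0 : R) < t%:R by rewrite ltr0n.
      apply: (@le_trans _ _ (ln (expR (a * e) * (2 * pi * t%:R) `^ (- (2 * a))))).
        have z0 : 0 < expR (a * e) * (2 * pi * t%:R) `^ (- (2 * a)) by rewrite mulr_gt0 ?expR_gt0// powR_gt0// mulr_gt0.
        rewrite ler_ln ?posrE//.
        by rewrite powR_2pi; apply: vK; rewrite t0 (leq_trans tJ).
      rewrite lnM ?posrE ?expR_gt0 ?powR_gt0 ?mulr_gt0 ?pi_gt0// expRK ln_powR lnM ?posrE ?mulr_gt0 ?pi_gt0//.
      by rewrite mulNr.
    have vJ : ln (c ^+ 2 + (2 * pi * J%:R) ^+ 2) <= 2 * (ln (2 * pi) + ln J%:R) + J%:R ^- 2.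
      have y0 : 0 < (2 * pi * J%:R) ^+ 2 :> R by rewrite exprn_gt0// mulr_gt0.
      have -> : c ^+ 2 + (2 * pi * J%:R) ^+ 2 = (2 * pi * J%:R) ^+ 2 * (1 + c ^+ 2 / (2 * pi * J%:R) ^+ 2).
        by move: y0; set y := (2 * pi * _) ^+ 2 => y0; field; rewrite gt_eqF.
      have x0 : 0 <= c ^+ 2 / (2 * pi * J%:R) ^+ 2 by rewrite divr_ge0 ?sqr_ge0.
      have x1 : c ^+ 2 / (2 * pi * J%:R) ^+ 2 <= J%:R ^- 2.
        rewrite -[leRHS]mul1r ler_pM ?sqr_ge0 ?invr_ge0 ?sqr_ge0//.
          by rewrite expr_le1// ltW.
        have z0 : 0 < 2 * pi * J%:R :> R by rewrite mulr_gt0.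
        rewrite lef_pV2 ?posrE ?exprn_gt0//.
        by rewrite lerXn2r ?nnegrE ?mulr_ge0 ?pi_ge0// ler_peMl.
      rewrite lnM ?posrE//; last by rewrite ltr_wpDr.
      have z0 : 0 < 2 * pi * J%:R :> R by rewrite mulr_gt0.
      rewrite lnXn ?z0// (lnM (x := 2 * pi)) ?posrE// [_ *+ 2]mulr2n.
      have := @le_ln1Dx R (c ^+ 2 / (2 * pi * J%:R) ^+ 2); rewrite (lt_le_trans (ltrN10 R) x0) => /(_ isT) hl.
      apply: lerD; last exact: le_trans x1.
      by rewrite le_eqVlt; apply/orP; left; apply/eqP; ring.
    have := ler_wpM2l (ltW a0) vJ; move: vt; move: (ln (v t)) (ln (c ^+ 2 + _)) (ln (2 * pi)) (ln t%:R) (ln J%:R) (J%:R ^- 2).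
    move=> z1 z2 z3 z4 z5 z6 h1 h2.
    lra.
  have gS : \sum_(1 <= t < N) g t <= a * e * J%:R + 2 * a * J%:R + a.
    have J1N : (J.+1 <= N)%N by apply: leq_ltn_trans JN'; rewrite leq_pmull.
    rewrite (big_cat_nat (n := J.+1))//=.
    rewrite [X in _ + X]big_nat [X in _ + X]big1 ?addr0; last first.
      by move=> i /andP[iJ _]; rewrite /g leqNgt iJ.
    rewrite big_add1/= big_mkord.
    rewrite (eq_bigr (fun k : 'I_J => (a * e + a * J%:R ^- 2) + 2 * a * (ln J%:R - ln k.+1%:R))); last first.
      by move=> i _; rewrite /g ltn_ord/=; ring.
    rewrite big_split/= sumr_const card_ord -mulr_sumr sumrB sumr_const card_ord -[ln J%:R *+ J]mulr_natl.
    rewrite -[(a * e + _) *+ J]mulr_natl.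
    have := ler_wpM2l (ltW a0) (@ln_fact_ge R J).
    have : a * (J%:R * J%:R ^- 2) <= a.
      rewrite ler_piMr ?(ltW a0)// expr2 invfM mulrA divff ?gt_eqF// mul1r invf_le1//.
    have -> : J%:R * (a * e + a * J%:R ^- 2) = a * e * J%:R + a * (J%:R * J%:R ^- 2) by ring.
    move: (J%:R * J%:R ^- 2) (\sum_(k < J) _) (J%:R * ln J%:R) => z1 z2 z3 h1 h2; lra.
  rewrite /info ler_pdivrMr//.
  apply: (@le_trans _ _ (\sum_(k < N) g (fold N k))).
    rewrite sumE; apply: ler_sum => i _; rewrite sg2; case: leqP => iJ; first exact: hg.
    exact: g0.
  apply: (le_trans (sum_fold_le N g0)); rewrite {1}/g/= -/C0.
  move: gS; set X := \sum_(1 <= t < N) g t; move: (ln J%:R) => z hX.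
  lra.
have hT : \sum_(i | i \notin S) sg i ^+ 2 <= A * J%:R `^ (1 - 2 * a) * (2 * expR (a * e) / (2 * a - 1)) + 2 * (J ^ 2)%:R `^ (1 - 2 * a) / (2 * a - 1).
  pose h (t : nat) := if (t <= J)%N then 0 else if (t <= J ^ 2)%N then expR (a * e) * (A * t%:R `^ (- (2 * a))) else t%:R `^ (- (2 * a)).
  have h0 t : 0 <= h t.
    by rewrite /h; repeat case: ifP => _; rewrite ?lexx ?powR_ge0// mulr_ge0 ?expR_ge0// mulr_ge0 ?powR_ge0// ltW.
  apply: (@le_trans _ _ (\sum_(k < N) h (fold N k))).
    rewrite big_mkcond/=; apply: ler_sum => i _; rewrite inE sg2 /h.
    case: leqP => Ji; first exact: lexx.
    have i0 : (0 < fold N i)%N by apply: leq_ltn_trans Ji.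
    case: leqP => iK; first by apply: vK; rewrite i0.
    by apply: v_le => //; exact: fold_le2.
  apply: (le_trans (sum_fold_le N h0)); rewrite {1}/h/= add0r.
  have -> : A * J%:R `^ (1 - 2 * a) * (2 * expR (a * e) / (2 * a - 1)) = 2 * (expR (a * e) * (A * (J%:R `^ (1 - 2 * a) / (2 * a - 1)))) by ring.
  rewrite -[2 * _ / _]mulrA.
  rewrite -mulrDr ler_wpM2l// (big_cat_nat (n := (J ^ 2).+1))//=; last by apply: leq_ltn_trans JN; rewrite leq_pmull.
  rewrite (big_cat_nat (n := J.+1))//= [X in X + _ + _]big_nat [X in X + _ + _]big1 ?add0r; last first.
    by move=> i /andP[_ iJ]; rewrite /h -ltnS iJ.
  apply: lerD.
    apply: le_trans (ler_wpM2l (expR_ge0 _) (ler_wpM2l (ltW A0) (@sum_tail J (J ^ 2).+1 J0))).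
    rewrite !mulr_sumr !big_nat; apply: ler_sum => i /andP[iJ iK]; rewrite /h leqNgt iJ/=.
    by rewrite -ltnS iK.
  apply: le_trans (@sum_tail (J ^ 2) N _); last by rewrite expn_gt0 J0.
  rewrite !big_nat; apply: ler_sum => i /andP[iK _]; rewrite /h leqNgt (leq_ltn_trans JK iK)/=.
  by rewrite leqNgt iK.
apply: ach_weak (ach_upper He sg0 th0 thS dl01).
  rewrite lerD2r; apply: lerD hI _.
  by rewrite ler_wpM2l// mulr_ge0// ltW.
have k0 := kap_gt0 dl01.
have X1 : (1 + dl) * #|S|%:R * th <= A * J%:R `^ (1 - 2 * a) * ((1 + dl) * (2 + J%:R^-1)).
  apply: (@le_trans _ _ ((1 + dl) * (2 * J).+1%:R * (A * J%:R `^ (- (2 * a))))).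
    rewrite ler_pM ?(ltW th0) ?mulr_ge0 ?ler_wpM2l// addr_ge0 ?(ltW d0)//.
  rewrite -Jb -natr1 natrM le_eqVlt; apply/orP; left; apply/eqP; field; exact: lt0r_neq0.
have X3 : 67 * expR (- (kap dl * #|S|%:R / 2)) * \sum_i sg i ^+ 2 <= 67 * expR (- (kap dl * J%:R)) * spec_mass.
  have sE : \sum_i sg i ^+ 2 = \sum_(k < N) v k by apply: eq_bigr => i _; rewrite sqr_sqrtr ?ltW.
  rewrite sE ler_pM ?mulr_ge0 ?expR_ge0 ?sumr_ge0 ?spec_mass_ge//; first by move=> i _; exact: ltW.
  rewrite ler_wpM2l// ler_expR lerN2 -mulrA ler_wpM2l ?(ltW k0)// ler_pdivlMr//.
  by rewrite mulrC -natrM.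
by rewrite mulrDr; apply: lerD X3; rewrite -addrA; apply: lerD X1 hT.
Qed.

End circulant_upper.

Lemma ach_eq {R : realType} d (Omega : measurableType d) (P : probability Omega R) N
    (V W : 'I_N -> Omega -> R) (L D : R) :
  (forall i w, W i w = V i w) -> ach P V L D -> ach P W L D.
Proof. by move=> E; have -> : W = V by apply/funext => i; apply/funext => w. Qed.

Lemma ach_rows {R : realType} d (Omega : measurableType d) (P : probability Omega R) N
    (A : 'I_N -> 'I_N -> R) (xi : 'I_N -> Omega -> R) (r : 'I_N -> R) (k L D : R) :
  std_gauss P xi -> (forall i, 0 <= r i <= k) -> ach P (lmap A xi) L D ->
  ach P (lmap (fun i l => r i * A i l) xi) L (k ^+ 2 * D).
Proof.
move=> H rk; apply: (ach_lip (F := fun x i => r i * x i)).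
- by apply: measurable_lmap; exact: H.1.
- by apply: measurable_lmap; exact: H.1.
- exact: sqr_ge0.
- move=> x y; rewrite /dist2 mulr_sumr; apply: ler_sum => i _.
  have /andP[r0 r1] := rk i.
  by rewrite -mulrBr exprMn ler_wpM2r ?sqr_ge0// lerXn2r ?nnegrE// (le_trans r0).
by move=> w i; rewrite /lmap mulr_sumr; apply: eq_bigr => l _; rewrite mulrA.
Qed.

Definition TN {R : realType} (a : R) n (i l : 'I_n.+1) : R :=
  n.+1%:R `^ (- a) * (if (l <= i)%N then wc a (i - l) else 0).

Definition TZN {R : realType} (a c : R) n (i l : 'I_n.+1) : R := n.+1%:R `^ (- a) * TZ a (damp n c) i l.

(** * The wrapped terms and the removal of the damping *)

Section damping.
Context {R : realType}.
Variables (a c : R) (n : nat).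
Hypotheses (a2 : 2^-1 < a) (c0 : 0 < c) (c1 : c <= 1).
Notation N := n.+1.
Notation q := (damp n c).

Let a0 : 0 < a. Proof. by apply: lt_trans a2. Qed.
Let q01 : 0 < q < 1 := damp01 n c0.
Let q0 : 0 < q. Proof. by have /andP[] := q01. Qed.
Let q1 : q <= 1. Proof. by have /andP[_ /ltW] := q01. Qed.

Lemma damp_inv (i : 'I_N) : q ^- i <= expR c.
Proof.
rewrite /damp -expRM_natl -expRN ler_expR mulrN opprK.
rewrite mulrCA -[leRHS]mulr1 ler_wpM2l ?(ltW c0)// ler_pdivrMr// mul1r ler_nat ltnW//.
Qed.

Lemma fds_scale s (k : R) (f : nat -> R) i : fds s (fun i => k * f i) i = k * fds s f i.
Proof.
elim: s f i => [//|s IH] f i; rewrite /fds !iterSr.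
rewrite -[LHS]/(fds s _ i) -[in RHS]/(fds s _ i) -IH; congr (fds s _ i).
by apply/funext => j; rewrite /fd mulrBr.
Qed.

(** [ach_smooth] is applied to the rows of [Hm] without q^i, which would spoil their differences;
    q^i <= 1 is restored afterwards as a factor on the rows. [kappa] dominates all orders up to 2p
    and is independent of N thanks to [spec_mass]. *)
Lemma fold_ach d (Omega : measurableType d) (P : probability Omega R) (xi : 'I_N -> Omega -> R) p l kappa :
  std_gauss P xi -> (0 < p)%N -> 2 <= l ->
  kappa = (\sum_(s < (2 * p).+1) fdK a s ^+ 2) * (expR c ^+ 2 * spec_mass a c) ->
  ach P (lmap (fun i j : 'I_N => N%:R `^ (- a) * (q ^+ i * Hm a q i j)) xi) 
    ((2 * p)%:R * (4 * p + 1)%:R * (8 * p + 9)%:R * l ^+ 3)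
    ((2 * ((2 * p)%:R * (4 * p + 1)%:R) ^+ 2 * (1 + 128 * kappa ^+ 2) +
           2 * kappa * (2 ^+ (4 * p) + 1)) / l ^+ (4 * p)).
Proof.
move=> H p0 l2 kE.
have sm0 : 0 <= spec_mass a c.
  by apply: le_trans (spec_mass_ge n a2 c0 c1); apply: sumr_ge0 => k _; exact: powR_ge0.
have k0 : 0 <= kappa.
  rewrite kE !mulr_ge0 ?sqr_ge0//; apply: sumr_ge0 => s _; exact: sqr_ge0.
pose U (i : nat) (j : 'I_N) := N%:R `^ (- a) * Hm a q i j.
have hU s (i : 'I_N) : (s <= 2 * p)%N -> \sum_j fds s (U ^~ j) i ^+ 2 <= kappa / N%:R / i.+1%:R ^+ (2 * s).
  move=> sp; rewrite (eq_bigr (fun j => (N%:R `^ (- a)) ^+ 2 * fds s ((Hm a q)^~ j) i ^+ 2)); last first.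
    by move=> j _; rewrite fds_scale exprMn.
  rewrite -mulr_sumr; apply: (le_trans (ler_wpM2l (sqr_ge0 _) (fds_Hm_row a0 q01 s (damp_inv i)))).
  have -> : (N%:R `^ (- a)) ^+ 2 * ((fdK a s / i.+1%:R ^+ s) ^+ 2 * (expR c ^+ 2 * ((\sum_(k < N) lam a n q k) / N%:R)))
     = (fdK a s ^+ 2 * (expR c ^+ 2 * ((N%:R `^ (- a)) ^+ 2 * (\sum_(k < N) lam a n q k)))) / N%:R / i.+1%:R ^+ (2 * s).
    have e1 : (0 : R) < i.+1%:R ^+ s by rewrite exprn_gt0.
    by rewrite mulnC exprM; move: e1; set z := i.+1%:R ^+ s => e1; field; rewrite !gt_eqF.
  rewrite !ler_wpM2r ?invr_ge0 ?exprn_ge0// kE ler_pM ?sqr_ge0//.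
  - rewrite mulr_ge0 ?sqr_ge0// mulr_ge0 ?sqr_ge0//; apply: sumr_ge0 => k _; by rewrite ltW// lam_gt0.
  - rewrite (bigD1 (Ordinal (sp : (s < (2 * p).+1)%N)))//= lerDl; apply: sumr_ge0 => *; exact: sqr_ge0.
  rewrite ler_wpM2l ?sqr_ge0// mulr_sumr; apply: le_trans (spec_mass_ge n a2 c0 c1).
  by rewrite le_eqVlt; apply/orP; left; apply/eqP; apply: eq_bigr => k _; rewrite lam_scaled.
have := ach_smooth H p0 l2 k0 hU.
move/(ach_rows (r := fun i => q ^+ i) (k := 1) H).
rewrite expr1n mul1r => h.
apply: (ach_eq _ (h _)) => [i w|i]; last by rewrite exprn_ge0 ?(ltW q0)//= exprn_ile1// ltW.
by rewrite /lmap; apply: eq_bigr => j _; rewrite /U; ring.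
Qed.

Lemma TZN_split (i j : 'I_N) : CN a c i j = TZN a c i j + N%:R `^ (- a) * (q ^+ i * Hm a q i j).
Proof. by rewrite /CN circ_split// mulrDr. Qed.

(** The damped matrix is diag(q^i) T diag(q^(-l)). Column factors above 1 are outside the scope of
    [ach_noise], so q^(-n) is moved from the columns to the rows: the columns get q^(n-l) <= 1 and
    the rows q^(i-n) <= exp(c). *)
Lemma ach_TZN d (Omega : measurableType d) (P : probability Omega R) (xi : 'I_N -> Omega -> R) L D D' :
  std_gauss P xi -> D < D' -> ach P (lmap (@TN _ a n) xi) L D ->
  ach P (lmap (@TZN _ a c n) xi) L (expR (2 * c) * D').
Proof.
move=> H DD h.
have hq (l : 'I_N) : 0 <= q ^+ (n - l) <= 1.
  by rewrite exprn_ge0 ?(ltW q0)//= exprn_ile1// ltW.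
have rk (i : 'I_N) : 0 <= q ^+ i * q ^- n <= expR c.
  rewrite mulr_ge0 ?exprn_ge0 ?invr_ge0 ?exprn_ge0 ?(ltW q0)//=.
  rewrite -[leRHS]mul1r ler_pM ?exprn_ge0 ?invr_ge0 ?exprn_ge0 ?(ltW q0)//.
    by rewrite exprn_ile1// ltW.
  exact: (damp_inv ord_max).
have := ach_rows (r := fun i => q ^+ i * q ^- n) H rk (ach_noise H hq DD h).
rewrite -expRM_natl; apply: ach_eq => i w; rewrite /lmap; apply: eq_bigr => l _; congr (_ * _).
rewrite /TZN /TN /TZ; case: leqP => li; last by rewrite !mulr0 mul0r mulr0.
have -> : q ^+ (i - l) = q ^+ i / q ^+ l by rewrite expfB_cond ?gt_eqF//.
have -> : q ^+ (n - l) = q ^+ n / q ^+ l.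
  by rewrite exprB ?unitfE ?gt_eqF// -ltnS.
have [z0 z1] : 0 < q ^+ n /\ 0 < q ^+ l by split; rewrite exprn_gt0.
by field; rewrite !gt_eqF.
Qed.

(** In this direction the column factors q^l are at most 1 as they stand, and the row factors q^(-i)
    are at most exp(c). *)
Lemma ach_TN d (Omega : measurableType d) (P : probability Omega R) (xi : 'I_N -> Omega -> R) L D D' :
  std_gauss P xi -> D < D' -> ach P (lmap (@TZN _ a c n) xi) L D ->
  ach P (lmap (@TN _ a n) xi) L (expR (2 * c) * D').
Proof.
move=> H DD h.
have hq (l : 'I_N) : 0 <= q ^+ l <= 1.
  by rewrite exprn_ge0 ?(ltW q0)//= exprn_ile1// ltW.
have rk (i : 'I_N) : 0 <= q ^- i <= expR c.
  by rewrite invr_ge0 exprn_ge0 ?(ltW q0)//= damp_inv.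
have := ach_rows (r := fun i => q ^- i) H rk (ach_noise H hq DD h).
rewrite -expRM_natl; apply: ach_eq => i w; rewrite /lmap; apply: eq_bigr => l _; congr (_ * _).
rewrite /TZN /TN /TZ; case: leqP => li; last by rewrite !mulr0 mul0r mulr0.
have -> : q ^+ (i - l) = q ^+ i / q ^+ l by rewrite expfB_cond ?gt_eqF//.
have [z0 z1] : 0 < q ^+ i /\ 0 < q ^+ l by split; rewrite exprn_gt0.
by field; rewrite !gt_eqF.
Qed.

End damping.

(** Water-filling for variances (2 pi k)^(-2a), each taken twice, at the level of frequency J: the
    rate is the sum over k <= J of 2a ln(J/k), about 2 a J, and the distortion is about (2 pi)^(-2a)
    J^(1-2a) (2 + 2/(2a - 1)). Inserting J = L/(2a) gives [qcst a] times L^(1-2a). *)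
Definition qcst {R : realType} (a : R) : R :=
  (2 * pi) `^ (- (2 * a)) * (2 * a) `^ (2 * a - 1) * (2 * (2 * a) / (2 * a - 1)).

(** * Limits for the circulant matrix *)

Section circulant_asymptotics.
Context {R : realType}.
Variables (a c : R).
Hypotheses (a2 : 2^-1 < a) (c0 : 0 < c) (c1 : c <= 1).

Let a0 : 0 < a. Proof. by apply: lt_trans a2. Qed.
Let b1 : 1 < 2 * a. Proof. by have := a2; lra. Qed.
Let b10 : 0 < 2 * a - 1. Proof. by have := a2; lra. Qed.
Let A := (2 * pi) `^ (- (2 * a)) : R.
Let A0 : 0 < A. Proof. by rewrite powR_gt0// mulr_gt0// pi_gt0. Qed.

Lemma qcst_gt0 : 0 < qcst a.
Proof. by rewrite mulr_gt0 ?divr_gt0 ?mulr_gt0// powR_gt0// mulr_gt0. Qed.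

Lemma powR_small (s e : R) : 0 < s -> 0 < e -> exists2 x0, 1 <= x0 & forall x, x0 <= x -> x `^ (- s) <= e.
Proof.
move=> s0 e0; exists (Num.max 1 (e `^ (- s^-1))); first by rewrite le_max lexx.
move=> x; rewrite ge_max => /andP[x1 xe].
apply: (@le_trans _ _ ((e `^ (- s^-1)) `^ (- s))).
  by apply: powRN_le; [exact: ltW|exact: powR_gt0|].
by rewrite -powRrM mulrNN mulVf ?gt_eqF// powRr1// ltW.
Qed.

Lemma expRN_ge (e : R) : 0 <= e <= 2^-1 -> expR (- (2 * e)) <= 1 - e.
Proof.
move=> /andP[e0 e1]; rewrite expRN -[leRHS]invrK lef_pV2 ?posrE ?expR_gt0 ?invr_gt0//; last by lra.
apply: le_trans (expR_ge1Dx _); rewrite -[leLHS]mul1r ler_pdivrMr; last by lra.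
have := mulr_ge0 e0 (_ : 0 <= 1 - 2 * e); rewrite subr_ge0 => /(_ _); nra.
Qed.

(** A single parameter [e] controls the Chernoff deviation, the defect of the symbol and the
    remainders. J is large depending on e and c, and n is large depending on J. *)
Lemma circ_upper_freq (e : R) : 0 < e <= 2^-1 ->
  exists x0 : R, forall J : nat, x0 <= J%:R -> exists N0 : nat, forall n : nat, (N0 <= n)%N ->
  forall d (Omega : measurableType d) (P : probability Omega R) (xi : 'I_n.+1 -> Omega -> R),
  std_gauss P xi -> ach P (lmap (@CN _ a c n) xi) ((2 * a + (a + 5) * e) * J%:R)
    (A * J%:R `^ (1 - 2 * a) * ((1 + e) * (2 + e) + 2 * expR (a * e) / (2 * a - 1) + 2 * e)).
Proof.
move=> /andP[e0 e1].
have dl : 0 < e < 1 by lra.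
set C0 := a * ln (4 + 4 * (2 * pi) ^+ 2 / c ^+ 2) / 2.
have C00 : 0 <= C0.
  have w0 : 0 <= 4 * (2 * pi) ^+ 2 / c ^+ 2 :> R by rewrite divr_ge0 ?sqr_ge0// mulr_ge0 ?sqr_ge0.
  rewrite divr_ge0// mulr_ge0 ?(ltW a0)// ln_ge0//; move: w0; set z := _ / _; lra.
have C1p : 0 <= a + C0 + 5 by have := ltW a0; lra.
have [x1 x11 h1] := lin_dom C1p e0.
have k0 := kap_gt0 dl.
have sm0 : 0 < spec_mass a c.
  by rewrite ltr_wpDr ?powR_gt0 ?divr_gt0 ?exprn_gt0// mulr_ge0// addr_ge0// invr_ge0 ltW.
set m := 67 * spec_mass a c / (A * e).
have m0 : 0 < m by rewrite divr_gt0 ?mulr_gt0.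
have C2p : 0 <= `|ln m| + (2 * a - 1) by rewrite addr_ge0// ltW.
have [x2 x21 h2] := lin_dom C2p k0.
have e3 : 0 < e * A * (2 * a - 1) / 2 by rewrite divr_gt0 ?mulr_gt0.
have [x3 x31 h3] := powR_small b10 e3.
exists (Num.max x1 (Num.max x2 (Num.max x3 e^-1))) => J.
rewrite !ge_max => /and4P[J1 J2 J3 J4].
have JR : (1 : R) <= J%:R by apply: le_trans J1.
have JR0 : (0 : R) < J%:R by apply: lt_le_trans JR.
have J0 : (0 < J)%N by rewrite -(ltr0n R).
have lJ : 0 <= ln J%:R :> R by exact: ln_ge0.
pose y : R := (pi * (J ^ 2)%:R) ^+ 2.
have y0 : 0 <= y by exact: sqr_ge0.
have d0 : 0 < 1 - expR (- e) by rewrite subr_gt0 expR_lt1 oppr_lt0.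
(* The second summand makes (1 + y)/N at most 1 - exp(-e), from which the requirement of
   [circ_upper] on the symbol follows. *)
exists (2 * J ^ 2 + (Num.truncn ((1 + y) / (1 - expR (- e)))).+1)%N => n nN d Omega P xi H.
have N1 : (2 * J ^ 2 < n.+1)%N by rewrite ltnS (leq_trans _ nN)// leq_addr.
have N2 : (1 + y) / (1 - expR (- e)) <= n.+1%:R.
  apply: ltW; apply: lt_le_trans (truncnS_gt _) _.
  by rewrite ler_nat (leq_trans _ (leqnSn n))// (leq_trans _ nN)// leq_addl.
have NR : (0 : R) < n.+1%:R by [].
have N3 : (1 : R) <= n.+1%:R by rewrite ler1n.
have HN : expR (- e) <= (1 - n.+1%:R^-1) * (1 - (pi * (J ^ 2)%:R / n.+1%:R) ^+ 2).
  rewrite expr_div_n -/y.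
  have i0 : 0 < (n.+1%:R : R)^-1 by rewrite invr_gt0.
  have i1 : (n.+1%:R : R)^-1 <= 1 by rewrite invf_le1.
  have hy : y / n.+1%:R ^+ 2 <= y * n.+1%:R^-1.
    rewrite ler_wpM2l// expr2 invfM ler_piMr// ltW//.
  have hz : (1 + y) * n.+1%:R^-1 <= 1 - expR (- e).
    by rewrite ler_pdivrMr// -ler_pdivrMl// mulrC.
  have hw : 0 <= y / n.+1%:R ^+ 2 by rewrite divr_ge0// sqr_ge0.
  have := mulr_ge0 (ltW i0) hw.
  move: hw hy hz; set w := y / _ ^+ 2; set z := (n.+1%:R)^-1; move: (expR _) => E; nra.
have := circ_upper a2 c0 c1 H J0 N1 (ltW e0) dl HN.
rewrite -/A; apply: ach_weak.
  have := h1 _ J1.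
  rewrite -/C0 -[(2 * J).+1%:R]natr1 natrM.
  have := mulr_ge0 (addr_ge0 C00 (ler0n R 5)) lJ.
  move: (ln (J%:R : R)) (J%:R : R) => l j; lra.
have JP : J%:R `^ (1 - 2 * a) = J%:R `^ (- (2 * a - 1)) :> R by congr (_ `^ _); ring.
have p0 : 0 < J%:R `^ (1 - 2 * a) :> R by rewrite powR_gt0.
have D2 : 2 * (J ^ 2)%:R `^ (1 - 2 * a) / (2 * a - 1) <= A * J%:R `^ (1 - 2 * a) * e.
  rewrite natrX expr2 powRM// ler_pdivrMr//.
  have := ler_wpM2l (ltW p0) (h3 _ J3); rewrite -JP.
  move: (J%:R `^ _) => p; lra.
have D3 : 67 * expR (- (kap e * J%:R)) * spec_mass a c <= A * J%:R `^ (1 - 2 * a) * e.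
  have -> : 67 * expR (- (kap e * J%:R)) * spec_mass a c = expR (- (kap e * J%:R)) * m * (A * e).
    by rewrite /m; field; rewrite !gt_eqF.
  rewrite [leRHS](_ : _ = J%:R `^ (1 - 2 * a) * (A * e)); last by ring.
  apply: ler_wpM2r; first by rewrite ltW// mulr_gt0.
  rewrite -{1}(lnK (x := m))// -expRD -[leRHS]lnK ?posrE// ler_expR ln_powR.
  have := h2 _ J2; have := ler_norm (ln m); have := mulr_ge0 (normr_ge0 (ln m)) lJ.
  have := b10; move: (ln (J%:R : R)) (J%:R : R) (ln m) `|ln m| (kap e) => l j lm lm' k; lra.
have D1 : J%:R^-1 <= e by rewrite invf_ple// posrE.
have D1' : A * J%:R `^ (1 - 2 * a) * ((1 + e) * (2 + J%:R^-1)) <= A * J%:R `^ (1 - 2 * a) * ((1 + e) * (2 + e)).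
  apply: ler_wpM2l; first by rewrite ltW// mulr_gt0.
  by rewrite ler_wpM2l ?lerD2l// addr_ge0// ltW.
rewrite -/A in D1' *; move: D1' D2 D3 p0.
set p := A * _; set X1 := (1 + e) * _; set X2 := (1 + e) * _; set Y := _ / (2 * a - 1); set Z := _ / (2 * a - 1); set W := 67 * _ * _.
move=> D1' D2 D3 _; rewrite !mulrDr.
lra.
Qed.

Lemma powR_divN (x y s : R) : 0 < x -> 0 < y -> (x / y) `^ (- s) = y `^ s * x `^ (- s).
Proof.
move=> x0 y0; rewrite powRM ?invr_ge0 ?(ltW x0) ?(ltW y0)// mulrC; congr (_ * _).
by rewrite -powR_inv1 ?(ltW y0)// -powRrM mulrNN mul1r.
Qed.

Let ta0 : 0 < 2 * a. Proof. by rewrite mulr_gt0. Qed.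

Lemma expRX_le (C e : R) : 0 < C -> 0 < e -> exists2 t, 0 < t <= 2^-1 & expR (C * t) <= 1 + e.
Proof.
move=> C0 e0; have l0 : 0 < ln (1 + e) by rewrite ln_gt0// ltrDl.
exists (Num.min 2^-1 (ln (1 + e) / C)).
  by rewrite lt_min ge_min lexx/= invr_gt0 ltr0n divr_gt0.
rewrite -[leRHS]lnK ?posrE ?addr_gt0// ler_expR mulrC -ler_pdivlMr//.
by rewrite ge_min lexx orbT.
Qed.

(** J is the largest integer whose rate (2a + (a + 5) e) J fits into L. Every loss is bounded by an
    exponential of a multiple of e, so that they combine into one factor, which [expRX_le] makes at
    most 1 + eps. *)
Lemma CN_upper (eps : R) : 0 < eps -> exists L0 : R, forall L, L0 <= L -> exists N0 : nat, forall n : nat, (N0 <= n)%N ->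
  forall d (Omega : measurableType d) (P : probability Omega R) (xi : 'I_n.+1 -> Omega -> R),
  std_gauss P xi -> ach P (lmap (@CN _ a c n) xi) L ((1 + eps) * (qcst a * L `^ (1 - 2 * a))).
Proof.
move=> eps0; set B := 2 * a - 1; have B0 : 0 < B := b10.
have a7 : 0 < a + 7 by have := a0; lra.
have C0 : 0 < (a + 3) + B * (a + 7) by have := mulr_gt0 B0 a7; have := a0; lra.
have [e /andP[e0 e1] eE] := expRX_le C0 eps0.
have e01 : 0 < e <= 2^-1 by rewrite e0.
have [x0 hx] := circ_upper_freq e01.
set A' := 2 * a + (a + 5) * e.
have A'0 : 0 < A'.
  have a5 : 0 < a + 5 by have := a0; lra.
  by have := mulr_gt0 a5 e0; have := a0; rewrite /A'; lra.
have ei : 0 < e^-1 by rewrite invr_gt0.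
exists (A' * (Num.max x0 1 + 1 + e^-1)) => L hL.
have y0 : Num.max x0 1 + 1 + e^-1 <= L / A' by rewrite ler_pdivlMr// mulrC.
have m1 : x0 <= Num.max x0 1 by rewrite le_max lexx.
have m2 : 1 <= Num.max x0 1 by rewrite le_max lexx orbT.
have L0 : 0 < L / A' by apply: lt_le_trans y0; move: (Num.max _ _) m2 => z z1; lra.
have LL : 0 < L by move: L0; rewrite pmulr_lgt0// invr_gt0.
set J := Num.truncn (L / A').
have /andP[J1 J2] : J%:R <= L / A' < J.+1%:R by apply: truncn_itv; exact: ltW.
have J3 : L / A' - 1 <= J%:R by rewrite lerBlDr natr1 ltW.
have xJ : x0 <= J%:R by apply: le_trans J3; move: (Num.max _ _) m1 m2 y0 => z; lra.
have [N0 hN] := hx J xJ.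
exists N0 => n nN d Omega P xi H.
apply: ach_weak (hN n nN d Omega P xi H); first by rewrite mulrC -ler_pdivlMr.
have JP (x : R) : x `^ (1 - 2 * a) = x `^ (- B) by congr (_ `^ _); rewrite /B; ring.
have j0 : 0 < L / (2 * a) * expR (- ((a + 7) * e)) by rewrite mulr_gt0 ?expR_gt0// divr_gt0// mulr_gt0.
have JL : L / (2 * a) * expR (- ((a + 7) * e)) <= J%:R.
  apply: (@le_trans _ _ (L / A' * (1 - e))); last first.
    apply: le_trans J3; rewrite mulrBr mulr1 lerD2l lerN2 -ler_pdivrMr// mul1r.
    by apply: le_trans y0; rewrite lerDr ltW//; move: (Num.max _ _) m2 => z; lra.
  rewrite -!mulrA ler_wpM2l ?(ltW LL)//.
  have -> : - ((a + 7) * e) = - ((a + 5) * e) + - (2 * e) by ring.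
  rewrite expRD mulrA; apply: ler_pM; rewrite ?expR_ge0//; last first.
  - by rewrite expRN_ge// (ltW e0).
  2: by rewrite mulr_ge0 ?expR_ge0// invr_ge0 ltW.
  rewrite expRN -invfM lef_pV2 ?posrE ?A'0 ?(mulr_gt0 ta0 (expR_gt0 _))// mulrC.
  apply: (@le_trans _ _ ((1 + (a + 5) * e) * (2 * a))).
    have a5 : 0 < a + 5 by have := a0; lra.
    have := mulr_gt0 B0 (mulr_gt0 a5 e0); rewrite /A' /B; lra.
  by rewrite ler_wpM2r ?(ltW ta0)// expR_ge1Dx.
have X1 : J%:R `^ (1 - 2 * a) <= (2 * a) `^ B * L `^ (- B) * expR (B * (a + 7) * e).
  rewrite JP; apply: (le_trans (powRN_le (ltW B0) j0 JL)).
  rewrite (powRM _ (ltW (divr_gt0 LL ta0)) (expR_ge0 _)) powR_divN// -expRM mulrNN.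
  by rewrite [(a + 7) * e * B]mulrC mulrA.
have X2 : (1 + e) * (2 + e) + 2 * expR (a * e) / B + 2 * e <= (2 + 2 / B) * expR ((a + 3) * e).
  have f1 := expR_ge1Dx e.
  have f2 : expR (a * e) <= expR ((a + 3) * e) by rewrite ler_expR ler_wpM2r ?(ltW e0)// lerDl.
  have f3 : expR e ^+ 3 <= expR ((a + 3) * e).
    by rewrite -expRM_natl ler_expR ler_wpM2r ?(ltW e0)// lerDr ltW.
  have f4 : (1 + e) ^+ 3 <= expR e ^+ 3 by rewrite lerXn2r ?nnegrE ?expR_ge0// addr_ge0// ltW.
  have f5 : expR (a * e) / B <= expR ((a + 3) * e) / B by rewrite ler_wpM2r ?invr_ge0 ?(ltW b10).
  have f6 : (1 + e) * (2 + e) + 2 * e <= 2 * (1 + e) ^+ 3.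
    rewrite -subr_ge0 (_ : _ - _ = e + 5 * e ^+ 2 + 2 * e ^+ 3); last by ring.
    by rewrite !addr_ge0 ?mulr_ge0 ?exprn_ge0 ?ltW.
  have := le_trans f4 f3; move: f5 f6; rewrite (mulrDl 2).
  have -> : 2 * expR (a * e) / B = 2 * (expR (a * e) / B) by rewrite mulrA.
  have -> : 2 / B * expR ((a + 3) * e) = 2 * (expR ((a + 3) * e) / B) by ring.
  move: (expR (a * e) / B) (expR ((a + 3) * e) / B) (expR ((a + 3) * e)) ((1 + e) ^+ 3) ((1 + e) * (2 + e)) => *; lra.
apply: (@le_trans _ _ (A * ((2 * a) `^ B * L `^ (- B) * expR (B * (a + 7) * e)) * ((2 + 2 / B) * expR ((a + 3) * e)))).
  rewrite ler_pM//; first by rewrite mulr_ge0 ?powR_ge0// ltW.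
    have g1 : 0 <= (1 + e) * (2 + e) by rewrite mulr_ge0// addr_ge0// ltW.
    have g2 : 0 <= 2 * expR (a * e) / (2 * a - 1) by apply: divr_ge0; [rewrite mulr_ge0 ?expR_ge0|exact: ltW].
    have g3 : 0 <= 2 * e by rewrite mulr_ge0// ltW.
    exact: addr_ge0 (addr_ge0 g1 g2) g3.
  by rewrite ler_wpM2l// ltW.
have -> : A * ((2 * a) `^ B * L `^ (- B) * expR (B * (a + 7) * e)) * ((2 + 2 / B) * expR ((a + 3) * e))
   = expR (((a + 3) + B * (a + 7)) * e) * (qcst a * L `^ (- B)).
  rewrite /qcst -/A -/B.
  have -> : ((a + 3) + B * (a + 7)) * e = B * (a + 7) * e + (a + 3) * e by ring.
  have -> : 2 * (2 * a) / B = 2 + 2 / B by rewrite /B; field; rewrite gt_eqF.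
  by rewrite expRD; ring.
by rewrite JP ler_wpM2r// mulr_ge0 ?powR_ge0// ltW// qcst_gt0.
Qed.

(** J is the first integer above L/(2a), as 2 L <= 4 a J demands. The losses are linear in e: B e
    from rounding J, and (a + 2) e from the bracket in [circ_lower]; their sum dictates the choice
    of e. *)
Lemma CN_lower (eps : R) : 0 < eps -> exists L0 : R, forall L, L0 <= L -> exists N0 : nat, forall n : nat, (N0 <= n)%N ->
  forall d (Omega : measurableType d) (P : probability Omega R) (xi : 'I_n.+1 -> Omega -> R) D,
  std_gauss P xi -> ach P (lmap (@CN _ a c n) xi) L D -> (1 - eps) * (qcst a * L `^ (1 - 2 * a)) <= D.
Proof.
move=> eps0; set B := 2 * a - 1; have B0 : 0 < B := b10.
have Ba : 0 < B + a + 2 by have := a0; move: B0; lra.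
pose e := Num.min 1 eps / (B + a + 2).
have e0 : 0 < e by rewrite divr_gt0// lt_min ltr01.
have eE : (B + a + 2) * e <= eps by rewrite mulrC divfK ?gt_eqF// ge_min lexx orbT.
have e1 : (B + a + 2) * e <= 1 by rewrite mulrC divfK ?gt_eqF// ge_min lexx.
have ei : 0 < e^-1 by rewrite invr_gt0.
have [x1 x11 h1] := powR_small b10 e0.
have C80 : 0 <= 8 * a by rewrite mulr_ge0// ltW.
have [x2 x21 h2] := lin_dom C80 e0.
exists (2 * a * (x1 + x2 + e^-1)) => L hL.
have y0 : x1 + x2 + e^-1 <= L / (2 * a) by rewrite ler_pdivlMr ?mulr_gt0// mulrC.
have y1 : x1 <= L / (2 * a) by lra.
have y2 : x2 <= L / (2 * a) by lra.
have y3 : e^-1 <= L / (2 * a) by lra.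
have L0 : 0 < L / (2 * a) by lra.
have LL : 0 < L by move: L0; rewrite pmulr_lgt0// invr_gt0 mulr_gt0.
set J := (Num.truncn (L / (2 * a))).+1.
have /andP[J1 J2] : (Num.truncn (L / (2 * a)))%:R <= L / (2 * a) < J%:R by apply: truncn_itv; exact: ltW.
have J3 : J%:R <= L / (2 * a) * (1 + e).
  rewrite /J -natr1 mulrDr mulr1 lerD// -ler_pdivrMr// mul1r//.
have JR : (1 : R) <= J%:R by rewrite ler1n.
have J0 : (0 : R) < J%:R by [].
exists (2 * J ^ 2)%N => n nN d Omega P xi D H h.
have hJ : 2 * L <= 4 * a * J%:R.
  by move: J2; rewrite ltr_pdivrMr ?mulr_gt0// => J2; lra.
have := circ_lower a2 c0 c1 H (ltn0Sn _) (nN : (2 * J ^ 2 < n.+1)%N) hJ h.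
apply: le_trans; rewrite -/A -/B.
have JP (x : R) : x `^ (1 - 2 * a) = x `^ (- B) by congr (_ `^ _); rewrite /B; ring.
rewrite !JP.
have p1 (x s : R) : 0 < x -> 0 < s -> 1 - s * x <= (1 + x) `^ (- s).
  move=> xp sp; have x10 : 0 < 1 + x by rewrite addr_gt0.
  rewrite /powR gt_eqF//; apply: le_trans (expR_ge1Dx _).
  rewrite lerD2l mulNr lerN2 ler_wpM2l ?(ltW sp)// le_ln1Dx// (lt_trans _ xp)//.
have X1 : (2 * a) `^ B * L `^ (- B) * (1 - B * e) <= J%:R `^ (- B).
  apply: le_trans (powRN_le (ltW b10) J0 J3).
  rewrite (powRM _ (ltW (divr_gt0 LL ta0))) ?addr_ge0 ?(ltW e0)// powR_divN//.
  by rewrite ler_wpM2l ?mulr_ge0 ?powR_ge0// p1.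
have ej : J%:R^-1 <= e.
  by rewrite invf_ple ?posrE// (le_trans y3)// ltW.
set z := 4 * a * _ / _.
have X2 : z <= e.
  rewrite /z ler_pdivrMr//.
  have := h2 J%:R (le_trans y2 (ltW J2)); have : 0 <= a * ln J%:R by rewrite mulr_ge0 ?ln_ge0// ltW.
  move: (ln (J%:R : R)) (J%:R : R) => l j; lra.
have X3 : J%:R `^ (- B) <= e by apply: h1; exact: le_trans (ltW J2).
have Be : 0 <= B * e by rewrite mulr_ge0// ltW.
have ae : 0 <= a * e by rewrite mulr_ge0// ltW.
have e1' : B * e + a * e + 2 * e <= 1 by move: e1; rewrite !mulrDl.
have X4 : 1 - a * e <= (1 + J%:R ^- 2) `^ (- a).
  apply: le_trans (@p1 _ a _ _); rewrite ?a0 ?invr_gt0 ?exprn_gt0// lerD2l lerN2 ler_wpM2l ?(ltW a0)//.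
  apply: le_trans ej; rewrite lef_pV2 ?posrE ?exprn_gt0// expr2 ler_peMr// ltW//.
have X5 : 1 - B * e <= (1 + J%:R^-1) `^ (- B).
  apply: le_trans (@p1 _ B _ _); rewrite ?B0 ?invr_gt0// lerD2l lerN2 ler_wpM2l ?(ltW B0)//.
set m := 2 * _ * _ - z.
have Bi : 0 < 1 + B^-1 by rewrite addr_gt0 ?invr_gt0.
have X6 : (2 + 2 / B) * (1 - (a + 2) * e) <= m.
  have g1 : (1 + B^-1) * (1 - e) <= 1 + ((1 + J%:R^-1) `^ (- B) - J%:R `^ (- B)) / B.
    rewrite [leLHS](_ : _ = 1 + (1 - B * e - e) / B); last by field; rewrite gt_eqF.
    by rewrite lerD2l ler_wpM2r ?invr_ge0 ?(ltW B0)// lerD// lerN2.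
  have e2 : 0 <= 1 - e by move: Be ae e0 e1'; lra.
  have ae2 : 0 <= 1 - a * e by move: Be ae e0 e1'; lra.
  have g2 : (1 - a * e) * ((1 + B^-1) * (1 - e)) <= (1 + J%:R ^- 2) `^ (- a) * (1 + ((1 + J%:R^-1) `^ (- B) - J%:R `^ (- B)) / B).
    by rewrite ler_pM// mulr_ge0// ltW.
  have g3 : 0 <= B^-1 * e by rewrite mulr_ge0 ?invr_ge0// ltW.
  have g4 : 0 <= a * e ^+ 2 * (1 + B^-1) by exact: mulr_ge0 (mulr_ge0 (ltW a0) (sqr_ge0 _)) (ltW Bi).
  rewrite /m -[2 * _ * _]mulrA.
  have -> : (2 + 2 / B) * (1 - (a + 2) * e) = 2 * ((1 - a * e) * ((1 + B^-1) * (1 - e))) - 2 * (e * (1 + B^-1)) - 2 * (a * e ^+ 2 * (1 + B^-1)) by ring.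
  move: g2 g4 g3 X2 e0; set T := (1 - a * e) * _; set U := (1 + J%:R ^- 2) `^ _ * _; set G := a * e ^+ 2 * _.
  have -> : e * (1 + B^-1) = e + B^-1 * e by ring.
  set G3 := B^-1 * e; lra.
apply: (@le_trans _ _ (A * ((2 * a) `^ B * L `^ (- B) * (1 - B * e)) * ((2 + 2 / B) * (1 - (a + 2) * e)))); last first.
  have f1 : 0 <= 1 - B * e by move: Be ae e0 e1'; lra.
  have f2 : 0 <= 1 - (a + 2) * e by rewrite mulrDl; move: Be ae e0 e1'; lra.
  rewrite ler_pM ?mulr_ge0 ?powR_ge0 ?(ltW A0)//.
    by rewrite addr_ge0// divr_ge0// ltW.
  by rewrite ler_wpM2l// ltW.
have -> : A * ((2 * a) `^ B * L `^ (- B) * (1 - B * e)) * ((2 + 2 / B) * (1 - (a + 2) * e))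
   = (1 - B * e) * (1 - (a + 2) * e) * (qcst a * L `^ (- B)).
  rewrite /qcst -/A -/B.
  have -> : 2 * (2 * a) / B = 2 + 2 / B by rewrite /B; field; rewrite gt_eqF.
  by ring.
apply: ler_wpM2r; first exact: mulr_ge0 (ltW qcst_gt0) (powR_ge0 _ _).
have : 0 <= (B * e) * ((a + 2) * e) by apply: mulr_ge0 => //; apply: mulr_ge0; [rewrite addr_ge0// ltW|exact: ltW].
have -> : (1 - B * e) * (1 - (a + 2) * e) = 1 - (B + a + 2) * e + (B * e) * ((a + 2) * e) by ring.
by move: eE; lra.
Qed.

End circulant_asymptotics.

(** * From the circulant to the triangular matrix *)

Section lower_triangular.
Context {R : realType}.
Variable a : R.
Hypothesis a2 : 2^-1 < a.

Let a0 : 0 < a. Proof. by apply: lt_trans a2. Qed.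
Let b10 : 0 < 2 * a - 1. Proof. by have := a2; lra. Qed.
Let ta0 : 0 < 2 * a. Proof. by rewrite mulr_gt0. Qed.

(** With l = (r L/C1)^(1/3) the rate is r L and the error of order L^(-4p/3); p >= 2a brings it
    below a multiple of L^(-2a), and the spare factor L absorbs the constant and t. *)
Lemma fold_small (c r t : R) : 0 < c -> c <= 1 -> 0 < r -> 0 < t -> exists L0 : R, forall L, L0 <= L -> forall n : nat,
  forall d (Omega : measurableType d) (P : probability Omega R) (xi : 'I_n.+1 -> Omega -> R),
  std_gauss P xi ->
  ach P (lmap (fun i j : 'I_n.+1 => n.+1%:R `^ (- a) * (damp n c ^+ i * Hm a (damp n c) i j)) xi) (r * L)
    (t * L `^ (1 - 2 * a)).
Proof.
move=> c0 c1 r0 t0.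
pose p := (Num.truncn (2 * a)).+1.
have pa : 2 * a <= p%:R.
  by have /andP[_ /ltW] := truncn_itv (ltW ta0).
pose kappa := (\sum_(s < (2 * p).+1) fdK a s ^+ 2) * (expR c ^+ 2 * spec_mass a c).
pose C1 : R := (2 * p)%:R * (4 * p + 1)%:R * (8 * p + 9)%:R.
pose C2 : R := 2 * ((2 * p)%:R * (4 * p + 1)%:R) ^+ 2 * (1 + 128 * kappa ^+ 2) + 2 * kappa * (2 ^+ (4 * p) + 1).
have C10 : 0 < C1 by rewrite !mulr_gt0// ltr0n// addn_gt0 orbT.
pose M := `|C2| * (C1 / r) `^ (2 * a).
have M0 : 0 <= M by rewrite mulr_ge0 ?powR_ge0.
exists (Num.max 1 (Num.max (8 * C1 / r) (M / t))) => L.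
rewrite !ge_max => /and3P[L1 L2 L3] n d Omega P xi H.
have L0 : 0 < L by lra.
pose y := r * L / C1; have y8 : 8 <= y.
  by rewrite /y ler_pdivlMr// mulrC [C1 * 8]mulrC [r * L]mulrC -ler_pdivrMr.
have y0 : 0 < y by lra.
pose l := y `^ 3^-1.
have l3 : l ^+ 3 = y by rewrite -powR_mulrn ?powR_ge0// -powRrM mulVf// powRr1// ltW.
have l2 : 2 <= l.
  rewrite -(ler_pXn2r (n := 3))// ?nnegrE ?powR_ge0// l3; apply: le_trans y8.
  by rewrite !exprS expr0; lra.
have := fold_ach (P := P) a2 c0 c1 H (ltn0Sn _) l2 (erefl kappa).
rewrite -/C1 -/C2; apply: ach_weak; first by rewrite l3 /y mulrC divfK ?gt_eqF.
have l1 : 1 <= l by lra.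
have lm (m : nat) : 3 * (2 * a) <= m%:R -> y `^ (2 * a) <= l ^+ m.
  move=> am; have l0 : 0 <= l by exact: powR_ge0.
  by rewrite -(powR_mulrn m l0) -l3 -(powR_mulrn 3 l0) -powRrM ler_powR.
have lp : y `^ (2 * a) <= l ^+ (4 * p).
  by apply: lm; rewrite natrM; have := pa; have := ta0; lra.
have yp : 0 < y `^ (2 * a) by rewrite powR_gt0.
apply: (@le_trans _ _ (`|C2| / y `^ (2 * a))).
  apply: (@le_trans _ _ (`|C2| / l ^+ (4 * p))).
    by rewrite ler_wpM2r ?ler_norm// invr_ge0 exprn_ge0// powR_ge0.
  by rewrite ler_wpM2l// lef_pV2// posrE// (lt_le_trans yp).
have yE : y = L / (C1 / r) by rewrite /y; field; rewrite !gt_eqF.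
have Cr : 0 < C1 / r by rewrite divr_gt0.
rewrite -powRN {1}yE powR_divN// mulrA -/M.
rewrite powRD ?(gt_eqF L0) ?implybT// powRr1 ?(ltW L0)// mulrA ler_wpM2r ?powR_ge0//.
by rewrite mulrC -ler_pdivrMr.
Qed.

(** The same small e serves as the damping parameter, as the share of the rate spent on the wrapped
    terms and as the weight in [ach_add]. The wrapped error is made e^2 qcst, so that the factor 1 +
    1/e turns it into e + e^2. *)
Lemma TN_upper (eps : R) : 0 < eps -> exists L0 : R, forall L, L0 <= L -> exists N0 : nat, forall n : nat, (N0 <= n)%N ->
  forall d (Omega : measurableType d) (P : probability Omega R) (xi : 'I_n.+1 -> Omega -> R),
  std_gauss P xi -> ach P (lmap (@TN _ a n) xi) L ((1 + eps) * (qcst a * L `^ (1 - 2 * a))).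
Proof.
move=> eps0; set B := 2 * a - 1; have B0 : 0 < B := b10.
have C0 : 0 < 7 + 2 * B by move: B0; lra.
have [e /andP[e0 e1] eE] := expRX_le C0 eps0.
have eR : e <= 1 by move: e1; lra.
have [L1 h1] := CN_upper a2 e0 eR e0.
have q0 := qcst_gt0 a2.
have t0 : 0 < e ^+ 2 * qcst a by rewrite mulr_gt0// exprn_gt0.
have [L2 h2] := fold_small e0 eR e0 t0.
exists (Num.max 1 (Num.max (2 * L1) (Num.max L1 L2))) => L.
rewrite !ge_max => /and4P[Lp L3 L3' L4].
have LL : 0 < L by lra.
have Le : L1 <= (1 - e) * L.
  apply: (@le_trans _ _ (2^-1 * L)); first by lra.
  by rewrite ler_wpM2r ?(ltW LL)//; move: e1; lra.
have [N0 hN] := h1 _ Le.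
exists N0 => n nN d Omega P xi H.
have H1 := hN n nN _ _ _ _ H.
have H2 := h2 L L4 n _ _ _ _ H.
set Y := qcst a * L `^ (1 - 2 * a).
have Y0 : 0 < Y by rewrite mulr_gt0// powR_gt0.
have mCN : mvec (lmap (@CN _ a e n) xi) by apply: measurable_lmap; exact: H.1.
set S := fun i j : 'I_n.+1 => _ in H2.
have mS : mvec (lmap S xi) by apply: measurable_lmap; exact: H.1.
have mS' : mvec (fun i w => -1 * lmap S xi i w).
  by move=> i; apply: measurable_funM => //; exact: mS.
have H2' := ach_scale mS mS' (fun i w => erefl) H2.
have := ach_add mCN mS' e0 H1 H2'.
have -> : (1 - e) * L + e * L = L by ring.
move=> H3.
have {}H3 : ach P (lmap (@TZN _ a e n) xi) L (expR ((4 + 2 * B) * e) * Y).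
  apply: ach_eq (ach_weak (lexx _) _ H3) => [i w|].
    rewrite /lmap mulr_sumr -big_split/=; apply: eq_bigr => j _.
    by rewrite (TZN_split a2 e0) /S; ring.
  have JP (x : R) : x `^ (1 - 2 * a) = x `^ (- B) by congr (_ `^ _); rewrite /B; ring.
  have e2 : 0 < 1 - e by move: e1; lra.
  have E1 : ((1 - e) * L) `^ (1 - 2 * a) <= expR (2 * B * e) * L `^ (1 - 2 * a).
    rewrite powRM ?(ltW e2) ?(ltW LL)// ler_wpM2r ?powR_ge0// JP.
    have e3 : 0 <= e <= 2^-1 by rewrite (ltW e0).
    apply: (le_trans (powRN_le (ltW B0) (expR_gt0 _) (expRN_ge e3))).
    rewrite -expRM ler_expR le_eqVlt; apply/orP; left; apply/eqP; ring.
  have E2 : (1 + e) ^+ 2 <= expR (2 * e).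
    by rewrite (expRM_natl 2) lerXn2r ?nnegrE ?expR_ge0 ?expR_ge1Dx// addr_ge0// ltW.
  have E3 : (1 + e) * ((1 + e) * (qcst a * ((1 - e) * L) `^ (1 - 2 * a))) <= expR ((2 + 2 * B) * e) * Y.
    rewrite [leLHS](_ : _ = (1 + e) ^+ 2 * (qcst a * ((1 - e) * L) `^ (1 - 2 * a))); last by ring.
    have -> : expR ((2 + 2 * B) * e) * Y = expR (2 * e) * (qcst a * (expR (2 * B * e) * L `^ (1 - 2 * a))).
      by rewrite mulrDl expRD /Y; ring.
    apply: ler_pM => //; [exact: sqr_ge0|exact: mulr_ge0 (ltW q0) (powR_ge0 _ _)|].
    by rewrite ler_wpM2l// ltW.
  have -> : (1 + e^-1) * ((-1) ^+ 2 * (e ^+ 2 * qcst a * L `^ (1 - 2 * a))) = (e + e ^+ 2) * Y.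
    by rewrite /Y; field; rewrite gt_eqF.
  have E4 : 1 <= expR ((2 + 2 * B) * e).
    have b2 : 0 <= 2 + 2 * B by move: B0; lra.
    by rewrite -[leLHS]expR0 ler_expR; exact: mulr_ge0 b2 (ltW e0).
  have E5 : 1 + e + e ^+ 2 <= expR (2 * e).
    apply: le_trans (expR_ge1Dx _); rewrite expr2.
    have : e * e <= e by rewrite ler_piMl// ltW.
    lra.
  have -> : (4 + 2 * B) * e = (2 + 2 * B) * e + 2 * e by ring.
  rewrite expRD; move: E3 E4 E5; set E := expR ((2 + _) * e); set F := expR (2 * e) => E3 E4 E5.
  have ee : 0 <= e + e ^+ 2 by rewrite addr_ge0 ?sqr_ge0// ltW.
  apply: (@le_trans _ _ (E * Y + E * (e + e ^+ 2) * Y)).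
    by apply: lerD => //; rewrite ler_wpM2r ?(ltW Y0)// ler_peMl.
  rewrite -mulrDl ler_wpM2r ?(ltW Y0)//.
  rewrite [leLHS](_ : _ = E * (1 + e + e ^+ 2)); last by ring.
  by rewrite ler_wpM2l// (le_trans ler01).
have D1 : expR ((4 + 2 * B) * e) * Y < expR ((4 + 2 * B) * e) * Y * expR e.
  by rewrite ltr_pMr ?expR_gt1//; exact: mulr_gt0 (expR_gt0 _) Y0.
have := ach_TN e0 H D1 H3.
apply: ach_weak => //; rewrite -/Y.
have -> : expR (2 * e) * (expR ((4 + 2 * B) * e) * Y * expR e) = expR ((7 + 2 * B) * e) * Y.
  have -> : (7 + 2 * B) * e = 2 * e + ((4 + 2 * B) * e + e) by ring.
  by rewrite !expRD; ring.
by rewrite ler_wpM2r// ltW.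
Qed.

(** A code for the triangular matrix, damped and combined with a cheap code for the wrapped terms,
    is a code for the circulant matrix at rate (1 + e) L, to which [CN_lower] applies. *)
Lemma TN_lower (eps : R) : 0 < eps -> exists L0 : R, forall L, L0 <= L -> exists N0 : nat, forall n : nat, (N0 <= n)%N ->
  forall d (Omega : measurableType d) (P : probability Omega R) (xi : 'I_n.+1 -> Omega -> R) D,
  std_gauss P xi -> ach P (lmap (@TN _ a n) xi) L D -> (1 - eps) * (qcst a * L `^ (1 - 2 * a)) <= D.
Proof.
move=> eps0; set B := 2 * a - 1; have B0 : 0 < B := b10.
have B7 : 0 < B + 7 by move: B0; lra.
pose e := Num.min 1 eps / (B + 7).
have e0 : 0 < e by rewrite divr_gt0// lt_min ltr01.
have eE : (B + 7) * e <= eps by rewrite mulrC divfK ?gt_eqF// ge_min lexx orbT.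
have e1 : (B + 7) * e <= 1 by rewrite mulrC divfK ?gt_eqF// ge_min lexx.
have Be : 0 < B * e by rewrite mulr_gt0.
have eR : e <= 1 by move: e1 Be; rewrite mulrDl; lra.
have [L1 h1] := CN_lower a2 e0 eR e0.
have q0 := qcst_gt0 a2.
have t0 : 0 < e ^+ 2 * qcst a by rewrite mulr_gt0// exprn_gt0.
have [L2 h2] := fold_small e0 eR e0 t0.
exists (Num.max 1 (Num.max L1 L2)) => L.
rewrite !ge_max => /and3P[Lp L3 L4].
have LL : 0 < L by lra.
have Le : L1 <= (1 + e) * L.
  by apply: (le_trans L3); rewrite ler_peMl ?(ltW LL)// lerDl ltW.
have [N0 hN] := h1 _ Le.
exists N0 => n nN d Omega P xi D H h.
have H2 := h2 L L4 n _ _ _ _ H.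
set Y := qcst a * L `^ (1 - 2 * a).
have Y0 : 0 < Y by rewrite mulr_gt0// powR_gt0.
have DD : D < D + e * Y by rewrite ltrDl mulr_gt0.
have H1 := ach_TZN e0 H DD h.
have mT : mvec (lmap (@TZN _ a e n) xi) by apply: measurable_lmap; exact: H.1.
set S := fun i j : 'I_n.+1 => _ in H2.
have mS : mvec (lmap S xi) by apply: measurable_lmap; exact: H.1.
have := ach_add mT mS e0 H1 H2.
have -> : L + e * L = (1 + e) * L by ring.
move=> H3.
have {}H3 := ach_eq (W := lmap (@CN _ a e n) xi) _ H3.
have {}H3 : ach P (lmap (@CN _ a e n) xi) ((1 + e) * L) ((1 + e) * (expR (2 * e) * (D + e * Y)) + (1 + e^-1) * (e ^+ 2 * qcst a * L `^ (1 - 2 * a))).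
  apply: H3 => i w; rewrite /lmap -big_split/=; apply: eq_bigr => j _.
  by rewrite (TZN_split a2 e0) /S; ring.
have := hN n nN _ _ _ _ _ H H3.
have -> : (1 + e^-1) * (e ^+ 2 * qcst a * L `^ (1 - 2 * a)) = (e + e ^+ 2) * Y.
  by rewrite /Y; field; rewrite gt_eqF.
have JP (x : R) : x `^ (1 - 2 * a) = x `^ (- B) by congr (_ `^ _); rewrite /B; ring.
have e2 : 0 < 1 + e by rewrite addr_gt0.
have E1 : (1 - B * e) * L `^ (1 - 2 * a) <= ((1 + e) * L) `^ (1 - 2 * a).
  rewrite powRM ?(ltW e2) ?(ltW LL)// ler_wpM2r ?powR_ge0// JP.
  have e3 : 1 + e <= expR e := expR_ge1Dx e.
  apply: le_trans (powRN_le (ltW B0) e2 e3).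
  by rewrite -expRM mulrN [B * e]mulrC; exact: expR_ge1Dx.
have e4 : 0 <= 1 - e by lra.
have E2 : (1 - e) * ((1 - B * e) * Y) <= (1 - e) * (qcst a * ((1 + e) * L) `^ (1 - 2 * a)).
  rewrite ler_wpM2l//; have -> : (1 - B * e) * Y = qcst a * ((1 - B * e) * L `^ (1 - 2 * a)) by rewrite /Y; ring.
  by rewrite ler_wpM2l// ltW.
move=> E3; have {E2 E3} := le_trans E2 E3.
have D0 : 0 <= D := ach_ge0 h.
have E4 : (1 + e) * (expR (2 * e) * (D + e * Y)) <= expR (3 * e) * (D + e * Y).
  have -> : 3 * e = e + 2 * e by ring.
  rewrite expRD -mulrA ler_wpM2r ?expR_ge1Dx// mulr_ge0 ?expR_ge0// addr_ge0// mulr_ge0// ltW//.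
move=> E3; have {E3 E4} := le_trans E3 (lerD E4 (lexx _)).
rewrite -lerBlDr -ler_pdivrMl ?expR_gt0// -expRN => E5.
have : (1 - 3 * e) * ((1 - (B + 3) * e) * Y) <= expR (- (3 * e)) * ((1 - e) * ((1 - B * e) * Y) - (e + e ^+ 2) * Y).
  have m0 : 0 <= (1 - (B + 3) * e) * Y.
    by rewrite mulr_ge0 ?(ltW Y0)//; move: e1; rewrite !mulrDl; lra.
  apply: (@le_trans _ _ (expR (- (3 * e)) * ((1 - (B + 3) * e) * Y))).
    by rewrite ler_wpM2r// -mulNr; have := expR_ge1Dx (- 3 * e); rewrite mulNr.
  rewrite ler_wpM2l ?expR_ge0//.
  have -> : (1 - e) * ((1 - B * e) * Y) - (e + e ^+ 2) * Y = ((1 - e) * (1 - B * e) - e - e ^+ 2) * Y by ring.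
  rewrite ler_wpM2r ?(ltW Y0)//.
  have : e * e <= e by rewrite ler_piMl// ltW.
  have := mulr_ge0 (ltW e0) (ltW Be).
  rewrite expr2 !mulrDl !mulrDr mulrN; lra.
move=> E6; have {E5 E6} := le_trans E6 E5.
have E7 : 0 <= 3 * e * ((B + 3) * e) * Y.
  have B3 : 0 <= B + 3 by move: B0; lra.
  have e3 : 0 <= 3 * e by rewrite mulr_ge0// ltW.
  exact: mulr_ge0 (mulr_ge0 e3 (mulr_ge0 B3 (ltW e0))) (ltW Y0).
have -> : (1 - 3 * e) * ((1 - (B + 3) * e) * Y) = (1 - (B + 7) * e) * Y + e * Y + 3 * e * ((B + 3) * e) * Y by ring.
move=> E6; have : (1 - eps) * Y <= (1 - (B + 7) * e) * Y by rewrite ler_wpM2r ?(ltW Y0)// lerD2l lerN2.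
by move: E6 E7; lra.
Qed.

End lower_triangular.

(** * Discretization of the Riemann-Liouville process *)

Section gaussian_law.
Context {R : realType} d (Omega : measurableType d) (P : probability Omega R).

(** For v = 0 the variable vanishes almost surely; otherwise the normal density is brought to
    standard form by [gamma1_smooth] with scale 1/sqrt v. *)
Lemma centered_gaussian_is_gauss (Z : Omega -> R) (v : R) : 0 <= v ->
  centered_gaussian_law P Z v -> is_gauss P Z v.
Proof.
move=> v0 [mZ]; case: eqP => [-> HZ|/eqP vn HZ]; split=> // c p.
  rewrite mulr0 mul0r oppr0 expR0 mulr1.
  have -> : ((1 + cos p)%:E = \int[P]_w (1 + cos p)%:E :> \bar R)%E by rewrite integral_prob_cst.
  have mA : measurable (Z @^-1` [set 0]) by apply: measurable_preimageT.
  apply: ge0_ae_eq_integral => //.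
  - by apply/measurable_EFinP; apply: measurable_1cos; apply: measurable_funD => //; exact: measurable_funM.
  exists (~` (Z @^-1` [set 0])); split; first exact: measurableC.
    by apply: etrans (probability_setC P mA) _; rewrite HZ subee.
  move=> w /= hw; apply: contra_not hw => /= Zw _.
  by rewrite Zw mulr0 add0r.
set s := Num.sqrt v in HZ; have s0 : 0 < s by rewrite sqrtr_gt0 lt_neqAle eq_sym vn.
pose G (y : R) := 1 + cos (c * y + p).
have cG : continuous G.
  by move=> y; apply: cvgD; [exact: cvg_cst|exact: continuous_cos_affine].
have G0 y : 0 <= G y by exact: cos1_ge0.
have mG : measurable_fun [set: measurableTypeR R] (EFin \o G).
  by apply/measurable_EFinP; exact: continuous_measurable_fun.
have G0' x : (0 <= (EFin \o G) x)%E by rewrite lee_fin.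
have h1 := @ge0_integral_density _ _ _ (measurableTypeR R) R P (normal_prob 0 s) Z (cst 1) mZ
  (measurable_cst _) (fun _ => ler01) _ (EFin \o G) mG G0'.
have h2 : (\int[normal_prob 0 s]_x (EFin \o G) x = \int[lebesgue_measure]_x ((EFin \o G) x * (normal_pdf 0 s x)%:E))%E.
  apply: (@ge0_integral_density _ _ _ _ _ lebesgue_measure (normal_prob 0 s) idfun (normal_pdf 0 s)) => //.
  - exact: measurable_id.
  - exact: measurable_normal_pdf.
  - exact: normal_pdf_ge0.
transitivity (\int[normal_prob 0 s]_x (EFin \o G) x)%E.
  rewrite h1; last first.
    move=> A mA; apply: etrans (esym (HZ A mA)) _.
    have mA' : measurable (Z @^-1` A) by exact: measurable_preimageT.
    by rewrite (integral_cst P mA' 1%E) mul1e.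
  by apply: eq_integral => w _; rewrite mule1.
rewrite h2//.
have si : 0 < s^-1 by rewrite invr_gt0.
transitivity (\int[gamma1]_z (G (0 + z / s^-1))%:E)%E.
  rewrite gamma1_smooth//; apply: eq_integral => y _; rewrite /= -EFinM; congr (_ %:E).
  rewrite normal_pdfE ?gt_eqF// /normal_peak /normal_fun /bump subr0 -[RHS]mulrA; congr (_ * (_ * _)).
    rewrite -mulrnAr sqrtrM ?sqr_ge0// sqrtr_sqr gtr0_norm// invfM//.
  by congr expR; rewrite -[s ^+ 2 *+ 2]mulr_natl; field; rewrite gt_eqF.
have -> : c ^+ 2 * v / 2 = (c * s) ^+ 2 / 2 by rewrite exprMn sqr_sqrtr.
rewrite -integral_gamma1_cos; apply: eq_integral => z _.
by rewrite /G add0r invrK [z * s]mulrC mulrA.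
Qed.

Lemma gaussian_family_increments (I : Type) (D : set I) (Z : I -> Omega -> R) (C : I -> I -> R) N
    (i0 : I) (p q : 'I_N -> I) (x : R) (e : 'I_N -> R) :
  centered_gaussian_family P D Z C -> D i0 -> (forall l, D (p l)) -> (forall l, D (q l)) ->
  centered_gaussian_law P (fun w => x * Z i0 w + \sum_l e l * (Z (p l) w - Z (q l) w))
   (x ^+ 2 * C i0 i0 + x * (\sum_l e l * (C i0 (p l) - C i0 (q l))) + x * (\sum_l e l * (C (p l) i0 - C (q l) i0))
    + \sum_l \sum_m e l * e m * (C (p l) (p m) - C (p l) (q m) - C (q l) (p m) + C (q l) (q m))).
Proof.
move=> H D0 Dp Dq.
(* The family property concerns one indexed combination, so Z i0, Z (p l) and Z (q l) are listed in
   1 + 2 N places with coefficients x, e l and - e l. *)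
pose ix (j : 'I_(1 + (N + N))) := match fintype.split j with inl _ => i0 | inr k => match fintype.split k with inl l => p l | inr l => q l end end.
pose cx (j : 'I_(1 + (N + N))) := match fintype.split j with inl _ => x | inr k => match fintype.split k with inl l => e l | inr l => - e l end end.
have Dix j : D (ix j) by rewrite /ix; case: (fintype.split j) => // k; case: (fintype.split k).
have E1 (l : 'I_1) : (ix (lshift _ l) = i0) * (cx (lshift _ l) = x).
  by rewrite /ix /cx (unsplitK (inl l)).
have E2 (l : 'I_N) : (ix (rshift 1 (lshift N l)) = p l) * (cx (rshift 1 (lshift N l)) = e l).
  by rewrite /ix /cx (unsplitK (inr (lshift N l))) (unsplitK (inl l)).
have E3 (l : 'I_N) : (ix (rshift 1 (rshift N l)) = q l) * (cx (rshift 1 (rshift N l)) = - e l).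
  by rewrite /ix /cx (unsplitK (inr (rshift N l))) (unsplitK (inr l)).
have sumE (F : 'I_(1 + (N + N)) -> R) : \sum_j F j = F (lshift _ ord0) + (\sum_l F (rshift 1 (lshift N l)) + \sum_l F (rshift 1 (rshift N l))).
  by rewrite big_split_ord big_ord1 big_split_ord.
have := H _ ix cx Dix.
have -> : (fun w => \sum_j cx j * Z (ix j) w) = (fun w => x * Z i0 w + \sum_l e l * (Z (p l) w - Z (q l) w)).
  apply/funext => w; rewrite sumE !E1; congr (_ + _).
  rewrite -big_split/=; apply: eq_bigr => l _.
  by rewrite !E2 !E3 mulNr mulrBr.
congr (centered_gaussian_law _ _ _).
have S (u : R) (j : I) : \sum_k u * cx k * C j (ix k) = u * x * C j i0 + \sum_l u * e l * (C j (p l) - C j (q l)).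
  rewrite sumE !E1; congr (_ + _); rewrite -big_split/=; apply: eq_bigr => l _.
  by rewrite !E2 !E3; ring.
under eq_bigr => j _ do rewrite S.
rewrite sumE !E1 -big_split/= -!addrA; congr (_ + _).
congr (_ + _); first by rewrite mulr_sumr; apply: eq_bigr => l _; rewrite mulrA.
rewrite mulr_sumr -big_split/=; apply: eq_bigr => l _.
rewrite !E2 !E3 addrACA -big_split/=; congr (_ + _); first by ring.
by apply: eq_bigr => m _; ring.
Qed.

End gaussian_law.

(** * Integrals of powers *)

Section power_integrals.
Context {R : realType}.
Notation mu := (@lebesgue_measure R).

Lemma integral_derive (f F : R -> R) (a b : R) : a < b ->
  (forall x, a <= x <= b -> is_derive x (1:R) F (f x)) -> {within `[a, b], continuous f} ->
  (\int[mu]_(x in `[a, b]) (f x)%:E = (F b - F a)%:E)%E.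
Proof.
move=> ab dF cf; have cF x : a <= x <= b -> {for x, continuous F}.
  move=> /dF [dFx _]; apply: differentiable_continuous; exact/derivable1_diffP.
rewrite (continuous_FTC2 (F := F) ab cf)//.
- split.
  + by move=> x; rewrite in_itv/= => /andP[/ltW ax /ltW xb]; have [] := dF x (introT andP (conj ax xb)).
  + by apply: cvg_at_right_filter; apply: cF; rewrite lexx ltW.
  + by apply: cvg_at_left_filter; apply: cF; rewrite lexx ltW.
- move=> x; rewrite in_itv/= => /andP[/ltW ax /ltW xb]; rewrite derive1E.
  by have [_ ] := dF x (introT andP (conj ax xb)).
Qed.

Lemma cvg_squeeze0 (u : R^nat) : (forall e, 0 < e -> exists N, forall n, (N <= n)%N -> `|u n| <= e) -> u @ \oo --> (0 : R).
Proof.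
move=> h; apply/cvgrPdist_le => e e0; have [N hN] := h e e0.
by near=> n; rewrite sub0r normrN; apply: hN; near: n; exact: nbhs_infty_ge.
Unshelve. all: by end_near. Qed.

Lemma eventually_ge (x0 : R) : exists N, forall n : nat, (N <= n)%N -> x0 <= n%:R.
Proof.
exists (Num.truncn `|x0|).+1 => n nN; apply: (le_trans (ler_norm _)).
by apply: ltW; apply: (lt_le_trans (truncnS_gt _)); rewrite ler_nat.
Qed.

Lemma is_derive_powR_sub (t p s : R) : p != 0 -> s < t ->
  is_derive s (1:R) (fun s => - ((t - s) `^ p / p)) ((t - s) `^ (p - 1)).
Proof.
move=> p0 st.
have h : is_derive s (1:R) (fun s => (t - s) `^ p) ((p * (t - s) `^ (p - 1)) * (-1)).
  apply: (@is_derive1_comp _ (fun x => x `^ p) (fun s => t - s)).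
    by apply: is_derive1_powR; rewrite subr_gt0.
  by rewrite -[-1]sub0r; exact: (is_deriveB (is_derive_cst _ _ _) (is_derive_id _ _)).
have -> : (fun s => - ((t - s) `^ p / p)) = (- p^-1) \*: (fun s => (t - s) `^ p).
  apply/funext => x; change (- ((t - x) `^ p / p) = - p^-1 * (t - x) `^ p); ring.
apply: is_derive_eq.
by rewrite /GRing.scale/=; field.
Qed.

Lemma derive_continuous (f : R -> R) (df : R -> R) (A : set R) :
  (forall x, A x -> is_derive x (1:R) f (df x)) -> {within A, continuous f}.
Proof.
move=> h; apply: continuous_in_subspaceT => x /set_mem /h [dfx _].
by apply: differentiable_continuous; exact/derivable1_diffP.
Qed.

Lemma is_derive_powR1 (t r s : R) : s < t ->
  is_derive s (1:R) (fun s => (t - s) `^ r) (- (r * (t - s) `^ (r - 1))).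
Proof.
move=> st; have h : is_derive s (1:R) (fun s => (t - s) `^ r) ((r * (t - s) `^ (r - 1)) * (-1)).
  apply: (@is_derive1_comp _ (fun x => x `^ r) (fun s => t - s)).
    by apply: is_derive1_powR; rewrite subr_gt0.
  by rewrite -[-1]sub0r; exact: (is_deriveB (is_derive_cst _ _ _) (is_derive_id _ _)).
by apply: is_derive_eq; rewrite mulrN1.
Qed.

Lemma integral_powR_sub_lt (p t u : R) : 0 < p -> 0 < u < t ->
  (\int[mu]_(s in `[0%R, u]) ((t - s) `^ (p - 1))%:E = ((t `^ p - (t - u) `^ p) / p)%:E)%E.
Proof.
move=> p0 /andP[u0 ut].
have dF (x : R) : 0 <= x <= u -> is_derive x (1:R) (fun s => - ((t - s) `^ p / p)) ((t - x) `^ (p - 1)).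
  by move=> /andP[_ xu]; apply: is_derive_powR_sub; [exact: lt0r_neq0|exact: le_lt_trans ut].
rewrite (integral_derive u0 dF).
- by congr (_ %:E); rewrite subr0 opprK addrC mulrBl.
- apply: (@derive_continuous _ (fun s => - ((p - 1) * (t - s) `^ (p - 1 - 1)))).
  move=> x /=; rewrite in_itv/= => /andP[_ xu]; apply: is_derive_powR1; exact: le_lt_trans ut.
Qed.

Lemma measurable_powR_sub (t r : R) (A : set R) : measurable A -> measurable_fun A (fun s : R => ((t - s) `^ r)%:E).
Proof.
move=> mA; apply/measurable_EFinP; apply: (measurable_funS measurableT) => //.
have m1 : measurable_fun [set: R] (fun s : R => t - s) by exact: measurable_funB.
apply: (@measurableT_comp _ _ _ _ _ _ (@powR R ^~ r)) => //.
Qed.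

(** At u = t the integrand may be singular, so the interval is exhausted by [0, u - u/(n+2)] and the
    value passes to the limit. *)
Lemma integral_powR_sub (p t u : R) : 0 < p -> 0 <= u <= t ->
  (\int[mu]_(s in `[0%R, u]) ((t - s) `^ (p - 1))%:E = ((t `^ p - (t - u) `^ p) / p)%:E)%E.
Proof.
move=> p0 /andP[]; rewrite le_eqVlt => /predU1P[<- _|u0].
  by rewrite set_itv1 integral_set1 subr0 subrr mul0r.
rewrite le_eqVlt => /predU1P[<-|ut]; last by apply: integral_powR_sub_lt; rewrite ?u0.
rewrite -integral_itv_bndo_bndc; last exact: measurable_powR_sub.
pose r (n : nat) : R := u - u / n.+2%:R.
have r0 n : 0 < r n < u.
  rewrite subr_gt0 gtrBl divr_gt0// andbT ltr_pdivrMr// ltr_pMr// ltr1n//.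
have ru : `[0, u[%classic = \bigcup_n `[0, r n]%classic.
  apply/seteqP; split => x /=; rewrite ?in_itv/=.
    move=> /andP[x0 xu]; have ux : 0 < u - x by rewrite subr_gt0.
    have [N hN] := eventually_ge (u / (u - x)).
    exists N => //=; rewrite in_itv/= x0/= lerBrDl -lerBrDr ler_pdivrMr//.
    rewrite mulrC -ler_pdivrMr//; apply: (le_trans (hN _ (leqnn _))).
    by rewrite ler_nat leqW.
  by move=> [n _]; rewrite /= in_itv/= => /andP[-> xr]/=; have /andP[_] := r0 n; exact: le_lt_trans.
rewrite ru.
have h1 : (\int[mu]_(s in `[0%R, r i]) ((u - s) `^ (p - 1))%:E)%E @[i --> \oo] --> (\int[mu]_(s in \bigcup_i `[0%R, r i]%classic) ((u - s) `^ (p - 1))%:E)%E.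
  apply: ge0_nondecreasing_set_cvg_integral => //.
  - move=> m n mn; apply/subsetPset => x /=; rewrite !in_itv/= => /andP[-> xr]/=.
    by apply: (le_trans xr); rewrite lerD2l lerN2 ler_wpM2l ?(ltW u0)// lef_pV2 ?posrE// ler_nat !ltnS.
  - by move=> i; exact: measurable_powR_sub.
  - by move=> i x _; rewrite lee_fin powR_ge0.
have h2 : (\int[mu]_(s in `[0%R, r i]) ((u - s) `^ (p - 1))%:E)%E @[i --> \oo] --> ((u `^ p - (u - u) `^ p) / p)%:E.
  under eq_fun do rewrite integral_powR_sub_lt//.
  apply/cvg_EFin; first by near=> n.
  rewrite subrr powR0 ?gt_eqF// subr0.
  have -> : u `^ p / p = (u `^ p - 0) / p by rewrite subr0.
  apply: cvgM; last exact: cvg_cst.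
  apply: cvgB; first exact: cvg_cst.
  apply: cvg_squeeze0 => e e0.
  have e1 : 0 < e / u `^ p by rewrite divr_gt0// powR_gt0.
  have [x0 x01 hx] := powR_small p0 e1.
  have [N hN] := eventually_ge x0.
  exists N => n nN; have -> : u - r n = u / n.+2%:R by rewrite /r opprB addrC subrK.
  rewrite ger0_norm ?powR_ge0// -[X in _ `^ X]opprK powR_divN// opprK.
  rewrite -ler_pdivlMr ?powR_gt0//; apply: hx; apply: (le_trans (hN _ nN)).
  by rewrite ler_nat !leqW.
apply: cvg_unique h1 h2 => //.
Unshelve. all: by end_near. Qed.

End power_integrals.

(** * The Gamma function *)

Section gamma_function.
Context {R : realType}.
Notation mu := (@lebesgue_measure R).

(** Extended-valued, so that the functional equation can be proved before finiteness, which is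
    deduced from it. *)
Definition eGam (x : R) : \bar R := (\int[mu]_(t in `]0%R, +oo[) (t `^ (x - 1) * expR (- t))%:E)%E.

Let mG (r : R) (A : set R) : measurable A -> measurable_fun A (fun t : R => (t `^ r * expR (- t))%:E).
Proof.
move=> mA; apply/measurable_EFinP; apply: (measurable_funS measurableT) => //.
apply: measurable_funM; first by apply: (@measurableT_comp _ _ _ _ _ _ (@powR R ^~ r)).
by apply: continuous_measurable_fun => x; apply: continuous_comp; [exact: opp_continuous|exact: continuous_expR].
Qed.

Let G0 (r t : R) : 0 <= t `^ r * expR (- t).
Proof. by rewrite mulr_ge0 ?powR_ge0 ?expR_ge0. Qed.

Lemma eGam_ge0 x : (0 <= eGam x)%E.
Proof. by apply: integral_ge0 => t _; rewrite lee_fin. Qed.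

Lemma is_derive_gam (r t : R) : 0 < t ->
  is_derive t (1:R) (fun t => t `^ r * expR (- t)) (r * (t `^ (r - 1) * expR (- t)) - t `^ r * expR (- t)).
Proof.
move=> t0.
have h1 : is_derive t (1:R) (fun t : R => expR (- t)) (expR (- t) * (-1)).
  apply: (@is_derive1_comp _ expR (fun t => - t)); exact: is_deriveN.
have h2 : is_derive t (1:R) (fun t => t `^ r) (r * t `^ (r - 1)) by exact: is_derive1_powR.
have h := is_deriveM h2 h1; apply: (is_derive_eq h).
by rewrite /GRing.scale/=; ring.
Qed.

Lemma cvg_gam_boundary (x : R) : 0 < x ->
  (fun n : nat => (n.+2%:R^-1 `^ x * expR (- n.+2%:R^-1) - n.+2%:R `^ x * expR (- n.+2%:R)) : R) @ \oo --> (0 : R).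
Proof.
move=> x0; apply: cvg_squeeze0 => e e0.
have e2 : 0 < e / 2 by rewrite divr_gt0.
have [x1 x11 h1] := powR_small x0 e2.
have half : (0 : R) < 2^-1 by rewrite invr_gt0.
have [x2 x21 h2] := lin_dom (ltW x0) half.
have [N hN] := eventually_ge (Num.max x1 (Num.max x2 (4 / e))).
exists N => n nN.
have : Num.max x1 (Num.max x2 (4 / e)) <= n.+2%:R by apply: (le_trans (hN _ nN)); rewrite ler_nat !leqW.
rewrite !ge_max => /and3P[y1 y2 y3].
set y : R := n.+2%:R in y1 y2 y3 *; have y0 : 0 < y by [].
have b1 : y^-1 `^ x * expR (- y^-1) <= e / 2.
  apply: (@le_trans _ _ (y^-1 `^ x)).
    by rewrite ler_piMr ?powR_ge0// -[leRHS]expR0 ler_expR oppr_le0 invr_ge0 ltW.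
  by rewrite -powR_inv1 ?(ltW y0)// -powRrM mulN1r; exact: h1.
have b2 : y `^ x * expR (- y) <= e / 2.
  rewrite -[y `^ x]lnK ?posrE ?powR_gt0// -expRD ln_powR.
  apply: (@le_trans _ _ (expR (- (y / 2)))).
    rewrite ler_expR; have := h2 _ y2; have := ltW x0; have := y0; move: (ln y) => l; clear -x0; move: x y x0 => x' y' x0'; lra.
  rewrite expRN -[leRHS]invrK lef_pV2 ?posrE ?expR_gt0 ?invr_gt0//.
  apply: le_trans (expR_ge1Dx _); rewrite invf_div.
  have e42 : 4 / e = 2 * (2 / e) by rewrite mulrA -natrM.
  by move: y3 y0; rewrite e42; clear; move: (2 / e) => v; lra.
have p1 : 0 <= y^-1 `^ x * expR (- y^-1) by [].
have p2 : 0 <= y `^ x * expR (- y) by [].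
rewrite ler_norml; apply/andP; split; move: p1 p2 b1 b2; move: (y^-1 `^ x * _) (y `^ x * _) => u v; lra.
Qed.

(** Integration by parts on [1/(n+2), n+2]; the integrals converge by monotonicity and the boundary
    terms vanish by [cvg_gam_boundary]. *)
Lemma eGam_succ (x : R) : 0 < x -> (eGam (x + 1) = x%:E * eGam x)%E.
Proof.
move=> x0.
pose F (n : nat) : set R := `[n.+2%:R^-1, n.+2%:R]%classic.
have mF n : measurable (F n) by exact: measurable_itv.
have FE : `]0%R, +oo[%classic = \bigcup_n F n.
  apply/seteqP; split => t /=; rewrite ?in_itv/= ?andbT.
    move=> t0; have [N hN] := eventually_ge (Num.max t t^-1).
    have := hN _ (leqnn _); rewrite ge_max => /andP[t1 t2].
    have NN : N%:R <= N.+2%:R :> R by rewrite ler_nat !leqW.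
    exists N => //; rewrite /F /= in_itv/= (le_trans t1 NN) andbT invf_ple ?posrE//.
    exact: le_trans NN.
  by move=> [n _]; rewrite /F /= in_itv/= => /andP[h _]; apply: lt_le_trans h; rewrite invr_gt0.
have ndF : {homo F : n m / (n <= m)%N >-> (n <= m)%O}.
  move=> m n mn; apply/subsetPset => t; rewrite /F /= !in_itv/= => /andP[h1 h2].
  have mnR : m.+2%:R <= n.+2%:R :> R by rewrite ler_nat !ltnS.
  by rewrite (le_trans h2 mnR) andbT (le_trans _ h1)// lef_pV2 ?posrE.
have cv (r : R) : (\int[mu]_(t in F n) (t `^ r * expR (- t))%:E)%E @[n --> \oo] --> (\int[mu]_(t in `]0%R, +oo[) (t `^ r * expR (- t))%:E)%E.
  rewrite FE; apply: ge0_nondecreasing_set_cvg_integral => //.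
  - by move=> i; exact: mG.
  - by move=> i t _; rewrite lee_fin.
have pos n t : F n t -> 0 < t by rewrite /F /= in_itv/= => /andP[h _]; apply: lt_le_trans h; rewrite invr_gt0.
have ct (r : R) n : {within F n, continuous (fun t : R => t `^ r * expR (- t))}.
  by apply: (derive_continuous (df := fun t => r * (t `^ (r - 1) * expR (- t)) - t `^ r * expR (- t))) => t /pos; exact: is_derive_gam.
have it (r : R) n : mu.-integrable (F n) (EFin \o (fun t : R => t `^ r * expR (- t))).
  by apply: continuous_compact_integrable; [exact: segment_compact|exact: ct].
pose dl (n : nat) : R := n.+2%:R^-1 `^ x * expR (- n.+2%:R^-1) - n.+2%:R `^ x * expR (- n.+2%:R).
have E n : (\int[mu]_(t in F n) (t `^ x * expR (- t))%:E = x%:E * (\int[mu]_(t in F n) (t `^ (x - 1) * expR (- t))%:E) + (dl n)%:E)%E.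
  have n2 : n.+2%:R^-1 < n.+2%:R :> R.
    by apply: (@lt_trans _ _ 1); rewrite ?invf_lt1// ltr1n.
  have dF (t : R) : n.+2%:R^-1 <= t <= n.+2%:R -> is_derive t (1:R) (fun t => t `^ x * expR (- t)) (x * (t `^ (x - 1) * expR (- t)) - t `^ x * expR (- t)).
    move=> /andP[h _]; apply: is_derive_gam; apply: lt_le_trans h; rewrite invr_gt0//.
  have cf : {within `[n.+2%:R^-1, n.+2%:R], continuous (fun t : R => x * (t `^ (x - 1) * expR (- t)) - t `^ x * expR (- t))}.
    apply: continuous_in_subspaceT => t /set_mem /pos t0.
    have cg (r : R) : {for t, continuous (fun t : R => t `^ r * expR (- t))}.
      have [d _] := is_derive_gam r t0; apply: differentiable_continuous; exact/derivable1_diffP.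
    by apply: cvgB; [apply: cvgM; [exact: cvg_cst|exact: cg]|exact: cg].
  have I0 := integral_derive n2 dF cf.
  have jf : mu.-integrable (F n) (EFin \o (fun t : R => x * (t `^ (x - 1) * expR (- t)) - t `^ x * expR (- t))).
    by apply: continuous_compact_integrable; [exact: segment_compact|exact: cf].
  pose f (t : R) : R := x * (t `^ (x - 1) * expR (- t)) - t `^ x * expR (- t).
  have I1 : (\int[mu]_(t in F n) ((f t)%:E + (t `^ x * expR (- t))%:E) = \int[mu]_(t in F n) (f t)%:E + \int[mu]_(t in F n) (t `^ x * expR (- t))%:E)%E.
    by apply: (@integralD _ _ _ mu (F n)); [exact: mF|exact: jf|exact: it].
  have I2 : (\int[mu]_(t in F n) ((x%:E * (t `^ (x - 1) * expR (- t))%:E)) = (- dl n)%:E + \int[mu]_(t in F n) (t `^ x * expR (- t))%:E)%E.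
    transitivity (\int[mu]_(t in F n) ((f t)%:E + (t `^ x * expR (- t))%:E))%E.
      by apply: eq_integral => t _; rewrite -EFinD /f subrK EFinM.
    rewrite I1; congr (_ + _)%E; apply: etrans I0 _.
    by rewrite /dl opprB.
  rewrite ge0_integralZl_EFin// in I2; last 3 first.
  - by move=> t _; rewrite lee_fin.
  - exact: mG.
  - exact: ltW.
  all: try exact: mF.
  by rewrite I2 addeAC -EFinD addNr add0e.
have h1 := cv x; have h2 := cv (x - 1).
rewrite /eGam addrK.
suff h3 : (\int[mu]_(t in F n) (t `^ x * expR (- t))%:E)%E @[n --> \oo] --> (x%:E * \int[mu]_(t in `]0%R, +oo[) (t `^ (x - 1) * expR (- t))%:E)%E.
  by apply: cvg_unique h1 h3.
rewrite (funext E) -[X in _ --> X]adde0; apply: cvgeD.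
- by rewrite fin_num_adde_defl.
- exact: cvgeZl.
- by apply/cvg_EFin; [near=> n|exact: cvg_gam_boundary].
Unshelve. all: by end_near. Qed.

Lemma eGam1 : eGam 1 = 1%E.
Proof.
rewrite /eGam integral_itv_obnd_cbnd; last exact: mG.
rewrite -(@integral_exponential_pdf R 1 ltr01) integral_mkcond; apply: eq_integral => t _.
rewrite /exponential_pdf !patchE; case: ifP => // _.
by rewrite subrr powRr0 !mul1r mulN1r.
Qed.

Lemma eGam_fact (m : nat) : eGam m.+1%:R = (m`!%:R)%:E.
Proof.
elim: m => [|m IH]; first by rewrite eGam1.
by rewrite -natr1 eGam_succ// IH factS natrM EFinM.
Qed.

(** For t > 0, t^x <= 1 + t^m bounds the value at x + 1 by factorials, and the functional equation
    brings finiteness down to x, where the integrand may be singular at 0. *)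
Lemma eGam_fin (x : R) : 0 < x -> eGam x \is a fin_num.
Proof.
move=> x0.
have h : (eGam (x + 1) < +oo)%E.
  pose m := (Num.truncn x).+1.
  have xm : x <= m%:R by have /andP[_ /ltW] := truncn_itv (ltW x0).
  apply: (@le_lt_trans _ _ (eGam 1 + eGam m.+1%:R)%E); last by rewrite eGam1 eGam_fact ltry.
  rewrite /eGam -ge0_integralD//; last 4 first.
  - by move=> t _; rewrite lee_fin.
  - exact: mG.
  - by move=> t _; rewrite lee_fin.
  - exact: mG.
  apply: ge0_le_integral => //.
  - by move=> t _; rewrite lee_fin.
  - exact: mG.
  - by apply: emeasurable_funD; exact: mG.
  move=> t; rewrite /= in_itv/= andbT => t0; rewrite -EFinD lee_fin -mulrDl ler_wpM2r ?expR_ge0//.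
  rewrite subrr powRr0 addrK -natr1 addrK.
  have [t1|/ltW t1] := leP t 1.
    apply: (@le_trans _ _ 1); last by rewrite lerDl powR_ge0.
    have e1 : (1 : R) `^ x = 1 by rewrite powR1.
    rewrite -[leRHS]e1; apply: ge0_ler_powR; rewrite ?nnegrE ?(ltW x0) ?(ltW t0)//.
  by apply: (@le_trans _ _ (t `^ m%:R)); [exact: ler_powR|rewrite lerDr].
rewrite ge0_fin_numE ?eGam_ge0//; move: h; rewrite eGam_succ//.
by case: (eGam x) (eGam_ge0 x) => [r|//|//] _; rewrite ?ltry// gt0_muley// ltxx.
Qed.

Lemma GammaE (x : R) : Gamma x = fine (eGam x). Proof. by []. Qed.

Lemma Gamma_succ (x : R) : 0 < x -> Gamma (x + 1) = x * Gamma x.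
Proof. by move=> x0; rewrite !GammaE eGam_succ// fineM// eGam_fin. Qed.

Lemma Gamma_fact m : Gamma m.+1%:R = m`!%:R :> R.
Proof. by rewrite GammaE eGam_fact. Qed.

(* convexity of t^(-r), expanded at the mean y of the Gamma density *)
Lemma Gamma_ratio (y r : R) : 0 < r -> r < y -> Gamma y <= y `^ r * Gamma (y - r).
Proof.
move=> r0 ry; have y0 : 0 < y by exact: lt_trans ry.
have yr : 0 < y - r by rewrite subr_gt0.
have yp : 0 < y `^ r by rewrite powR_gt0.
pose k : R := r * y `^ (- r) / y.
have yi : 0 < y `^ (- r) by rewrite powR_gt0.
have k0 : 0 <= k by rewrite /k divr_ge0 ?mulr_ge0 ?ltW.
have h : (((1 + r) * y `^ (- r))%:E * eGam y <= eGam (y - r) + k%:E * eGam (y + 1))%E.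
  have mD : measurable (`]0, +oo[%classic : set R) by exact: measurable_itv.
  have Zl (k' s : R) : 0 <= k' -> (k'%:E * (\int[mu]_(t in `]0%R, +oo[) (t `^ s * expR (- t))%:E) = \int[mu]_(t in `]0%R, +oo[) (k' * (t `^ s * expR (- t)))%:E)%E.
    move=> kp; rewrite -ge0_integralZl_EFin//; [by move=> t _; rewrite lee_fin|exact: mG].
  have mZ (k' s : R) (A : set R) : measurable A -> measurable_fun A (fun t : R => (k' * (t `^ s * expR (- t)))%:E).
    move=> mA; have /measurable_EFinP h := mG s mA; apply/measurable_EFinP.
    by apply: measurable_funM => //; exact: h.
  have c0 : 0 <= (1 + r) * y `^ (- r) by rewrite mulr_ge0 ?powR_ge0// addr_ge0// ltW.
  have nn (t : R) : 0 <= k * (t `^ (y + 1 - 1) * expR (- t)) by rewrite mulr_ge0.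
  rewrite /eGam !Zl// -ge0_integralD//; last 4 first.
  - by move=> t _; rewrite lee_fin.
  - exact: mG.
  - by move=> t _; rewrite lee_fin.
  - exact: mZ.
  apply: ge0_le_integral => //.
  - by move=> t _; rewrite lee_fin mulr_ge0.
  - exact: mZ.
  - by apply: emeasurable_funD; [exact: mG|exact: mZ].
  move=> t; rewrite /= in_itv/= andbT => t0; rewrite -EFinD lee_fin.
  have b1 : 1 < r + 1 by rewrite ltrDr.
  have := powR_tangent b1 t0 y0.
  have -> : 1 - (r + 1) = - r by ring.
  have -> : y `^ (- (r + 1)) = y `^ (- r) / y.
    rewrite opprD powRD ?(gt_eqF y0) ?implybT//; congr (_ * _).
    by rewrite powRN powRr1// ltW.
  have -> : t `^ (y - r - 1) = t `^ (- r) * t `^ (y - 1).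
    by rewrite -powRD ?(gt_eqF t0) ?implybT//; congr (_ `^ _); ring.
  have -> : t `^ (y + 1 - 1) = t * t `^ (y - 1).
    by rewrite -{2}[t]powRr1 ?(ltW t0)// -powRD ?(gt_eqF t0) ?implybT//; congr (_ `^ _); ring.
  move=> tg; have w0 := G0 (y - 1) t; move: w0; set w := t `^ (y - 1) * expR (- t) => w0.
  have -> : t `^ (- r) * t `^ (y - 1) * expR (- t) = t `^ (- r) * w by rewrite /w mulrA.
  have -> : k * (t * t `^ (y - 1) * expR (- t)) = k * t * w by rewrite /w; ring.
  rewrite -mulrDl ler_wpM2r//.
  have : - r * (y `^ (- r) / y) * (t - y) = - (k * t) + r * y `^ (- r) by rewrite /k; field; rewrite gt_eqF.
  move: tg => + e; rewrite e; move: (t `^ (- r)) (y `^ (- r)) (k * t) => u v z; lra.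
move: h; rewrite eGam_succ// -[eGam y]fineK ?eGam_fin// -[eGam (y - r)]fineK ?eGam_fin//.
rewrite -!EFinM -EFinD lee_fin -!GammaE => h.
have : y `^ (- r) * Gamma y <= Gamma (y - r).
  move: h; rewrite /k; have -> : r * y `^ (- r) / y * (y * Gamma y) = r * (y `^ (- r) * Gamma y) by field; rewrite gt_eqF.
  rewrite mulrDl mul1r mulrDl mulrA; move: (y `^ (- r) * Gamma y) => z; lra.
by rewrite powRN ler_pdivrMl.
Qed.

End gamma_function.

(** * The weights as a discrete kernel *)

Section kernel_discretization.
Context {R : realType}.
Variable a : R.
Hypothesis a2 : 2^-1 < a.

Let a0 : 0 < a. Proof. by apply: lt_trans a2. Qed.
Let b10 : 0 < 2 * a - 1. Proof. by have := a2; lra. Qed.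

Lemma Gamma_wc m : Gamma (a + m%:R) = Gamma a * wc a m * m`!%:R.
Proof.
elim: m => [|m IH]; first by rewrite addr0 wc0 !mulr1.
have am : 0 < a + m%:R by rewrite ltr_wpDr.
have -> : a + m.+1%:R = (a + m%:R) + 1 by rewrite -addrA natr1.
rewrite Gamma_succ// IH wcS factS natrM.
have : m.+1%:R != 0 :> R by rewrite pnatr_eq0.
by move: (m.+1%:R : R) => z z0; field.
Qed.

Lemma powR_1D_le (x s : R) : 0 <= x -> 0 <= s -> (1 + x) `^ s <= expR (s * x).
Proof.
move=> x0 s0; rewrite /powR gt_eqF ?ltr_wpDr// ler_expR ler_wpM2l// le_ln1Dx//.
exact: lt_le_trans x0.
Qed.

Lemma powR_1D_ge (x s : R) : 0 <= x -> 0 <= s -> expR (- (s * x)) <= (1 + x) `^ (- s).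
Proof.
move=> x0 s0; rewrite /powR gt_eqF ?ltr_wpDr// ler_expR mulNr lerN2 ler_wpM2l// le_ln1Dx//.
exact: lt_le_trans x0.
Qed.

Lemma Gamma_gt0 : 0 < Gamma a.
Proof.
pose K := Num.truncn a; have /andP[Ka aK] : K%:R <= a < K.+1%:R by apply: truncn_itv; exact: ltW.
have r0 : 0 < K.+1%:R - a by rewrite subr_gt0.
have ry : K.+1%:R - a < K.+1%:R by rewrite gtrBl.
have := Gamma_ratio r0 ry; rewrite Gamma_fact.
have -> : K.+1%:R - (K.+1%:R - a) = a by rewrite opprB addrC subrK.
move=> h; have : 0 < K.+1%:R `^ (K.+1%:R - a) * Gamma a by apply: lt_le_trans h; rewrite ltr0n fact_gt0.
by rewrite pmulr_rgt0// powR_gt0.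
Qed.

(** Two uses of [Gamma_ratio] around Gamma (a + m): r = a at y = a + m for the upper bound, and r =
    K + 1 - a at y = m + K + 1, with K the integer part of a, for the lower one. In both the other
    Gamma value is a factorial. *)
Lemma wc_Gamma_bounds : exists2 C : R, 0 <= C & forall m : nat, (0 < m)%N ->
  m%:R `^ (a - 1) * expR (- (C / m%:R)) <= Gamma a * wc a m <= m%:R `^ (a - 1) * expR (C / m%:R).
Proof.
pose K := Num.truncn a; have /andP[Ka aK] : K%:R <= a < K.+1%:R by apply: truncn_itv; exact: ltW.
exists (K.+1%:R ^+ 2) => [|[//|m] _]; first exact: sqr_ge0.
set M : R := m.+1%:R; have M0 : 0 < M by [].
have M0' : M != 0 by rewrite gt_eqF.
have f0 : 0 < m.+1`!%:R :> R by rewrite ltr0n fact_gt0.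
have ME (s : R) : M `^ s / M = M `^ (s - 1).
  by rewrite powRD ?M0' ?implybT// powR_inv1// ltW.
apply/andP; split.
  have r0 : 0 < K.+1%:R - a by rewrite subr_gt0.
  have ry : K.+1%:R - a < (m.+1 + K).+1%:R.
    by rewrite ltrBlDr (@le_lt_trans _ _ (m.+1 + K).+1%:R) ?ltrDl// ler_nat ltnS leq_addl.
  have := Gamma_ratio r0 ry; rewrite Gamma_fact.
  have -> : (m.+1 + K).+1%:R - (K.+1%:R - a) = a + m.+1%:R by rewrite -addnS natrD; ring.
  rewrite Gamma_wc.
  have fK : m.+1`!%:R * M ^+ K <= (m.+1 + K)`!%:R.
    elim: (K) => [|k IH]; first by rewrite mulr1 addn0.
    rewrite exprSr mulrA addnS (factS (m.+1 + k)) natrM [leRHS]mulrC ler_pM ?mulr_ge0 ?exprn_ge0 ?(ltW M0)//.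
    by rewrite /M ler_nat leqW // leq_addr.
  move=> h; have {h} := le_trans fK h.
  have -> : (m.+1 + K).+1%:R `^ (K.+1%:R - a) * (Gamma a * wc a m.+1 * m.+1`!%:R)
     = m.+1`!%:R * ((m.+1 + K).+1%:R `^ (K.+1%:R - a) * (Gamma a * wc a m.+1)) by ring.
  rewrite ler_pM2l//.
  set r := K.+1%:R - a in r0 *; set y : R := (m.+1 + K).+1%:R.
  have y0 : 0 < y by [].
  move=> h; have : M ^+ K * y `^ (- r) <= Gamma a * wc a m.+1.
    by rewrite powRN ler_pdivrMr ?powR_gt0// [leRHS]mulrC.
  apply: le_trans.
  have yE : y = M * (1 + K.+1%:R / M) by rewrite /y -addnS natrD -/M; field.
  rewrite yE (powRM _ (ltW M0)); last by rewrite addr_ge0// divr_ge0// ltW.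
  rewrite mulrA ler_pM ?powR_ge0 ?expR_ge0//.
    rewrite -powR_mulrn ?(ltW M0)// -powRD ?M0' ?implybT//.
    rewrite le_eqVlt; apply/orP; left; apply/eqP; congr (_ `^ _).
    by rewrite /r -[K.+1%:R]natr1; ring.
  apply: le_trans (powR_1D_ge _ (ltW r0)); last by rewrite divr_ge0// ltW.
  rewrite ler_expR lerN2 mulrA ler_wpM2r ?invr_ge0 ?(ltW M0)// expr2 ler_wpM2r//.
  by rewrite /r gerBl ltW.
have ry : a < a + m.+1%:R by rewrite ltrDl.
have := Gamma_ratio a0 ry; rewrite Gamma_wc addrAC subrr add0r Gamma_fact.
rewrite factS natrM mulrA ler_pM2r ?ltr0n ?fact_gt0// => h.
have {h} : Gamma a * wc a m.+1 <= (a + M) `^ a / M by rewrite ler_pdivlMr.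
move/le_trans; apply.
have -> : a + M = M * (1 + a / M) by field.
rewrite (powRM _ (ltW M0)); last by rewrite addr_ge0// divr_ge0 ?(ltW a0)// ltW.
rewrite mulrAC ME ler_wpM2l ?powR_ge0//.
apply: (le_trans (powR_1D_le _ (ltW a0))); first by rewrite divr_ge0 ?(ltW a0)// ltW.
rewrite ler_expR mulrA ler_wpM2r ?invr_ge0 ?(ltW M0)// expr2.
by rewrite ler_pM// ltW.
Qed.

(** Both quantities lie between j^(a-1) exp(-D/j) and j^(a-1) exp(D/j), an interval of length
    O(j^(a-2)). *)
Lemma kernel_wc_close : exists2 C : R, 0 <= C & forall (j : nat) (y : R), (2 <= j)%N -> j%:R - 1 <= y <= j%:R + 1 ->
  `|y `^ (a - 1) - Gamma a * wc a j| <= C * j%:R `^ (a - 2).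
Proof.
have [C C0 hC] := wc_Gamma_bounds.
pose D := C + 2 * `|a - 1|; have D0 : 0 <= D by rewrite addr_ge0// mulr_ge0.
exists (2 * D * expR D) => [|j y j2 /andP[y1 y2]]; first by rewrite !mulr_ge0 ?expR_ge0.
have jR : (2 : R) <= j%:R by rewrite ler_nat.
have j0 : (0 : R) < j%:R by lra.
have y0 : 0 < y by lra.
have ji : 0 < j%:R^-1 :> R by rewrite invr_gt0.
have ji2 : j%:R^-1 <= 2^-1 :> R by rewrite lef_pV2 ?posrE.
pose u := y / j%:R; have u0 : 0 < u by rewrite divr_gt0.
have jj : j%:R * j%:R^-1 = 1 :> R by rewrite mulfV// gt_eqF.
have u1 : 1 - j%:R^-1 <= u.
  by rewrite /u ler_pdivlMr// mulrBl mul1r mulVf ?gt_eqF.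
have u2 : u <= 1 + j%:R^-1.
  by rewrite /u ler_pdivrMr// mulrDl mul1r mulVf ?gt_eqF.
have lu : `|ln u| <= 2 * j%:R^-1.
  rewrite ler_norml; apply/andP; split.
    rewrite -ler_expR lnK ?posrE//; apply: le_trans u1; apply: expRN_ge.
    by rewrite ltW.
  apply: (@le_trans _ _ (ln (1 + j%:R^-1))); first by rewrite ler_ln ?posrE ?addr_gt0.
  apply: (@le_trans _ _ j%:R^-1); last by move: ji; set z := _^-1; lra.
  by apply: le_ln1Dx; apply: lt_trans ji.
set p := j%:R `^ (a - 1); have p0 : 0 < p by rewrite powR_gt0.
have yE : y `^ (a - 1) = p * expR ((a - 1) * ln u).
  have -> : y = j%:R * u by rewrite /u mulrCA jj mulr1.
  by rewrite powRM ?(ltW j0) ?(ltW u0)// {2}/powR gt_eqF.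
have la : `|(a - 1) * ln u| <= D / j%:R.
  rewrite normrM /D mulrDl (le_trans (ler_wpM2l (normr_ge0 _) lu))// mulrCA mulrA.
  by rewrite lerDr divr_ge0// ltW.
have Cj : C / j%:R <= D / j%:R by rewrite ler_wpM2r ?(ltW ji)// lerDl mulr_ge0.
have /andP[h1 h2] := hC j (ltnW j2).
move: la; rewrite ler_norml => /andP[l1 l2].
set x := D / j%:R in l1 l2 Cj.
have x0 : 0 <= x by rewrite divr_ge0// ltW.
have B1 : p * expR (- x) <= y `^ (a - 1) <= p * expR x.
  by rewrite yE !ler_wpM2l ?(ltW p0)// ler_expR.
have B2 : p * expR (- x) <= Gamma a * wc a j <= p * expR x.
  by rewrite (le_trans _ h1) ?(le_trans h2)// ler_wpM2l ?(ltW p0)// ler_expR ?lerN2.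
have B3 : p * expR x - p * expR (- x) <= 2 * D * expR D * j%:R `^ (a - 2).
  have -> : j%:R `^ (a - 2) = p / j%:R :> R.
    rewrite /p -powR_inv1 ?(ltW j0)// -powRD ?(gt_eqF j0) ?implybT//; congr (_ `^ _); ring.
  have -> : 2 * D * expR D * (p / j%:R) = p * (expR D * (2 * x)) by rewrite /x; ring.
  rewrite -mulrBr ler_wpM2l ?(ltW p0)//.
  have xD : x <= D.
    by rewrite ler_pdivrMr// ler_peMr//; lra.
  have -> : expR (- x) = expR x * expR (- (2 * x)) by rewrite -expRD; congr expR; ring.
  rewrite -[X in X - _]mulr1 -mulrBr ler_pM ?expR_ge0 ?ler_expR//.
    by rewrite subr_ge0 -[leRHS]expR0 ler_expR oppr_le0 mulr_ge0.
  by have := expR_ge1Dx (- (2 * x)); move: (expR _) => E; lra.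
apply: le_trans B3; rewrite ler_norml.
move: B1 B2 => /andP[b1 b2] /andP[b3 b4]; move: b1 b2 b3 b4.
move: (p * expR x) (p * expR (- x)) (y `^ (a - 1)) (Gamma a * wc a j) => *; apply/andP; split; lra.
Qed.

End kernel_discretization.

(** * Mean-square error of the step approximation *)

Section kernel_variance.
Context {R : realType}.
Variable a : R.
Hypothesis a2 : 2^-1 < a.

Let a0 : 0 < a. Proof. by apply: lt_trans a2. Qed.
Let b10 : 0 < 2 * a - 1. Proof. by have := a2; lra. Qed.

(** Step value that replaces the kernel at distance about j/N from t; it is close to (j/N)^(a-1). *)
Definition kcoef (N j : nat) : R := Gamma a * N%:R `^ (1 - a) * wc a j.
(** Order of the mean-square error in 1/N: 2a - 1 from the cells next to t, capped at 1 so that the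
    other cells leave a summable series. *)
Definition ksig : R := Num.min (2 * a - 1) 1.

Lemma is_derive_kernel_sq (c x : R) : 0 < x ->
  is_derive x (1:R) (fun x => x `^ (2 * a - 1) / (2 * a - 1) - 2 * c * (x `^ a / a) + c ^+ 2 * x) ((x `^ (a - 1) - c) ^+ 2).
Proof.
move=> x0.
have h1 : is_derive x (1:R) (fun x => x `^ (2 * a - 1)) ((2 * a - 1) * x `^ (2 * a - 1 - 1)) by exact: is_derive1_powR.
have h2 : is_derive x (1:R) (fun x => x `^ a) (a * x `^ (a - 1)) by exact: is_derive1_powR.
have -> : (fun x => x `^ (2 * a - 1) / (2 * a - 1) - 2 * c * (x `^ a / a) + c ^+ 2 * x)
  = ((2 * a - 1)^-1 \*: (fun x => x `^ (2 * a - 1))) - ((2 * c / a) \*: (fun x => x `^ a)) + ((c ^+ 2) \*: id).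
  apply/funext => y.
  change (y `^ (2 * a - 1) / (2 * a - 1) - 2 * c * (y `^ a / a) + c ^+ 2 * y =
    (2 * a - 1)^-1 * y `^ (2 * a - 1) - 2 * c / a * y `^ a + c ^+ 2 * y); ring.
apply: is_derive_eq.
have e : x `^ (2 * a - 1 - 1) = (x `^ (a - 1)) ^+ 2.
  by rewrite expr2 -powRD ?(gt_eqF x0) ?implybT//; congr (_ `^ _); ring.
rewrite e /GRing.scale/=; move: (x `^ (a - 1)) => z; field.
by rewrite !gt_eqF.
Qed.

Lemma kernel_sq_mvt (c u w : R) : 0 < u -> u < w -> exists2 y, u < y < w &
  w `^ (2 * a - 1) / (2 * a - 1) - 2 * c * (w `^ a / a) + c ^+ 2 * w
  - (u `^ (2 * a - 1) / (2 * a - 1) - 2 * c * (u `^ a / a) + c ^+ 2 * u) = (y `^ (a - 1) - c) ^+ 2 * (w - u).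
Proof.
move=> u0 uw; pose df (y : R) := (y `^ (a - 1) - c) ^+ 2.
have dF (y : R) : 0 < y -> is_derive y (1:R) (fun x => x `^ (2 * a - 1) / (2 * a - 1) - 2 * c * (x `^ a / a) + c ^+ 2 * x) (df y).
  exact: is_derive_kernel_sq.
move: dF; set f := fun x : R => _ => dF.
have dI (y : R) : y \in `]u, w[ -> is_derive y (1:R) f (df y).
  by rewrite in_itv/= => /andP[h _]; apply: dF; exact: lt_trans h.
have dJ (y : R) : `[u, w]%classic y -> is_derive y (1:R) f (df y).
  by rewrite /= in_itv/= => /andP[h _]; apply: dF; exact: lt_le_trans h.
have [y yI yE] := MVT uw dI (derive_continuous dJ).
by exists y => //; move: yI; rewrite in_itv.
Qed.

Definition kcell n (t : R) : nat := Num.truncn (t * n.+1%:R).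
(** The minus sign makes X_t plus the weighted increments the approximation error. *)
Definition kweight n t (l : nat) : R := if (l <= kcell n t)%N then - kcoef n.+1 (kcell n t - l) else 0.
(** Time left from grid point l to t, cut off at 0; its a-th powers express the covariance of X_t
    with the increments. *)
Definition kres n (t : R) (l : nat) : R := t - Num.min t (l%:R / n.+1%:R).

(* cellwise, the variance is the integral of the squared difference of the kernel and its step approximation *)
Lemma kernel_var_le : exists2 C : R, 0 <= C & forall n t, 0 <= t < 1 ->
  t `^ (2 * a - 1) / (2 * a - 1) + 2 * (\sum_(l < n.+1) kweight n t l * ((kres n t l `^ a - kres n t l.+1 `^ a) / a))
   + (\sum_(l < n.+1) kweight n t l ^+ 2) / n.+1%:R <= C * n.+1%:R `^ (- ksig).
Proof.
have [C' C'0 hC] := kernel_wc_close a2.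
set G := Gamma a in hC; have G0 : 0 < G := Gamma_gt0 a2.
pose M1 : R := 2 `^ (2 * a - 1) / (2 * a - 1) + G ^+ 2 * (1 + a ^+ 2).
have M10 : 0 <= M1 by rewrite addr_ge0 ?divr_ge0 ?powR_ge0 ?(ltW b10)// mulr_ge0 ?sqr_ge0// addr_ge0 ?sqr_ge0.
pose M := 4 * M1 + 4 * C' ^+ 2.
have M0 : 0 <= M by rewrite addr_ge0// mulr_ge0 ?sqr_ge0.
exists (2 * M) => [|n t /andP[t0 t1]]; first by rewrite mulr_ge0.
pose N := n.+1; pose i := kcell n t; pose e := kweight n t; pose x := kres n t.
rewrite -/N -/e -/x.
have NR : (0 : R) < N%:R by [].
have N1 : (1 : R) <= N%:R by rewrite ler1n.
have tN : 0 <= t * N%:R by rewrite mulr_ge0// ltW.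
have /andP[i1 i2] : i%:R <= t * N%:R < i.+1%:R by exact: truncn_itv.
have iN : (i < N)%N by rewrite -(ltr_nat R) (le_lt_trans i1)// -[ltRHS]mul1r ltr_pM2r.
have x0 l : 0 <= x l by rewrite subr_ge0 ge_min lexx.
have xS l : x l.+1 <= x l.
  rewrite lerD2l lerN2 le_min ge_min lexx/= ge_min; apply/orP; right.
  by rewrite ler_pM2r ?invr_gt0// ler_nat.
have xle l : x l <= Num.max 0 (t - l%:R / N%:R).
  rewrite /x /kres le_max; case: (leP t (l%:R / N%:R)) => h; first by rewrite subrr lexx.
  by rewrite lexx orbT.
pose A (y : R) := y `^ (2 * a - 1) / (2 * a - 1).
have A0 y : 0 <= A y by rewrite divr_ge0 ?powR_ge0// ltW.
have A00 : A 0 = 0 by rewrite /A powR0 ?mul0r// gt_eqF.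
have Amono y z : 0 <= y -> y <= z -> A y <= A z.
  move=> y0 yz; rewrite ler_wpM2r ?invr_ge0 ?(ltW b10)//; apply: ge0_ler_powR; rewrite ?nnegrE ?(ltW b10)//.
  exact: le_trans yz.
(* Contribution of cell l, in terms of primitives; the first parts telescope to the variance of
   X_t. *)
pose T (l : nat) : R := (A (x l) - A (x l.+1)) + 2 * (e l * ((x l `^ a - x l.+1 `^ a) / a)) + e l ^+ 2 / N%:R.
have tele : \sum_(l < N) (A (x l) - A (x l.+1)) = A t.
  have : \sum_(0 <= l < N) (A (x l.+1) - A (x l)) = A (x N) - A (x 0) by rewrite telescope_sumr.
  have -> : x N = 0 by rewrite /x /kres divff ?gt_eqF// min_l ?subrr// ltW.
  have -> : x 0 = t by rewrite /x /kres mul0r min_r// subr0.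
  rewrite A00 sub0r big_mkord => h; rewrite -[RHS]opprK -h -sumrN; apply: eq_bigr => l _.
  by rewrite opprB.
have -> : t `^ (2 * a - 1) / (2 * a - 1) + 2 * (\sum_(l < N) e l * ((x l `^ a - x l.+1 `^ a) / a)) + (\sum_(l < N) e l ^+ 2) / N%:R = \sum_(l < N) T l.
  by rewrite /T big_split/= big_split/= tele mulr_sumr mulr_suml.
pose s := N%:R `^ (- ksig) : R; have s0 : 0 < s by rewrite powR_gt0.
have s1 : N%:R `^ (1 - 2 * a) <= s.
  apply: ler_powR => //; rewrite -[1 - 2 * a]opprB lerN2 /ksig ge_min lexx//.
have NN j : (kcoef N j) ^+ 2 / N%:R = G ^+ 2 * wc a j ^+ 2 * N%:R `^ (1 - 2 * a).
  have -> : N%:R `^ (1 - 2 * a) = N%:R `^ (1 - a) ^+ 2 / N%:R :> R.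
    rewrite expr2 -{4}[N%:R](powRr1 (ltW NR)) -powRN -!powRD ?(gt_eqF NR) ?implybT//.
    by congr (_ `^ _); ring.
  by rewrite /kcoef -/G; ring.
have Tle l : (l < N)%N -> T l <= if (l <= i)%N then s * (M * (i - l).+1%:R ^- 2) else 0.
  move=> lN; case: leqP => li; last first.
    have xl : x l = 0.
      apply/eqP; rewrite eq_le x0 andbT (le_trans (xle l))// ge_max lexx/= subr_le0 ler_pdivlMr//.
      by apply: ltW; apply: (lt_le_trans i2); rewrite ler_nat.
    have xl' : x l.+1 = 0 by apply/eqP; rewrite eq_le x0 andbT -xl.
    by rewrite /T xl xl' !subrr mul0r mulr0 mulr0 /e /kweight leqNgt li/= expr0n mul0r !addr0.
  have eE : e l = - kcoef N (i - l) by rewrite /e /kweight li.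
  (* In the two cells nearest to t the parts are bounded separately, since the kernel may be
     singular there. In the other cells the mean value theorem gives a point at which
     [kernel_wc_close] applies. *)
  have [j2|j2] := leqP (i - l) 1.
    have xl : x l <= 2 / N%:R.
      apply: (le_trans (xle l)); rewrite ge_max divr_ge0//= lerBlDr -mulrDl ler_pdivlMr//.
      apply: (le_trans (ltW i2)); rewrite -natrD ler_nat.
      by move: (j2); rewrite leq_subLR addn1 add2n ltnS.
    have p0 : 0 < N%:R `^ (1 - 2 * a) :> R by rewrite powR_gt0.
    have A2 : A (x l) <= 2 `^ (2 * a - 1) / (2 * a - 1) * N%:R `^ (1 - 2 * a).
      apply: (le_trans (Amono _ _ (x0 l) xl)); rewrite /A.
      have -> : 2 * a - 1 = - (1 - 2 * a) by ring.
      by rewrite powR_divN// le_eqVlt; apply/orP; left; apply/eqP; ring.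
    have w1 : wc a (i - l) ^+ 2 <= 1 + a ^+ 2.
      move: j2; case: (i - l)%N => [|[|//]] _; first by rewrite wc0 expr1n lerDl sqr_ge0.
      by rewrite wcS wc0 mul1r addr0 divr1 lerDr.
    have c2 : (kcoef N (i - l)) ^+ 2 / N%:R <= G ^+ 2 * (1 + a ^+ 2) * N%:R `^ (1 - 2 * a).
      by rewrite NN ler_wpM2r ?(ltW p0)// ler_wpM2l ?sqr_ge0.
    have k0 : 0 <= kcoef N (i - l) by rewrite /kcoef -/G !mulr_ge0 ?powR_ge0 ?(ltW G0)// ltW// wc_gt0.
    have d0 : 0 <= (x l `^ a - x l.+1 `^ a) / a.
      rewrite divr_ge0 ?(ltW a0)// subr_ge0; apply: ge0_ler_powR; rewrite ?nnegrE ?(ltW a0)//.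
    have T1 : T l <= M1 * N%:R `^ (1 - 2 * a).
      rewrite /T eE sqrrN mulNr; have := mulr_ge0 k0 d0; have := A0 (x l.+1).
      move=> q1 q2; rewrite /M1 [leRHS]mulrDl; move: A2 c2 q1 q2.
      have aux (u1 u2 u3 u4 u5 u6 : R) : u1 <= u2 -> u3 <= u4 -> 0 <= u5 -> 0 <= u6 -> u1 - u5 + 2 * - u6 + u3 <= u2 + u4 by move=> *; lra.
      exact: aux.
    apply: (le_trans T1); apply: (@le_trans _ _ (M1 * s)); first by rewrite ler_wpM2l.
    rewrite mulrC ler_wpM2l ?(ltW s0)//.
    have j4 : 4^-1 <= (i - l).+1%:R ^- 2 :> R.
      rewrite lef_pV2 ?posrE ?exprn_gt0// -natrX ler_nat.
      by move: j2; case: (i - l)%N => [|[|//]].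
    have := ler_wpM2l M0 j4; have : 0 <= C' ^+ 2 by exact: sqr_ge0.
    rewrite {1}/M; move: (M * _) (C' ^+ 2) => u v; lra.
  have li' : (l + 2 <= i)%N by rewrite -leq_subRL.
  have liR : l%:R + 2 <= i%:R :> R by rewrite -natrD ler_nat.
  have xE k : (k <= i)%N -> x k = t - k%:R / N%:R.
    move=> ki; rewrite /x /kres min_r// ler_pdivrMr//; apply: le_trans i1; by rewrite ler_nat.
  have jE : (i - l)%:R = i%:R - l%:R :> R by rewrite natrB.
  have xlE := xE l li; have xlE' := xE l.+1 (leq_trans (leqnSn _) (leq_trans _ li')).
  rewrite addn2 in xlE'; have {}xlE' := xlE' (leqnn _).
  have xd : x l - x l.+1 = N%:R^-1.
    by rewrite xlE xlE' -[l.+1%:R]natr1 (mulrDl l%:R) mul1r; ring.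
  have xlow : (i%:R - l%:R - 1) / N%:R <= x l.+1.
    rewrite xlE' ler_pdivrMr// mulrBl divfK ?gt_eqF// -[l.+1%:R]natr1.
    by move: i1; move: (t * _) (l%:R : R) => u v; lra.
  have xup : x l <= (i%:R - l%:R + 1) / N%:R.
    rewrite xlE ler_pdivlMr// mulrBl divfK ?gt_eqF//.
    by move: i2; rewrite -[i.+1%:R]natr1; move: (t * _) (l%:R : R) => u v; lra.
  have xpos : 0 < x l.+1.
    apply: lt_le_trans xlow; rewrite divr_gt0//; lra.
  have xlt : x l.+1 < x l by rewrite -subr_gt0 xd invr_gt0.
  set c := kcoef N (i - l) in eE.
  have [y /andP[y1 y2] fE] := kernel_sq_mvt c xpos xlt.
  have TE : T l = (y `^ (a - 1) - c) ^+ 2 / N%:R.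
    rewrite -xd -fE /T eE -xd /A sqrrN; ring.
  have y0 : 0 < y by exact: lt_trans y1.
  pose z := y * N%:R; have yz : y = z / N%:R by rewrite /z mulfK// gt_eqF.
  have z0 : 0 < z by rewrite mulr_gt0.
  have zI : (i - l)%:R - 1 <= z <= (i - l)%:R + 1.
    rewrite jE; apply/andP; split.
      by rewrite /z -ler_pdivrMr//; apply: le_trans (ltW y1).
    by rewrite /z -ler_pdivlMr//; apply: le_trans xup; exact: ltW.
  have j2' : (2 <= i - l)%N by [].
  have hz := hC _ _ j2' zI.
  have yE : y `^ (a - 1) - c = N%:R `^ (1 - a) * (z `^ (a - 1) - G * wc a (i - l)).
    rewrite {1}yz (_ : a - 1 = - (1 - a)); last by ring.
    rewrite powR_divN// /c /kcoef -/G; ring.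
  set j := (i - l)%N in hz yE j2' *.
  have j0 : (0 : R) < j%:R by rewrite ltr0n (leq_trans _ j2').
  have jN : j%:R <= N%:R :> R by rewrite ler_nat (leq_trans (leq_subr _ _))// ltnW.
  have sq : (z `^ (a - 1) - G * wc a j) ^+ 2 <= (C' * j%:R `^ (a - 2)) ^+ 2.
    by rewrite -real_normK ?num_real// lerXn2r ?nnegrE// mulr_ge0// powR_ge0.
  have N2 : N%:R `^ (1 - a) ^+ 2 / N%:R = N%:R `^ (1 - 2 * a) :> R.
    rewrite expr2 -{3}[N%:R](powRr1 (ltW NR)) -powRN -!powRD ?(gt_eqF NR) ?implybT//.
    by congr (_ `^ _); ring.
  have s13 : ksig <= 1 by rewrite /ksig ge_min lexx orbT.
  have s2a : ksig <= 2 * a - 1 by rewrite /ksig ge_min lexx.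
  (* As j <= N and ksig <= 2a - 1, the power j^(2a-1-ksig) is traded for the same power of N; ksig
     <= 1 then leaves j^(-2). *)
  have jp : N%:R `^ (1 - 2 * a) * (j%:R `^ (a - 2)) ^+ 2 <= s * j%:R ^- 2.
    have -> : (j%:R `^ (a - 2)) ^+ 2 = j%:R `^ (2 * a - 1 - ksig) * j%:R `^ (ksig - 3) :> R.
      by rewrite expr2 -!powRD ?(gt_eqF j0) ?implybT//; congr (_ `^ _); ring.
    have -> : s = N%:R `^ (1 - 2 * a) * N%:R `^ (2 * a - 1 - ksig).
      by rewrite -powRD ?(gt_eqF NR) ?implybT//; congr (_ `^ _); ring.
    rewrite -[leRHS]mulrA ler_wpM2l ?powR_ge0// ler_pM ?powR_ge0//.
      apply: ge0_ler_powR; rewrite ?nnegrE ?subr_ge0 ?(ltW j0) ?(ltW NR)//.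
    have -> : j%:R ^- 2 = j%:R `^ (- 2) :> R by rewrite powRN powR_mulrn// ltW.
    by apply: ler_powR; [rewrite ler1n (leq_trans _ j2')|move: s13; lra].
  have jj : j%:R ^- 2 <= 4 * j.+1%:R ^- 2 :> R.
    have j1 : (1 : R) <= j%:R by rewrite ler1n (leq_trans _ j2').
    rewrite -[j.+1%:R]natr1 -subr_ge0; move: (j%:R : R) j0 j1 => v v0 v1.
    rewrite (_ : 4 * (v + 1) ^- 2 - v ^- 2 = (v - 1) * (3 * v + 1) / (v ^+ 2 * (v + 1) ^+ 2)); last first.
      by field; rewrite !gt_eqF// addr_gt0.
    rewrite divr_ge0 ?mulr_ge0 ?sqr_ge0 ?subr_ge0//; lra.
  rewrite TE yE exprMn mulrAC N2.
  apply: (@le_trans _ _ (C' ^+ 2 * (s * j%:R ^- 2))).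
    apply: (le_trans (ler_wpM2l (powR_ge0 _ _) sq)).
    by rewrite exprMn mulrCA ler_wpM2l ?sqr_ge0.
  rewrite mulrCA ler_wpM2l ?(ltW s0)//.
  apply: (le_trans (ler_wpM2l (sqr_ge0 _) jj)); rewrite mulrCA mulrA.
  by rewrite ler_wpM2r ?invr_ge0 ?sqr_ge0// lerDr mulr_ge0.
apply: (@le_trans _ _ (\sum_(l < N) if (l <= i)%N then s * (M * (i - l).+1%:R ^- 2) else 0)).
  by apply: ler_sum => l _; exact: Tle.
rewrite -big_mkcond/= (eq_bigl (fun l : 'I_N => (l < i.+1)%N))//.
rewrite -(big_ord_widen N (fun l => s * (M * (i - l).+1%:R ^- 2)) iN).
rewrite (reindex_inj rev_ord_inj)/=.
rewrite (eq_bigr (fun l : 'I_i.+1 => s * M * l.+1%:R ^- 2)); last first.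
  by move=> l _; rewrite subSS subKn ?mulrA// -ltnS.
rewrite -mulr_sumr -/s [leRHS]mulrC [2 * M]mulrC mulrA ler_wpM2l ?mulr_ge0 ?(ltW s0)//.
exact: sum_inv_sqr.
Qed.

End kernel_variance.

(** * Brownian increments and their covariance with the process *)

Section brownian_increments.
Context {R : realType} d (Omega : measurableType d) (P : probability Omega R).

(* for v < 0 the law would be the uniform law on [0,1], by the junk values of sqrt and normal_prob *)
Lemma centered_gaussian_var_ge0 (Z : Omega -> R) (v : R) :
  centered_gaussian_law P Z v -> centered_gaussian_law P (fun w => - Z w) v -> 0 <= v.
Proof.
move=> [mZ H1] [mZ' H2]; rewrite leNgt; apply/negP => v0.
rewrite lt_eqF// ler0_sqrtr ?ltW// in H1; rewrite lt_eqF// ler0_sqrtr ?ltW// in H2.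
have nE (A : set R) : measurable A -> A `<=` `[0, 1]%classic -> normal_prob 0 0 A = lebesgue_measure A.
  move=> mA sA; rewrite /normal_prob /normal_pdf eqxx integral_indic//.
  by rewrite setIidr.
have m01 : measurable (`[0, 1]%classic : set R) by exact: measurable_itv.
have e1 : P (Z @^-1` `[0, 1]%classic) = 1%E.
  by rewrite H1// nE// lebesgue_measure_itv/= lte_fin ltr01 oppr0 adde0.
have e2 : P ((fun w => - Z w) @^-1` `[0, 1]%classic) = 1%E.
  by rewrite H2// nE// lebesgue_measure_itv/= lte_fin ltr01 oppr0 adde0.
have e3 : P (Z @^-1` [set 0]) = 0%E.
  by rewrite H1// nE ?lebesgue_measure_set1// => x ->; rewrite /= in_itv/= lexx ler01.
have mA : measurable (Z @^-1` `[0, 1]%classic) by exact: measurable_preimageT.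
have mB : measurable ((fun w => - Z w) @^-1` `[0, 1]%classic) by exact: measurable_preimageT.
have c2 : P (~` ((fun w => - Z w) @^-1` `[0, 1]%classic)) = 0%E.
  by apply: etrans (probability_setC P mB) _; rewrite e2 subee.
have : (P (Z @^-1` `[0%R, 1%R]%classic) <= P (Z @^-1` [set 0%R]) + P (~` ((fun w => (- Z w)%R) @^-1` `[0%R, 1%R]%classic)))%E.
  apply: le_trans (measureU2 _ _ _); last 2 first.
  - exact: measurable_preimageT.
  - exact: measurableC.
  apply: le_measure; rewrite ?inE//.
    by apply: measurableU; [exact: measurable_preimageT|exact: measurableC].
  move=> w /=; rewrite !in_itv/= => /andP[z0 z1].
  have [zw|zw] := eqVneq (Z w) 0; [by left|right].
  by rewrite oppr_ge0 => /andP[z2 _]; case/negP: zw; rewrite eq_le z2 z0.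
by rewrite e1 e3 c2 adde0 leNgt lte01.
Qed.

Variables (rho : R) (W X : R -> Omega -> R).
Hypotheses (rho0 : 0 < rho) (HX : is_RL_process_of_BM P rho W X).
Let a := rho + 2^-1.
Let a2 : 2^-1 < a. Proof. by rewrite ltrDr. Qed.
Let a0 : 0 < a. Proof. by apply: lt_trans a2. Qed.
Let b10 : 0 < 2 * a - 1. Proof. by have := a2; lra. Qed.

Lemma min_grid n p q : Num.min (p%:R / n.+1%:R) (q%:R / n.+1%:R) = (minn p q)%:R / n.+1%:R :> R.
Proof.
rewrite /minn; case: ltnP => h; [rewrite min_l//|rewrite min_r//]; rewrite ler_pM2r ?invr_gt0// ler_nat//.
exact: ltnW.
Qed.

(** Increments over distinct cells are uncorrelated: for l <> m the four minima cancel. *)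
Lemma increments_cov n (e : 'I_n.+1 -> R) :
  \sum_l \sum_m e l * e m * (Num.min (l.+1%:R / n.+1%:R) (m.+1%:R / n.+1%:R) - Num.min (l.+1%:R / n.+1%:R) (m%:R / n.+1%:R)
    - Num.min (l%:R / n.+1%:R) (m.+1%:R / n.+1%:R) + Num.min (l%:R / n.+1%:R) (m%:R / n.+1%:R)) = (\sum_l e l ^+ 2) / n.+1%:R.
Proof.
rewrite mulr_suml; apply: eq_bigr => l _.
rewrite (bigD1 l)//= big1 ?addr0 => [|m ml]; rewrite !min_grid.
  have -> : minn l.+1 l.+1 = l.+1 by rewrite minnn.
  have -> : minn l.+1 l = l by apply/minn_idPr.
  have -> : minn l l.+1 = l by apply/minn_idPl.
  by rewrite minnn -[l.+1%:R]natr1 (mulrDl l%:R) mul1r; ring.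
have h : (minn l.+1 m.+1 + minn l m = minn l.+1 m + minn l m.+1)%N.
  have : nat_of_ord m != nat_of_ord l by [].
  by move: (nat_of_ord l) (nat_of_ord m) => i j ij; lia.
have hR : (minn l.+1 m.+1)%:R + (minn l m)%:R = (minn l.+1 m)%:R + (minn l m.+1)%:R :> R by rewrite -!natrD h.
rewrite [X in _ * X](_ : _ = 0) ?mulr0//.
rewrite -!mulrBl -mulrDl [X in X * _](_ : _ = 0) ?mul0r//.
by move: hR; move: (_%:R) (_%:R) (_%:R) (_%:R) => x1 x2 x3 x4; lra.
Qed.

Let fam : centered_gaussian_family P RL_BM_domain (fun k => if k.1 then X k.2 else W k.2) (RL_BM_cov rho).
Proof. by case: HX. Qed.

Let gridF n l : RL_BM_domain (false, l%:R / n.+1%:R : R).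
Proof. by rewrite /RL_BM_domain/= divr_ge0. Qed.

Definition bmi n (l : 'I_n.+1) (w : Omega) : R := Num.sqrt n.+1%:R * (W (l.+1%:R / n.+1%:R) w - W (l%:R / n.+1%:R) w).

Lemma bmi_std_gauss n : std_gauss P (@bmi n).
Proof.
have law (e : 'I_n.+1 -> R) : is_gauss P (fun w => \sum_l e l * (W (l.+1%:R / n.+1%:R) w - W (l%:R / n.+1%:R) w)) ((\sum_l e l ^+ 2) / n.+1%:R).
  apply: centered_gaussian_is_gauss.
    by rewrite divr_ge0//; apply: sumr_ge0 => l _; exact: sqr_ge0.
  have := gaussian_family_increments (i0 := (false, 0)) (p := fun l : 'I_n.+1 => (false, l.+1%:R / n.+1%:R))
    (q := fun l : 'I_n.+1 => (false, l%:R / n.+1%:R)) 0 e fam (lexx _) (fun l => gridF n l.+1) (fun l => gridF n l).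
  rewrite /= increments_cov expr0n/= !mul0r !add0r.
  by congr (centered_gaussian_law _ _ _); apply/funext => w; rewrite mul0r add0r.
have lin (c : 'I_n.+1 -> R) : (fun w => \sum_l c l * bmi l w) = (fun w => \sum_l (c l * Num.sqrt n.+1%:R) * (W (l.+1%:R / n.+1%:R) w - W (l%:R / n.+1%:R) w)).
  by apply/funext => w; apply: eq_bigr => l _; rewrite mulrA.
split=> [l|c p].
  have [m _] := law (fun k => (k == l)%:R * Num.sqrt n.+1%:R).
  rewrite -lin in m; rewrite (_ : bmi l = (fun w => \sum_k (k == l)%:R * bmi k w))//.
  apply/funext => w; rewrite (bigD1 l)//= eqxx mul1r big1 ?addr0// => k /negPf ->.
  by rewrite mul0r.
have [_ h] := law (fun l => c l * Num.sqrt n.+1%:R).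
transitivity (\int[P]_w (1 + cos (1 * (\sum_l (c l * Num.sqrt n.+1%:R) * (W (l.+1%:R / n.+1%:R) w - W (l%:R / n.+1%:R) w)) + p))%:E)%E.
  by apply: eq_integral => w _; rewrite mul1r -(congr1 (@^~ w) (lin c)).
rewrite h; congr (1 + cos p * expR (- (_ / 2)))%:E.
rewrite expr1n mul1r mulr_suml; apply: eq_bigr => l _.
by rewrite exprMn sqr_sqrtr// mulfK.
Qed.

Let covXX t : 0 <= t -> RL_BM_cov rho (true, t) (true, t) = t `^ (2 * a - 1) / (2 * a - 1).
Proof.
move=> t0; rewrite /RL_BM_cov minxx /Rintegral.
have -> : (\int[lebesgue_measure]_(s in `[0%R, t]) (RL_kernel rho t s * RL_kernel rho t s)%:E =
  \int[lebesgue_measure]_(s in `[0%R, t]) ((t - s) `^ (2 * a - 1 - 1))%:E)%E.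
  apply: eq_integral => s _; congr (_ %:E); rewrite /RL_kernel -expr2 -powR_mulrn ?powR_ge0// -powRrM.
  by congr (_ `^ _); rewrite /a; field.
have := @integral_powR_sub R (2 * a - 1) t t b10; rewrite t0 lexx => -> //.
by rewrite /= subrr powR0 ?subr0// gt_eqF.
Qed.

Let covXW t u : 0 <= t -> 0 <= u -> RL_BM_cov rho (true, t) (false, u) = (t `^ a - (t - Num.min t u) `^ a) / a.
Proof.
move=> t0 u0; rewrite /RL_BM_cov /Rintegral.
have -> : (\int[lebesgue_measure]_(s in `[0%R, Num.min t u]) (RL_kernel rho t s)%:E =
  \int[lebesgue_measure]_(s in `[0%R, Num.min t u]) ((t - s) `^ (a - 1))%:E)%E.
  by apply: eq_integral => s _; congr (_ `^ _)%:E; rewrite /a; field.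
by rewrite integral_powR_sub// le_min t0 u0 ge_min lexx.
Qed.

Lemma RL_step_error n t : 0 <= t < 1 ->
  (\int[P]_w ((X t w + \sum_(l < n.+1) kweight a n t l * (W (l.+1%:R / n.+1%:R) w - W (l%:R / n.+1%:R) w)) ^+ 2)%:E =
   (t `^ (2 * a - 1) / (2 * a - 1) + 2 * (\sum_(l < n.+1) kweight a n t l * ((kres n t l `^ a - kres n t l.+1 `^ a) / a))
   + (\sum_(l < n.+1) kweight a n t l ^+ 2) / n.+1%:R)%:E)%E.
Proof.
move=> /andP[t0 t1].
have Dt : RL_BM_domain (true, t) by rewrite /RL_BM_domain/= t0 ltW.
pose v := t `^ (2 * a - 1) / (2 * a - 1) + 2 * (\sum_(l < n.+1) kweight a n t l * ((kres n t l `^ a - kres n t l.+1 `^ a) / a))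
   + (\sum_(l < n.+1) kweight a n t l ^+ 2) / n.+1%:R.
have E1 := covXX t0.
have E2 (l : nat) := covXW t0 (divr_ge0 (ler0n R l) (ler0n R n.+1)).
rewrite /= in E1 E2.
(* Both signs x = 1 and x = -1 are used: [centered_gaussian_var_ge0] needs the law of the variable
   and of its opposite to conclude v >= 0. *)
have law (x : R) : x ^+ 2 = 1 -> centered_gaussian_law P (fun w => x * (X t w + \sum_(l < n.+1) kweight a n t l * (W (l.+1%:R / n.+1%:R) w - W (l%:R / n.+1%:R) w))) v.
  move=> x2.
  have := gaussian_family_increments (i0 := (true, t)) (p := fun l : 'I_n.+1 => (false, l.+1%:R / n.+1%:R))
    (q := fun l : 'I_n.+1 => (false, l%:R / n.+1%:R)) x (fun l => x * kweight a n t l) fam Dt (fun l => gridF n l.+1) (fun l => gridF n l).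
  rewrite /= increments_cov.
  congr (centered_gaussian_law _ _ _).
    apply/funext => w; rewrite mulrDr mulr_sumr; congr (_ + _); apply: eq_bigr => l _; exact: esym (mulrA _ _ _).
  rewrite E1 x2 mul1r /v -!addrA; congr (_ + _); rewrite addrA; congr (_ + _); last first.
    by congr (_ / _); apply: eq_bigr => l _; rewrite exprMn x2 mul1r.
  have S : x * (\sum_(l < n.+1) x * kweight a n t l * (Rintegral lebesgue_measure `[0, Num.min t (l.+1%:R / n.+1%:R)] (RL_kernel rho t) - Rintegral lebesgue_measure `[0, Num.min t (l%:R / n.+1%:R)] (RL_kernel rho t)))
      = \sum_(l < n.+1) kweight a n t l * ((kres n t l `^ a - kres n t l.+1 `^ a) / a).
    rewrite mulr_sumr; apply: eq_bigr => l _; rewrite !E2 mulrA mulrA -expr2 x2 mul1r; congr (_ * _).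
    rewrite /kres; ring.
  by rewrite S; move: (\sum_(l < n.+1) _) => z; ring.
have v0 : 0 <= v.
  apply: (@centered_gaussian_var_ge0 _ v (law 1 (expr1n _ 2))).
  have m1 : (-1) ^+ 2 = 1 :> R by rewrite sqrrN expr1n.
  have := law (-1) m1.
  by congr (centered_gaussian_law _ _ _); apply/funext => w; rewrite mulN1r mul1r.
have := law 1 (expr1n _ 2) => /(centered_gaussian_is_gauss v0) /(is_gauss_sqr v0).
by under eq_integral do rewrite mul1r.
Qed.

End brownian_increments.

(** * Step functions in L^2 *)

Section step_functions.
Context {R : realType}.
Notation T := (measurableTypeR R).
Notation mu := (@lebesgue_measure R).

Definition cell n (k : nat) : set R := `[k%:R / n.+1%:R, k.+1%:R / n.+1%:R[%classic.

(** Defined on the whole line, with half-open cells that partition [0, 1[; the point 1 is lost but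
    negligible. *)
Definition stp n (v : 'I_n.+1 -> R) (t : R) : R := \sum_(k < n.+1) \1_(cell n k) t * v k.

Lemma measurable_cell n k : measurable (cell n k : set T).
Proof. exact: measurable_itv. Qed.

Lemma lebesgue_cell n k : mu (cell n k) = (n.+1%:R^-1)%:E.
Proof.
rewrite /cell lebesgue_measure_itv/= lte_fin ltr_pM2r ?invr_gt0// ltr_nat ltnSn -EFinD; congr (_ %:E).
by rewrite -mulrBl -[k.+1%:R]natr1 addrC addKr mul1r.
Qed.

Lemma kcell_lt n (t : R) : 0 <= t < 1 -> (kcell n t < n.+1)%N.
Proof.
move=> /andP[t0 t1]; have /andP[i1 _] : (kcell n t)%:R <= t * n.+1%:R < (kcell n t).+1%:R.
  by apply: truncn_itv; rewrite mulr_ge0.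
by rewrite -(ltr_nat R) (le_lt_trans i1)// -[ltRHS]mul1r ltr_pM2r.
Qed.

Lemma mem_cell n (t : R) (k : nat) : 0 <= t < 1 -> (t \in cell n k) = (k == kcell n t).
Proof.
move=> /andP[t0 t1]; have /andP[i1 i2] : (kcell n t)%:R <= t * n.+1%:R < (kcell n t).+1%:R.
  by apply: truncn_itv; rewrite mulr_ge0.
apply/idP/eqP => [/set_mem|->]; last first.
  by apply/mem_set; rewrite /cell /= in_itv/= ler_pdivrMr// i1 ltr_pdivlMr.
rewrite /cell /= in_itv/= ler_pdivrMr// ltr_pdivlMr// => /andP[k1 k2].
have h1 := le_lt_trans k1 i2; have h2 := le_lt_trans i1 k2.
by rewrite ltr_nat ltnS in h1; rewrite ltr_nat ltnS in h2; apply/eqP; rewrite eqn_leq h1 h2.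
Qed.

Lemma stp_in n (v : 'I_n.+1 -> R) (t : R) (ht : 0 <= t < 1) : stp v t = v (Ordinal (kcell_lt n ht)).
Proof.
rewrite /stp (bigD1 (Ordinal (kcell_lt n ht)))//= indicE mem_cell// eqxx mul1r big1 ?addr0// => k kn.
have h : (nat_of_ord k == kcell n t) = false by apply/negbTE; exact: kn.
by rewrite indicE mem_cell// h mul0r.
Qed.

Lemma stp_out n (v : 'I_n.+1 -> R) (t : R) : ~~ (0 <= t < 1) -> stp v t = 0.
Proof.
move=> ht; rewrite /stp big1// => k _; suff h : (t \in cell n k) = false by rewrite indicE h mul0r.
apply/negP => /set_mem; rewrite /cell /= in_itv/= => /andP[h1 h2]; case/negP: ht.
rewrite (le_trans _ h1) ?divr_ge0//= (lt_le_trans h2)// ler_pdivrMr// mul1r ler_nat//.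
Qed.

Lemma stp_map2 n (F : R -> R -> R) (v v' : 'I_n.+1 -> R) (t : R) : F 0 0 = 0 ->
  F (stp v t) (stp v' t) = stp (fun k => F (v k) (v' k)) t.
Proof.
move=> F0; have [ht|ht] := boolP (0 <= t < 1); first by rewrite !(stp_in _ ht).
by rewrite !stp_out.
Qed.

Lemma measurable_stp n (v : 'I_n.+1 -> R) : measurable_fun [set: T] (stp v).
Proof.
apply: measurable_sum => k; apply: measurable_funM => //; apply: measurable_indic; exact: measurable_cell.
Qed.

Lemma integral_stp n (v : 'I_n.+1 -> R) : (forall k, 0 <= v k) ->
  (\int[mu]_t (stp v t)%:E = ((\sum_k v k) / n.+1%:R)%:E)%E.
Proof.
move=> v0; under eq_integral do rewrite /stp -sumEFin.
rewrite ge0_integral_sum//; last 2 first.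
- move=> k; apply/measurable_EFinP; apply: measurable_funM => //; apply: measurable_indic; exact: measurable_cell.
- by move=> k t _; rewrite lee_fin mulr_ge0.
rewrite mulr_suml -sumEFin; apply: eq_bigr => k _.
under eq_integral do rewrite mulrC EFinM.
rewrite ge0_integralZl_EFin//; last first.
  by apply/measurable_EFinP; apply: measurable_indic; exact: measurable_cell.
rewrite integral_indic//; last exact: measurable_cell.
by rewrite setIT EFinM; congr (_ * _)%E; exact: lebesgue_cell.
Qed.

Definition dst (u v : R -> R) : \bar R := (\int[mu]_t ((u t - v t) ^+ 2)%:E)%E.

Lemma measurable_sqrB (u v : T -> R) : measurable_fun [set: T] u -> measurable_fun [set: T] v ->
  measurable_fun [set: T] (fun t => ((u t - v t) ^+ 2)%:E).
Proof. by move=> mu' mv; apply/measurable_EFinP; apply: measurable_funX; exact: measurable_funB. Qed.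

Lemma dst_ge0 u v : (0 <= dst u v)%E.
Proof. by apply: integral_ge0 => t _; rewrite lee_fin sqr_ge0. Qed.

Lemma dstC u v : dst u v = dst v u.
Proof. by apply: eq_integral => t _; rewrite -sqrrN opprB. Qed.

Lemma dst_tri (e : R) (u v s : T -> R) : 0 < e -> measurable_fun [set: T] u -> measurable_fun [set: T] v ->
  measurable_fun [set: T] s -> (dst u v <= (1 + e)%:E * dst u s + (1 + e^-1)%:E * dst s v)%E.
Proof.
move=> e0 mu' mv ms.
have e1 : 0 <= 1 + e by rewrite addr_ge0// ltW.
have e2 : 0 <= 1 + e^-1 by rewrite addr_ge0// invr_ge0 ltW.
have q0 (x : R) : 0 <= x ^+ 2 := sqr_ge0 x.
have Zl (k : R) (f g : T -> R) : 0 <= k -> measurable_fun [set: T] f -> measurable_fun [set: T] g ->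
    (k%:E * dst f g = \int[mu]_t (k * (f t - g t) ^+ 2)%:E)%E.
  move=> k0 mf mg; rewrite /dst -ge0_integralZl_EFin//; first by move=> t _; rewrite lee_fin.
  exact: measurable_sqrB.
have mz (k : R) (f g : T -> R) : measurable_fun [set: T] f -> measurable_fun [set: T] g ->
    measurable_fun [set: T] (fun t => (k * (f t - g t) ^+ 2)%:E).
  move=> mf mg; have /measurable_EFinP h := measurable_sqrB mf mg.
  by apply/measurable_EFinP; exact: measurable_funM.
rewrite !Zl// /dst -ge0_integralD//; last 4 first.
- by move=> t _; rewrite lee_fin mulr_ge0.
- exact: mz.
- by move=> t _; rewrite lee_fin mulr_ge0.
- exact: mz.
apply: ge0_le_integral => //.
- by move=> t _; rewrite lee_fin.
- exact: measurable_sqrB.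
- by apply: emeasurable_funD; exact: mz.
move=> t _; rewrite -EFinD lee_fin.
rewrite (_ : u t - v t = (u t - s t) + (s t - v t)); last by ring.
exact: sqr_add_le.
Qed.

Lemma dst_stp n (v v' : 'I_n.+1 -> R) : dst (stp v) (stp v') = (dist2 v v' / n.+1%:R)%:E.
Proof.
rewrite /dst; under eq_integral => t _ do rewrite (stp_map2 (F := fun x y => (x - y) ^+ 2)) ?subrr ?expr0n//.
by rewrite integral_stp// => k; exact: sqr_ge0.
Qed.

(* orthogonal projection onto step functions does not increase the distance to a step function *)
Lemma dst_avg n (f : T -> R) : measurable_fun [set: T] f -> (\int[mu]_t ((f t) ^+ 2)%:E < +oo)%E ->
  exists m : 'I_n.+1 -> R, forall v : 'I_n.+1 -> R, (dst (stp v) (stp m) <= dst (stp v) f)%E.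
Proof.
move=> mf f2.
have mc (k : 'I_n.+1) := measurable_cell n k.
have mf2 : measurable_fun [set: T] (fun t => f t ^+ 2) by exact: measurable_funX.
have i2 (k : 'I_n.+1) : mu.-integrable (cell n k) (EFin \o (fun t => f t ^+ 2)).
  apply: (@integrableS _ _ _ mu setT) => //.
  apply/integrableP; split; first exact/measurable_EFinP.
  by under eq_integral do rewrite /= ger0_norm ?sqr_ge0//.
have ic (k : 'I_n.+1) (c : R) : mu.-integrable (cell n k) (EFin \o (fun _ : T => c)).
  apply/integrableP; split; first exact/measurable_EFinP.
  by rewrite integral_cst// [X in (_ * X)%E](lebesgue_cell n k) -EFinM ltry.
have i1 (k : 'I_n.+1) : mu.-integrable (cell n k) (EFin \o f).
  apply: (le_integrable (mc k) (f := EFin \o f) (g := EFin \o (fun t => 1 + f t ^+ 2))).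
  - by apply/measurable_EFinP; exact: measurable_funTS.
  - move=> t _; rewrite /= lee_fin [leRHS]ger0_norm ?addr_ge0 ?sqr_ge0//.
    rewrite -[f t ^+ 2]real_normK ?num_real//.
    by have := sqr_ge0 (`|f t| - 1); have := normr_ge0 (f t); move: `|f t| => z; rewrite sqrrB expr1n; lra.
  - exact: (integrableD (mc k) (ic k 1) (i2 k)).
pose I1 (k : 'I_n.+1) := \int[mu]_(t in cell n k) f t.
pose I2 (k : 'I_n.+1) := \int[mu]_(t in cell n k) (f t ^+ 2).
have ex (k : 'I_n.+1) (c : R) : (\int[mu]_(t in cell n k) ((c - f t) ^+ 2)%:E = (I2 k + (- 2 * c * I1 k) + c ^+ 2 / n.+1%:R)%:E)%E.
  have j1 : mu.-integrable (cell n k) (EFin \o (fun t => - 2 * c * f t)).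
    exact: (integrableZl (mc k) (- 2 * c) (i1 k)).
  have j2 : mu.-integrable (cell n k) (EFin \o (fun t => f t ^+ 2 + - 2 * c * f t)).
    exact: (integrableD (mc k) (i2 k) j1).
  transitivity (\int[mu]_(t in cell n k) ((f t ^+ 2 + - 2 * c * f t)%:E + (c ^+ 2)%:E))%E.
    by apply: eq_integral => t _; rewrite -EFinD; congr (_ %:E); ring.
  rewrite (integralD (mc k) j2 (ic k (c ^+ 2))) integral_cst// [X in (_ + _ * X)%E](lebesgue_cell n k) -EFinM.
  rewrite EFinD; congr (_ + _)%E.
  transitivity (\int[mu]_(t in cell n k) ((f t ^+ 2)%:E + (- 2 * c * f t)%:E))%E; first by apply: eq_integral.
  rewrite (integralD (mc k) (i2 k) j1) EFinD; congr (_ + _)%E.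
    by rewrite /I2 /Rintegral fineK//; apply: integrable_fin_num => //; exact: i2.
  rewrite -(RintegralZl _ (mc k) (i1 k)) /Rintegral fineK//; apply: integrable_fin_num => //; exact: j1.
exists (fun k => n.+1%:R * I1 k) => v.
rewrite dst_stp /dist2 mulr_suml -sumEFin.
apply: (@le_trans _ _ (\sum_(k < n.+1) \int[mu]_(t in cell n k) ((v k - f t) ^+ 2)%:E)%E).
  apply: lee_sum => k _; rewrite ex lee_fin.
  have : 0 <= I2 k + (- 2 * (n.+1%:R * I1 k) * I1 k) + (n.+1%:R * I1 k) ^+ 2 / n.+1%:R.
    by rewrite -lee_fin -ex; apply: integral_ge0 => t _; rewrite lee_fin sqr_ge0.
  have n0 : n.+1%:R != 0 :> R by rewrite pnatr_eq0.
  move: (n.+1%:R : R) n0 => N N0.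
  have -> : (N * I1 k) ^+ 2 / N = N * I1 k * I1 k by field.
  have -> : (v k - N * I1 k) ^+ 2 / N = v k ^+ 2 / N - 2 * v k * I1 k + N * I1 k * I1 k by field.
  move: (v k ^+ 2 / N) (I2 k) => x1 x2.
  have -> : - 2 * (N * I1 k) * I1 k = - 2 * (N * I1 k * I1 k) by ring.
  have -> : - 2 * v k * I1 k = - (2 * v k * I1 k) by ring.
  move: (2 * v k * I1 k) (N * I1 k * I1 k) => x3 x4; lra.
have mq (k : 'I_n.+1) : measurable_fun [set: T] (fun t => (\1_(cell n k) t * (v k - f t) ^+ 2)%:E).
  apply/measurable_EFinP; apply: measurable_funM; first by apply: measurable_indic; exact: mc.
  by apply: measurable_funX; exact: measurable_funB.
rewrite (eq_bigr (fun k : 'I_n.+1 => \int[mu]_t (\1_(cell n k) t * (v k - f t) ^+ 2)%:E)%E); last first.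
  move=> k _; rewrite integral_mkcond; apply: eq_integral => t _; rewrite patchE indicE.
  by case: ifP; rewrite ?mul1r ?mul0r.
rewrite -ge0_integral_sum//; last by move=> k t _; rewrite lee_fin mulr_ge0 ?sqr_ge0.
apply: ge0_le_integral => //.
- by move=> t _; rewrite sumEFin lee_fin; apply: sumr_ge0 => k _; rewrite mulr_ge0 ?sqr_ge0.
- exact: emeasurable_sum.
- by apply: measurable_sqrB => //; exact: measurable_stp.
move=> t _; rewrite sumEFin lee_fin -/(stp (fun k => (v k - f t) ^+ 2) t).
have [ht|ht] := boolP (0 <= t < 1); first by rewrite !(stp_in _ ht).
by rewrite !stp_out ?sqr_ge0.
Qed.

End step_functions.

Lemma measurable_mind_in {R : realType} d (T : measurableType d) (A : Type) (f : T -> A -> \bar R) (s : seq A) :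
  (forall i e, (i < size s)%N -> measurable_fun setT (f ^~ (nth e s i))) -> measurable_fun setT (fun x => mind (f x) s).
Proof.
elim: s => [|a s IH] h.
  by rewrite (_ : (fun x => _) = cst +oo%E)//; apply/funext => x; rewrite /mind big_nil.
rewrite (_ : (fun x => _) = (fun x => Order.min (f x a) (mind (f x) s))); last first.
  by apply/funext => x; rewrite mind_cons.
by apply: measurable_mine; [exact: (h 0%N a)|apply: IH => i e is_; exact: (h i.+1 e)].
Qed.

(** * The process as a random function *)

Section process.
Context {R : realType} d (Omega : measurableType d) (P : probability Omega R).
Variables (rho : R) (W X : R -> Omega -> R).
Hypotheses (rho0 : 0 < rho) (HX : is_RL_process_of_BM P rho W X).
Notation T := (measurableTypeR R).
Notation mu := (@lebesgue_measure R).
Let a := rho + 2^-1.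
Let a2 : 2^-1 < a. Proof. by rewrite ltrDr. Qed.

(** Extension by 0 replaces integrals over [0, 1] by integrals over the line, where the product
    measurability and Tonelli results apply directly. *)
Definition cut (f : R -> R) (t : R) : R := if 0 <= t < 1 then f t else 0.

Let Xp (w : Omega) : R -> R := cut (X ^~ w).

Lemma measurable_cut (f : R -> R) : measurable_fun (`[0, 1]%classic : set R) f -> measurable_fun [set: T] (cut f).
Proof.
move=> mf; have -> : cut f = f \_ `[0%R, 1%R[.
  apply/funext => t; rewrite patchE /cut; have -> : (t \in `[0%R, 1%R[%classic) = (0 <= t < 1) by rewrite mem_setE in_itv.
  by case: ifP.
apply/(measurable_restrictT _ _).1 => //.
apply: (measurable_funS _ _ mf); first exact: measurable_itv.
by move=> t /=; rewrite !in_itv/= => /andP[-> /ltW].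
Qed.

Lemma cut_stp n (v : 'I_n.+1 -> R) : cut (stp v) = stp v.
Proof. by apply/funext => t; rewrite /cut; case: ifPn => // ht; rewrite stp_out. Qed.

Lemma L2_01_dist2_cut (f g : R -> R) : measurable_fun [set: T] (cut f) -> measurable_fun [set: T] (cut g) ->
  L2_01_dist2 f g = dst (cut f) (cut g).
Proof.
move=> mf mg; have m := measurable_sqrB mf mg.
have E t : t \in `[0%R, 1%R[%classic -> ((f t - g t) ^+ 2)%:E = ((cut f t - cut g t) ^+ 2)%:E.
  by rewrite mem_setE in_itv/= /cut => ->.
rewrite /L2_01_dist2 -integral_itv_bndo_bndc; last first.
  apply: (eq_measurable_fun (fun t => ((cut f t - cut g t) ^+ 2)%:E)); first by move=> t ht; rewrite E.
  by apply: measurable_funTS.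
transitivity (\int[mu]_(t in `[0%R, 1%R[) ((cut f t - cut g t) ^+ 2)%:E)%E; first by apply: eq_integral => t ht; exact: E.
rewrite integral_mkcond; apply: eq_integral => t _; rewrite patchE mem_setE in_itv/=.
by case: ifPn => // ht; rewrite /cut (negbTE ht) subrr expr0n.
Qed.

Lemma measurable_X t : 0 <= t <= 1 -> measurable_fun [set: Omega] (X t).
Proof.
move=> ht; have [_ _ _ fam] := HX.
have [m _] := fam 1%N (fun=> (true, t)) (fun=> 1) (fun=> ht).
by move: m; congr (measurable_fun _ _); apply/funext => w; rewrite big_ord1 mul1r.
Qed.

(** Continuity of the paths makes the process a limit of its samples at left grid points. These are
    jointly measurable, and hence so is the process. *)
Lemma stp_cvg_X w t : (fun n => stp (fun k : 'I_n.+1 => X (k%:R / n.+1%:R) w) t) @ \oo --> Xp w t.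
Proof.
rewrite /Xp /cut; case: ifPn => [ht|ht]; last first.
  by apply: cvg_near_cst; near=> n; rewrite stp_out.
have /andP[t0 t1] := ht.
have [_ _ cX _] := HX.
have /subspace_continuousP := cX w => /(_ t).
have tI : (`[0, 1]%classic : set R) t by rewrite /= in_itv/= t0 ltW.
move=> /(_ tI) /cvgrPdist_le cv.
apply/cvgrPdist_le => e e0; have := cv e e0.
rewrite near_withinE => /nbhs_ballP[dl /= dl0 hb].
have [N hN] := eventually_ge dl^-1.
near=> n; rewrite (stp_in _ ht)/=.
have /andP[i1 i2] : (kcell n t)%:R <= t * n.+1%:R < (kcell n t).+1%:R by apply: truncn_itv; rewrite mulr_ge0.
have s1 : (kcell n t)%:R / n.+1%:R <= t by rewrite ler_pdivrMr.
apply: hb; last by rewrite /= in_itv/= divr_ge0//= (le_trans s1)// ltW.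
rewrite /ball/= ger0_norm ?subr_ge0// ltrBlDr.
have : t < (kcell n t)%:R / n.+1%:R + n.+1%:R^-1 by rewrite -{2}[n.+1%:R^-1]mul1r -mulrDl natr1 ltr_pdivlMr.
move=> h; apply: (lt_le_trans h); rewrite addrC lerD2r invf_ple ?posrE//.
have : dl^-1 <= n%:R by apply: hN; near: n; exact: nbhs_infty_ge.
by move/le_trans; apply; rewrite ler_nat.
Unshelve. all: by end_near. Qed.

Let gridI n (k : 'I_n.+1) : 0 <= (k%:R / n.+1%:R : R) <= 1.
Proof. by rewrite divr_ge0//= ler_pdivrMr// mul1r ler_nat ltnW. Qed.

Lemma measurable_Xp w : measurable_fun [set: T] (Xp w).
Proof. by apply: (measurable_fun_cvg (fun n => @measurable_stp R n _)) => t _; exact: stp_cvg_X. Qed.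

Lemma measurable_Xp_joint : measurable_fun [set: Omega * T] (fun z => Xp z.1 z.2).
Proof.
apply: (measurable_fun_cvg (h := fun n z => stp (fun k : 'I_n.+1 => X (k%:R / n.+1%:R) z.1) z.2)); last first.
  by move=> z _; exact: stp_cvg_X.
move=> n; apply: measurable_sum => k; apply: measurable_funM.
  have mi : measurable_fun [set: T] (\1_(cell n k) : T -> R) by apply: measurable_indic; exact: measurable_cell.
  exact: (measurableT_comp mi measurable_snd).
by apply: (measurableT_comp (measurable_X (gridI k))); exact: measurable_fst.
Qed.

Lemma measurable_dst_joint (F : Omega -> T -> R) : measurable_fun [set: Omega * T] (fun z => F z.1 z.2) ->
  measurable_fun [set: Omega] (fun w => dst (Xp w) (F w)).
Proof.
move=> mF; pose f (z : Omega * T) : \bar R := ((Xp z.1 z.2 - F z.1 z.2) ^+ 2)%:E.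
have mf : measurable_fun [set: Omega * T] f.
  apply/measurable_EFinP; apply: measurable_funX; apply: measurable_funB => //; exact: measurable_Xp_joint.
exact: (@measurable_fun_fubini_tonelli_F _ _ _ _ R mu f mf (fun z => sqr_ge0 _)).
Qed.

(** The increments in [bmi] carry sqrt N and [TN] carries N^(-a), so the weights on the plain
    Brownian increments are Gamma(a) N^(1-a) w_m, as in [kcoef]. *)
Definition RLstep n (w : Omega) : R -> R :=
  stp (fun i : 'I_n.+1 => Gamma a * Num.sqrt n.+1%:R * lmap (@TN R a n) (@bmi R d Omega W n) i w).

Lemma measurable_RLstep n : measurable_fun [set: Omega * T] (fun z => @RLstep n z.1 z.2).
Proof.
apply: measurable_sum => k; apply: measurable_funM.
  have mi : measurable_fun [set: T] (\1_(cell n k) : T -> R) by apply: measurable_indic; exact: measurable_cell.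
  exact: (measurableT_comp mi measurable_snd).
apply: measurable_funM => //; have [mb _] := bmi_std_gauss rho0 HX n.
by apply: (measurableT_comp (measurable_lmap (@TN R a n) mb k)); exact: measurable_fst.
Qed.

Lemma RLstepE n w t : 0 <= t < 1 ->
  Xp w t - RLstep n w t = X t w + \sum_(l < n.+1) kweight a n t l * (W (l.+1%:R / n.+1%:R) w - W (l%:R / n.+1%:R) w).
Proof.
move=> ht; rewrite /Xp /cut ht /RLstep (stp_in _ ht); congr (_ + _).
rewrite /lmap mulr_sumr -sumrN; apply: eq_bigr => l _; rewrite /TN /bmi /kweight /=.
case: leqP => li; last by rewrite mulr0 mul0r mulr0 oppr0 mul0r.
have N0 : (0 : R) < n.+1%:R by [].
have e : n.+1%:R `^ (1 - a) = n.+1%:R `^ (- a) * (Num.sqrt n.+1%:R * Num.sqrt n.+1%:R) :> R.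
  by rewrite -expr2 sqr_sqrtr// powRD ?(gt_eqF N0) ?implybT// powRr1// mulrC.
by rewrite /kcoef e; ring.
Qed.

Lemma RLstep_error : exists2 C : R, 0 <= C & forall n,
  (\int[P]_w dst (Xp w) (RLstep n w) <= (C * n.+1%:R `^ (- ksig a))%:E)%E.
Proof.
have [C C0 hC] := kernel_var_le a2; exists C => // n.
pose f (z : Omega * T) : \bar R := ((Xp z.1 z.2 - RLstep n z.1 z.2) ^+ 2)%:E.
have mf : measurable_fun [set: Omega * T] f.
  apply/measurable_EFinP; apply: measurable_funX; apply: measurable_funB; [exact: measurable_Xp_joint|exact: measurable_RLstep].
have f0 z : (0 <= f z)%E by rewrite lee_fin sqr_ge0.
have := @fubini_tonelli _ _ _ _ R P mu f mf f0; rewrite /f/= => ->.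
set c := C * _; have c0 : 0 <= c by rewrite mulr_ge0 ?powR_ge0.
(* [cell 0 0] is the interval [0, 1[, outside which both functions vanish. *)
apply: (@le_trans _ _ (\int[mu]_t (\1_(cell 0 0) t * c)%:E)%E).
  apply: ge0_le_integral => //.
  - by move=> t _; apply: integral_ge0 => w _; rewrite lee_fin sqr_ge0.
  - exact: (@measurable_fun_fubini_tonelli_G _ _ _ _ R P f mf f0).
  - by apply/measurable_EFinP; apply: measurable_funM => //; apply: measurable_indic; exact: measurable_cell.
  move=> t _; have [ht|ht] := boolP (0 <= t < 1); last first.
    rewrite integral0_eq ?lee_fin ?mulr_ge0// => w _.
    by rewrite /Xp /cut (negbTE ht) /RLstep stp_out// subrr expr0n.
  have -> : \1_(cell 0 0) t = 1 :> R.
    rewrite indicE (mem_cell _ _ ht); have := kcell_lt 0 ht.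
    by rewrite ltnS leqn0 => /eqP ->.
  rewrite mul1r; under eq_integral => w _ do rewrite (RLstepE n w ht).
  by rewrite (RL_step_error rho0 HX)// lee_fin; exact: hC.
under eq_integral do rewrite mulrC EFinM.
rewrite ge0_integralZl_EFin//; last first.
  by apply/measurable_EFinP; apply: measurable_indic; exact: measurable_cell.
rewrite integral_indic//; last exact: measurable_cell.
by rewrite setIT [X in (_ * X)%E](lebesgue_cell 0 0) invr1 mule1.
Qed.

End process.

Lemma le_integral_lin2 {R : realType} d (T : measurableType d) (P : probability T R) (F f1 f2 : T -> \bar R) (k1 k2 D1 D2 : R) :
  (forall w, 0 <= F w)%E -> (forall w, 0 <= f1 w)%E -> (forall w, 0 <= f2 w)%E -> 0 <= k1 -> 0 <= k2 ->
  measurable_fun setT F -> measurable_fun setT f1 -> measurable_fun setT f2 ->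
  (forall w, F w <= k1%:E * f1 w + k2%:E * f2 w)%E ->
  (\int[P]_w f1 w <= D1%:E)%E -> (\int[P]_w f2 w <= D2%:E)%E -> (\int[P]_w F w <= (k1 * D1 + k2 * D2)%:E)%E.
Proof.
move=> F0 p1 p2 k10 k20 mF m1 m2 FE h1 h2.
have q1 w : (0 <= k1%:E * f1 w)%E by rewrite mule_ge0.
have q2 w : (0 <= k2%:E * f2 w)%E by rewrite mule_ge0.
have n1 : measurable_fun setT (fun w => (k1%:E * f1 w)%E) by apply: emeasurable_funM.
have n2 : measurable_fun setT (fun w => (k2%:E * f2 w)%E) by apply: emeasurable_funM.
apply: (@le_trans _ _ (\int[P]_w (k1%:E * f1 w + k2%:E * f2 w))%E).
  by apply: ge0_le_integral => //; exact: emeasurable_funD.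
rewrite ge0_integralD// !ge0_integralZl_EFin// EFinD !EFinM.
by apply: leeD; apply: lee_wpmul2l; rewrite ?lee_fin.
Qed.

(** * Transfer between the process and the vector *)

Section transfer.
Context {R : realType} d (Omega : measurableType d) (P : probability Omega R).
Variables (rho : R) (W X : R -> Omega -> R).
Hypotheses (rho0 : 0 < rho) (HX : is_RL_process_of_BM P rho W X).
Notation T := (measurableTypeR R).
Notation mu := (@lebesgue_measure R).
Let a := rho + 2^-1.
Let a2 : 2^-1 < a. Proof. by rewrite ltrDr. Qed.
Let G := Gamma a.
Let G0 : 0 < G. Proof. exact: Gamma_gt0. Qed.
Let Xp (w : Omega) : R -> R := cut (X ^~ w).
Let V n := lmap (@TN R a n) (@bmi R d Omega W n).
Let g n : R := G * Num.sqrt n.+1%:R.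

Let g0 n : 0 < g n. Proof. by rewrite mulr_gt0// sqrtr_gt0. Qed.

Let mV n : mvec (@V n).
Proof. by apply: measurable_lmap; have [] := bmi_std_gauss rho0 HX n. Qed.

Let dst_scaled n (x y : 'I_n.+1 -> R) : dst (stp (fun i => g n * x i)) (stp (fun i => g n * y i)) = (G ^+ 2 * dist2 x y)%:E.
Proof.
rewrite dst_stp /dist2; congr (_ %:E); rewrite mulr_suml mulr_sumr; apply: eq_bigr => i _.
have n0 : n.+1%:R != 0 :> R by rewrite pnatr_eq0.
rewrite -mulrBr exprMn /g exprMn sqr_sqrtr//; move: (n.+1%:R : R) n0 => N N0.
by field.
Qed.

Let mXp w : measurable_fun [set: T] (Xp w).
Proof. exact: measurable_Xp HX w. Qed.

Let mY n w : measurable_fun [set: T] (@RLstep R d Omega rho W n w).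
Proof. exact: measurable_stp. Qed.

Let mdY n : measurable_fun [set: Omega] (fun w => dst (Xp w) (@RLstep R d Omega rho W n w)).
Proof. by apply: (measurable_dst_joint HX); exact: (measurable_RLstep rho0 HX n). Qed.

Let mcutL f : L2_01 f -> measurable_fun [set: T] (cut f).
Proof. by move=> [mf _]; exact: measurable_cut. Qed.

Let mdist f : L2_01 f -> measurable_fun [set: Omega] (fun w => L2_01_dist2 (X ^~ w) f).
Proof.
move=> hf; rewrite (_ : (fun w => _) = (fun w => dst (Xp w) (cut f))); last first.
  by apply/funext => w; rewrite L2_01_dist2_cut//; [exact: mXp|exact: mcutL].
apply: (measurable_dst_joint HX (F := fun _ => cut f)).
exact: (measurableT_comp (mcutL hf) measurable_snd).
Qed.

Let dist_ge0 w f : (0 <= L2_01_dist2 (X ^~ w) f)%E.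
Proof. by apply: integral_ge0 => t _; rewrite lee_fin sqr_ge0. Qed.

(** Codewords become step functions. The scaling by [g n] turns the L^2 distance of step functions
    into Gamma(a)^2 times the distance of vectors, and the weighted triangle inequality adds the
    discretization error. *)
Lemma distortion_le_ach : exists2 C : R, 0 <= C & forall n m L D e, 0 < e -> ach P (@V n) L D -> expR L <= m%:R ->
  exists alpha : seq (R -> R), [/\ (size alpha <= m)%N,
    (forall i, (i < size alpha)%N -> L2_01 (nth (fun _ => 0) alpha i)) &
    (distortion P X alpha <= ((1 + e) * G ^+ 2 * D + (1 + e^-1) * (C * n.+1%:R `^ (- ksig a)))%:E)%E].
Proof.
have [C C0 hC] := RLstep_error rho0 HX; exists C => // n m L D e e0 [s sL sD] Lm.
pose F (v : 'I_n.+1 -> R) : R -> R := stp (fun i => g n * v i).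
have LF v : L2_01 (F v).
  split; first by apply: measurable_funTS; exact: measurable_stp.
  apply: (@le_lt_trans _ _ (dst (F v) (F (fun=> 0)))).
    have -> : dst (F v) (F (fun=> 0)) = (\int[mu]_t ((F v t) ^+ 2)%:E)%E.
      apply: eq_integral => t _; rewrite (_ : F (fun=> 0) t = 0) ?subr0//.
      by rewrite /F /stp big1// => k _; rewrite !mulr0.
    apply: ge0_subset_integral => //.
      by apply/measurable_EFinP; apply: measurable_funX; exact: measurable_stp.
    by move=> t _; rewrite lee_fin sqr_ge0.
  by rewrite /F dst_scaled ltry.
exists [seq F v | v <- s]; split.
- by rewrite size_map -(ler_nat R) (le_trans sL).
- by move=> i; rewrite size_map => is_; rewrite (nth_map (fun=> 0)).
have e1 : 0 <= 1 + e by rewrite addr_ge0// ltW.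
have e2 : 0 <= 1 + e^-1 by rewrite addr_ge0// invr_ge0 ltW.
apply: (le_integral_lin2 (f1 := fun w => mind (fun b => (dist2 (rv (@V n) w) b)%:E) s) (f2 := fun w => dst (Xp w) (@RLstep R d Omega rho W n w))) => //.
- by move=> w; apply: (mind_ge0 (f := L2_01_dist2 (X ^~ w))).
- by move=> w; exact: mind_dist2_ge0.
- by move=> w; exact: dst_ge0.
- by rewrite mulr_ge0 ?sqr_ge0.
- apply: (measurable_mind_in (f := fun w => L2_01_dist2 (X ^~ w))) => i f; rewrite size_map => is_.
  by rewrite (nth_map (fun=> 0))//; exact: mdist.
- by apply: measurable_mdist.
- move=> w; have sn := ach_nnil sD.
  have [i is_ ->] := mind_ex (fun b => (dist2 (rv (@V n) w) b)%:E) (fun=> 0) sn.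
  apply: (@le_trans _ _ (L2_01_dist2 (X ^~ w) (F (nth (fun=> 0) s i)))).
    rewrite -(nth_map (fun=> 0) (fun=> 0) F)//.
    by apply: (mind_le (L2_01_dist2 (X ^~ w))); rewrite size_map.
  rewrite L2_01_dist2_cut; [|exact: mXp|exact: mcutL].
  rewrite cut_stp -/(F _) dstC.
  apply: (le_trans (dst_tri e0 (measurable_stp _) (mXp w) (mY n w))).
  rewrite (dstC (@RLstep R d Omega rho W n w) (Xp w)).
  rewrite (dstC (stp _) (@RLstep R d Omega rho W n w)).
  have E : dst (@RLstep R d Omega rho W n w) (stp (fun i0 => g n * nth (fun=> 0) s i i0)) = (G ^+ 2 * dist2 (rv (@V n) w) (nth (fun=> 0) s i))%:E.
    by rewrite -dst_scaled.
  by rewrite E !EFinM muleA.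
Qed.

(** Every function of the codebook is averaged over the cells. Seen from a step function this
    projection does not increase the distance, so the averages form a codebook for the vector, up to
    the discretization error. *)
Lemma ach_le_distortion : exists2 C : R, 0 <= C & forall n m alpha D e, 0 < e -> (0 < m)%N -> (size alpha <= m)%N ->
  (forall i, (i < size alpha)%N -> L2_01 (nth (fun _ => 0) alpha i)) -> (distortion P X alpha <= D%:E)%E ->
  ach P (@V n) (ln m%:R) (G ^- 2 * (1 + e) * D + G ^- 2 * (1 + e^-1) * (C * n.+1%:R `^ (- ksig a))).
Proof.
have [C C0 hC] := RLstep_error rho0 HX; exists C => // n m alpha D e e0 m0 am aL aD.
(* The averages are controlled for square-integrable f only; the implication lets [choice] range
   over all functions. *)
have avgE (f : R -> R) : exists av : 'I_n.+1 -> R, L2_01 f -> forall v : 'I_n.+1 -> R, (dst (stp v) (stp av) <= dst (stp v) (cut f))%E.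
  have [hf|hf] := pselect (L2_01 f); last by exists (fun=> 0).
  have f2 : (\int[mu]_t ((cut f t) ^+ 2)%:E < +oo)%E.
    apply: le_lt_trans hf.2.
    rewrite [leRHS]integral_mkcond; apply: ge0_le_integral => //.
    - by move=> t _; rewrite lee_fin sqr_ge0.
    - by apply/measurable_EFinP; apply: measurable_funX; exact: mcutL.
    - apply/(measurable_restrictT _ _).1; first exact: measurable_itv.
      by apply/measurable_EFinP; apply: measurable_funX; exact: hf.1.
    move=> t _; rewrite patchE mem_setE in_itv/= /cut; case: ifPn => [/andP[t0 t1]|_]; first by rewrite t0 (ltW t1).
    by rewrite expr0n/=; case: ifP => _; rewrite ?lee_fin ?sqr_ge0.
  by have [av hav] := dst_avg n (mcutL hf) f2; exists av.
have [avg havg] := choice avgE.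
pose F (f : R -> R) : 'I_n.+1 -> R := fun i => avg f i / g n.
have an : alpha <> [::].
  move=> an; move: aD; rewrite an /distortion; under eq_integral do rewrite big_nil.
  by rewrite integral_prob_cst.
exists [seq F f | f <- alpha].
  by rewrite size_map lnK ?posrE ?ltr0n// ler_nat.
have e1 : 0 <= 1 + e by rewrite addr_ge0// ltW.
have e2 : 0 <= 1 + e^-1 by rewrite addr_ge0// invr_ge0 ltW.
have Gi : 0 <= G ^- 2 by rewrite invr_ge0 sqr_ge0.
apply: (le_integral_lin2 (f1 := fun w => mind (L2_01_dist2 (X ^~ w)) alpha) (f2 := fun w => dst (Xp w) (@RLstep R d Omega rho W n w))) => //.
- by move=> w; exact: mind_dist2_ge0.
- by move=> w; apply: mind_ge0.
- by move=> w; exact: dst_ge0.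
- by rewrite mulr_ge0.
- by rewrite mulr_ge0.
- by apply: measurable_mdist.
- apply: (measurable_mind_in (f := fun w => L2_01_dist2 (X ^~ w))) => i f is_.
  by rewrite (set_nth_default (fun=> 0))//; apply: mdist; exact: aL.
move=> w; have [i is_ ->] := mind_ex (L2_01_dist2 (X ^~ w)) (fun=> 0) an.
set f := nth _ alpha i; have Lf : L2_01 f := aL _ is_.
apply: (@le_trans _ _ ((dist2 (rv (@V n) w) (F f))%:E)).
  rewrite /f -(nth_map (fun=> 0) (fun=> 0) F)//.
  by apply: (mind_le (fun b => (dist2 (rv (@V n) w) b)%:E)); rewrite size_map.
have E : dst (@RLstep R d Omega rho W n w) (stp (avg f)) = (G ^+ 2 * dist2 (rv (@V n) w) (F f))%:E.
  rewrite -dst_scaled /RLstep; congr (dst _ (stp _)); apply/funext => k.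
  by rewrite /F mulrC divfK// gt_eqF.
have -> : ((dist2 (rv (@V n) w) (F f))%:E = (G ^- 2)%:E * dst (@RLstep R d Omega rho W n w) (stp (avg f)))%E.
  by rewrite E -EFinM mulKf// sqrf_eq0 gt_eqF.
rewrite (EFinM (G ^- 2)) (EFinM (G ^- 2)) -!muleA -ge0_muleDr ?mule_ge0 ?dist_ge0 ?dst_ge0//.
apply: lee_wpmul2l; first by rewrite lee_fin.
apply: (le_trans (havg f Lf _)); rewrite dstC L2_01_dist2_cut; [|exact: mXp|exact: mcutL].
rewrite (dstC (cut (X ^~ w))).
exact: (dst_tri e0 (mcutL Lf) (mY n w) (mXp w)).
Qed.

End transfer.

(** * Asymptotics of the quantization error *)

(** The ratio r of the roots satisfies (1 - e)^2 <= 1 - e <= r^2 <= 1 + e <= (1 + e)^2. *)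
Lemma sqrt_ratio_close {R : realType} (x y e : R) : 0 < y -> 0 < e <= 1 -> (1 - e) * y <= x <= (1 + e) * y ->
  `|1 - Num.sqrt x / Num.sqrt y| <= e.
Proof.
move=> y0 /andP[e0 e1] /andP[h1 h2].
have x0 : 0 <= x by apply: le_trans h1; rewrite mulr_ge0 ?subr_ge0// ltW.
have sy : 0 < Num.sqrt y by rewrite sqrtr_gt0.
set r := Num.sqrt x / Num.sqrt y; have r0 : 0 <= r by rewrite divr_ge0 ?sqrtr_ge0.
have rE : r ^+ 2 = x / y by rewrite /r expr_div_n !sqr_sqrtr// ltW.
have r1 : 1 - e <= r ^+ 2 by rewrite rE ler_pdivlMr.
have r2 : r ^+ 2 <= 1 + e by rewrite rE ler_pdivrMr.
have a1 : r <= 1 + e.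
  rewrite -(ler_pXn2r (n := 2))// ?nnegrE ?addr_ge0 ?(ltW e0)//; apply: (le_trans r2).
  by rewrite expr2 ler_peMr ?addr_ge0 ?(ltW e0)// lerDl ltW.
have a3 : 1 - e <= r.
  rewrite -(ler_pXn2r (n := 2))// ?nnegrE ?subr_ge0//; apply: le_trans r1.
  by rewrite expr2 ler_piMr ?subr_ge0// gerBl ltW.
by rewrite ler_norml; apply/andP; split; lra.
Qed.

Lemma eventually_ln {R : realType} (L0 : R) : exists n0 : nat, forall m, (n0 <= m)%N -> [/\ (0 < m)%N, L0 <= ln m%:R & 0 < ln m%:R :> R].
Proof.
have [n0 h] := eventually_ge (expR (Num.max L0 1)); exists n0 => m /h hm.
have m0 : 0 < m%:R :> R by apply: lt_le_trans hm; exact: expR_gt0.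
have : Num.max L0 1 <= ln m%:R by rewrite -ler_expR lnK ?posrE.
rewrite ge_max => /andP[h1 h2]; split=> //; first by rewrite -(ltr_nat R).
exact: lt_le_trans h2.
Qed.

Section asymptotics.
Context {R : realType} d (Omega : measurableType d) (P : probability Omega R).
Variables (rho : R) (W X : R -> Omega -> R).
Hypotheses (rho0 : 0 < rho) (HX : is_RL_process_of_BM P rho W X).
Let a := rho + 2^-1.
Let a2 : 2^-1 < a. Proof. by rewrite ltrDr. Qed.
Let a0 : 0 < a. Proof. by apply: lt_trans a2. Qed.
Let G := Gamma a.
Let G0 : 0 < G. Proof. exact: Gamma_gt0. Qed.
Let G20 : 0 < G ^+ 2. Proof. by rewrite exprn_gt0. Qed.

(** Squared error predicted at L = ln n; [RL_rate_sqr] identifies its root with the expression of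
    the theorem. *)
Definition RL_rate (L : R) : R := Gamma (rho + 2^-1) ^+ 2 * (qcst (rho + 2^-1) * L `^ (1 - 2 * (rho + 2^-1))).

Lemma RL_rate_gt0 L : 0 < L -> 0 < RL_rate L.
Proof. by move=> L0; rewrite /RL_rate -/a -/G mulr_gt0// mulr_gt0 ?qcst_gt0// powR_gt0. Qed.

Definition codebooks n : set (seq (R -> R)) := [set alpha | (size alpha <= n)%N /\
   forall i, (i < size alpha)%N -> L2_01 (nth (fun _ => 0) alpha i)].

Let small_error (C y t : R) : 0 <= C -> 0 < t -> 0 <= y -> exists N0, forall n, (N0 <= n)%N -> y * (C * n.+1%:R `^ (- ksig a)) <= t.
Proof.
move=> C0 t0 y0.
have s0 : 0 < ksig a by rewrite lt_min ltr01 andbT; have := a2; lra.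
have t1 : 0 < t / (y * C + 1) by rewrite divr_gt0// ltr_wpDl// mulr_ge0.
have [x0 x01 h] := powR_small s0 t1; have [N hN] := eventually_ge x0.
exists N => n nN.
have h1 : n.+1%:R `^ (- ksig a) <= t / (y * C + 1).
  by apply: h; apply: (le_trans (hN _ nN)); rewrite ler_nat.
rewrite mulrA; have c0 : 0 <= y * C by rewrite mulr_ge0.
apply: (le_trans (ler_wpM2l c0 h1)); rewrite mulrA ler_pdivrMr ?ltr_wpDl//.
by rewrite mulrC ler_wpM2l ?(ltW t0)// lerDl.
Qed.

(** The mesh n is chosen last, depending on the codebook size m, so that the discretization error is
    at most t times the main term even after multiplication by 1 + 1/t. *)
Lemma distortion_upper (eps : R) : 0 < eps <= 1 -> exists n0 : nat, forall m, (n0 <= m)%N ->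
  (ereal_inf [set distortion P X alpha | alpha in codebooks m] <= ((1 + eps) * RL_rate (ln m%:R))%:E)%E.
Proof.
move=> /andP[e0 e1]; pose t := eps / 4; have t0 : 0 < t by rewrite divr_gt0.
have [L0 hL] := TN_upper a2 t0.
have [C C0 hC] := distortion_le_ach rho0 HX.
have [n0 hn] := eventually_ln L0; exists n0 => m /hn[m0 mL ml].
have [N1 h1] := hL _ mL.
set Y := RL_rate _; have Yp : 0 < Y := RL_rate_gt0 ml.
have ti : 0 <= 1 + t^-1 by rewrite addr_ge0// invr_ge0 ltW.
have [N2 h2] := small_error C0 (mulr_gt0 t0 Yp) ti.
pose n := maxn N1 N2.
have hA := h1 n (leq_maxl _ _) _ _ _ _ (bmi_std_gauss rho0 HX n).
have Lm : expR (ln m%:R) <= m%:R :> R by rewrite lnK// posrE ltr0n.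
have [alpha [s1 s2 s3]] := hC n m _ _ t t0 hA Lm.
apply: (@le_trans _ _ (distortion P X alpha)).
  by apply: ereal_inf_lbound; exists alpha.
apply: (le_trans s3); rewrite lee_fin.
have h3 := h2 n (leq_maxr _ _).
apply: (le_trans (lerD (lexx _) h3)).
rewrite [X in X + _](_ : _ = (1 + t) ^+ 2 * Y); last by rewrite /Y /RL_rate -/a; ring.
have -> : eps = 4 * t by rewrite /t; field.
rewrite -mulrDl ler_wpM2r ?(ltW Yp)//.
have t4 : t <= 1 by rewrite /t; move: e1; lra.
have : t * t <= t by rewrite ler_piMr// ltW.
by rewrite (_ : (1 + t) ^+ 2 + t = 1 + 3 * t + t * t); [move: (t * t) => z; lra|ring].
Qed.

Lemma distortion_lower (eps : R) : 0 < eps <= 1 -> exists n0 : nat, forall m, (n0 <= m)%N ->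
  (((1 - eps) * RL_rate (ln m%:R))%:E <= ereal_inf [set distortion P X alpha | alpha in codebooks m])%E.
Proof.
move=> /andP[e0 e1]; pose t := eps / 4; have t0 : 0 < t by rewrite divr_gt0.
have [L0 hL] := TN_lower a2 t0.
have [C C0 hC] := ach_le_distortion rho0 HX.
have [n0 hn] := eventually_ln L0; exists n0 => m /hn[m0 mL ml].
have [N1 h1] := hL _ mL.
set Y := RL_rate _; have Yp : 0 < Y := RL_rate_gt0 ml.
have ti : 0 <= 1 + t^-1 by rewrite addr_ge0// invr_ge0 ltW.
have [N2 h2] := small_error C0 (mulr_gt0 t0 Yp) ti.
pose n := maxn N1 N2.
apply: le_ereal_inf_tmp => _ [alpha [s1 s2] <-].
have d0 : (0 <= distortion P X alpha)%E.
  apply: integral_ge0 => w _; apply: (mind_ge0 (f := L2_01_dist2 (X ^~ w))) => f.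
  by apply: integral_ge0 => s _; rewrite lee_fin sqr_ge0.
have [->|dfin] := eqVneq (distortion P X alpha) +oo%E; first by rewrite leey.
have fD : distortion P X alpha \is a fin_num by rewrite ge0_fin_numE// ltey.
pose D := fine (distortion P X alpha); have DE : distortion P X alpha = D%:E by rewrite fineK.
rewrite DE lee_fin; have D0 : 0 <= D by rewrite -lee_fin -DE.
have aD : (distortion P X alpha <= D%:E)%E by rewrite DE.
have hA := hC n m alpha D t t0 m0 s1 s2 aD.
have := h1 n (leq_maxl _ _) _ _ _ _ _ (bmi_std_gauss rho0 HX n) hA.
set E := C * _ => h3.
have h4 : (1 - t) * Y <= (1 + t) * D + (1 + t^-1) * E.
  have -> : (1 - t) * Y = G ^+ 2 * ((1 - t) * (qcst a * ln m%:R `^ (1 - 2 * a))) by rewrite /Y /RL_rate -/a -/G; ring.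
  apply: (le_trans (ler_wpM2l (ltW G20) h3)); rewrite -/a -/G.
  by move: (t^-1) => ti'; rewrite le_eqVlt; apply/orP; left; apply/eqP; field; rewrite gt_eqF.
have h5 := h2 n (leq_maxr _ _).
have h6 : (1 - 2 * t) * Y <= (1 + t) * D.
  move: h4 h5; rewrite -/E; move: ((1 + t^-1) * E) ((1 + t) * D) => u z; lra.
have -> : eps = 4 * t by rewrite /t; field.
have t4 : t <= 1 by rewrite /t; move: e1; lra.
have t1 : 0 < 1 + t by rewrite addr_gt0.
rewrite -(ler_pM2l t1); apply: le_trans h6.
rewrite mulrA ler_wpM2r ?(ltW Yp)//.
have := sqr_ge0 t; rewrite (_ : (1 + t) * (1 - 4 * t) = 1 - 3 * t - 4 * t ^+ 2); last by ring.
by move: (t ^+ 2) => z; lra.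
Qed.

Lemma RL_rate_sqr L : 0 < L -> pi `^ (- (rho + 2^-1)) * (rho + 2^-1) `^ rho *
      Num.sqrt ((2 * rho + 1) / (2 * rho)) * Gamma (rho + 2^-1) * L `^ (- rho) = Num.sqrt (RL_rate L).
Proof.
move=> L0; rewrite -/a -/G.
have p0 : 0 < pi :> R := pi_gt0 R.
have q0 : 0 <= (2 * rho + 1) / (2 * rho) by rewrite divr_ge0// ?addr_ge0 ?mulr_ge0 ?ltW.
set K := _ * L `^ _.
have K0 : 0 <= K by rewrite /K !mulr_ge0 ?powR_ge0 ?sqrtr_ge0// ltW.
rewrite -[LHS](ger0_norm K0) -sqrtr_sqr; congr Num.sqrt.
have sq (x s : R) : (x `^ s) ^+ 2 = x `^ (s * 2) by rewrite -powR_mulrn ?powR_ge0// -powRrM.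
rewrite /K 4!exprMn sqr_sqrtr// !sq /RL_rate -/a -/G /qcst.
have -> : 1 - 2 * a = - rho * 2 by rewrite /a; field.
have -> : 2 * a - 1 = rho * 2 by rewrite /a; field.
have -> : - (2 * a) = - a * 2 by ring.
rewrite (powRM _ (ler0n R 2) (ltW p0)) (powRM _ (ler0n R 2) (ltW a0)).
(* Since a = rho + 1/2, the powers of 2 in [qcst] collapse to 1/2, which cancels the factor 2 in its
   last term. *)
have e2 : 2 `^ (- a * 2) * 2 `^ (rho * 2) = 2^-1 :> R.
  rewrite -powRD ?pnatr_eq0 ?implybT//.
  have -> : - a * 2 + rho * 2 = -1 by rewrite /a; field.
  by rewrite powR_inv1.
move: e2; set P2 := 2 `^ (- a * 2); set Q2 := 2 `^ (rho * 2) => e2.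
move: (pi `^ (- a * 2)) (a `^ (rho * 2)) (L `^ (- rho * 2)) => pp aa LL.
rewrite (_ : P2 * pp * (Q2 * aa) = (P2 * Q2) * (pp * aa)); last by ring.
by rewrite e2 /a; field; rewrite gt_eqF.
Qed.

End asymptotics.

Theorem theorem3 (R : realType) (d : measure_display) (Omega : measurableType d)
    (P : probability Omega R) (rho : R) (W X : R -> Omega -> R) :
  0 < rho ->
  is_RL_process_of_BM P rho W X ->
  (fun n : nat =>
     quant_err P X n /
     (pi `^ (- (rho + 2^-1)) * (rho + 2^-1) `^ rho *
      Num.sqrt ((2 * rho + 1) / (2 * rho)) * Gamma (rho + 2^-1) *
      (ln n%:R) `^ (- rho))) @ \oo --> (1 : R).
Proof.
move=> rho0 HX; apply/cvgrPdist_le => e e0.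
pose t := Num.min e 1.
have t01 : 0 < t <= 1 by rewrite lt_min e0 ltr01 ge_min lexx orbT.
have [n1 h1] := distortion_upper rho0 HX t01.
have [n2 h2] := distortion_lower rho0 HX t01.
have [n3 h3] := eventually_ln (0 : R).
near=> n.
have /h1{h1}hu : (n1 <= n)%N by near: n; exact: nbhs_infty_ge.
have /h2{h2}hl : (n2 <= n)%N by near: n; exact: nbhs_infty_ge.
have /h3{h3}[_ _ L0] : (n3 <= n)%N by near: n; exact: nbhs_infty_ge.
rewrite RL_rate_sqr// /quant_err -/(codebooks n).
set V := ereal_inf _ in hu hl *.
(* The two bounds make the infimum finite, so [fine] in [quant_err] returns its true value. *)
have fV : V \is a fin_num.
  by rewrite fin_numE -ltNye -ltey (lt_le_trans _ hl) ?ltNyr// (le_lt_trans hu) ?ltry.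
apply: (@le_trans _ _ t); last by rewrite ge_min lexx.
apply: sqrt_ratio_close => //; first exact: RL_rate_gt0.
by rewrite -!lee_fin fineK// hl hu.
Unshelve. all: by end_near.
Qed.
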